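(* Let $\kappa$ be a strongly compact cardinal, let $f:\kappa\to\kappa$ be a partial function with domain unbounded in $\kappa$ having the Menas property, let $G$ be $V$-generic for the lottery preparation of $\kappa$ relative to $f$, and let $g$ be $V[G]$-generic for $\mathrm{Add}(\kappa,1)^{V[G]}$. Then $\kappa$ is strongly compact in $V[G][g]$.
   Context: $\mathrm{Add}(\kappa,1)$ is the poset adding a Cohen subset of $\kappa$ by initial segments: conditions are functions $p:\alpha\to 2$ for $\alpha<\kappa$, ordered by extension. A fine measure on $P_\kappa\lambda$ is a $\kappa$-complete ultrafilter on $P_\kappa\lambda$ containing $\{x:\alpha\in x\}$ for each $\alpha<\lambda$. For strongly compact $\kappa$, $f$ has the Menas property if for every $\lambda$ there is a fine measure $\mu$ on $P_\kappa\lambda$ with ultrapower embedding $j:V\to M$ such that $j(f)(\kappa)\ge|[\mathrm{id}]_\mu|^M$. The lottery sum of a collection $A$ of posets is $\oplus A=\{\langle\mathbb{Q},p\rangle:\mathbb{Q}\in A,\ p\in\mathbb{Q}\}\cup\{1\}$, with $1$ above everything and $\langle\mathbb{Q},p\rangle\le\langle\mathbb{Q}',q\rangle$ iff $\mathbb{Q}=\mathbb{Q}'$ and $p\le_{\mathbb{Q}}q$. A poset is ${<}\delta$-strategically closed if in the game where two players alternately play a descending sequence of length $\delta$ (the second player at limit stages) the second player has a strategy ensuring the play can always be continued. A poset is allowed at stage $\gamma$ if it is ${<}\delta$-strategically closed for every $\delta<\gamma$. The lottery preparation of $\kappa$ relative to $f$ is the reverse Easton support iteration of length $\kappa$ (direct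 limits at inaccessible limits, inverse limits elsewhere) whose stage $\gamma$ forcing is nontrivial only when $\gamma\in\mathrm{dom}(f)$ and $f``\gamma\subseteq\gamma$, and then is the lottery sum in $V^{\mathbb{P}_\gamma}$ of all posets in $H(f(\gamma)^+)$ allowed at stage $\gamma$. *)

(* Defs.v *)
(* Set theory is carried out inside an arbitrary first-order model of ZFC.
   Set-theoretic notions are formulas (in higher-order abstract syntax), because
   the same formula has to be interpreted in V, in V[G], in an ultrapower of V,
   and under a forcing relation defined inside V. *)

Set Implicit Arguments.

(** * Formulas of set theory *)

Inductive form (T : Type) : Type :=
| FMem : T -> T -> form T
| FEq  : T -> T -> form T
| FBot : form T
| FImp : form T -> form T -> form T
| FAll : (T -> form T) -> form T.
Arguments FBot {T}.

Declare Scope form_scope.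
Delimit Scope form_scope with F.
Bind Scope form_scope with form.
Open Scope form_scope.

(* The remaining connectives are the classical negative abbreviations, so that
   [forces] below need only treat the primitive ones. *)
Notation "x ∈ y" := (FMem x y) (at level 70) : form_scope.
Notation "x ≐ y" := (FEq x y) (at level 70) : form_scope.
Notation "A ⇒ B" := (FImp A B) (at level 99, right associativity, B at level 200) : form_scope.
Notation "¬ A" := (FImp A FBot) (at level 75, right associativity) : form_scope.
Notation "A ∧ B" := (FImp (FImp A (FImp B FBot)) FBot) (at level 80, right associativity) : form_scope.
Notation "A ∨ B" := (FImp (FImp A FBot) B) (at level 85, right associativity) : form_scope.
Notation "A ⇔ B" := ((A ⇒ B) ∧ (B ⇒ A)) (at level 95, no associativity) : form_scope.
Notation "∀ x , A" := (FAll (fun x => A))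
  (at level 200, x name, A at level 200) : form_scope.
Notation "∃ x , A" := (FImp (FAll (fun x => FImp A FBot)) FBot)
  (at level 200, x name, A at level 200) : form_scope.
Notation "∀ x ∈ a , A" := (FAll (fun x => FImp (FMem x a) A))
  (at level 200, x name, a at level 69, A at level 200) : form_scope.
Notation "∃ x ∈ a , A" := (∃ x, (FMem x a ∧ A))
  (at level 200, x name, a at level 69, A at level 200) : form_scope.

Fixpoint sat (T : Type) (mem : T -> T -> Prop) (phi : form T) : Prop :=
  match phi with
  | FMem x y => mem x y
  | FEq x y => x = y
  | FBot => False
  | FImp a b => sat mem a -> sat mem b
  | FAll h => forall x, sat mem (h x)
  end.

(** * Elementary notions *)

Definition incl {T} (x y : T) : form T := ∀ z ∈ x, z ∈ y.
Definition empty {T} (x : T) : form T := ∀ z, ¬ z ∈ x.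
Definition upair {T} (a b c : T) : form T := ∀ z, z ∈ c ⇔ z ≐ a ∨ z ≐ b.
(* c is the Kuratowski pair of a and b *)
Definition is_pair {T} (a b c : T) : form T :=
  ∃ u, ∃ v, upair a a u ∧ upair a b v ∧ upair u v c.
Definition powerset {T} (a p : T) : form T := ∀ z, z ∈ p ⇔ incl z a.
Definition is_succ {T} (a b : T) : form T := ∀ z, z ∈ b ⇔ z ∈ a ∨ z ≐ a.

(* The pair of a and b belongs to r.  For a function r this reads "r(a) = b",
   for an order r it reads "a <= b", for a forcing name r it says that the name a
   is attached to the condition b. *)
Definition pair_in {T} (r a b : T) : form T := ∃ c ∈ r, is_pair a b c.

Definition is_function {T} (f : T) : form T :=
  (∀ c ∈ f, ∃ a, ∃ b, is_pair a b c) ∧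
  (∀ a, ∀ b, ∀ b', pair_in f a b ⇒ pair_in f a b' ⇒ b ≐ b').
Definition function_on {T} (f d : T) : form T :=
  is_function f ∧ ∀ a, a ∈ d ⇔ ∃ b, pair_in f a b.
Definition restriction {T} (f d r : T) : form T :=
  ∀ z, z ∈ r ⇔ z ∈ f ∧ ∃ a ∈ d, ∃ b, is_pair a b z.

Definition is_injection {T} (f a b : T) : form T :=
  function_on f a ∧ (∀ x ∈ a, ∃ y ∈ b, pair_in f x y) ∧
  (∀ x, ∀ x', ∀ y, pair_in f x y ⇒ pair_in f x' y ⇒ x ≐ x').
Definition injects {T} (a b : T) : form T := ∃ f, is_injection f a b.
Definition equinumerous {T} (a b : T) : form T :=
  ∃ f, is_injection f a b ∧ ∀ y ∈ b, ∃ x ∈ a, pair_in f x y.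

Definition transitive {T} (x : T) : form T := ∀ y ∈ x, incl y x.
Definition ordinal {T} (x : T) : form T := transitive x ∧ ∀ y ∈ x, transitive y.
Definition limit_ordinal {T} (x : T) : form T :=
  ordinal x ∧ ¬ empty x ∧ ∀ y ∈ x, ∃ z ∈ x, y ∈ z.
Definition is_omega {T} (w : T) : form T :=
  limit_ordinal w ∧ ∀ n ∈ w, ¬ limit_ordinal n.

Definition cardinal {T} (k : T) : form T := ordinal k ∧ ∀ a ∈ k, ¬ injects k a.
Definition is_card {T} (x k : T) : form T := cardinal k ∧ equinumerous x k.
(* |x| < k, for a cardinal k *)
Definition smaller {T} (x k : T) : form T := ∃ a ∈ k, injects x a.
Definition uncountable {T} (k : T) : form T := ∃ w ∈ k, is_omega w.
Definition regular {T} (k : T) : form T :=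
  limit_ordinal k ∧
  ∀ a ∈ k, ∀ f, function_on f a ⇒ (∀ x ∈ a, ∃ y ∈ k, pair_in f x y) ⇒
    ∃ b ∈ k, ∀ x, ∀ y, pair_in f x y ⇒ y ∈ b.
Definition inaccessible {T} (k : T) : form T :=
  cardinal k ∧ uncountable k ∧ regular k ∧
  ∀ a ∈ k, ∀ p, powerset a p ⇒ smaller p k.
(* k is the least cardinal above the ordinal a *)
Definition cardinal_succ {T} (a k : T) : form T :=
  cardinal k ∧ a ∈ k ∧ ∀ b ∈ k, injects b a.

Definition trans_closure {T} (x t : T) : form T :=
  transitive t ∧ incl x t ∧ ∀ u, transitive u ⇒ incl x u ⇒ incl t u.
(* x is in H(k) *)
Definition in_H {T} (k x : T) : form T := ∃ t, trans_closure x t ∧ smaller t k.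

(** * ZFC *)

(* First-order syntax with de Bruijn indices, for the axiom schemes: a scheme
   ranging over [T -> form T] would be second-order. *)
Inductive fo : Type :=
| fo_mem : nat -> nat -> fo
| fo_eq  : nat -> nat -> fo
| fo_bot : fo
| fo_imp : fo -> fo -> fo
| fo_all : fo -> fo.

Definition scons {T : Type} (x : T) (e : nat -> T) (n : nat) : T :=
  match n with O => x | S m => e m end.

Fixpoint interp {T : Type} (e : nat -> T) (phi : fo) : form T :=
  match phi with
  | fo_mem i j => e i ∈ e j
  | fo_eq i j => e i ≐ e j
  | fo_bot => FBot
  | fo_imp a b => interp e a ⇒ interp e b
  | fo_all a => ∀ x, interp (scons x e) a
  end.

Record ZFC (T : Type) (mem : T -> T -> Prop) : Prop := {
  zfc_ext : sat mem (∀ x, ∀ y, (∀ z, z ∈ x ⇔ z ∈ y) ⇒ x ≐ y);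
  zfc_found : sat mem (∀ x, ¬ empty x ⇒ ∃ y ∈ x, ∀ z ∈ y, ¬ z ∈ x);
  zfc_pair : sat mem (∀ a, ∀ b, ∃ c, upair a b c);
  zfc_union : sat mem (∀ x, ∃ u, ∀ z, z ∈ u ⇔ ∃ y ∈ x, z ∈ y);
  zfc_power : sat mem (∀ x, ∃ p, powerset x p);
  zfc_inf : sat mem
    (∃ w, (∃ e ∈ w, empty e) ∧ ∀ n ∈ w, ∃ m ∈ w, is_succ n m);
  zfc_sep : forall (phi : fo) (e : nat -> T), sat mem
    (∀ a, ∃ b, ∀ x, x ∈ b ⇔ x ∈ a ∧ interp (scons x e) phi);
  zfc_repl : forall (phi : fo) (e : nat -> T),
    let R x y := interp (scons x (scons y e)) phi in sat mem
    (∀ a, (∀ x ∈ a, ∀ y, ∀ y', R x y ⇒ R x y' ⇒ y ≐ y') ⇒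
      ∃ b, ∀ y, y ∈ b ⇔ ∃ x ∈ a, R x y);
  zfc_choice : sat mem
    (∀ a, (∀ x ∈ a, ¬ empty x) ⇒
      ∃ h, function_on h a ∧ ∀ x ∈ a, ∃ y ∈ x, pair_in h x y)
}.

Record zfc_model : Type := {
  univ :> Type;
  mem : univ -> univ -> Prop;
  univ_ZFC : ZFC mem
}.
Arguments mem {z} _ _.

Definition holds (M : zfc_model) (phi : form M) : Prop := sat (@mem M) phi.
Notation "M ⊨ phi" := (@holds M phi%F) (at level 99, phi at level 200) : type_scope.

(** * Strongly compact cardinals and the Menas property *)

(* X is P_k(l) *)
Definition is_Pkl {T} (k l X : T) : form T :=
  ∀ x, x ∈ X ⇔ incl x l ∧ smaller x k.

Definition ultrafilter {T} (X U : T) : form T :=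
  (∀ A ∈ U, incl A X) ∧ X ∈ U ∧ (∀ A ∈ U, ¬ empty A) ∧
  (∀ A ∈ U, ∀ B, incl A B ⇒ incl B X ⇒ B ∈ U) ∧
  (∀ A ∈ U, ∀ B ∈ U, ∀ C, (∀ x, x ∈ C ⇔ x ∈ A ∧ x ∈ B) ⇒ C ∈ U) ∧
  (∀ A, ∀ B, incl A X ⇒ (∀ x, x ∈ B ⇔ x ∈ X ∧ ¬ x ∈ A) ⇒ A ∈ U ∨ B ∈ U).

Definition complete {T} (k X U : T) : form T :=
  ∀ S, incl S U ⇒ smaller S k ⇒
  ∀ B, (∀ x, x ∈ B ⇔ x ∈ X ∧ ∀ A ∈ S, x ∈ A) ⇒ B ∈ U.

Definition fine_measure {T} (k l X U : T) : form T :=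
  is_Pkl k l X ∧ ultrafilter X U ∧ complete k X U ∧
  ∀ a ∈ l, ∀ B, (∀ x, x ∈ B ⇔ x ∈ X ∧ a ∈ x) ⇒ B ∈ U.

Definition strongly_compact {T} (k : T) : form T :=
  cardinal k ∧ uncountable k ∧
  ∀ l, ordinal l ⇒ incl k l ⇒ ∃ X, ∃ U, fine_measure k l X U.

Definition almost_all {T} (X U : T) (phi : T -> form T) : form T :=
  ∃ B ∈ U, ∀ x, x ∈ B ⇔ x ∈ X ∧ phi x.

(* Truth in the ultrapower of the universe by U: its elements are represented by
   the functions with domain X, equality and membership being taken modulo U. *)
Fixpoint ult {T} (X U : T) (phi : form T) : form T :=
  match phi with
  | FMem a b => almost_all X U (fun x => ∃ y, ∃ z, pair_in a x y ∧ pair_in b x z ∧ y ∈ z)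
  | FEq a b => almost_all X U (fun x => ∃ y, ∃ z, pair_in a x y ∧ pair_in b x z ∧ y ≐ z)
  | FBot => FBot
  | FImp a b => ult X U a ⇒ ult X U b
  | FAll h => ∀ x, function_on x X ⇒ ult X U (h x)
  end.

(* The function a represents the ordinal k of the transitive collapse of the
   ultrapower; h is the inverse of the collapsing map on k + 1. *)
Definition ult_represents {T} (X U k a : T) : form T :=
  ∃ s, is_succ k s ∧ ∃ h, function_on h s ∧ pair_in h k a ∧
  ∀ b ∈ s, ∀ c, pair_in h b c ⇒ function_on c X ∧
    ∀ g, function_on g X ⇒
      (ult X U (g ∈ c) ⇔ ∃ b' ∈ b, ∃ c', pair_in h b' c' ∧ ult X U (g ≐ c')).

(* The ordinals l < k are excluded: for them a fine measure may be principal,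
   and then j is the identity and f is not defined at k. *)
Definition menas_property {T} (k f : T) : form T :=
  ∀ l, ordinal l ⇒ incl k l ⇒
  ∃ X, ∃ U, fine_measure k l X U ∧
  ∃ jf, function_on jf X ∧ (∀ x ∈ X, pair_in jf x f) ∧
  ∃ i, function_on i X ∧ (∀ x ∈ X, pair_in i x x) ∧
  ∃ a, ult_represents X U k a ∧
  ult X U (∃ e, pair_in jf a e ∧ ∃ c, is_card i c ∧ (c ∈ e ∨ c ≐ e)).

Definition unbounded_partial_function {T} (k f : T) : form T :=
  is_function f ∧ (∀ a, ∀ b, pair_in f a b ⇒ a ∈ k ∧ b ∈ k) ∧
  ∀ a ∈ k, ∃ b ∈ k, a ∈ b ∧ ∃ c, pair_in f b c.

(** * Posets *)

Definition poset {T} (A L : T) : form T :=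
  ¬ empty A ∧ (∀ z ∈ L, ∃ p ∈ A, ∃ q ∈ A, is_pair p q z) ∧
  (∀ p ∈ A, pair_in L p p) ∧
  (∀ p, ∀ q, ∀ r, pair_in L p q ⇒ pair_in L q r ⇒ pair_in L p r) ∧
  (∀ p, ∀ q, pair_in L p q ⇒ pair_in L q p ⇒ p ≐ q).

(* A is Add(k,1), ordered by L *)
Definition is_Add {T} (k A L : T) : form T :=
  (∀ p, p ∈ A ⇔ ∃ a ∈ k, function_on p a ∧
     ∀ x, ∀ y, pair_in p x y ⇒ empty y ∨ (∃ e, empty e ∧ is_succ e y)) ∧
  (∀ z, z ∈ L ⇔ ∃ p ∈ A, ∃ q ∈ A, is_pair p q z ∧ incl q p).

(* s is a descending sequence of length a of conditions *)
Definition descending {T} (A L a s : T) : form T :=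
  function_on s a ∧ (∀ b ∈ a, ∃ p ∈ A, pair_in s b p) ∧
  (∀ b ∈ a, ∀ c ∈ b, ∀ p, ∀ q, pair_in s b p ⇒ pair_in s c q ⇒ pair_in L p q).

(* E is the set of stages below d at which the second player moves: the first
   player opens, the second moves at limits, and at successors they alternate. *)
Definition second_player_stages {T} (d E : T) : form T :=
  incl E d ∧ (∀ a ∈ d, empty a ⇒ ¬ a ∈ E) ∧
  (∀ a ∈ d, limit_ordinal a ⇒ a ∈ E) ∧
  (∀ a ∈ d, ∀ b ∈ d, is_succ a b ⇒ (b ∈ E ⇔ ¬ a ∈ E)).

(* <d-strategic closure.  Only the second player's moves can be impossible, since
   the first one never moves at a limit stage. *)
Definition strategically_closed {T} (A L d : T) : form T :=
  ∃ E, second_player_stages d E ∧ ∃ S, is_function S ∧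
  ∀ a ∈ E, ∀ s, descending A L a s ⇒
    (∀ b ∈ a, b ∈ E ⇒ ∃ r, restriction s b r ∧ ∃ p, pair_in S r p ∧ pair_in s b p) ⇒
    ∃ p ∈ A, pair_in S s p ∧ ∀ b, ∀ q, pair_in s b q ⇒ pair_in L p q.

Definition allowed {T} (c A L : T) : form T := ∀ d ∈ c, strategically_closed A L d.

(* D is the lottery sum of all posets in H(a^+) allowed at stage c, ordered by R,
   with top element o, coded by the empty set (which is not a pair). *)
Definition stage_lottery {T} (c a D R o : T) : form T :=
  empty o ∧
  (∃ k, cardinal_succ a k ∧
   ∀ z, z ∈ D ⇔ z ≐ o ∨
     ∃ Q, ∃ A, ∃ L, is_pair A L Q ∧ poset A L ∧ in_H k Q ∧ allowed c A L ∧
     ∃ p ∈ A, is_pair Q p z) ∧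
  (∀ z, z ∈ R ⇔ ∃ x ∈ D, ∃ y ∈ D, is_pair x y z ∧
     (y ≐ o ∨
      ∃ Q, ∃ A, ∃ L, is_pair A L Q ∧
      ∃ p, ∃ q, is_pair Q p x ∧ is_pair Q q y ∧ pair_in L p q)).

Definition stage_trivial {T} (D R o : T) : form T :=
  empty o ∧ (∀ z, z ∈ D ⇔ z ≐ o) ∧ (∀ z, z ∈ R ⇔ is_pair o o z).

(** * The forcing relation *)

(* Names: every set x serves as a P-name, namely for the set of the values of
   those c for which some p in the generic filter has (c,p) in x. *)

(* p forces a = b.  The set R is the recursively defined relation
   "q forces x = y" for x, y in the transitive set t. *)
Definition forces_eq {T} (P L p a b : T) : form T :=
  let at_ R q x y := ∃ z, is_pair x y z ∧ pair_in R q z in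
  let half R q x y :=
    ∀ c, ∀ s ∈ P, pair_in x c s ⇒ ∀ r ∈ P, pair_in L r q ⇒ pair_in L r s ⇒
    ∃ r' ∈ P, pair_in L r' r ∧ ∃ d, ∃ s' ∈ P, pair_in y d s' ∧ pair_in L r' s' ∧ at_ R r' c d in
  ∃ t, transitive t ∧ a ∈ t ∧ b ∈ t ∧ ∃ R,
    (∀ q ∈ P, ∀ x ∈ t, ∀ y ∈ t, at_ R q x y ⇔ half R q x y ∧ half R q y x) ∧
    at_ R p a b.

Definition forces_mem {T} (P L p a b : T) : form T :=
  ∀ q ∈ P, pair_in L q p ⇒
  ∃ r ∈ P, pair_in L r q ∧ ∃ d, ∃ s ∈ P, pair_in b d s ∧ pair_in L r s ∧ forces_eq P L r a d.

Fixpoint forces {T} (P L : T) (phi : form T) (p : T) : form T :=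
  match phi with
  | FMem a b => forces_mem P L p a b
  | FEq a b => forces_eq P L p a b
  | FBot => FBot
  | FImp a b => ∀ q ∈ P, pair_in L q p ⇒ forces P L a q ⇒ forces P L b q
  | FAll h => ∀ x, forces P L (h x) p
  end.

(* b is the canonical name of a, with every condition (rather than just 1)
   attached to the names of the elements of a. *)
Definition check_name {T} (P a b : T) : form T :=
  ∃ t, transitive t ∧ a ∈ t ∧ ∃ h, function_on h t ∧ pair_in h a b ∧
  ∀ x ∈ t, ∀ y, pair_in h x y ⇒
    ∀ z, z ∈ y ⇔ ∃ w ∈ x, ∃ w', pair_in h w w' ∧ ∃ p ∈ P, is_pair w' p z.

(** * The lottery preparation *)

(* In what follows Ps and Ls are the sequences of the posets P_c (c <= k) and of
   their orders, and Qs, Rs, Os (indexed by k) are the sequences of names for the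
   stage forcings, their orders and their top elements. *)

(* p restricted to b forces phi over P_b *)
Definition forced_at {T} (Ps Ls b p : T) (phi : form T) : form T :=
  ∀ P, ∀ L, ∀ r, pair_in Ps b P ⇒ pair_in Ls b L ⇒ restriction p b r ⇒ forces P L phi r.

(* p is a condition of P_c.  Direct limits are taken at inaccessible c, inverse
   limits at all other limits. *)
Definition is_condition {T} (Ps Ls Qs Os c p : T) : form T :=
  function_on p c ∧
  (∀ b ∈ c, ∃ r, restriction p b r ∧ ∃ P, pair_in Ps b P ∧ r ∈ P) ∧
  (∀ b ∈ c, ∀ x, ∀ D, pair_in p b x ⇒ pair_in Qs b D ⇒
     (∃ s, pair_in D x s) ∧ forced_at Ps Ls b p (x ∈ D)) ∧
  (inaccessible c ⇒
     ∃ d ∈ c, ∀ b ∈ c, b ∈ d ∨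
       ∀ x, ∀ o, pair_in p b x ⇒ pair_in Os b o ⇒ forced_at Ps Ls b p (x ≐ o)).

(* p <= q in P_c *)
Definition condition_le {T} (Ps Ls Rs c p q : T) : form T :=
  ∀ b ∈ c, ∀ x, ∀ y, ∀ R, pair_in p b x ⇒ pair_in q b y ⇒ pair_in Rs b R ⇒
    forced_at Ps Ls b p (pair_in R x y).

(* Every name forced to be in D is forced equal to one in the domain of D; since
   the coordinates of conditions are taken in that domain (to have a set of
   them), this makes all names of conditions available as coordinates. *)
Definition full_name {T} (P L D : T) : form T :=
  ∀ p ∈ P, ∀ x, forces P L (x ∈ D) p ⇒
    ∃ y, (∃ s, pair_in D y s) ∧ forces P L (x ≐ y) p.

Definition is_stage {T} (f c P L D R o : T) : form T :=
  let closed := ∀ b ∈ c, ∀ e, pair_in f b e ⇒ e ∈ c in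
  full_name P L D ∧
  (∀ a, pair_in f c a ∧ closed ⇒
     ∃ c', ∃ a', check_name P c c' ∧ check_name P a a' ∧
     ∀ p ∈ P, forces P L (stage_lottery c' a' D R o) p) ∧
  (¬ ((∃ a, pair_in f c a) ∧ closed) ⇒
     ∀ p ∈ P, forces P L (stage_trivial D R o) p).

(* P, ordered by L, is the lottery preparation of k relative to f *)
Definition lottery_preparation {T} (k f P L : T) : form T :=
  ∃ k', is_succ k k' ∧
  ∃ Ps, ∃ Ls, ∃ Qs, ∃ Rs, ∃ Os,
  function_on Ps k' ∧ function_on Ls k' ∧
  function_on Qs k ∧ function_on Rs k ∧ function_on Os k ∧
  (∀ c ∈ k', ∀ Pc, ∀ Lc, pair_in Ps c Pc ⇒ pair_in Ls c Lc ⇒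
     (∀ p, p ∈ Pc ⇔ is_condition Ps Ls Qs Os c p) ∧
     (∀ z, z ∈ Lc ⇔ ∃ p ∈ Pc, ∃ q ∈ Pc, is_pair p q z ∧ condition_le Ps Ls Rs c p q)) ∧
  (∀ c ∈ k, ∀ Pc, ∀ Lc, ∀ D, ∀ R, ∀ o,
     pair_in Ps c Pc ⇒ pair_in Ls c Lc ⇒
     pair_in Qs c D ⇒ pair_in Rs c R ⇒ pair_in Os c o ⇒
     is_stage f c Pc Lc D R o) ∧
  pair_in Ps k P ∧ pair_in Ls k L.

(** * Generic extensions *)

Definition dense {T} (P L D : T) : form T :=
  incl D P ∧ ∀ p ∈ P, ∃ d ∈ D, pair_in L d p.

(* w is the value of the name x under G *)
Definition valuation {T} (G x w : T) : form T :=
  ∃ t, transitive t ∧ x ∈ t ∧ ∃ h, function_on h t ∧ pair_in h x w ∧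
  ∀ y ∈ t, ∀ v, pair_in h y v ⇒
    ∀ z, z ∈ v ⇔ ∃ c, ∃ p ∈ G, pair_in y c p ∧ pair_in h c z.

(* W is V[G], where i embeds V as a transitive submodel of W and G is V-generic
   for the forcing P ordered by L. *)
Record generic_extension (V W : zfc_model) (i : V -> W) (P L : V) (G : W) : Prop := {
  ge_mem : forall x y : V, mem (i x) (i y) <-> mem x y;
  ge_transitive : forall (x : V) (w : W), mem w (i x) -> exists y : V, w = i y;
  ge_subset : W ⊨ incl G (i P);
  ge_nonempty : W ⊨ ¬ empty G;
  ge_upward : W ⊨ ∀ p ∈ G, ∀ q, pair_in (i L) p q ⇒ q ∈ G;
  ge_directed : W ⊨ ∀ p ∈ G, ∀ q ∈ G, ∃ r ∈ G, pair_in (i L) r p ∧ pair_in (i L) r q;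
  ge_generic : forall D : V, (V ⊨ dense P L D) -> W ⊨ ∃ p ∈ G, p ∈ i D;
  ge_generated : forall w : W, exists x : V, W ⊨ valuation G (i x) w
}.
Arguments generic_extension {V W} i P L G.

(* Main.v *)
(* Hamkins' argument. Reduce to a countable V, where forcing is truth in all generic extensions. For large l take a
   Menas fine measure on P_kappa(l), and let A x represent kappa: functions x |-> F x below A x, or into P_(A x), are
   almost constant up to equivalence. Almost everywhere the lottery at A x contains Add(A x,1), and f (A x) >= |x|,
   so the tail forcing has strategies for games of length |x|. Playing them yields conditions rho_x, below the union
   of the stage-(A x) generic, which decide whether x cap lambda lies in the sets named in a list indexed by x, up to
   the part below A x + 1, which normality reflects to a single condition. The sets forced to contain x cap lambda
   almost everywhere form a fine kappa-complete ultrafilter of the extension. *)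
From Corelib Require Import ssreflect.
From Stdlib Require Import Classical ClassicalEpsilon Arith Lia List ProofIrrelevance Cantor FunctionalExtensionality PropExtensionality.
Require Import Defs.
Set Implicit Arguments.
Unset Strict Implicit.

Implicit Types V W : zfc_model.

Notation "H .1" := (proj1 H).
Notation "H .2" := (proj2 H).

Notation funext := functional_extensionality.

Ltac splits := repeat match goal with |- _ /\ _ => split end; try done.

(** * Semantics and definability *)

Class Means (T : Type) (m : T -> T -> Prop) (phi : form T) (P : Prop) : Prop :=
  means : sat m phi <-> P.

Section Connectives.
Variables (T : Type) (m : T -> T -> Prop).
Notation Means := (Means m).

Lemma sat_and (a b : form T) : sat m (a ∧ b) <-> sat m a /\ sat m b.
Proof. rewrite /=; tauto. Qed.

Lemma sat_exists (h : T -> form T) : sat m (∃ x, h x) <-> exists x, sat m (h x).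
Proof.
split=> [H | [x Hx] H]; last exact: (H x Hx).
apply: NNPP => N; apply: H => x Hx; apply: N; by exists x.
Qed.

Lemma means_sat phi : Means phi (sat m phi).
Proof. done. Qed.
Lemma means_iff phi P Q : Means phi P -> (P <-> Q) -> Means phi Q.
Proof. rewrite /Means; tauto. Qed.
Lemma means_mem x y : Means (FMem x y) (m x y).
Proof. done. Qed.
Lemma means_eq x y : Means (FEq x y) (x = y).
Proof. done. Qed.
Lemma means_bot : Means FBot False.
Proof. done. Qed.
Lemma means_imp a b P Q : Means a P -> Means b Q -> Means (FImp a b) (P -> Q).
Proof. rewrite /Means /=; tauto. Qed.
Lemma means_not a P : Means a P -> Means (FImp a FBot) (~ P).
Proof. rewrite /Means /=; tauto. Qed.
Lemma means_and a b P Q : Means a P -> Means b Q -> Means (FImp (FImp a (FImp b FBot)) FBot) (P /\ Q).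
Proof. rewrite /Means /=; tauto. Qed.
Lemma means_or a b P Q : Means a P -> Means b Q -> Means (FImp (FImp a FBot) b) (P \/ Q).
Proof. rewrite /Means /=; tauto. Qed.
Lemma means_equiv a b P Q : Means a P -> Means b Q -> Means (FImp (FImp (FImp a b) (FImp (FImp b a) FBot)) FBot) (P <-> Q).
Proof. rewrite /Means /=; tauto. Qed.
Lemma means_all h P : (forall x, Means (h x) (P x)) -> Means (FAll h) (forall x, P x).
Proof. by move=> H; split=> K x; apply/H. Qed.
Lemma means_ex h P : (forall x, Means (h x) (P x)) -> Means (FImp (FAll (fun x => FImp (h x) FBot)) FBot) (exists x, P x).
Proof. by move=> H; rewrite /Means (sat_exists h); split=> -[x Hx]; exists x; apply/H. Qed.
End Connectives.

Hint Resolve means_mem means_eq means_bot | 0 : typeclass_instances.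
Hint Resolve means_equiv | 1 : typeclass_instances.
Hint Resolve means_and means_ex means_all | 2 : typeclass_instances.
Hint Resolve means_or | 3 : typeclass_instances.
Hint Resolve means_not | 4 : typeclass_instances.
Hint Resolve means_imp | 5 : typeclass_instances.

Fixpoint rename (s : nat -> nat) (phi : fo) : fo :=
  match phi with
  | fo_mem i j => fo_mem (s i) (s j)
  | fo_eq i j => fo_eq (s i) (s j)
  | fo_bot => fo_bot
  | fo_imp a b => fo_imp (rename s a) (rename s b)
  | fo_all a => fo_all (rename (fun n => match n with O => O | S k => S (s k) end) a)
  end.

Section Renaming.
Variables (T : Type) (m : T -> T -> Prop).

Lemma interp_ext phi (e e' : nat -> T) : (forall n, e n = e' n) -> sat m (interp e phi) <-> sat m (interp e' phi).
Proof.
elim: phi e e' => [i j|i j||a IHa b IHb|a IHa] e e' E /=.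
1,2: by rewrite !E.
- done.
- by rewrite (IHa e e') // (IHb e e').
- by split=> K x; move: (K x); apply IHa; case=> /=.
Qed.

Lemma sat_rename phi s (e : nat -> T) : sat m (interp e (rename s phi)) <-> sat m (interp (fun n => e (s n)) phi).
Proof.
elim: phi s e => [i j|i j||a IHa b IHb|a IHa] s e //=.
- by rewrite IHa IHb.
- by split=> K x; move: (K x); rewrite IHa; apply interp_ext; case.
Qed.
End Renaming.

Infix "#" := mem (at level 70).
Notation "∀ x # a , P" := (forall x, x # a -> P) (at level 200, x name, a at level 69, P at level 200).
Notation "∃ x # a , P" := (exists x, x # a /\ P) (at level 200, x name, a at level 69, P at level 200).

Section Definability.
Variable V : zfc_model.

Definition atom (c : nat + V) (e : nat -> V) : V :=
  match c with inl i => e i | inr v => v end.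

Definition definable (Q : (nat -> V) -> Prop) : Prop :=
  exists phi s, forall e, Q e <-> sat mem (interp (fun k => atom (s k) e) phi).

Definition definable_fun (t : (nat -> V) -> V) : Prop :=
  definable (fun e => e 0 = t (fun k => e (S k))).

Lemma definable_ext Q Q' : (forall e, Q' e <-> Q e) -> definable Q -> definable Q'.
Proof. by move=> E [phi[s H]]; exists phi, s => e; rewrite E. Qed.

Lemma definable_atoms (r : nat -> nat + V) Q : definable Q -> definable (fun e => Q (fun k => atom (r k) e)).
Proof.
move=> [phi[s H]]; exists phi, (fun k => match s k with inl i => r i | c => c end) => e.
by rewrite H; apply: interp_ext => k; case: (s k).
Qed.

Lemma definable_rename (r : nat -> nat) Q : definable Q -> definable (fun e => Q (fun k => e (r k))).
Proof. exact: (definable_atoms (fun k => inl (r k))). Qed.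

Lemma definable_binder Q : definable Q -> exists phi s, forall x e,
  Q (scons x e) <-> sat mem (interp (scons x (fun k => atom (s k) e)) phi).
Proof.
move=> [phi[s H]].
exists (rename (fun k => match s k with inl 0 => 0 | _ => S k end) phi).
exists (fun k => match s k with inl (S i) => inl i | c => c end) => x e.
by rewrite H sat_rename; apply: interp_ext => k; case E: (s k) => [[|i]|v] //=; rewrite E.
Qed.

Lemma definable_bot : definable (fun _ => False).
Proof. by exists fo_bot, (fun _ => inl 0). Qed.
Lemma definable_mem_atoms a b : definable (fun e => atom a e # atom b e).
Proof. by exists (fo_mem 0 1), (fun k => match k with 0 => a | _ => b end). Qed.
Lemma definable_eq_atoms a b : definable (fun e => atom a e = atom b e).
Proof. by exists (fo_eq 0 1), (fun k => match k with 0 => a | _ => b end). Qed.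

Lemma definable_imp Q Q' : definable Q -> definable Q' -> definable (fun e => Q e -> Q' e).
Proof.
move=> [phi[s H]] [phi'[s' H']].
exists (fo_imp (rename (fun k => 2 * k) phi) (rename (fun k => S (2 * k)) phi')).
exists (fun k => if Nat.even k then s (Nat.div2 k) else s' (Nat.div2 k)) => e.
rewrite H H' /= !sat_rename.
have E : sat mem (interp (fun k => atom (s k) e) phi) <-> sat mem (interp (fun k => atom
  (if Nat.even (2 * k) then s (Nat.div2 (2 * k)) else s' (Nat.div2 (2 * k))) e) phi).
{ by apply: interp_ext => k; rewrite Nat.even_even Nat.div2_double. }
have E' : sat mem (interp (fun k => atom (s' k) e) phi') <-> sat mem (interp (fun k => atom
  (if Nat.even (S (2 * k)) then s (Nat.div2 (S (2 * k))) else s' (Nat.div2 (S (2 * k)))) e) phi').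
{ apply: interp_ext => k; rewrite Nat.div2_succ_double.
  by replace (S (2 * k)) with (2 * k + 1) by lia; rewrite Nat.even_odd. }
by rewrite E E'.
Qed.

Lemma definable_all (Q : V -> (nat -> V) -> Prop) :
  definable (fun e => Q (e 0) (fun k => e (S k))) -> definable (fun e => forall x, Q x e).
Proof.
case/definable_binder => phi [s H]; exists (fo_all phi), s => e.
by split=> K x; apply (H x e); exact: K.
Qed.

Lemma definable_not Q : definable Q -> definable (fun e => ~ Q e).
Proof. move=> H; exact: (definable_imp H definable_bot). Qed.

Lemma definable_and Q Q' : definable Q -> definable Q' -> definable (fun e => Q e /\ Q' e).
Proof.
move=> H H'; apply: (definable_ext (Q := fun e => ~ (Q e -> ~ Q' e))) => [e|]; first by tauto.
exact: (definable_not (definable_imp H (definable_not H'))).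
Qed.

Lemma definable_or Q Q' : definable Q -> definable Q' -> definable (fun e => Q e \/ Q' e).
Proof.
move=> H H'; apply: (definable_ext (Q := fun e => ~ Q e -> Q' e)) => [e|]; first by tauto.
exact: (definable_imp (definable_not H) H').
Qed.

Lemma definable_iff Q Q' : definable Q -> definable Q' -> definable (fun e => Q e <-> Q' e).
Proof. by move=> H H'; apply: definable_and; apply: definable_imp. Qed.

Lemma definable_ex (Q : V -> (nat -> V) -> Prop) :
  definable (fun e => Q (e 0) (fun k => e (S k))) -> definable (fun e => exists x, Q x e).
Proof.
move=> H; apply: (definable_ext (Q := fun e => ~ forall x, ~ Q x e)) => [e|].
- split=> [[x Hx] N|N]; [exact: (N x Hx)|exact: not_all_not_ex].
- exact: (definable_not (definable_all (Q := fun x e => ~ Q x e) (definable_not H))).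
Qed.

Lemma definable_prop (P : Prop) : definable (fun _ => P).
Proof.
case: (classic P) => H; last by apply: definable_ext definable_bot.
by apply: definable_ext (definable_not definable_bot) => _; tauto.
Qed.

Lemma definable_fun_var k : definable_fun (fun e => e k).
Proof. exact: (definable_eq_atoms (inl 0) (inl (S k))). Qed.
Lemma definable_fun_const c : definable_fun (fun _ => c).
Proof. exact: (definable_eq_atoms (inl 0) (inr c)). Qed.
Lemma definable_fun_rename (r : nat -> nat) t : definable_fun t -> definable_fun (fun e => t (fun k => e (r k))).
Proof. exact: (definable_rename (fun k => match k with 0 => 0 | S k => S (r k) end)). Qed.

Lemma definable_subst (Q : V -> (nat -> V) -> Prop) t :
  definable (fun e => Q (e 0) (fun k => e (S k))) -> definable_fun t -> definable (fun e => Q (t e) e).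
Proof.
move=> H Ht; apply: (definable_ext (Q := fun e => exists x, x = t e /\ Q x e)) => [e|].
- by split=> [|[x[-> K]] //]; exists (t e).
- exact: (definable_ex (Q := fun x e => x = t e /\ Q x e) (definable_and Ht H)).
Qed.

Lemma definable_rel (R : V -> V -> Prop) t u : definable (fun e => R (e 1) (e 0)) ->
  definable_fun t -> definable_fun u -> definable (fun e => R (t e) (u e)).
Proof.
move=> H Ht Hu; apply: (definable_subst (Q := fun x e => R x (u e))) => //.
apply: (definable_subst (Q := fun y e => R (e 0) y)) (definable_fun_rename S Hu) => //.
Qed.

Lemma definable_mem t u : definable_fun t -> definable_fun u -> definable (fun e => t e # u e).
Proof. exact: (definable_rel (definable_mem_atoms (inl 1) (inl 0))). Qed.
Lemma definable_eq t u : definable_fun t -> definable_fun u -> definable (fun e => t e = u e).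
Proof. exact: (definable_rel (definable_eq_atoms (inl 1) (inl 0))). Qed.

Lemma definable_sat phi (v : nat -> (nat -> V) -> V) : (forall k, definable_fun (v k)) ->
  definable (fun e => sat mem (interp (fun k => v k e) phi)).
Proof.
elim: phi v => [i j|i j||a IHa b IHb|a IHa] v Hv /=.
- exact: definable_mem.
- exact: definable_eq.
- exact: definable_bot.
- by apply: definable_imp; [apply: IHa|apply: IHb].
- apply: (definable_all (Q := fun x e => sat mem (interp (scons x (fun k => v k e)) a))).
  apply: (IHa (fun n e => match n with 0 => e 0 | S k => v k (fun i => e (S i)) end)) => -[|k].
  + exact: definable_fun_var.
  + exact: (definable_fun_rename S (Hv k)).
Qed.

Lemma definable_comp (v : nat -> (nat -> V) -> V) Q :
  definable Q -> (forall k, definable_fun (v k)) -> definable (fun e => Q (fun k => v k e)).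
Proof.
move=> [phi[s H]] Hv; apply: definable_ext (fun e => H _) _.
apply: (@definable_sat phi (fun k e => atom (s k) (fun j => v j e))) => k.
by case: (s k) => [i|c] /=; [exact: Hv|exact: definable_fun_const].
Qed.
End Definability.

Class Definable1 V (Q : V -> Prop) : Prop := definable1 : definable (fun e => Q (e 0)).
Class Definable2 V (Q : V -> V -> Prop) : Prop :=
  definable2 : definable (fun e => Q (e 0) (e 1)).
Class Definable3 V (Q : V -> V -> V -> Prop) : Prop :=
  definable3 : definable (fun e => Q (e 0) (e 1) (e 2)).
Class Definable4 V (Q : V -> V -> V -> V -> Prop) : Prop :=
  definable4 : definable (fun e => Q (e 0) (e 1) (e 2) (e 3)).
Class Definable5 V (Q : V -> V -> V -> V -> V -> Prop) : Prop :=
  definable5 : definable (fun e => Q (e 0) (e 1) (e 2) (e 3) (e 4)).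
Class DefinableFun1 V (F : V -> V) : Prop :=
  definable_fun1 : definable_fun (fun e => F (e 0)).
Class DefinableFun2 V (F : V -> V -> V) : Prop :=
  definable_fun2 : definable_fun (fun e => F (e 0) (e 1)).
Class DefinableFun3 V (F : V -> V -> V -> V) : Prop :=
  definable_fun3 : definable_fun (fun e => F (e 0) (e 1) (e 2)).

Section Composition.
Variables (V : zfc_model) (t u v w x : (nat -> V) -> V).

Definition arguments (k : nat) : (nat -> V) -> V :=
  match k with 0 => t | 1 => u | 2 => v | 3 => w | _ => x end.

Lemma definable_comp5 Q : Definable5 Q -> definable_fun t -> definable_fun u -> definable_fun v ->
  definable_fun w -> definable_fun x -> definable (fun e => Q (t e) (u e) (v e) (w e) (x e)).
Proof. by move=> H *; apply: (definable_comp (v := arguments) H); do 4?case. Qed.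
End Composition.

Section CompositionFew.
Variables (V : zfc_model) (t u v w : (nat -> V) -> V).

Lemma definable_comp4 Q : Definable4 Q -> definable_fun t -> definable_fun u -> definable_fun v ->
  definable_fun w -> definable (fun e => Q (t e) (u e) (v e) (w e)).
Proof. by move=> H *; apply: (definable_comp (v := arguments t u v w t) H); do 4?case. Qed.

Lemma definable_comp3 Q : Definable3 Q -> definable_fun t -> definable_fun u -> definable_fun v ->
  definable (fun e => Q (t e) (u e) (v e)).
Proof. by move=> H *; apply: (definable_comp (v := arguments t u v t t) H); do 4?case. Qed.

Lemma definable_comp2 Q : Definable2 Q -> definable_fun t -> definable_fun u -> definable (fun e => Q (t e) (u e)).
Proof. by move=> H *; apply: (definable_comp (v := arguments t u t t t) H); do 4?case. Qed.
Lemma definable_comp1 Q : Definable1 Q -> definable_fun t -> definable (fun e => Q (t e)).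
Proof. by move=> H *; apply: (definable_comp (v := arguments t t t t t) H); do 4?case. Qed.

Definition value_and_arguments : nat -> (nat -> V) -> V :=
  let shift s (e : nat -> V) : V := s (fun k => e (S k)) in arguments (fun e => e 0) (shift t) (shift u) (shift v) (shift v).

Lemma definable_value_and_arguments Q : definable Q -> definable_fun t -> definable_fun u -> definable_fun v ->
  definable (fun e => Q (fun k => value_and_arguments k e)).
Proof.
move=> H *; apply: (definable_comp H) => -[|[|[|[|k]]]]; first exact: definable_fun_var.
all: exact: (definable_fun_rename S).
Qed.

Lemma definable_fun_comp3 F : DefinableFun3 F -> definable_fun t -> definable_fun u -> definable_fun v ->
  definable_fun (fun e => F (t e) (u e) (v e)).
Proof. exact: definable_value_and_arguments. Qed.
End CompositionFew.

Lemma definable_fun_comp2 V t u (F : V -> V -> V) :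
  DefinableFun2 F -> definable_fun t -> definable_fun u -> definable_fun (fun e => F (t e) (u e)).
Proof. by move=> H *; apply: (definable_value_and_arguments (t := t) (u := u) (v := t) H). Qed.

Lemma definable_fun_comp1 V t (F : V -> V) : DefinableFun1 F -> definable_fun t -> definable_fun (fun e => F (t e)).
Proof. by move=> H *; apply: (definable_value_and_arguments (t := t) (u := t) (v := t) H). Qed.

(** * Sets *)

Section Basics.
Variable V : zfc_model.
Implicit Types x y z a b c d f r : V.
Notation Means := (Means (@mem V)).

Lemma set_ext x y : (forall z, z # x <-> z # y) -> x = y.
Proof.
have E : Means (∀ x, ∀ y, (∀ z, z ∈ x ⇔ z ∈ y) ⇒ x ≐ y) (forall x y : V, (forall z, z # x <-> z # y) -> x = y) by exact _.
exact: (E.1 (zfc_ext (univ_ZFC V)) x y).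
Qed.

Lemma foundation x : (exists y, y # x) -> ∃ y # x, ∀ z # y, ~ z # x.
Proof.
move=> [y Hy].
have E : Means (∀ x, ¬ empty x ⇒ ∃ y ∈ x, ∀ z ∈ y, ¬ z ∈ x) (forall x : V, (forall z, ~ z # x) \/ ∃ y # x, ∀ z # y, ~ z # x).
{ rewrite /empty; exact _. }
by case: (E.1 (zfc_found (univ_ZFC V)) x) => // /(_ y Hy).
Qed.

Lemma inhabited_model : inhabited V.
Proof. by move: (zfc_inf (univ_ZFC V)) => /sat_exists[x _]. Qed.

Definition the (P : V -> Prop) : V := epsilon inhabited_model P.

Lemma the_spec P : (exists x, P x) -> P (the P).
Proof. exact: epsilon_spec. Qed.

Definition duo a b : V := the (fun c => forall z, z # c <-> z = a \/ z = b).

Lemma in_duo a b z : z # duo a b <-> z = a \/ z = b.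
Proof.
apply: (the_spec (P := fun c => forall z, z # c <-> z = a \/ z = b)).
have E : Means (∀ a, ∀ b, ∃ c, upair a b c) (forall a b : V, exists c, forall z, z # c <-> z = a \/ z = b).
{ rewrite /upair; exact _. }
exact: (E.1 (zfc_pair (univ_ZFC V))).
Qed.

Definition union x : V := the (fun u => forall z, z # u <-> ∃ y # x, z # y).

Lemma in_union x z : z # union x <-> ∃ y # x, z # y.
Proof.
apply: (the_spec (P := fun u => forall z, z # u <-> ∃ y # x, z # y)).
have E : Means (∀ x, ∃ u, ∀ z, z ∈ u ⇔ ∃ y ∈ x, z ∈ y) (forall x : V, exists u, forall z, z # u <-> ∃ y # x, z # y) by exact _.
exact: (E.1 (zfc_union (univ_ZFC V))).
Qed.

Definition sub x y : Prop := ∀ z # x, z # y.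
Definition power x : V := the (fun p => forall z, z # p <-> sub z x).

Lemma in_power x z : z # power x <-> sub z x.
Proof.
apply: (the_spec (P := fun p => forall z, z # p <-> sub z x)).
have E : Means (∀ x, ∃ p, powerset x p) (forall x : V, exists p, forall z, z # p <-> ∀ u # z, u # x).
{ rewrite /powerset /incl; exact _. }
exact: (E.1 (zfc_power (univ_ZFC V))).
Qed.

Definition sep a (Q : V -> Prop) : V := the (fun b => forall x, x # b <-> x # a /\ Q x).

Lemma in_sep a Q x : Definable1 Q -> x # sep a Q <-> x # a /\ Q x.
Proof.
move=> /definable_binder[phi[s H]].
apply: (the_spec (P := fun b => forall x, x # b <-> x # a /\ Q x)).
pose env x := scons x (fun k => atom (s k) (fun _ => a)).
have E : Means (∀ a, ∃ b, ∀ x, x ∈ b ⇔ x ∈ a ∧ interp (env x) phi)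
  (forall a, exists b, forall x, x # b <-> x # a /\ sat mem (interp (env x) phi)).
{ pose proof (means_sat (@mem V)); exact _. }
case: (E.1 (zfc_sep (univ_ZFC V) phi _) a) => b Hb.
by exists b => z; rewrite Hb -H.
Qed.

Lemma replacement a (R : V -> V -> Prop) : Definable2 R -> (forall x y y', x # a -> R x y -> R x y' -> y = y') ->
  exists b, forall y, y # b <-> ∃ x # a, R x y.
Proof.
move=> [phi[s H]] U.
pose psi := rename (fun k => match s k with inl 0 => 0 | inl 1 => 1 | _ => S (S k) end) phi.
pose env x y := scons x (scons y (fun k => atom (s k) (fun _ => a))).
have J x y : sat mem (interp (env x y) psi) <-> R x y.
{ rewrite (H (scons x (scons y (fun _ => a)))) /psi /env sat_rename; apply: interp_ext => k.
  by case E : (s k) => [[|[|i]]|v] /=; rewrite ?E. }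
have E : Means (∀ a, (∀ x ∈ a, ∀ y, ∀ y', interp (env x y) psi ⇒ interp (env x y') psi ⇒ y ≐ y') ⇒
  ∃ b, ∀ y, y ∈ b ⇔ ∃ x ∈ a, interp (env x y) psi) (forall a, (∀ x # a,
    forall y y', sat mem (interp (env x y) psi) -> sat mem (interp (env x y') psi) -> y = y') ->
  exists b, forall y, y # b <-> ∃ x # a, sat mem (interp (env x y) psi)).
{ pose proof (means_sat (@mem V)); exact _. }
case: (E.1 (zfc_repl (univ_ZFC V) psi _) a) => [x Hx y y' /J A /J B|b Hb]; first exact: (U x y y').
by exists b => y; rewrite Hb; split=> -[x[Hx /J]]; exists x.
Qed.

Definition image a (F : V -> V) : V := the (fun b => forall y, y # b <-> ∃ x # a, y = F x).

Lemma in_image a F y : DefinableFun1 F -> y # image a F <-> ∃ x # a, y = F x.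
Proof.
move=> H; apply: (the_spec (P := fun b => forall y, y # b <-> ∃ x # a, y = F x)).
apply: (replacement (R := fun x y => y = F x)) => [|x z z' _ -> ->] //.
exact: (definable_rename (fun k => match k with 0 => 1 | _ => 0 end) H).
Qed.

Definition pair a b : V := duo (duo a a) (duo a b).
Definition emp : V := sep (the (fun _ => True)) (fun _ => False).
Definition sing a : V := duo a a.
Definition cup a b : V := union (duo a b).
Definition succ a : V := cup a (sing a).
Definition cap a b : V := sep a (fun x => x # b).
Definition diff a b : V := sep a (fun x => ~ x # b).
(* Outside the domain of f, and when f is not a function, the value [app f x] is junk. *)
Definition app f x : V := union (sep (union (union f)) (fun y => pair x y # f)).
Definition lam d (F : V -> V) : V := image d (fun x => pair x (F x)).
Definition trans x : Prop := ∀ y # x, sub y x.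
Definition ord x : Prop := trans x /\ ∀ y # x, trans y.
Definition is_fun f : Prop :=
  (∀ c # f, exists a b, c = pair a b) /\ (forall a b b', pair a b # f -> pair a b' # f -> b = b').
Definition fun_on f d : Prop := is_fun f /\ forall a, a # d <-> exists b, pair a b # f.
Definition restr f d : V := sep f (fun z => ∃ a # d, exists b, z = pair a b).

Lemma definable_fun_of_mem (t : (nat -> V) -> V) : definable (fun e => e 0 # t (fun k => e (S k))) -> definable_fun t.
Proof.
move=> H; apply: (definable_ext (Q := fun e => forall z, z # e 0 <-> z # t (fun k => e (S k)))) => [e|].
- by split=> [->|K] //; exact: set_ext.
- apply: (definable_all (Q := fun z e => z # e 0 <-> z # t (fun k => e (S k)))).
  apply: definable_iff; first exact: (definable_mem_atoms (inl 0) (inl 1)).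
  exact: (definable_rename (fun k => match k with 0 => 0 | S k => S (S k) end) H).
Qed.

Lemma definable_fun_sep t (Q : V -> (nat -> V) -> Prop) : definable_fun t ->
  definable (fun e => Q (e 0) (fun k => e (S k))) -> definable_fun (fun e => sep (t e) (fun x => Q x e)).
Proof.
move=> Ht HQ; apply: definable_fun_of_mem.
apply: (definable_ext _ (definable_and (definable_mem (definable_fun_var V 0) (definable_fun_rename S Ht)) HQ)).
move=> e; apply: in_sep.
exact: (definable_atoms (fun k => match k with 0 => inl 0 | S k => inr (e (S k)) end) HQ).
Qed.

Lemma definable_fun_image t (F : V -> (nat -> V) -> V) : definable_fun t ->
  definable_fun (fun e => F (e 0) (fun k => e (S k))) -> definable_fun (fun e => image (t e) (fun x => F x e)).
Proof.
move=> Ht HF; apply: definable_fun_of_mem.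
apply: (definable_ext (Q := fun e => ∃ x # t (fun k => e (S k)), e 0 = F x (fun k => e (S k)))) => [e|].
- apply: in_image.
  exact: (definable_atoms (fun k => match k with 0 => inl 0 | 1 => inl 1 | S (S k) => inr (e (S k)) end) HF).
- apply: (definable_ex (Q := fun x e => x # t (fun k => e (S k)) /\ e 0 = F x (fun k => e (S k)))).
  apply: definable_and; first exact: (definable_mem (definable_fun_var V 0) (definable_fun_rename (fun k => S (S k)) Ht)).
  exact: (definable_rename (fun k => match k with 0 => 1 | 1 => 0 | k => k end) HF).
Qed.

Lemma definable2_sub : Definable2 sub.
Proof.
apply: (definable_all (Q := fun z e => z # e 0 -> z # e 1)).
by apply: definable_imp; apply: definable_mem; apply: definable_fun_var.
Qed.

Lemma definable_fun2_duo : DefinableFun2 duo.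
Proof.
apply: definable_fun_of_mem; apply: definable_ext (fun e => in_duo _ _ _) _.
by apply: definable_or; apply: definable_eq; apply: definable_fun_var.
Qed.

Lemma definable_fun1_union : DefinableFun1 union.
Proof.
apply: definable_fun_of_mem; apply: definable_ext (fun e => in_union _ _) _.
apply: (definable_ex (Q := fun y e => y # e 1 /\ e 0 # y)).
by apply: definable_and; apply: definable_mem; apply: definable_fun_var.
Qed.

Lemma definable_fun1_power : DefinableFun1 power.
Proof.
apply: definable_fun_of_mem; apply: definable_ext (fun e => in_power _ _) _.
exact: (definable_comp2 definable2_sub (definable_fun_var V 0) (definable_fun_var V 1)).
Qed.
End Basics.
Arguments emp {V}.
Notation "x .+1" := (succ x) (at level 2, left associativity, format "x .+1").

Create HintDb definable.
Hint Resolve definable2_sub definable_fun2_duo definable_fun1_union definable_fun1_power : definable.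

Ltac definability_forcing := fail.
Ltac definability_extra := fail.
Ltac head_of t := lazymatch t with ?f _ => head_of f | _ => t end.
Ltac definability_op lem :=
  simple apply lem; [first [solve [trivial with definable nocore] | definability_unfold] | ..]
with definability_unfold := match goal with |- _ ?R => let h := head_of R in unfold h; solve [repeat definability_step] end
with definability_step :=
  cbv beta;
  match goal with
  | |- Definable1 ?Q => first [solve [trivial with definable nocore] | change (definable (fun e => Q (e 0)))]
  | |- Definable2 ?Q => first [solve [trivial with definable nocore] | change (definable (fun e => Q (e 0) (e 1)))]
  | |- Definable3 ?Q => change (definable (fun e => Q (e 0) (e 1) (e 2)))
  | |- Definable4 ?Q => change (definable (fun e => Q (e 0) (e 1) (e 2) (e 3)))
  | |- Definable5 ?Q => change (definable (fun e => Q (e 0) (e 1) (e 2) (e 3) (e 4)))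
  | |- DefinableFun1 ?F => first [solve [trivial with definable nocore] | change (definable_fun (fun e => F (e 0)))]
  | |- DefinableFun2 ?F => first [solve [trivial with definable nocore] | change (definable_fun (fun e => F (e 0) (e 1)))]
  | |- DefinableFun3 ?F => change (definable_fun (fun e => F (e 0) (e 1) (e 2)))
  | |- definable (fun _ => ?P) => simple apply definable_prop
  | |- definable_fun (fun _ => ?c) => simple apply definable_fun_const
  | |- definable_fun (fun e => e ?k) => simple apply definable_fun_var
  | |- definable (fun e => @?A e /\ @?B e) => simple apply (@definable_and _ A B)
  | |- definable (fun e => @?A e \/ @?B e) => simple apply (@definable_or _ A B)
  | |- definable (fun e => @?A e <-> @?B e) => simple apply (@definable_iff _ A B)
  | |- definable (fun e => ~ @?A e) => simple apply (@definable_not _ A)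
  | |- definable (fun e => @?A e -> @?B e) => simple apply (@definable_imp _ A B)
  | |- definable (fun e => forall x, @?Q x e) => simple apply (@definable_all _ Q)
  | |- definable (fun e => exists x, @?Q x e) => simple apply (@definable_ex _ Q)
  | |- definable (fun e => @?t e = @?u e) => simple apply (@definable_eq _ t u)
  | |- definable (fun e => @?t e # @?u e) => simple apply (@definable_mem _ t u)
  | |- definable_fun (fun e => sep (@?t e) (@?Q e)) => simple apply (@definable_fun_sep _ t (fun x e => Q e x))
  | |- definable_fun (fun e => image (@?t e) (@?F e)) => simple apply (@definable_fun_image _ t (fun x e => F e x))
  | H : definable_fun ?t |- definable_fun (fun e => ?t (fun k => e (@?r k))) => exact (definable_fun_rename r H)
  | H : definable_fun ?t |- definable_fun (fun e => ?t e) => exact H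
  | H : definable ?Q |- definable (fun e => ?Q (fun k => e (@?r k))) => exact (definable_rename r H)
  | H : definable ?Q |- definable (fun e => ?Q e) => exact H
  | _ => definability_extra
  | |- definable (fun e => ?R (@?t e) (@?u e) (@?v e) (@?w e) (@?x e)) => definability_op (@definable_comp5 _ t u v w x R)
  | |- definable (fun e => ?R (@?t e) (@?u e) (@?v e) (@?w e)) => definability_op (@definable_comp4 _ t u v w R)
  | |- definable (fun e => ?R (@?t e) (@?u e) (@?v e)) => definability_op (@definable_comp3 _ t u v R)
  | |- definable (fun e => ?R (@?t e) (@?u e)) => definability_op (@definable_comp2 _ t u R)
  | |- definable (fun e => ?R (@?t e)) => definability_op (@definable_comp1 _ t R)
  | |- definable_fun (fun e => ?F (@?t e) (@?u e) (@?v e)) => definability_op (@definable_fun_comp3 _ t u v F)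
  | |- definable_fun (fun e => ?F (@?t e) (@?u e)) => definability_op (@definable_fun_comp2 _ t u F)
  | |- definable_fun (fun e => ?F (@?t e)) => definability_op (@definable_fun_comp1 _ t F)
  end.
Ltac definability := intros; repeat definability_step.
Hint Extern 0 (Definable1 _) => solve [definability] : typeclass_instances.
Hint Extern 0 (Definable2 _) => solve [definability] : typeclass_instances.
Hint Extern 0 (DefinableFun1 _) => solve [definability] : typeclass_instances.
Hint Extern 0 (DefinableFun2 _) => solve [definability] : typeclass_instances.

Lemma unordered_pair_inj (T : Type) (a b c d : T) :
  (forall x, (x = a \/ x = b) <-> (x = c \/ x = d)) -> (a = c /\ b = d) \/ (a = d /\ b = c).
Proof.
move=> H.
case: ((H a).1 (or_introl eq_refl)) ((H b).1 (or_intror eq_refl)) => Ea [] Eb;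
case: ((H c).2 (or_introl eq_refl)) ((H d).2 (or_intror eq_refl)) => Ec [] Ed;
  first [by left; split; congruence | by right; split; congruence].
Qed.

Section Operations.
Variable V : zfc_model.
Implicit Types x y z a b c d f g r : V.

Lemma definable_fun2_pair : DefinableFun2 (@pair V).
Proof. rewrite /pair; definability. Qed.
Lemma duo_inj a b c d : duo a b = duo c d -> (a = c /\ b = d) \/ (a = d /\ b = c).
Proof. by move=> E; apply: unordered_pair_inj => x; rewrite -!in_duo E. Qed.

Lemma pair_inj a b c d : pair a b = pair c d -> a = c /\ b = d.
Proof.
move=> /duo_inj[[/duo_inj A /duo_inj B]|[/duo_inj A /duo_inj B]]; intuition congruence.
Qed.

Lemma in_emp x : ~ x # emp.
Proof. by move=> /in_sep[]. Qed.
Lemma eq_emp x : (forall z, ~ z # x) -> x = emp.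
Proof. by move=> H; apply: set_ext => z; split=> [/H|/in_emp]. Qed.
Lemma neq_emp_ex x : x <> emp -> exists z, z # x.
Proof. by move=> H; apply: NNPP => N; apply: H; apply: eq_emp => z Hz; apply: N; exists z. Qed.

Lemma not_sub x y : ~ sub x y -> ∃ z # x, ~ z # y.
Proof.
move=> H; apply: NNPP => N; apply: H => z Hz; apply: NNPP => Nz; apply: N; by exists z.
Qed.

Lemma sub_antisym x y : sub x y -> sub y x -> x = y.
Proof. by move=> S S'; apply: set_ext => z; split; auto. Qed.
Lemma in_sing a x : x # sing a <-> x = a.
Proof. rewrite in_duo; tauto. Qed.

Lemma in_cup a b x : x # cup a b <-> x # a \/ x # b.
Proof.
rewrite in_union; split=> [[y[/in_duo[->|->]]]|[H|H]]; try tauto.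
- by exists a; rewrite in_duo; tauto.
- by exists b; rewrite in_duo; tauto.
Qed.

Lemma inS a x : x # a.+1 <-> x # a \/ x = a.
Proof. by rewrite in_cup in_sing. Qed.
Lemma memS a : a # a.+1.
Proof. by apply/inS; right. Qed.
Lemma subS a : sub a a.+1.
Proof. by move=> x Hx; apply/inS; left. Qed.
Lemma in_cap a b x : x # cap a b <-> x # a /\ x # b.
Proof. exact: in_sep. Qed.
Lemma in_diff a b x : x # diff a b <-> x # a /\ ~ x # b.
Proof. exact: in_sep. Qed.

End Operations.
Hint Resolve definable_fun2_pair : definable.

Section Functions.
Variable V : zfc_model.
Implicit Types x y z a b c d f g r : V.

Lemma definable_fun_lam (t : (nat -> V) -> V) (F : V -> (nat -> V) -> V) : definable_fun t ->
  definable_fun (fun e => F (e 0) (fun k => e (S k))) -> definable_fun (fun e => lam (t e) (fun x => F x e)).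
Proof.
move=> Ht HF; apply: (definable_fun_image (F := fun x e => pair x (F x e))) => //.
exact: (definable_fun_comp2 (definable_fun2_pair V) (definable_fun_var V 0) HF).
Qed.

Definition ite (P : Prop) x y : V :=
  match excluded_middle_informative P with left _ => x | right _ => y end.

Lemma ite_true (P : Prop) x y : P -> ite P x y = x.
Proof. by rewrite /ite; case: excluded_middle_informative. Qed.
Lemma ite_false (P : Prop) x y : ~ P -> ite P x y = y.
Proof. by rewrite /ite; case: excluded_middle_informative. Qed.

Lemma definable_fun_ite (P : (nat -> V) -> Prop) t u : definable P -> definable_fun t ->
  definable_fun u -> definable_fun (fun e => ite (P e) (t e) (u e)).
Proof.
move=> HP Ht Hu; set shift := fun e : nat -> V => fun k => e (S k).
have HP' : definable (fun e => P (shift e)) := definable_rename S HP.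
apply: (definable_ext (Q := fun e => (P (shift e) -> e 0 = t (shift e)) /\ (~ P (shift e) -> e 0 = u (shift e)))).
- by move=> e; rewrite /ite -/(shift e); case: excluded_middle_informative; tauto.
- by apply: definable_and; apply: definable_imp => //; exact: definable_not.
Qed.

Lemma union_sep_unique a (Q : V -> Prop) y : Definable1 Q -> y # a -> (forall x, Q x <-> x = y) -> union (sep a Q) = y.
Proof.
move=> DQ Hy HQ; apply: set_ext => z; rewrite in_union; split=> [[w[/in_sep[_ /HQ->]]] //|Hz].
by exists y; split=> //; apply/in_sep; split=> //; apply/HQ.
Qed.

Lemma duo_in_pair x y : duo x y # pair x y.
Proof. by apply/in_duo; right. Qed.

Lemma app_eq f x y : is_fun f -> pair x y # f -> app f x = y.
Proof.
move=> [_ U] H; apply: union_sep_unique => [|w]; last by split=> [/U|->] //; exact.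
apply/in_union; exists (duo x y); split; last by apply/in_duo; right.
by apply/in_union; exists (pair x y); split=> //; exact: duo_in_pair.
Qed.

Definition pr1 z : V := union (sep (union z) (fun a => exists b, z = pair a b)).
Definition pr2 z : V := union (sep (union z) (fun b => exists a, z = pair a b)).

Lemma pr1_pair a b : pr1 (pair a b) = a.
Proof.
apply: union_sep_unique => [|x]; last by split=> [[y /pair_inj[]] //|->]; exists b.
by apply/in_union; exists (duo a b); split; [exact: duo_in_pair|apply/in_duo; left].
Qed.

Lemma pr2_pair a b : pr2 (pair a b) = b.
Proof.
apply: union_sep_unique => [|x]; last by split=> [[y /pair_inj[]] //|->]; exists a.
by apply/in_union; exists (duo a b); split; [exact: duo_in_pair|apply/in_duo; right].
Qed.

Lemma pair_app f d x : fun_on f d -> x # d -> pair x (app f x) # f.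
Proof. by move=> [H D] /D[y Hy]; rewrite (app_eq H Hy). Qed.

Lemma pair_in_fun f d x y : fun_on f d -> pair x y # f <-> x # d /\ y = app f x.
Proof.
move=> H; split=> [K|[K ->]]; last exact: (pair_app H).
by rewrite (app_eq H.1 K); split=> //; apply/H.2; exists y.
Qed.

Lemma in_fun f d z : fun_on f d -> z # f <-> ∃ x # d, z = pair x (app f x).
Proof.
move=> H; split=> [Hz|[x[Hx ->]]]; last exact: (pair_app H).
have [x[y E]] := H.1.1 z Hz; subst z.
by move/(pair_in_fun _ _ H): Hz => [Hx ->]; exists x.
Qed.

Lemma fun_on_ext f g d : fun_on f d -> fun_on g d -> (∀ x # d, app f x = app g x) -> f = g.
Proof.
move=> Hf Hg E; apply: set_ext => z; rewrite (in_fun _ Hf) (in_fun _ Hg).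
by split=> -[x[Hx ->]]; exists x; rewrite E.
Qed.

Lemma in_lam d (F : V -> V) z : DefinableFun1 F -> z # lam d F <-> ∃ x # d, z = pair x (F x).
Proof. by move=> H; rewrite in_image. Qed.

Lemma fun_on_lam d (F : V -> V) : DefinableFun1 F -> fun_on (lam d F) d.
Proof.
move=> H; split; first split=> [c /in_lam[x[_ ->]]|a b b']; first by exists x, (F x).
- by move=> /in_lam[x[_ /pair_inj[-> ->]]] /in_lam[y[_ /pair_inj[-> ->]]].
- move=> a; split=> [Ha|[b /in_lam[x[Hx /pair_inj[-> _]]]] //].
  by exists (F a); apply/in_lam; exists a.
Qed.

Lemma app_lam d (F : V -> V) x : DefinableFun1 F -> x # d -> app (lam d F) x = F x.
Proof. by move=> H Hx; apply: (app_eq (fun_on_lam d H).1); apply/in_lam; exists x. Qed.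
Lemma in_restr f d z : z # restr f d <-> z # f /\ ∃ a # d, exists b, z = pair a b.
Proof. exact: in_sep. Qed.

Lemma pair_in_restr f d a b : pair a b # restr f d <-> pair a b # f /\ a # d.
Proof.
rewrite in_restr; split=> [[H[a'[Ha[b' /pair_inj[E _]]]]]|[H Ha]]; first by subst a'.
by split=> //; exists a; split=> //; exists b.
Qed.

Lemma fun_on_restr f d x : fun_on f d -> sub x d -> fun_on (restr f x) x.
Proof.
move=> H S; split; first split=> [c /in_restr[Hc _]|a b b' /pair_in_restr[K _] /pair_in_restr[K' _]].
- exact: H.1.1.
- exact: (H.1.2 _ _ _ K K').
- move=> a; split=> [Ha|[b /pair_in_restr[]] //].
  by exists (app f a); apply/pair_in_restr; split=> //; apply: (pair_app H); apply: S.
Qed.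

Lemma app_restr f d x a : fun_on f d -> sub x d -> a # x -> app (restr f x) a = app f a.
Proof.
move=> H S Ha; apply: (app_eq (fun_on_restr H S).1); apply/pair_in_restr; split=> //.
by apply: (pair_app H); apply: S.
Qed.

Lemma restr_restr f x y : sub y x -> restr (restr f x) y = restr f y.
Proof.
move=> S; apply: set_ext => z; rewrite !in_restr; split; first tauto.
by move=> [H[a[Ha Hz]]]; split; last (by exists a); split=> //; exists a; split; first exact: S.
Qed.

Lemma dom_unique s a b : fun_on s a -> fun_on s b -> a = b.
Proof. by move=> [_ Ha] [_ Hb]; apply: set_ext => z; rewrite Ha Hb. Qed.

Lemma restr_dom f d : fun_on f d -> restr f d = f.
Proof.
move=> H; apply: set_ext => z; rewrite in_restr; split=> [[]|Hz] //; split=> //.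
by move/(in_fun _ H): Hz => [x[Hx ->]]; exists x; split=> //; exists (app f x).
Qed.

Lemma mem_irrefl x : ~ x # x.
Proof.
move=> H; have [|y[/in_sing->]] := @foundation V (sing x); first by exists x; apply/in_sing.
by move/(_ x H); apply; apply/in_sing.
Qed.

Lemma mem_asym x y : x # y -> ~ y # x.
Proof.
move=> H K; have [|z[/in_duo[]-> N]] := @foundation V (duo x y).
- by exists x; apply/in_duo; left.
- by apply: (N y K); apply/in_duo; right.
- by apply: (N x H); apply/in_duo; left.
Qed.

Lemma succ_inj x y : x.+1 = y.+1 -> x = y.
Proof.
move=> E; have /inS[H|//] : x # y.+1 by rewrite -E; exact: memS.
by have /inS[K|//] : y # x.+1; [rewrite E; exact: memS|case: (mem_asym H K)].
Qed.

Lemma succ_neq_emp x : x.+1 <> emp.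
Proof. by move=> E; apply: (@in_emp V x); rewrite -E; exact: memS. Qed.

Definition inductive (I : V) : Prop := emp # I /\ ∀ n # I, n.+1 # I.

Lemma ex_inductive : exists w, inductive w.
Proof.
have E : Means (@mem V) (∃ w, (∃ e ∈ w, empty e) ∧ ∀ n ∈ w, ∃ m ∈ w, is_succ n m) (exists w : V, (∃ e # w, forall z, ~ z # e) /\
  ∀ n # w, ∃ m # w, forall z, z # m <-> z # n \/ z = n).
{ rewrite /empty /is_succ; exact _. }
have [w[[e[He N]] K]] := E.1 (zfc_inf (univ_ZFC V)); exists w; split; first by rewrite -(eq_emp N).
move=> n /K[m[Hm Em]]; replace n.+1 with m => //.
by apply: set_ext => z; rewrite Em inS.
Qed.

Definition omega : V := sep (the inductive) (fun n => forall I, inductive I -> n # I).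

Lemma in_omega n : n # omega <-> forall I, inductive I -> n # I.
Proof.
rewrite in_sep.
by split=> [[]|H] //; split=> //; apply: H; apply: the_spec; exact: ex_inductive.
Qed.

Lemma emp_in_omega : emp # omega.
Proof. by apply/in_omega => I []. Qed.
Lemma succ_in_omega n : n # omega -> n.+1 # omega.
Proof. by rewrite !in_omega => H I HI; apply: HI.2; apply: H. Qed.

Lemma omega_ind (Q : V -> Prop) : Definable1 Q -> Q emp -> (∀ n # omega, Q n -> Q n.+1) -> ∀ n # omega, Q n.
Proof.
move=> D H0 HS n /in_omega/(_ (sep omega Q)) Hn; suff /Hn/in_sep[] : inductive (sep omega Q) by [].
split=> [|k /in_sep[Hk Qk]]; apply/in_sep; split; auto using emp_in_omega, succ_in_omega.
Qed.

Definition iterated_union x n y : Prop := exists s, pair n y # s /\ forall k z, pair k z # s ->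
  (k = emp /\ z = x) \/ exists k' z', k = k'.+1 /\ pair k' z' # s /\ z = union z'.

Lemma iterated_union_0 x y : iterated_union x emp y <-> y = x.
Proof.
split=> [[s[H K]]|->].
{ by case: (K _ _ H) => [[]|[k[z[E _]]]] //; case: (succ_neq_emp (eq_sym E)). }
by exists (sing (pair emp x)); split=> [|k z /in_sing/pair_inj]; [apply/in_sing|left].
Qed.

Lemma iterated_union_S x n y : iterated_union x n.+1 y <-> exists z, iterated_union x n z /\ y = union z.
Proof.
split=> [[s[H K]]|[z[[s[H K]] ->]]].
- have [[/succ_neq_emp]|[k[z[/succ_inj<- [Hz ->]]]]] // := K _ _ H.
  by exists z; split=> //; exists s.
- exists (cup s (sing (pair n.+1 (union z)))); split=> [|k w /in_cup[J|/in_sing/pair_inj[-> ->]]].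
  + by apply/in_cup; right; apply/in_sing.
  + have [J'|[k'[z'[? [Hz ?]]]]] := K _ _ J; first by left.
  by right; exists k', z'; rewrite in_cup; auto.
  + by right; exists n, z; rewrite in_cup; auto.
Qed.

Lemma ex_transitive_closure x : exists t, trans t /\ sub x t /\ forall u, trans u -> sub x u -> sub t u.
Proof.
have U n : n # omega -> exists y, forall z, iterated_union x n z <-> z = y.
{ move=> Hn; move: n Hn; apply: omega_ind; first by exists x => z; exact: iterated_union_0.
  move=> n _ [y H]; exists (union y) => z; rewrite iterated_union_S.
  by split=> [[w[/H-> ->]]|->] //; exists y; split=> //; apply/H. }
have [n y y' /U[w H] /H-> /H->|b Hb] // := @replacement V omega (iterated_union x) _.
exists (union b); split; [|split].
- move=> y /in_union[w[/Hb[n[Hn Hw]] Hy]] z Hz; apply/in_union; exists (union w).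
  rewrite Hb in_union; split; last by exists y.
  by exists n.+1; split; [exact: succ_in_omega|apply/iterated_union_S; exists w].
- move=> y Hy; apply/in_union; exists x; split=> //; apply/Hb; exists emp.
  by split; [exact: emp_in_omega|apply/iterated_union_0].
- move=> u Tu Su.
  have A n : n # omega -> forall y, iterated_union x n y -> sub y u.
  { move=> Hn; move: n Hn; apply: omega_ind; first by move=> y /iterated_union_0->.
  by move=> n _ IH y /iterated_union_S[z[/IH Sz ->]] w /in_union[v[/Sz Hv Hw]]; exact: (Tu v). }
  by move=> y /in_union[w [/Hb[n [Hn /(A n Hn) Sw]]]]; exact: Sw.
Qed.

Definition trcl x : V := the (fun t => trans t /\ sub x t /\ forall u, trans u -> sub x u -> sub t u).

Lemma trcl_spec x : trans (trcl x) /\ sub x (trcl x) /\ forall u, trans u -> sub x u -> sub (trcl x) u.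
Proof. exact: (the_spec (ex_transitive_closure x)). Qed.
Lemma trans_trcl x : trans (trcl x).
Proof. exact: (trcl_spec x).1. Qed.
Lemma in_trcl x y : y # x -> y # trcl x.
Proof. exact: (trcl_spec x).2.1. Qed.
Lemma trcl_min x u : trans u -> sub x u -> sub (trcl x) u.
Proof. exact: (trcl_spec x).2.2. Qed.
Lemma trcl_step x y z : y # trcl x -> z # y -> z # trcl x.
Proof. by move=> Hy; apply: (trans_trcl Hy). Qed.
Lemma trcl_sub x y : y # trcl x -> sub (trcl y) (trcl x).
Proof. by move=> Hy; apply: trcl_min => [|z]; [exact: trans_trcl|exact: trcl_step]. Qed.

Lemma eq_trcl x t : t = trcl x <-> trans t /\ sub x t /\ forall u, trans u -> sub x u -> sub t u.
Proof.
split=> [->|[T[S M]]]; first exact: trcl_spec.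
by apply: set_ext => z; split; [apply: M|apply: trcl_min] => //; [exact: trans_trcl|move=> w; exact: in_trcl].
Qed.

Lemma trcl_trans x : trans x -> trcl x = x.
Proof. by move=> T; apply/eq_sym/eq_trcl; split; last split. Qed.
Lemma definable_fun1_trcl : DefinableFun1 trcl.
Proof. apply: definable_ext (fun e => eq_trcl _ _) _; definability. Qed.
#[local] Hint Resolve definable_fun1_trcl : definable.

Lemma eps_ind (Q : V -> Prop) : Definable1 Q -> (forall x, (∀ y # x, Q y) -> Q x) -> forall x, Q x.
Proof.
move=> D H x; apply: NNPP => N.
have [|y[/in_sep[Hy NQ] M]] := @foundation V (sep (trcl (sing x)) (fun y => ~ Q y)).
- by exists x; apply/in_sep; split=> //; apply: in_trcl; apply/in_sing.
- apply/NQ/H => z Hz; apply: NNPP => NZ; apply: (M z Hz); apply/in_sep; split=> //.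
  exact: trcl_step Hy Hz.
Qed.

Lemma trcl_cases x z : z # trcl x <-> ∃ y # x, (z = y \/ z # trcl y).
Proof.
split=> [|[y[Hy[->|H]]]]; last by apply: (trcl_min _ _ H) => [|w]; [exact: trans_trcl|exact: trcl_step (in_trcl Hy)].
- pose u := union (image x (fun y => cup (sing y) (trcl y))).
  have U w : w # u <-> ∃ y # x, (w = y \/ w # trcl y).
  { rewrite in_union; split=> [[v[/in_image[y[Hy ->]]]]|[y[Hy Hw]]].
  - by rewrite in_cup in_sing; exists y.
  - by exists (cup (sing y) (trcl y)); rewrite in_cup in_sing in_image; split=> //; exists y. }
  move=> H; apply/U; apply: trcl_min H => [y /U[v[Hv Hy]] w Hw|y Hy]; apply/U; last by exists y; auto.
  exists v; split=> //; right; case: Hy Hw => [->|Hy]; [exact: in_trcl|exact: trcl_step].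
- exact: in_trcl.
Qed.

Lemma trcl_ind (Q : V -> Prop) : Definable1 Q -> (forall x, (∀ y # trcl x, Q y) -> Q x) -> forall x, Q x.
Proof.
move=> D H x; suff A : ∀ y # trcl x, Q y by exact: H.
elim/eps_ind: x => x IH y /trcl_cases[w[Hw[->|Hy]]]; last exact: (IH w).
by apply: H => z; exact: IH.
Qed.

Lemma not_in_trcl x : ~ x # trcl x.
Proof. by elim/trcl_ind: x => x IH Hx; exact: (IH x). Qed.

Lemma in_pair_trans t a b : trans t -> pair a b # t -> a # t /\ b # t.
Proof.
move=> T H; have K : duo a b # t by apply: (T _ H); apply/in_duo; right.
by split; apply: (T _ K); apply/in_duo; [left|right].
Qed.

Lemma pair_in_trcl x a b : pair a b # x -> a # trcl x /\ b # trcl x.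
Proof. by move=> /in_trcl; apply: in_pair_trans; exact: trans_trcl. Qed.
Lemma pair_in_trans t x a b : trans t -> x # t -> pair a b # x -> a # t /\ b # t.
Proof. by move=> T Hx /(T _ Hx); exact: in_pair_trans. Qed.

Section Rec.
Variable G : V -> V -> V.

Definition attempt x h : Prop :=
  fun_on h (trcl x) /\ ∀ y # trcl x, app h y = G y (restr h (trcl y)).
Definition rec x : V := G x (the (attempt x)).

Lemma attempt_unique x h h' : attempt x h -> attempt x h' -> h = h'.
Proof.
move=> [F E] [F' E']; apply: (fun_on_ext F F'); elim/trcl_ind => y IH Hy; have S := trcl_sub Hy.
rewrite E // E' //; congr (G y _); apply: (fun_on_ext (fun_on_restr F S) (fun_on_restr F' S)) => z Hz.
by rewrite (app_restr F) // (app_restr F') //; apply: IH; auto.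
Qed.

Lemma attempt_restr x h y : attempt x h -> y # trcl x -> attempt y (restr h (trcl y)).
Proof.
move=> [F E] Hy; have S := trcl_sub Hy; split; first exact: fun_on_restr F S.
by move=> z Hz; rewrite (app_restr F) // E ?restr_restr; auto; exact: trcl_sub.
Qed.

Lemma the_attempt x h : attempt x h -> the (attempt x) = h.
Proof. by move=> A; apply: attempt_unique (the_spec (ex_intro _ h A)) A. Qed.

Hypothesis DG : DefinableFun2 G.

Lemma ex_attempt x : exists h, attempt x h.
Proof.
elim/trcl_ind: x => x IH; have [y p p' _[h[A ->]][h'[A' ->]]|f Hf] :=
  @replacement V (trcl x) (fun y p => exists h, attempt y h /\ p = pair y (G y h)) _.
{ by rewrite (attempt_unique A A'). }
have F : fun_on f (trcl x).
{ split; first split=> [c /Hf[y[_[h[_ ->]]]]|a b b']; first by exists y, (G y h).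
  - move=> /Hf[y[_[h[A /pair_inj[-> ->]]]]] /Hf[y'[_[h'[A' /pair_inj[E ->]]]]]; subst y'.
  by rewrite (attempt_unique A A').
  - move=> a; split=> [Ha|[b /Hf[y[Hy[h[_ /pair_inj[-> _]]]]]] //].
  by have [h A] := IH a Ha; exists (G a h); apply/Hf; exists a; split=> //; exists h. }
have E y h : y # trcl x -> attempt y h -> app f y = G y h.
{ by move=> Hy A; apply: (app_eq F.1); apply/Hf; exists y; split=> //; exists h. }
exists f; split=> // y Hy; have S := trcl_sub Hy; have [h A] := IH y Hy; rewrite (E y h) //; congr (G y _).
apply: (fun_on_ext A.1 (fun_on_restr F S)) => z Hz.
by rewrite (app_restr F S Hz) (E z _ (S z Hz) (attempt_restr A Hz)) A.2.
Qed.

Lemma eq_rec x y : y = rec x <-> exists h, attempt x h /\ y = G x h.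
Proof.
have [h A] := ex_attempt x; rewrite /rec (the_attempt A).
by split=> [->|[h'[A' ->]]]; [exists h|rewrite (attempt_unique A A')].
Qed.

Lemma definable_fun1_rec : DefinableFun1 rec.
Proof. apply: definable_ext (fun e => eq_rec _ _) _; rewrite /attempt; definability. Qed.
#[local] Hint Resolve definable_fun1_rec : definable.

Lemma rec_eq x : rec x = G x (lam (trcl x) rec).
Proof.
have [h A] := ex_attempt x; rewrite {1}/rec (the_attempt A); congr (G x _).
apply: (fun_on_ext A.1 (fun_on_lam _ _)) => y Hy.
by rewrite app_lam // A.2 // /rec (the_attempt (attempt_restr A Hy)).
Qed.
End Rec.
End Functions.

Ltac definability_extra ::= match goal with
  | |- definable_fun (fun e => lam (@?t e) (@?F e)) =>
    simple apply (definable_fun_lam (t := t) (F := fun x e => F e x))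
  | |- definable_fun (fun e => ite (@?P e) (@?t e) (@?u e)) =>
    simple apply (definable_fun_ite (P := P) (t := t) (u := u))
  | |- definable_fun (fun e => rec ?G (@?t e)) =>
    simple apply (definable_fun_comp1 (F := rec G) (t := t)); [simple apply definable_fun1_rec | ]
  | _ => definability_forcing
  end.

Section BasicMeanings.
Variable V : zfc_model.
Implicit Types x y z a b c d f g r s : V.
Notation Means := (Means (@mem V)).

Lemma means_comprehension {x u} {phi : V -> form V} {Q : V -> Prop}
  {M : forall z, Means (phi z) (Q z)} : (forall z, z # u <-> Q z) -> Means (∀ z, z ∈ x ⇔ phi z) (x = u).
Proof.
move=> H; eapply means_iff; first exact _.
by split=> [E|-> //]; apply: set_ext => z; rewrite E H.
Qed.

Global Instance means_incl x y : Means (incl x y) (sub x y).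
Proof. rewrite /incl /sub; exact _. Qed.

Global Instance means_empty x : Means (empty x) (x = emp).
Proof.
eapply means_iff; first by rewrite /empty; exact _.
by split=> [|->]; [exact: eq_emp|exact: in_emp].
Qed.

Global Instance means_upair a b c : Means (upair a b c) (c = duo a b).
Proof. exact (means_comprehension (in_duo a b)). Qed.

Global Instance means_is_pair a b c : Means (is_pair a b c) (c = pair a b).
Proof.
eapply means_iff; first by rewrite /is_pair; exact _.
by split=> [[u[v[->[-> ->]]]] //|->]; exists (duo a a), (duo a b).
Qed.

Global Instance means_powerset a p : Means (powerset a p) (p = power a).
Proof. exact (means_comprehension (in_power a)). Qed.

Global Instance means_is_succ a b : Means (is_succ a b) (b = a.+1).
Proof. exact (means_comprehension (inS a)). Qed.

Global Instance means_pair_in r a b : Means (pair_in r a b) (pair a b # r).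
Proof.
eapply means_iff; first by rewrite /pair_in; exact _.
by split=> [[c[K <-]]|K] //; exists (pair a b).
Qed.

Global Instance means_is_function f : Means (is_function f) (is_fun f).
Proof. rewrite /is_function /is_fun; exact _. Qed.

Global Instance means_function_on f d : Means (function_on f d) (fun_on f d).
Proof. rewrite /function_on /fun_on; exact _. Qed.

Global Instance means_restriction f d r : Means (restriction f d r) (r = restr f d).
Proof. exact (means_comprehension (in_restr f d)). Qed.

Global Instance means_transitive x : Means (transitive x) (trans x).
Proof. rewrite /transitive /trans; exact _. Qed.

Global Instance means_ordinal x : Means (ordinal x) (ord x).
Proof. rewrite /ordinal /ord; exact _. Qed.

Global Instance means_trans_closure x t : Means (trans_closure x t) (t = trcl x).
Proof. by eapply means_iff; [rewrite /trans_closure; exact _|rewrite eq_trcl]. Qed.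
End BasicMeanings.

Hint Resolve definable_fun1_trcl : definable.

Section Ordinals.
Variable V : zfc_model.
Implicit Types x y z a b c d f g r s : V.

Lemma ord_in x y : ord x -> y # x -> ord y.
Proof. by move=> [T H] Hy; split=> [|z Hz]; apply: H => //; exact: (T y). Qed.
Lemma ord_trans x y z : ord z -> x # y -> y # z -> x # z.
Proof. by move=> [T _] Hx Hy; exact: (T y). Qed.

Lemma ord_total x y : ord x -> ord y -> x # y \/ x = y \/ y # x.
Proof.
elim/eps_ind: x y => x IHx y Ox; elim/eps_ind: y => y IHy Oy.
case: (classic (sub x y)) => [Sxy|/not_sub[z[Hz N]]].
- case: (classic (sub y x)) => [Syx|/not_sub[z[Hz N]]]; first by right; left; exact: sub_antisym.
  by left; case: (IHy z Hz (ord_in Oy Hz)) => [K|[->|]] //; exact: ord_trans K Hz.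
- by right; right; case: (IHx z Hz y (ord_in Ox Hz) Oy) => [|[<-|K]] //; exact: ord_trans K Hz.
Qed.

Lemma ord_emp : ord (emp : V).
Proof. by split=> y /in_emp. Qed.

Lemma ordS x : ord x -> ord x.+1.
Proof.
move=> [T H]; split=> y /inS[Hy|->] //; last exact: H.
- by move=> z Hz; apply/inS; left; exact: (T y).
- by move=> z Hz; apply/inS; left.
Qed.

Lemma ord_subS b c : ord c -> b # c.+1 -> sub b c.
Proof. by move=> Oc /inS[Hb|-> //] z Hz; exact: ord_trans Oc Hz Hb. Qed.

Lemma ordS_in c b : ord c -> b # c -> b.+1 # c.+1.
Proof.
move=> Oc Hb; case: (ord_total (ordS (ord_in Oc Hb)) Oc) => [K|[->|/inS[K|K]]].
- exact: subS.
- exact: memS.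
- by case: (mem_asym K Hb).
- by case: (@mem_irrefl _ b); rewrite -{2}K.
Qed.

Lemma ord_sub_in x y z : ord x -> ord z -> y # z -> sub x y -> x # z.
Proof.
move=> Ox Oz Hy S; case: (ord_total Ox (ord_in Oz Hy)) => [K|[->|K]] //.
- exact: ord_trans Oz K Hy.
- by case: (mem_irrefl (S _ K)).
Qed.

Lemma ord_common_bound c a b : ord c -> a # c -> b # c -> ∃ d # c, sub a d /\ sub b d.
Proof.
move=> Oc Ha Hb; case: (ord_total (ord_in Oc Ha) (ord_in Oc Hb)) => [K|[->|K]].
- by exists b; splits=> z Hz; exact: ord_trans (ord_in Oc Hb) Hz K.
- by exists b; splits=> z.
- by exists a; splits=> z Hz; exact: ord_trans (ord_in Oc Ha) Hz K.
Qed.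

Lemma restr_ord p b b' : ord b -> b' # b -> restr (restr p b) b' = restr p b'.
Proof. by move=> Ob Hb; apply: restr_restr => z Hz; exact: ord_trans Ob Hz Hb. Qed.

Lemma ord_union x : (∀ y # x, ord y) -> ord (union x).
Proof.
move=> H; split=> y /in_union[w[Hw Hy]]; last exact: (H w Hw).2.
by move=> z Hz; apply/in_union; exists w; split=> //; exact: ((H w Hw).1 y).
Qed.

Lemma ord_least (Q : V -> Prop) : Definable1 Q -> (exists x, ord x /\ Q x) -> exists x, ord x /\ Q x /\ ∀ y # x, ~ Q y.
Proof.
move=> D [x[Ox]]; elim/eps_ind: x Ox => x IH Ox Qx.
case: (classic (∃ y # x, Q y)) => [[y[Hy Qy]]|N]; first exact: (IH y Hy (ord_in Ox Hy)).
by exists x; split=> //; split=> // y Hy Qy; apply: N; exists y.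
Qed.

Lemma no_set_of_ordinals a : ~ forall x, ord x -> x # a.
Proof.
move=> H; pose u := union (sep a (@ord V)).
have O : ord u by apply: ord_union => y /in_sep[].
apply: (@mem_irrefl V u); apply/in_union; exists u.+1; split; last exact: memS.
by apply/in_sep; split; [apply: H|]; exact: ordS.
Qed.

Lemma ord_in_omega n : n # omega V -> ord n.
Proof. by move: n; apply: omega_ind => [|n _]; [exact: ord_emp|exact: ordS]. Qed.

Lemma ord_omega : ord (omega V).
Proof.
split=> [y Hy|y /ord_in_omega[]] //; move: y Hy; apply: omega_ind => [z /in_emp|n Hn IH z] //.
by move=> /inS[/IH|->].
Qed.

Lemma omega_cases n : n # omega V -> n = emp \/ ∃ m # omega V, n = m.+1.
Proof. by move: n; apply: omega_ind => [|n Hn _]; [left|right; exists n]. Qed.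

Lemma choice_function a : (∀ x # a, exists y, y # x) -> exists h, ∀ x # a, app h x # x.
Proof.
move=> H; have E : Means (@mem V) (∀ a, (∀ x ∈ a, ¬ empty x) ⇒ ∃ h, function_on h a ∧ ∀ x ∈ a, ∃ y ∈ x, pair_in h x y)
  (forall a, (∀ x # a, ~ x = emp) -> exists h, fun_on h a /\ ∀ x # a, ∃ y # x, pair x y # h) by exact _.
have [x /H[y Hy] Ex|h[F K]] := E.1 (zfc_choice (univ_ZFC V)) a.
- by apply: (@in_emp V y); rewrite -Ex.
- by exists h => x /K[y[Hy P]]; rewrite (app_eq F.1 P).
Qed.

Lemma ex_selector a : exists h, forall x, sub x a -> x <> emp -> app h x # x.
Proof.
have [x /in_diff[_ /in_sing/neq_emp_ex]|h Hh] // := @choice_function (diff (power a) (sing emp)).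
by exists h => x S N; apply: Hh; rewrite in_diff in_power in_sing.
Qed.

Definition rank : V -> V := rec (fun x h => union (image x (fun y => succ (app h y)))).
Definition stage : V -> V := rec (fun x h => union (image x (fun y => power (app h y)))).

Lemma definable_fun1_rank : DefinableFun1 rank.
Proof. apply: definable_fun1_rec; definability. Qed.
Lemma definable_fun1_stage : DefinableFun1 stage.
Proof. apply: definable_fun1_rec; definability. Qed.
#[local] Hint Resolve definable_fun1_rank definable_fun1_stage : definable.

Lemma in_union_image_app F G d x z : DefinableFun1 F -> DefinableFun1 G -> sub x d ->
  z # union (image x (fun y => G (app (lam d F) y))) <-> ∃ y # x, z # G (F y).
Proof.
move=> DF DG S; rewrite in_union; split=> [[w[/in_image[y[Hy ->]]]]|[y[Hy Hz]]].
- by rewrite app_lam; [exact: S|exists y].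
- exists (G (F y)); split=> //; apply/in_image; exists y; rewrite app_lam //; exact: S.
Qed.

Lemma in_rank x z : z # rank x <-> ∃ y # x, (z # rank y \/ z = rank y).
Proof.
rewrite /rank rec_eq -/rank in_union_image_app; first exact: in_trcl.
by split=> -[y[Hy /inS Hz]]; exists y; split.
Qed.

Lemma in_stage x z : z # stage x <-> ∃ y # x, sub z (stage y).
Proof.
rewrite /stage rec_eq -/stage in_union_image_app; first exact: in_trcl.
by split=> -[y[Hy /in_power Hz]]; exists y; split.
Qed.

Lemma ord_rank x : ord (rank x).
Proof.
elim/eps_ind: x => x IH; split=> y /in_rank[w[Hw Hy]].
- move=> z Hz; apply/in_rank; exists w; split=> //; left.
  by case: Hy => [Hy|E]; [exact: ord_trans (IH w Hw) Hz Hy|rewrite -E].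
- by case: Hy => [Hy|->]; [exact: (ord_in (IH w Hw) Hy).1|exact: (IH w Hw).1].
Qed.

Lemma sub_stage_rank x : sub x (stage (rank x)).
Proof.
elim/eps_ind: x => x IH y Hy; apply/in_stage; exists (rank y); split; last exact: IH.
by apply/in_rank; exists y; auto.
Qed.

Lemma collection a (R : V -> V -> Prop) : Definable2 R -> exists b, ∀ x # a, (exists y, R x y) -> ∃ y # b, R x y.
Proof.
move=> DR; pose reached x al := ∃ y # stage al, R x y.
have D : Definable2 reached by rewrite /reached; definability.
pose least x al := ord al /\ reached x al /\ ∀ be # al, ~ reached x be.
have D' : Definable2 least by rewrite /least; definability.
have [x al be _[O[E M]][O'[E' M']]|b Hb] := @replacement V a least _.
- case: (ord_total O O') => [H|[//|H]]; [case: (M' al H E)|case: (M be H E')].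
- exists (stage (union b)) => x Hx [y Hy].
  have [|al[O[[y'[Hy' K]] M]]] := @ord_least (reached x) _.
  + exists (rank y).+1; split; first exact: ordS (ord_rank y).
  exists y; split=> //; apply/in_stage; exists (rank y); split; first exact: memS.
  exact: sub_stage_rank.
  + exists y'; split=> //; have [w[Hw Sw]] := (in_stage _ _).1 Hy'.
  apply/in_stage; exists w; split=> //.
  apply/in_union; exists al; split=> //; apply/Hb; exists x; split=> //; split=> //.
  by split=> //; exists y'.
Qed.

Lemma ex_choice_fun a (R : V -> V -> Prop) : Definable2 R -> (∀ x # a, exists y, R x y) ->
  exists c, fun_on c a /\ ∀ x # a, R x (app c x).
Proof.
move=> DR H; have [b Hb] := collection a DR; have [h Hh] := ex_selector b.
exists (lam a (fun x => app h (sep b (R x)))); split; first exact: fun_on_lam.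
move=> x Hx; rewrite app_lam //; have [y Hy] := Hb x Hx (H x Hx).
suff /in_sep[] : app h (sep b (R x)) # sep b (R x) by [].
apply: Hh => [z /in_sep[] //|E]; apply: (@in_emp V y); rewrite -E; exact/in_sep.
Qed.

Definition inj f a b : Prop := fun_on f a /\ (∀ x # a, app f x # b) /\
  forall x x', x # a -> x' # a -> app f x = app f x' -> x = x'.
Definition embeds a b : Prop := exists f, inj f a b.
Definition card k : Prop := ord k /\ ∀ a # k, ~ embeds k a.
Definition small x k : Prop := ∃ a # k, embeds x a.

Lemma well_ordering a : exists al g, ord al /\ inj g al a /\ ∀ x # a, ∃ b # al, app g b = x.
Proof.
have [h Hh] := ex_selector a.
pose F := rec (fun x f => app h (diff a (image x (app f)))).
have DF : DefinableFun1 F by apply: definable_fun1_rec; definability.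
pose rest x := diff a (image x F).
have F_in_rest x : rest x <> emp -> F x # rest x.
{ have E : image x (app (lam (trcl x) F)) = image x F.
  { apply: set_ext => z; rewrite !in_image.
  by split=> -[y[Hy ->]]; exists y; rewrite app_lam //; exact: in_trcl. }
  by move=> N; rewrite /F rec_eq -/F E; apply: Hh => // z /in_diff[]. }
have F_inj x y : ord x -> ord y -> rest x <> emp -> rest y <> emp -> F x = F y -> x = y.
{ move=> Ox Oy /F_in_rest/in_diff[_ Nx] /F_in_rest/in_diff[_ Ny] E.
  case: (ord_total Ox Oy) => [H|[//|H]]; [case: Ny|case: Nx]; apply/in_image; by [exists x|exists y]. }
have [|al[Oal[Eal Lal]]] := @ord_least (fun x => rest x = emp) _.
{ apply: NNPP => N; have N' x : ord x -> rest x <> emp by move=> Ox E; apply: N; exists x.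
  have [z x x' _[Ox <-][Ox' E]|b Hb] := @replacement V a (fun z x => ord x /\ F x = z) _.
  - by apply: F_inj; auto.
  - apply: (@no_set_of_ordinals b) => x Ox; apply/Hb; exists (F x); split=> //.
  by have /F_in_rest/in_diff[] := N' x Ox. }
have F_al x : x # al -> F x # a by move=> /Lal/F_in_rest/in_diff[].
exists al, (lam al F); split=> //; split; first split; first exact: fun_on_lam.
- split=> [x Hx|x x' Hx Hx']; rewrite !app_lam //; auto.
  apply: F_inj; auto; exact: ord_in Oal _.
- move=> x Hx; apply: NNPP => N; apply: (@in_emp V x); rewrite -Eal; apply/in_diff; split=> //.
  by move=> /in_image[b[Hb E]]; apply: N; exists b; rewrite app_lam.
Qed.

Lemma transfinite_choice A (R : V -> V -> Prop) eta : ord eta -> Definable2 R ->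
  (forall xi s, xi # eta -> fun_on s xi -> (∀ z # xi, app s z # A /\ R (restr s z) (app s z)) -> ∃ a # A, R s a) ->
  exists s, fun_on s eta /\ ∀ z # eta, app s z # A /\ R (restr s z) (app s z).
Proof.
move=> Oe DR H; have [h Hh] := ex_selector A.
pose F := rec (fun _ f => app h (sep A (R f))).
have DF : DefinableFun1 F by apply: definable_fun1_rec; definability.
have Rs x y : sub x y -> restr (lam y F) x = lam x F.
{ move=> S; apply: (fun_on_ext (fun_on_restr (fun_on_lam y DF) S) (fun_on_lam x DF)) => z Hz.
  by rewrite (app_restr (fun_on_lam y DF) S) // !app_lam //; exact: S. }
exists (lam eta F); split; first exact: fun_on_lam.
move=> x; elim/eps_ind: x => x IH Hx; have S z (Hz : z # x) : sub z x := (ord_in Oe Hx).1 z Hz.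
rewrite Rs ?app_lam //; first exact: Oe.1.
have [|z Hz|a[Ha Ra]] := H x (lam x F) Hx; first exact: fun_on_lam.
{ have He := ord_trans Oe Hz Hx; move: (IH z Hz He).
  by rewrite (Rs z x (S z Hz)) (Rs z eta (Oe.1 z He)) !app_lam. }
rewrite {1 3}/F rec_eq -/F trcl_trans; first exact: (ord_in Oe Hx).1.
have /in_sep[//] : app h (sep A (R (lam x F))) # sep A (R (lam x F)).
apply: Hh => [z /in_sep[]|E] //; apply: (@in_emp V a); rewrite -E; exact/in_sep.
Qed.

Lemma inj_lam a b (F : V -> V) : DefinableFun1 F -> (∀ x # a, F x # b) ->
  (forall x x', x # a -> x' # a -> F x = F x' -> x = x') -> embeds a b.
Proof.
move=> D HF I; exists (lam a F); split; first exact: fun_on_lam.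
by split=> [x Hx|x x' Hx Hx']; rewrite !app_lam //; auto.
Qed.

Lemma embeds_sub a b : sub a b -> embeds a b.
Proof. by move=> S; apply: (inj_lam (F := fun x => x)). Qed.
Lemma embeds_refl a : embeds a a.
Proof. exact: embeds_sub. Qed.

Lemma embeds_trans a b c : embeds a b -> embeds b c -> embeds a c.
Proof.
move=> [f[F[Fi Fj]]] [g[G[Gi Gj]]]; apply: (inj_lam (F := fun x => app g (app f x))); auto.
Qed.

Lemma embeds_of_surjection g a b : (∀ y # b, ∃ x # a, app g x = y) -> embeds b a.
Proof.
move=> H; have [h[Fh Hh]] := @ex_choice_fun b (fun y x => x # a /\ app g x = y) _ H.
exists h; split=> //; split=> [y /Hh[] //|y y' /Hh[_ {2}<-] /Hh[_ {2}<-] -> //].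
Qed.

Lemma equipotent_ordinal a : exists al, ord al /\ embeds a al /\ embeds al a.
Proof.
have [al[g[O[J S]]]] := well_ordering a; exists al; split=> //.
by split; [exact: embeds_of_surjection S|exists g].
Qed.

Lemma small_or_embeds x k : ord k -> small x k \/ embeds k x.
Proof.
move=> Ok; have [al[O[I J]]] := equipotent_ordinal x.
case: (ord_total O Ok) => [H|[<-|H]]; [by left; exists al|by right|right].
by apply: embeds_trans J; apply: embeds_sub => z Hz; exact: ord_trans H.
Qed.

Lemma embeds_total a b : embeds a b \/ embeds b a.
Proof.
have [y[Oy[J J']]] := equipotent_ordinal b; case: (small_or_embeds a Oy) => [[u[Hu I]]|I].
- left; apply: (embeds_trans I (embeds_trans (embeds_sub _) J')) => z Hz; exact: ord_trans Oy Hz Hu.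
- by right; exact: embeds_trans J I.
Qed.

Lemma small_not_embeds x k : card k -> small x k -> ~ embeds k x.
Proof. by move=> [_ C] [a[Ha I]] J; apply: (C a Ha); exact: embeds_trans I. Qed.
Lemma small_embeds x y k : embeds x y -> small y k -> small x k.
Proof. by move=> I [a[Ha J]]; exists a; split=> //; exact: embeds_trans J. Qed.
Lemma small_mem x k : x # k -> small x k.
Proof. by move=> H; exists x; split=> //; exact: embeds_refl. Qed.

Definition prod a b : V := union (image a (fun x => image b (fun y => pair x y))).

Lemma in_prod a b z : z # prod a b <-> exists x y, x # a /\ y # b /\ z = pair x y.
Proof.
rewrite in_union; split=> [[w[/in_image[x[Hx ->]] /in_image[y[Hy ->]]]]|[x[y[Hx[Hy ->]]]]].
- by exists x, y.
- by exists (image b (pair x)); rewrite !in_image; split; [exists x|exists y].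
Qed.

Lemma pair_prod a b x y : pair x y # prod a b <-> x # a /\ y # b.
Proof.
rewrite in_prod; split=> [[x'[y'[Hx[Hy /pair_inj[-> ->]]]]] //|[Hx Hy]]; by exists x, y.
Qed.

End Ordinals.

(** * Forcing *)

Section ForcingRelation.
Variable V : zfc_model.
Implicit Types x y z a b c d f g p q r s t R : V.

Section Definitions.
Variables P L : V.

Definition le p q : Prop := pair p q # L.
Definition rel_at R q x y : Prop := pair q (pair x y) # R.

Definition forced_incl (A : V -> V -> V -> Prop) q x y : Prop :=
  forall c s, s # P -> pair c s # x -> ∀ r # P, le r q -> le r s ->
  ∃ r' # P, le r' r /\ exists d s', s' # P /\ pair d s' # y /\ le r' s' /\ A r' c d.

Definition eq_relation t R : Prop := ∀ q # P, ∀ x # t, ∀ y # t,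
  (rel_at R q x y <-> forced_incl (rel_at R) q x y /\ forced_incl (rel_at R) q y x).

Definition forced_eq p a b : Prop :=
  exists t, trans t /\ a # t /\ b # t /\ exists R, eq_relation t R /\ rel_at R p a b.

Definition forced_mem p a b : Prop := ∀ q # P, le q p ->
  ∃ r # P, le r q /\ exists d s, s # P /\ pair d s # b /\ le r s /\ forced_eq r a d.

Definition separates p x y : Prop := exists c s, s # P /\ pair c s # x /\ le p s /\
  forall r d s', r # P -> le r p -> s' # P -> pair d s' # y -> le r s' -> ~ forced_eq r c d.

Fixpoint Forces (phi : form V) (p : V) : Prop :=
  match phi with
  | FMem a b => forced_mem p a b
  | FEq a b => forced_eq p a b
  | FBot => False
  | FImp a b => ∀ q # P, le q p -> Forces a q -> Forces b q
  | FAll h => forall x, Forces (h x) p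
  end.

Global Instance means_forces_eq p a b : Means (@mem V) (forces_eq P L p a b) (forced_eq p a b).
Proof.
have M R q x y : Means (@mem V) (∃ z, is_pair x y z ∧ pair_in R q z) (rel_at R q x y).
{ by eapply means_iff; [exact _|split=> [[z[-> K]]|K] //; exists (pair x y)]. }
rewrite /forces_eq /forced_eq /eq_relation /forced_incl /le; exact _.
Qed.

Global Instance means_forces_mem p a b : Means (@mem V) (forces_mem P L p a b) (forced_mem p a b).
Proof. rewrite /forces_mem /forced_mem /le; exact _. Qed.

Global Instance means_forces phi p : Means (@mem V) (forces P L phi p) (Forces phi p).
Proof.
elim: phi p => [a b|a b||a IHa b IHb|h IH] p; cbn [forces Forces]; rewrite /le; exact _.
Qed.
End Definitions.

Lemma definable5_forced_eq : Definable5 forced_eq.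
Proof. rewrite /forced_eq /eq_relation /forced_incl; definability. Qed.
#[local] Hint Resolve definable5_forced_eq : definable.

Lemma definable_Forces phi (P L u : (nat -> V) -> V) (v : nat -> (nat -> V) -> V) :
  definable_fun P -> definable_fun L -> (forall k, definable_fun (v k)) -> definable_fun u ->
  definable (fun e => Forces (P e) (L e) (interp (fun k => v k e) phi) (u e)).
Proof.
elim: phi P L u v => [i j|i j||a IHa b IHb|a IHa] P L u v HP HL Hv Hu; cbn [interp Forces].
1,2: by move: (Hv i) (Hv j) => Hi Hj; definability.
- by definability.
- apply: (definable_all (Q := fun q e => q # P e -> le (L e) q (u e) ->
  Forces (P e) (L e) (interp (fun k => v k e) a) q -> Forces (P e) (L e) (interp (fun k => v k e) b) q)).
  do 3!(apply: definable_imp; first [by definability | idtac]).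
  + by apply: (IHa _ _ _ (fun k e => v k (fun j => e (S j)))) => [||k|]; definability; apply: definable_fun_rename.
  + by apply: (IHb _ _ _ (fun k e => v k (fun j => e (S j)))) => [||k|]; definability; apply: definable_fun_rename.
- apply: (definable_all (Q := fun x e => Forces (P e) (L e) (interp (scons x (fun k => v k e)) a) (u e))).
  apply: (IHa _ _ _ (fun k e => match k with 0 => e 0 | S j => v j (fun i => e (S i)) end)) => [||[|k]|];
  definability; apply: definable_fun_rename; exact: Hv.
Qed.
Section EqRelation.
Variables P L : V.

Lemma forced_incl_ext (A B : V -> V -> V -> Prop) q x y :
  (forall r c d s s', r # P -> pair c s # x -> pair d s' # y -> A r c d -> B r c d) ->
  forced_incl P L A q x y -> forced_incl P L B q x y.
Proof.
move=> AB H c s Hs Hc r Hr Hq Hrs; have [r'[Hr'[K[d[s'[Hs'[Hd[Hr's' Acd]]]]]]]] := H c s Hs Hc r Hr Hq Hrs.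
exists r'; splits; exists d, s'; splits; exact: (AB r' c d s s').
Qed.

Lemma ex_eq_relation t : exists R, eq_relation P L t R.
Proof.
pose Q R z := exists q x y, z = pair q (pair x y) /\ forced_incl P L (rel_at R) q x y /\ forced_incl P L (rel_at R) q y x.
pose Phi R := sep (prod P (prod t t)) (Q R).
have DQ : Definable2 Q by rewrite /Q /forced_incl; definability.
have DPhi : DefinableFun1 Phi by rewrite /Phi; definability.
have in_Phi R q x y : rel_at (Phi R) q x y <->
  q # P /\ x # t /\ y # t /\ forced_incl P L (rel_at R) q x y /\ forced_incl P L (rel_at R) q y x.
{ rewrite /rel_at in_sep !pair_prod; split=> [[[Hq[Hx Hy]][q'[x'[y'[/pair_inj[<- /pair_inj[<- <-]] K]]]]]|K].
  - by case: K => *; splits.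
  - by split; [tauto|exists q, x, y; tauto]. }
have Phi_mono R R' : sub R R' -> sub (Phi R) (Phi R').
{ move=> S z /in_sep[Hz[q[x[y[E[H1 H2]]]]]]; apply/in_sep; split=> //; exists q, x, y; split=> //.
  by split; [move: H1|move: H2]; apply: forced_incl_ext => r c d s s' _ _ _; exact: S. }
pose R0 := sep (prod P (prod t t)) (fun z => forall R, sub (Phi R) R -> z # R).
have R0_least R : sub (Phi R) R -> sub R0 R by move=> S z /in_sep[_]; exact.
have Pre : sub (Phi R0) R0.
{ move=> z Hz; apply/in_sep; split=> [|R S]; first by case/in_sep: Hz.
  exact/S/(Phi_mono _ _ (R0_least R S)). }
have Post : sub R0 (Phi R0) by apply/R0_least/Phi_mono.
exists R0 => q Hq x Hx y Hy; split=> [/Post/in_Phi|K]; first tauto.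
by apply: Pre; apply/in_Phi.
Qed.

End EqRelation.
End ForcingRelation.
Hint Resolve definable5_forced_eq : definable.
Ltac definability_schematic := fail.
Ltac definability_forcing ::= match goal with
  | |- definable (fun e => Forces (@?P e) (@?L e) (interp (@?v e) ?phi) (@?u e)) =>
    simple apply (@definable_Forces _ phi P L u (fun k e => v e k)); [ | | intro | ]
  | |- definable (fun e => Forces (@?P e) (@?L e) (FMem (@?x e) (@?y e)) (@?u e)) =>
    change (definable (fun e => forced_mem (P e) (L e) (u e) (x e) (y e)))
  | |- definable (fun e => Forces (@?P e) (@?L e) (FEq (@?x e) (@?y e)) (@?u e)) =>
    change (definable (fun e => forced_eq (P e) (L e) (u e) (x e) (y e)))
  | |- definable (fun e => sat mem (interp (@?v e) ?phi)) =>
    simple apply (@definable_sat _ phi (fun k e => v e k)); intro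
  | |- definable_fun (fun e => scons _ _ ?k) => destruct k; cbn [scons]
  | _ => definability_schematic
  end.

Section ForcingTheory.
Variable V : zfc_model.
Implicit Types x y z a b c d f g p q r s t R : V.
Variables P L : V.
Notation le := (le L).
Notation forced_eq := (forced_eq P L).
Notation forced_mem := (forced_mem P L).
Notation forced_incl := (forced_incl P L).
Notation Forces := (Forces P L).
Hypotheses (le_refl : ∀ p # P, le p p) (le_trans : forall p q r, le p q -> le q r -> le p r).

Lemma eq_relation_unique t R t' R' x y q : trans t -> trans t' -> eq_relation P L t R -> eq_relation P L t' R' ->
  x # t -> x # t' -> y # t -> y # t' -> q # P -> (rel_at R q x y <-> rel_at R' q x y) /\ (rel_at R q y x <-> rel_at R' q y x).
Proof.
move=> T T' HR HR'; elim/trcl_ind: x y q => x IH y q Hx Hx' Hy Hy' Hq.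
have A c s d s' r : pair c s # x -> pair d s' # y -> r # P ->
  (rel_at R r c d <-> rel_at R' r c d) /\ (rel_at R r d c <-> rel_at R' r d c).
{ move=> Hc Hd Hr; apply: IH => //; first exact: (pair_in_trcl Hc).1.
  - exact: (pair_in_trans T Hx Hc).1.
  - exact: (pair_in_trans T' Hx' Hc).1.
  - exact: (pair_in_trans T Hy Hd).1.
  - exact: (pair_in_trans T' Hy' Hd).1. }
have E : forced_incl (rel_at R) q x y <-> forced_incl (rel_at R') q x y.
{ by split; apply: forced_incl_ext => r c d s s' Hr Hc Hd; apply (A c s d s' r). }
have E' : forced_incl (rel_at R) q y x <-> forced_incl (rel_at R') q y x.
{ by split; apply: forced_incl_ext => r c d s s' Hr Hc Hd; apply (A d s' c s r). }
by rewrite (HR q Hq x) // (HR' q Hq x) // (HR q Hq y) // (HR' q Hq y) // E E'; tauto.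
Qed.

Lemma forced_eq_rel_at t R p a b : trans t -> eq_relation P L t R -> p # P -> a # t -> b # t ->
  forced_eq p a b <-> rel_at R p a b.
Proof.
move=> T HR Hp Ha Hb; split=> [[t'[T'[Ha'[Hb'[R'[HR' H]]]]]]|H].
- by apply (eq_relation_unique T T' HR HR').
- by exists t; splits; exists R.
Qed.

Lemma forced_eqE p a b : p # P -> forced_eq p a b <-> forced_incl forced_eq p a b /\ forced_incl forced_eq p b a.
Proof.
move=> Hp; pose t := trcl (duo a b); have T : trans t by exact: trans_trcl.
have Ha : a # t by apply/in_trcl/in_duo; left.
have Hb : b # t by apply/in_trcl/in_duo; right.
have [R HR] := ex_eq_relation P L t.
have E x y : x # t -> y # t -> forced_incl (rel_at R) p x y <-> forced_incl forced_eq p x y.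
{ move=> Hx Hy; split; apply: forced_incl_ext => r c d s s' Hr Hc Hd; apply (forced_eq_rel_at T HR Hr);
  by [exact: (pair_in_trans T Hx Hc).1|exact: (pair_in_trans T Hy Hd).1]. }
by rewrite (forced_eq_rel_at T HR) // (HR p Hp a Ha b Hb) !E.
Qed.

Lemma forced_incl_mono A p q x y : le q p -> forced_incl A p x y -> forced_incl A q x y.
Proof. move=> Hqp H c s Hs Hc r Hr Hrq; apply: (H c s Hs Hc r Hr); exact: le_trans Hqp. Qed.
Lemma forced_eq_mono p q a b : p # P -> q # P -> le q p -> forced_eq p a b -> forced_eq q a b.
Proof. by move=> Hp Hq Hle; rewrite !forced_eqE // => -[H K]; split; exact: forced_incl_mono Hle _. Qed.
Lemma forced_eq_sym p a b : p # P -> forced_eq p a b -> forced_eq p b a.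
Proof. by move=> Hp; rewrite !forced_eqE //; tauto. Qed.

Lemma forced_incl_refl A p x : (forall c s r, pair c s # x -> r # P -> A r c c) -> forced_incl A p x x.
Proof.
move=> H c s Hs Hc r Hr Hrp Hrs; exists r; splits; first exact: le_refl.
by exists c, s; splits; exact: H Hc Hr.
Qed.

Lemma forced_eq_refl p a : p # P -> forced_eq p a a.
Proof.
elim/trcl_ind: a p => a IH p Hp; apply/forced_eqE => //.
by split; apply: forced_incl_refl => c s r Hc Hr; apply: IH => //; exact: (pair_in_trcl Hc).1.
Qed.

Lemma forced_eq_trans p a b c : p # P -> forced_eq p a b -> forced_eq p b c -> forced_eq p a c.
Proof.
elim/trcl_ind: b a c p => b IH a c p Hp.
have H x y q : q # P -> forced_incl forced_eq q x b -> forced_incl forced_eq q b y -> forced_incl forced_eq q x y.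
{ move=> Hq A B u s Hs Hu r Hr Hrq Hrs.
  have [r1[Hr1[L1[d[s1[Hs1[Hd[K1 E1]]]]]]]] := A u s Hs Hu r Hr Hrq Hrs.
  have [r2[Hr2[L2[d'[s2[Hs2[Hd'[K2 E2]]]]]]]] := B d s1 Hs1 Hd r1 Hr1 (le_trans L1 Hrq) K1.
  exists r2; split=> //; split; first exact: le_trans L1.
  exists d', s2; splits; apply: (IH d) => //; first exact: (pair_in_trcl Hd).1.
  exact: forced_eq_mono E1. }
rewrite (forced_eqE a b) // (forced_eqE b c) // (forced_eqE a c) //.
by move=> [A A'] [B B']; split; [exact: H B|exact: H A'].
Qed.

Lemma forced_mem_mono p q a x : le q p -> forced_mem p a x -> forced_mem q a x.
Proof. by move=> Hqp H r Hr Hrq; apply: H => //; exact: le_trans Hqp. Qed.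

Lemma forced_mem_eq p a b x : p # P -> forced_eq p a b -> forced_mem p a x -> forced_mem p b x.
Proof.
move=> Hp E H q Hq Hqp; have [r[Hr[Hle[d[s[Hs[Hd[Hrs E']]]]]]]] := H q Hq Hqp.
exists r; split=> //; split=> //; exists d, s; splits.
apply: (@forced_eq_trans _ _ a) => //; apply: forced_eq_sym => //.
by apply: forced_eq_mono E => //; exact: le_trans Hqp.
Qed.

Lemma Forces_mono phi p q : p # P -> q # P -> le q p -> Forces phi p -> Forces phi q.
Proof.
elim: phi p q => [a b|a b||a IHa b IHb|h IH] p q Hp Hq Hle //=.
- move=> H r Hr Hrq; apply: H => //; exact: le_trans Hle.
- exact: forced_eq_mono.
- move=> H r Hr Hrq; apply: H => //; exact: le_trans Hle.
- by move=> H x; exact: IH (H x).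
Qed.

Lemma forced_eq_dense p a b : p # P -> (∀ q # P, le q p -> ∃ r # P, le r q /\ forced_eq r a b) -> forced_eq p a b.
Proof.
move=> Hp H; have K x y : (∀ r # P, forced_eq r a b -> forced_incl forced_eq r x y) -> forced_incl forced_eq p x y.
{ move=> I c s Hs Hc r Hr Hrp Hrs; have [r1[Hr1[L1 E]]] := H r Hr Hrp.
  have [r'[Hr'[L' K]]] := I r1 Hr1 E c s Hs Hc r1 Hr1 (le_refl Hr1) (le_trans L1 Hrs).
  by exists r'; split=> //; split=> //; exact: le_trans L1. }
by apply/forced_eqE => //; split; apply: K => r Hr /forced_eqE[].
Qed.

Lemma Forces_dense phi p : p # P -> (∀ q # P, le q p -> ∃ r # P, le r q /\ Forces phi r) -> Forces phi p.
Proof.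
elim: phi p => [a b|a b||a IHa b IHb|h IH] p Hp /= H.
- move=> q Hq Hqp; have [r[Hr[Hrq K]]] := H q Hq Hqp; have [r'[Hr'[Hle J]]] := K r Hr (le_refl Hr).
  by exists r'; split=> //; split=> //; exact: le_trans Hrq.
- exact: forced_eq_dense.
- by have [r[_[_ K]]] := H p Hp (le_refl Hp).
- move=> q Hq Hqp Ha; apply: IHb => // r Hr Hrq.
  have [r'[Hr'[Hle K]]] := H r Hr (le_trans Hrq Hqp); exists r'; split=> //; split=> //.
  by apply: (K r' Hr' (le_refl Hr')); apply: Forces_mono Ha => //; exact: le_trans Hrq.
- move=> x; apply: IH => // q Hq Hqp; have [r[Hr[Hle K]]] := H q Hq Hqp; by exists r.
Qed.

Lemma Forces_not_dense phi p : p # P -> ~ Forces phi p -> ∃ q # P, le q p /\ Forces (¬ phi) q.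
Proof.
move=> Hp N; apply: NNPP => M; apply: N; apply: Forces_dense => // q Hq Hqp.
apply: NNPP => K; apply: M; exists q; splits=> r Hr Hrq F; apply: K; by exists r.
Qed.

Lemma Forces_ex h q : q # P -> Forces (∃ x, h x) q -> exists r x, r # P /\ le r q /\ Forces (h x) r.
Proof.
by move=> Hq H; apply: NNPP => N; apply: (H q Hq (le_refl Hq)) => x r Hr Hrq K; apply: N; exists r, x.
Qed.

Lemma Forces_and (a b : form V) q : q # P -> Forces (a ∧ b) q -> ∃ r # P, le r q /\ Forces a r /\ Forces b r.
Proof.
move=> Hq H; apply: NNPP => N; apply: (H q Hq (le_refl Hq)) => r Hr Hrq A r' Hr' Hle B; apply: N.
exists r'; splits; [exact: le_trans Hrq|exact: Forces_mono A].
Qed.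
End ForcingTheory.

Section GenericFilters.
Variable V : zfc_model.
Implicit Types x y z a b c d p q r s : V.
Variables P L : V.
Notation le := (le L).
Notation forced_eq := (forced_eq P L).
Notation forced_mem := (forced_mem P L).
Notation Forces := (Forces P L).

Definition preorder : Prop :=
  (∀ p # P, le p p) /\ (forall p q r, le p q -> le q r -> le p r).

Record generic_filter (F : V -> Prop) : Prop := {
  filter_sub : forall p, F p -> p # P;
  filter_up : forall p q, F p -> q # P -> le p q -> F q;
  filter_meet : forall p q, F p -> F q -> exists r, F r /\ le r p /\ le r q;
  filter_nonempty : exists p, F p;
  filter_generic : forall Q, Definable1 Q -> (∀ p # P, ∃ q # P, le q p /\ Q q) -> exists p, F p /\ Q p }.

Hypothesis PO : preorder.
Let le_refl : ∀ p # P, le p p := PO.1.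
Let le_trans : forall p q r, le p q -> le q r -> le p r := PO.2.

Variable F : V -> Prop.
Hypothesis GF : generic_filter F.
Let F_sub p : F p -> p # P := filter_sub GF (p := p).

Lemma filter_generic_below (Q : V -> Prop) p0 : Definable1 Q -> F p0 ->
  (∀ p # P, le p p0 -> ∃ q # P, le q p /\ Q q) -> exists p, F p /\ le p p0 /\ Q p.
Proof.
move=> D F0 H; have [p Hp|p[Fp K]] := filter_generic GF (Q := fun q => (le q p0 /\ Q q) \/ ∀ r # P, le r q -> ~ le r p0).
- case: (classic (∃ r # P, le r p /\ le r p0)) => [[r[Hr[Hrp Hr0]]]|N].
  + have [q[Hq[Hqr K]]] := H r Hr Hr0; exists q; splits; first exact: le_trans Hrp.
  by left; split=> //; exact: le_trans Hr0.
  + by exists p; splits; [exact: le_refl|right=> r Hr Hrp Hr0; apply: N; exists r].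
- have [r[Fr[Hrp Hr0]]] := filter_meet GF Fp F0; case: K => [K|/(_ r (F_sub Fr) Hrp)//].
  by exists p.
Qed.

Section Evaluation.
Variables (T : Type) (val : V -> T).

Definition element (w : T) (x : V) : Prop := exists c p, F p /\ pair c p # x /\ w = val c.

Section InclusionStep.
Variables x y : V.
Hypothesis val_eq : forall c d s s', pair c s # x -> pair d s' # y -> val c = val d <-> exists p, F p /\ forced_eq p c d.

Lemma forced_incl_val p w : F p -> forced_incl P L forced_eq p x y -> element w x -> element w y.
Proof.
move=> Fp H [c[s[Fs[Hc ->]]]]; have [r[Fr[Hrp Hrs]]] := filter_meet GF Fp Fs.
have [q Hq Hqr|r'[Fr'[_[d[s'[Hs'[Hd[K E]]]]]]]] := @filter_generic_below (fun r' =>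
  exists d s', s' # P /\ pair d s' # y /\ le r' s' /\ forced_eq r' c d) r _ Fr.
- have [r'[Hr'[K J]]] := H c s (F_sub Fs) Hc q Hq (le_trans Hqr Hrp) (le_trans Hqr Hrs).
  by exists r'.
- exists d, s'; splits; first exact: filter_up Fr' Hs' K.
  by apply (val_eq Hc Hd); exists r'.
Qed.

Lemma separates_dense p : p # P -> ~ forced_incl P L forced_eq p x y -> ∃ q # P, le q p /\ separates P L q x y.
Proof.
move=> Hp N; apply: NNPP => M; apply: N => c s Hs Hc r Hr Hrp Hrs; apply: NNPP => K; apply: M.
exists r; splits; exists c, s; splits=> r' d s' Hr' H1 Hs' Hd H2 H3; apply: K.
by exists r'; splits; exists d, s'.
Qed.

Lemma separates_val p : F p -> separates P L p x y -> exists w, element w x /\ ~ element w y.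
Proof.
move=> Fp [c[s[Hs[Hc[Hps N]]]]]; exists (val c); split.
- by exists c, s; splits; exact: filter_up Fp Hs Hps.
- move=> [d[s'[Fs'[Hd E]]]]; have [q[Fq K]] := (val_eq Hc Hd).1 E.
  have [r1[Fr1[L1 L2]]] := filter_meet GF Fp Fs'.
  have [r[Fr[L3 L4]]] := filter_meet GF Fr1 Fq.
  apply: (N r d s' (F_sub Fr) (le_trans L3 L1) (F_sub Fs') Hd (le_trans L3 L2)).
  exact: (forced_eq_mono le_trans (F_sub Fq) (F_sub Fr) L4).
Qed.
End InclusionStep.

Lemma val_ext_forced_eq x y : (forall c d s s', pair c s # x -> pair d s' # y ->
  val c = val d <-> exists p, F p /\ forced_eq p c d) ->
  (forall w, element w x <-> element w y) <-> exists p, F p /\ forced_eq p x y.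
Proof.
move=> Exy; have Eyx c d s s' : pair c s # y -> pair d s' # x -> val c = val d <-> exists p, F p /\ forced_eq p c d.
{ move=> Hc Hd; split=> [E|[p[Fp K]]].
  - have [p[Fp K]] := (Exy d c s' s Hd Hc).1 (eq_sym E); exists p; split=> //; exact: forced_eq_sym (F_sub Fp) K.
  - apply/eq_sym/(Exy d c s' s) => //; exists p; split=> //; exact: forced_eq_sym (F_sub Fp) K. }
split=> [H|[p [Fp /(forced_eqE L _ _ (F_sub Fp))[Ixy Iyx]]] w]; last first.
{ by split; [exact: (forced_incl_val Exy Fp Ixy)|exact: (forced_incl_val Eyx Fp Iyx)]. }
have [p Hp|p[Fp[K|[K|K]]]] := filter_generic GF (Q := fun p =>
  forced_eq p x y \/ separates P L p x y \/ separates P L p y x); last 3 first.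
- by exists p.
- by have [w[]] := separates_val Exy Fp K; rewrite H.
- by have [w[]] := separates_val Eyx Fp K; rewrite H.
- case: (classic (forced_incl P L forced_eq p x y)) => [Ixy|/(separates_dense Hp)[q]].
  + case: (classic (forced_incl P L forced_eq p y x)) => [Iyx|/(separates_dense Hp)[q]].
  * by exists p; splits; [exact: le_refl|left; apply/forced_eqE].
  * by move=> [Hq[Hqp K]]; exists q; auto.
  + by move=> [Hq[Hqp K]]; exists q; auto.
Qed.

Variable m : T -> T -> Prop.
Hypotheses (in_val : forall x w, m w (val x) <-> element w x)
  (val_eq : forall a b, val a = val b <-> exists p, F p /\ forced_eq p a b).

Lemma val_mem_forced a b : m (val a) (val b) <-> exists p, F p /\ forced_mem p a b.
Proof.
split=> [/in_val[d[s[Fs[Hd /val_eq[p[Fp E]]]]]]|[p[Fp H]]].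
- have [r[Fr[Hrp Hrs]]] := filter_meet GF Fp Fs; exists r; split=> // q Hq Hqr.
  exists q; splits; first exact: le_refl.
  exists d, s; splits; [exact: F_sub|exact: le_trans Hrs|].
  exact: (forced_eq_mono le_trans (F_sub Fp) Hq (le_trans Hqr Hrp)).
- have [q Hq Hqp|r[Fr[_[d[s[Hs[Hd[Hrs E]]]]]]]] := @filter_generic_below (fun r =>
  exists d s, s # P /\ pair d s # b /\ le r s /\ forced_eq r a d) p _ Fp.
  + by have [r[Hr[K J]]] := H q Hq Hqp; exists r.
  + apply/in_val; exists d, s; splits; first exact: filter_up Fr Hs Hrs.
  by apply/val_eq; exists r.
Qed.

Hypothesis val_surj : forall w, exists x, w = val x.

Lemma Forces_incompatible phi p q : F p -> F q -> Forces phi p -> Forces (¬ phi) q -> False.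
Proof.
move=> Fp Fq H N; have [r[Fr[Hrp Hrq]]] := filter_meet GF Fp Fq.
exact: (N r (F_sub Fr) Hrq (Forces_mono le_trans (F_sub Fp) (F_sub Fr) Hrp H)).
Qed.

Lemma Forces_decided e phi : (exists p, F p /\ Forces (interp e phi) p) \/ exists p, F p /\ Forces (¬ interp e phi) p.
Proof.
have [p Hp|p[Fp[K|K]]] := filter_generic GF (Q := fun p =>
  Forces (interp e phi) p \/ Forces (interp e (fo_imp phi fo_bot)) p); last 2 first.
- by left; exists p.
- by right; exists p.
- case: (classic (Forces (interp e phi) p)) => [K|K].
  + by exists p; splits; [exact: le_refl|left].
  + have [q[Hq[Hqp N]]] := Forces_not_dense le_refl le_trans Hp K; by exists q; splits; right.
Qed.

Lemma truth_lemma phi e : sat m (interp (fun k => val (e k)) phi) <-> exists p, F p /\ Forces (interp e phi) p.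
Proof.
elim: phi e => [i j|i j||a IHa b IHb|a IHa] e.
- exact: val_mem_forced.
- exact: val_eq.
- by split=> // -[p[]].
- rewrite /= IHa IHb; split=> [H|[p[Fp H]][q[Fq K]]].
  + case: (Forces_decided e a) => [/H[p[Fp K]]|[p[Fp N]]].
  * by exists p; split=> // q Hq Hqp _; exact: (Forces_mono le_trans (F_sub Fp) Hq Hqp).
  * by exists p; split=> // q Hq Hqp /(N q Hq Hqp).
  + have [r[Fr[Hrp Hrq]]] := filter_meet GF Fp Fq; exists r; split=> //.
  apply: (H r (F_sub Fr) Hrp); exact: (Forces_mono le_trans (F_sub Fq) (F_sub Fr) Hrq).
- have E x : sat m (interp (scons (val x) (fun k => val (e k))) a) <-> exists p, F p /\ Forces (interp (scons x e) a) p.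
  { by rewrite -IHa; apply: interp_ext; case. }
  split=> [H|[p[Fp H]] w]; last by have [x ->] := val_surj w; apply/E; exists p; split=> //; exact: H.
  have [p Hp|p[Fp[K|[x K]]]] := filter_generic GF (Q := fun p => (forall x, Forces (interp (scons x e) a) p) \/
  exists x, Forces (interp (scons x e) (fo_imp a fo_bot)) p); last 2 first.
  + by exists p.
  + by have [q[Fq M]] := (E x).1 (H (val x)); case: (Forces_incompatible Fq Fp M K).
  + case: (classic (forall x, Forces (interp (scons x e) a) p)) => [K|].
  * by exists p; splits; [exact: le_refl|left].
  * move=> /not_all_ex_not[x /(Forces_not_dense le_refl le_trans Hp)[q[Hq[Hqp N]]]].
    by exists q; splits; right; exists x.
Qed.
End Evaluation.
End GenericFilters.

Section TransitiveEmbedding.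
Variables (V W : zfc_model) (i : V -> W).
Hypotheses (i_mem : forall x y : V, i x # i y <-> x # y) (i_trans : forall (x : V) (w : W), w # i x -> exists y, w = i y).
Implicit Types x y z a b c d f p : V.

Lemma embed_inj x y : i x = i y -> x = y.
Proof. by move=> E; apply: set_ext => z; rewrite -!i_mem E. Qed.

Lemma in_embed x w : w # i x <-> exists y, w = i y /\ y # x.
Proof.
split=> [H|[y[-> H]]]; last exact/i_mem.
by have [y E] := i_trans H; subst w; exists y; split=> //; apply/i_mem.
Qed.

Lemma embed_duo a b : i (duo a b) = duo (i a) (i b).
Proof.
apply: set_ext => w; rewrite in_embed in_duo; split=> [[y[-> /in_duo[->|->]]]|[->|->]]; auto.
- by exists a; rewrite in_duo; auto.
- by exists b; rewrite in_duo; auto.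
Qed.

Lemma embed_pair a b : i (pair a b) = pair (i a) (i b).
Proof. by rewrite /pair !embed_duo. Qed.
Lemma pair_embed_in a b x : pair (i a) (i b) # i x <-> pair a b # x.
Proof. by rewrite -embed_pair i_mem. Qed.

Lemma pair_in_embed x u v : pair u v # i x <-> exists a b, u = i a /\ v = i b /\ pair a b # x.
Proof.
split=> [H|[a[b[->[-> H]]]]]; last exact/pair_embed_in.
have [t[Et Ht]] := (in_embed _ _).1 H.
have [|z Ez] := @i_trans t (duo u v); first by rewrite -Et in_duo; right.
have [|a Ea] := @i_trans z u; first by rewrite -Ez in_duo; left.
have [|b Eb] := @i_trans z v; first by rewrite -Ez in_duo; right.
by exists a, b; splits; apply/pair_embed_in; rewrite -Ea -Eb.
Qed.

Lemma embed_emp : i emp = emp.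
Proof. by apply: eq_emp => w /in_embed[y[_ /in_emp]]. Qed.

Lemma embed_union x : i (union x) = union (i x).
Proof.
apply: set_ext => w; rewrite in_embed in_union; split.
- by move=> [y[-> /in_union[z[Hz Hy]]]]; exists (i z); rewrite !i_mem.
- move=> [v[/in_embed[z[-> Hz]] /in_embed[y[-> Hy]]]]; exists y; split=> //.
  by apply/in_union; exists z.
Qed.

Lemma embed_succ x : i x.+1 = succ (i x).
Proof. by rewrite /succ /cup /sing embed_union !embed_duo. Qed.

Lemma embed_sub x y : sub (i x) (i y) <-> sub x y.
Proof.
split=> [S z /i_mem/S/i_mem //|S w /in_embed[z[-> Hz]]]; apply/i_mem; exact: S.
Qed.

Lemma embed_trans x : trans (i x) <-> trans x.
Proof.
split=> [T y /i_mem/T/embed_sub //|T w /in_embed[y[-> Hy]]]; apply/embed_sub; exact: T.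
Qed.

Lemma embed_ord x : ord (i x) <-> ord x.
Proof.
rewrite /ord embed_trans; split=> -[T H]; split=> //.
- by move=> y /i_mem/H/embed_trans.
- by move=> w /in_embed[y[-> /H/embed_trans]].
Qed.

Lemma embed_is_fun f : is_fun (i f) <-> is_fun f.
Proof.
split=> -[A B]; split.
- move=> c /[dup] Hc /i_mem/A[u[v E]]; move/i_mem: Hc; rewrite E => /pair_in_embed[a[b[Eu[Ev K]]]].
  by exists a, b; apply: embed_inj; rewrite embed_pair -Eu -Ev.
- by move=> a b b' /pair_embed_in H /pair_embed_in K; apply: embed_inj; exact: B H K.
- by move=> w /in_embed[c[-> /A[a[b ->]]]]; exists (i a), (i b); exact: embed_pair.
- move=> u v v' /pair_in_embed[a[b[->[-> H]]]] /pair_in_embed[a'[b'[/embed_inj<- [-> K]]]].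
  by rewrite (B _ _ _ H K).
Qed.

Lemma embed_fun_on f d : fun_on (i f) (i d) <-> fun_on f d.
Proof.
rewrite /fun_on embed_is_fun; split=> -[F D]; split=> // a.
- rewrite -i_mem D; split=> [[v /pair_in_embed[a'[b[/embed_inj<- [_ K]]]]]|[b K]]; first by exists b.
  by exists (i b); apply/pair_embed_in.
- rewrite in_embed; split=> [[y[-> /D[b K]]]|[v /pair_in_embed[y[b[->[_ K]]]]]].
  + by exists (i b); apply/pair_embed_in.
  + by exists y; split=> //; apply/D; exists b.
Qed.

Lemma embed_app f d a : fun_on f d -> a # d -> i (app f a) = app (i f) (i a).
Proof.
move=> F Ha; symmetry; apply: app_eq; first by apply/embed_is_fun; case: F.
by apply/pair_embed_in; exact: pair_app F Ha.
Qed.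
End TransitiveEmbedding.

Section GenericExtension.
Variables (V W : zfc_model) (i : V -> W) (P L : V) (G : W).
Hypotheses (GE : generic_extension i P L G) (PO : preorder P L).
Let i_mem := ge_mem GE.
Let i_trans := ge_transitive GE.
Let in_i := in_embed i_mem i_trans.
Let pair_in_i := pair_embed_in i_mem i_trans.

Definition generic_set (p : V) : Prop := i p # G.

Lemma generic_sub p : generic_set p -> p # P.
Proof.
have M : Means (@mem W) (incl G (i P)) (sub G (i P)) by exact _.
by move=> /(M.1 (ge_subset GE))/i_mem.
Qed.

Lemma in_generic w : w # G -> exists p, w = i p /\ generic_set p.
Proof.
have M : Means (@mem W) (incl G (i P)) (sub G (i P)) by exact _.
by move=> /[dup] Hw /(M.1 (ge_subset GE))/i_trans[p E]; exists p; rewrite /generic_set -E.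
Qed.

Lemma set_filter : generic_filter P L generic_set.
Proof.
split; first exact: generic_sub.
- move=> p q Hp Hq Hle.
  have M : Means (@mem W) (∀ p ∈ G, ∀ q, pair_in (i L) p q ⇒ q ∈ G) (∀ p # G, forall q, pair p q # i L -> q # G) by exact _.
  by apply: (M.1 (ge_upward GE) (i p) Hp); apply/pair_in_i.
- move=> p q Hp Hq.
  have M : Means (@mem W) (∀ p ∈ G, ∀ q ∈ G, ∃ r ∈ G, pair_in (i L) r p ∧ pair_in (i L) r q)
  (∀ p # G, ∀ q # G, ∃ r # G, pair r p # i L /\ pair r q # i L) by exact _.
  have [w[/in_generic[r[-> Hr]][K1 K2]]] := M.1 (ge_directed GE) (i p) Hp (i q) Hq.
  by exists r; splits; [move: K1|move: K2]; apply pair_embed_in.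
- have M : Means (@mem W) (¬ empty G) (~ G = emp) by exact _.
  by have [w /in_generic[p[_ Hp]]] := neq_emp_ex (M.1 (ge_nonempty GE)); exists p.
- move=> Q D H.
  have M : Means (@mem V) (dense P L (sep P Q)) (sub (sep P Q) P /\ ∀ p # P, ∃ d # sep P Q, pair d p # L).
  { rewrite /dense; exact _. }
  have M' : Means (@mem W) (∃ p ∈ G, p ∈ i (sep P Q)) (∃ p # G, p # i (sep P Q)) by exact _.
  have [|w[/in_generic[p[-> Hp]] /i_mem/in_sep[_ K]]] := M'.1 (ge_generic GE (M.2 _)).
  + split=> [z /in_sep[] //|p /H[q[Hq[Hqp K]]]]; by exists q; rewrite in_sep.
  + by exists p.
Qed.

Definition valuation_step (y h : W) : W :=
  image (sep (trcl y) (fun c => ∃ p # G, pair c p # y)) (app h).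
Definition evaluate : W -> W := rec valuation_step.
Definition val (x : V) : W := evaluate (i x).

Lemma definable_fun1_evaluate : DefinableFun1 evaluate.
Proof. apply: definable_fun1_rec; rewrite /valuation_step; definability. Qed.
#[local] Hint Resolve definable_fun1_evaluate : definable.

Lemma in_evaluate y w : w # evaluate y <-> exists c p, p # G /\ pair c p # y /\ w = evaluate c.
Proof.
have D : DefinableFun2 valuation_step by rewrite /valuation_step; definability.
rewrite {1}/evaluate rec_eq -/evaluate in_image; split.
- by move=> [c[/in_sep[Hc[p[Hp K]]] ->]]; exists c, p; rewrite app_lam.
- move=> [c[p[Hp[K ->]]]]; have [Hc _] := pair_in_trcl K; exists c; rewrite in_sep app_lam //.
  by splits; exists p.
Qed.

Lemma in_val x w : w # val x <-> element generic_set val w x.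
Proof.
rewrite in_evaluate; split=> [[u [v [Hv [/(pair_in_embed i_mem i_trans)[c[p[->[E K]]]] ->]]]]|].
- by exists c, p; rewrite /generic_set -E.
- by move=> [c[p[Hp[K ->]]]]; exists (i c), (i p); splits; apply/pair_in_i.
Qed.

Lemma valuation_val x w : (W ⊨ valuation G (i x) w) -> w = val x.
Proof.
have M : Means (@mem W) (valuation G (i x) w) (exists t, trans t /\ i x # t /\
  exists h, fun_on h t /\ pair (i x) w # h /\ ∀ y # t, forall v, pair y v # h ->
  forall z, z # v <-> exists c p, p # G /\ pair c p # y /\ pair c z # h).
{ rewrite /valuation; exact _. }
move=> /M.1[t[T[Hx[h[Fh[Hw E]]]]]]; rewrite -(app_eq Fh.1 Hw) /val.
elim/trcl_ind: (i x) Hx => y IH Hy; apply: set_ext => z.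
rewrite in_evaluate (E y Hy _ (pair_app Fh Hy)).
split=> -[c[p[Hp[K J]]]]; exists c, p; splits; have [Hc _] := pair_in_trans T Hy K.
- by rewrite -IH //; [exact: (pair_in_trcl K).1|rewrite (app_eq Fh.1 J)].
- by rewrite J -IH //; [exact: (pair_in_trcl K).1|exact: pair_app Fh Hc].
Qed.

Lemma val_surj (w : W) : exists x, w = val x.
Proof. by have [x /valuation_val] := ge_generated GE w; exists x. Qed.

Lemma val_eq a b : val a = val b <-> exists p, generic_set p /\ forced_eq P L p a b.
Proof.
pose t := trcl (duo a b); have T : trans t by exact: trans_trcl.
have Ha : a # t by apply/in_trcl/in_duo; left.
have Hb : b # t by apply/in_trcl/in_duo; right.
have [R HR] := ex_eq_relation P L t.
have rel_R c d : c # t -> d # t -> (exists p, generic_set p /\ forced_eq P L p c d) <-> ∃ q # G, pair q (pair (i c) (i d)) # i R.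
{ move=> Hc Hd; split=> [[p[Hp E]]|[q[/in_generic[p[-> Hp]] K]]].
  - exists (i p); split=> //; rewrite -(embed_pair i_mem i_trans); apply/pair_in_i.
  by apply/(forced_eq_rel_at T HR (generic_sub Hp)).
  - exists p; split=> //; apply/(forced_eq_rel_at T HR (generic_sub Hp)) => //.
  by apply/pair_in_i; rewrite embed_pair. }
suff A w : w # i t -> ∀ v # i t, (evaluate w = evaluate v <-> ∃ q # G, pair q (pair w v) # i R).
{ by rewrite rel_R //; apply: A; exact/i_mem. }
elim/trcl_ind: w => w IH /in_i[x[Ew Hx]] v /in_i[y[-> Hy]].
subst w; have eq_below c s d : pair c s # x -> d # t -> val c = val d <-> exists p, generic_set p /\ forced_eq P L p c d.
{ move=> Hc Hd; have [Hct _] := pair_in_trans T Hx Hc; rewrite rel_R //; apply: IH; try exact/i_mem.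
  exact: (pair_in_trcl ((pair_in_i c s x).2 Hc)).1. }
rewrite -rel_R // -(val_ext_forced_eq PO set_filter).
- move=> c d s s' Hc Hd; exact: (eq_below c s d Hc (pair_in_trans T Hy Hd).1).
- by split=> [E w|]; [rewrite -!in_val /val E|move=> E; apply: set_ext => w; rewrite !in_val].
Qed.

Lemma val_mem a b : val a # val b <-> exists p, generic_set p /\ forced_mem P L p a b.
Proof. exact: (val_mem_forced PO set_filter in_val val_eq). Qed.

Theorem generic_truth phi e : sat (@mem W) (interp (fun k => val (e k)) phi) <-> exists p, i p # G /\ Forces P L (interp e phi) p.
Proof. exact: (truth_lemma PO set_filter in_val val_eq val_surj). Qed.
End GenericExtension.

(** * Countable models and generic extensions *)

Hint Opaque interp forces ult incl empty upair is_pair pair_in is_succ powerset is_function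
  function_on restriction is_injection injects equinumerous transitive ordinal limit_ordinal is_omega cardinal
  is_card smaller uncountable regular inaccessible cardinal_succ trans_closure in_H is_Pkl ultrafilter complete
  fine_measure strongly_compact almost_all ult_represents poset descending second_player_stages
  strategically_closed allowed stage_lottery stage_trivial forces_eq forces_mem check_name forced_at
  is_condition condition_le full_name is_stage dense valuation : typeclass_instances.
Ltac meaning := rewrite /holds; eapply (means (Means := _)).2.

Definition scheme : Type := forall T : Type, (nat -> T) -> form T.

Definition schematic (F : scheme) : Prop :=
  exists phi, forall T e, F T e = interp e phi.

Lemma schematic_mem i j : schematic (fun T e => e i ∈ e j).
Proof. by exists (fo_mem i j). Qed.
Lemma schematic_eq i j : schematic (fun T e => e i ≐ e j).
Proof. by exists (fo_eq i j). Qed.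
Lemma schematic_bot : schematic (fun T e => FBot).
Proof. by exists fo_bot. Qed.
Lemma schematic_imp F G : schematic F -> schematic G -> schematic (fun T e => FImp (F T e) (G T e)).
Proof. by move=> [p Hp] [q Hq]; exists (fo_imp p q) => T e; rewrite Hp Hq. Qed.

Lemma schematic_all (F : forall T : Type, T -> (nat -> T) -> form T) :
  schematic (fun T e => F T (e 0) (fun k => e (S k))) -> schematic (fun T e => FAll (fun x => F T x e)).
Proof.
move=> [p Hp]; exists (fo_all p) => T e /=; congr FAll; apply: funext => x.
exact: (Hp T (scons x e)).
Qed.

Lemma interp_rename T (e : nat -> T) s p : interp e (rename s p) = interp (fun k => e (s k)) p.
Proof.
elim: p s e => [i j|i j||a IHa b IHb|a IHa] s e //=; first by rewrite IHa IHb.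
congr FAll; apply: funext => x; rewrite IHa; congr (interp _ a).
by apply: funext => -[].
Qed.

Lemma schematic_interp_scons phi i t : schematic (fun T e => interp (scons (e i) (fun k => e (t k))) phi).
Proof.
exists (rename (fun k => match k with 0 => i | S k => t k end) phi) => T e; rewrite interp_rename.
by congr (interp _ phi); apply: funext => -[].
Qed.

Lemma schematic_interp_scons2 phi i j t : schematic (fun T e => interp (scons (e i) (scons (e j) (fun k => e (t k)))) phi).
Proof.
exists (rename (fun k => match k with 0 => i | 1 => j | S (S k) => t k end) phi) => T e; rewrite interp_rename.
by congr (interp _ phi); apply: funext => -[|[]].
Qed.

Lemma schematic_rename F s : schematic F -> schematic (fun T e => F T (fun n => e (s n))).
Proof. by move=> [phi E]; exists (rename s phi) => T e; rewrite interp_rename E. Qed.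

Existing Class schematic.
Ltac schematic_step := cbv beta; match goal with
  | |- schematic (fun T e => FMem (e ?i) (e ?j)) => exact (schematic_mem i j)
  | |- schematic (fun T e => FEq (e ?i) (e ?j)) => exact (schematic_eq i j)
  | |- schematic (fun T e => FBot) => exact schematic_bot
  | |- schematic (fun T e => FAll (fun x => @?F T x e)) => notypeclasses refine (@schematic_all F _)
  | |- schematic (fun T e => FImp (@?F T e) (@?G T e)) => notypeclasses refine (@schematic_imp F G _ _)
  | |- schematic (fun T e => interp (scons (e ?i) (scons (e ?j) (fun k => e (@?t k)))) ?phi) =>
    exact (schematic_interp_scons2 phi i j t)
  | |- schematic (fun T e => interp (scons (e ?i) (fun k => e (@?t k))) ?phi) => exact (schematic_interp_scons phi i t)
  | |- schematic _ => assumption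
  end.
Ltac schematic_unfold := cbv beta zeta delta -[schematic interp scons forces ult].
Hint Extern 1 (schematic _) => solve [schematic_unfold; repeat schematic_step] : typeclass_instances.

Section Checks.
Variables (V : zfc_model) (P : V).
Implicit Types x y d s : V.

Definition check : V -> V := rec (fun x h => prod (image x (app h)) P).

Lemma definable_fun1_check : DefinableFun1 check.
Proof. by apply: definable_fun1_rec; definability. Qed.
#[local] Hint Resolve definable_fun1_check : definable.

Lemma in_check x z : z # check x <-> exists y p, y # x /\ p # P /\ z = pair (check y) p.
Proof.
rewrite {1}/check rec_eq -/check in_prod; split=> [[d[p[/in_image[y[Hy ->]][Hp ->]]]]|[y[p[Hy[Hp ->]]]]].
- by exists y, p; rewrite app_lam //; exact: in_trcl.
- by exists (check y), p; splits; apply/in_image; exists y; rewrite app_lam //; exact: in_trcl.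
Qed.

Lemma pair_in_check x d s : pair d s # check x <-> s # P /\ ∃ y # x, d = check y.
Proof.
rewrite in_check; split=> [[y[p[Hy[Hp /pair_inj[-> ->]]]]]|[Hs[y[Hy ->]]]]; last by exists y, s.
by split=> //; exists y.
Qed.
End Checks.
Hint Resolve definable_fun1_check : definable.

Definition generic_name V (P : V) : V := image P (fun p => pair (check P p) p).

Lemma in_generic_name V (P z : V) : z # generic_name P <-> ∃ p # P, z = pair (check P p) p.
Proof. by rewrite in_image //; definability. Qed.

Section NameClasses.
Variable V : zfc_model.
Implicit Types x y z a b c d p q r s : V.
Variables P L : V.
Hypothesis PO : preorder P L.
Variable F : V -> Prop.
Hypothesis GF : generic_filter P L F.
Notation le := (le L).
Notation forced_eq := (forced_eq P L).
Notation forced_mem := (forced_mem P L).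
Notation Forces := (Forces P L).
Let le_trans := PO.2.
Let F_sub p : F p -> p # P := filter_sub GF (p := p).

Definition generic_eq x y : Prop := exists p, F p /\ forced_eq p x y.

Lemma generic_eq_refl x : generic_eq x x.
Proof. by have [p Fp] := filter_nonempty GF; exists p; split=> //; exact: (forced_eq_refl PO.1 x (F_sub Fp)). Qed.
Lemma generic_eq_sym x y : generic_eq x y -> generic_eq y x.
Proof. by move=> [p[Fp H]]; exists p; split=> //; exact: forced_eq_sym (F_sub Fp) H. Qed.

Lemma generic_eq_trans x y z : generic_eq x y -> generic_eq y z -> generic_eq x z.
Proof.
move=> [p[Fp H]] [q[Fq K]]; have [r[Fr[Hp Hq]]] := filter_meet GF Fp Fq; exists r; split=> //.
apply: (forced_eq_trans le_trans (b := y)) (F_sub Fr) _ _.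
- exact: (forced_eq_mono le_trans (F_sub Fp) (F_sub Fr) Hp H).
- exact: (forced_eq_mono le_trans (F_sub Fq) (F_sub Fr) Hq K).
Qed.

Definition name_class : Type := {A : V -> Prop | exists x, A = generic_eq x}.
Implicit Types A B C D : name_class.

Definition class x : name_class := exist _ (generic_eq x) (ex_intro _ x eq_refl).

Lemma class_eq x y : class x = class y <-> generic_eq x y.
Proof.
split=> [/(f_equal (@proj1_sig _ _)) /= ->|H]; first exact: generic_eq_refl.
apply: subset_eq_compat; apply: funext => z; apply: propositional_extensionality.
by split; apply: generic_eq_trans => //; exact: generic_eq_sym.
Qed.

Lemma class_surj A : exists x, A = class x.
Proof. by case: A => A HA; have [x E] := HA; exists x; apply: subset_eq_compat. Qed.

Definition class_mem A B : Prop := exists x, B = class x /\ element F class A x.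

Lemma in_class x A : class_mem A (class x) <-> element F class A x.
Proof.
split=> [[y [/class_eq[p [Fp /(forced_eqE L _ _ (F_sub Fp))[_ I]]] H]]|H]; last by exists x.
by apply: (forced_incl_val PO GF _ Fp I) H => *; exact: class_eq.
Qed.

Lemma class_memP a b : class_mem (class a) (class b) <-> exists p, F p /\ forced_mem p a b.
Proof. exact: (val_mem_forced PO GF in_class class_eq). Qed.
Lemma class_truth phi e : sat class_mem (interp (fun k => class (e k)) phi) <-> exists p, F p /\ Forces (interp e phi) p.
Proof. exact: (truth_lemma PO GF in_class class_eq class_surj). Qed.

Lemma class_extensionality A B : (forall C, class_mem C A <-> class_mem C B) -> A = B.
Proof.
have [x ->] := class_surj A; have [y ->] := class_surj B => H; apply/class_eq.
apply/(val_ext_forced_eq PO GF (val := class)) => [c d *|C]; first exact: class_eq.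
by rewrite -!in_class.
Qed.

Lemma class_env (e : nat -> name_class) : exists e', e = fun k => class (e' k).
Proof.
exists (fun k => proj1_sig (constructive_indefinite_description _ (class_surj (e k)))).
by apply: funext => k; case: constructive_indefinite_description.
Qed.

Definition name_duo a b : V := prod (duo a b) P.
Definition name_pair a b : V := name_duo (name_duo a a) (name_duo a b).

Lemma definable_fun2_name_pair : DefinableFun2 name_pair.
Proof. rewrite /name_pair /name_duo; definability. Qed.
#[local] Hint Resolve definable_fun2_name_pair : definable.

Lemma in_class_prod A x : class_mem A (class (prod x P)) <-> ∃ c # x, A = class c.
Proof.
rewrite in_class; split=> [[c[p[_[/pair_prod[Hc _] ->]]]]|[c[Hc ->]]]; first by exists c.
by have [p Fp] := filter_nonempty GF; exists c, p; rewrite pair_prod; splits; exact: F_sub.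
Qed.

Lemma in_name_duo A a b : class_mem A (class (name_duo a b)) <-> A = class a \/ A = class b.
Proof.
rewrite in_class_prod; split=> [[c[/in_duo[->|->] ->]]|[->|->]]; auto.
- by exists a; rewrite in_duo; auto.
- by exists b; rewrite in_duo; auto.
Qed.

Lemma eq_name_duo C a b : (forall D, class_mem D C <-> D = class a \/ D = class b) <-> C = class (name_duo a b).
Proof.
split=> [H|-> D]; last exact: in_name_duo.
by apply: class_extensionality => D; rewrite H in_name_duo.
Qed.

Lemma means_class_is_pair a b C : Means class_mem (is_pair (class a) (class b) C) (C = class (name_pair a b)).
Proof.
eapply means_iff; first by rewrite /is_pair /upair; exact _.
split=> [[A[B[/eq_name_duo->[/eq_name_duo-> /eq_name_duo]]]] //|->].
by exists (class (name_duo a a)), (class (name_duo a b)); rewrite !eq_name_duo.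
Qed.

Lemma class_name_pair_inj a b c d : class (name_pair a b) = class (name_pair c d) -> class a = class c /\ class b = class d.
Proof.
have H x y x' y' : class (name_duo x y) = class (name_duo x' y') ->
  (class x = class x' /\ class y = class y') \/ (class x = class y' /\ class y = class x').
{ by move=> E; apply: unordered_pair_inj => A; rewrite -!in_name_duo E. }
by move=> /H[[/H A /H B]|[/H A /H B]]; intuition congruence.
Qed.

Lemma class_separation (Phi : scheme) e A : schematic Phi ->
  exists B, forall C, class_mem C B <-> class_mem C A /\ sat class_mem (Phi name_class (scons C e)).
Proof.
move=> [phi E]; have [e' ->] := class_env e; have [x ->] := class_surj A.
have H d : sat class_mem (Phi name_class (scons (class d) (fun k => class (e' k)))) <->
  exists p, F p /\ Forces (interp (scons d e') phi) p.
{ by rewrite E -class_truth; apply: interp_ext; case. }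
exists (class (sep (prod (trcl x) P) (fun z => exists d s r,
  z = pair d r /\ s # P /\ pair d s # x /\ le r s /\ Forces (interp (scons d e') phi) r))) => C.
rewrite !in_class; split=> [[d[r[Fr[/in_sep[_[d'[s[r'[/pair_inj[<- <-][Hs[Hd[Hrs K]]]]]]]] ->]]]]|].
- by split; [exists d, s; splits; exact: filter_up Fr Hs Hrs|apply/H; exists r].
- move=> [[d[s[Fs[Hd ->]]]] /H[p[Fp K]]]; have [r[Fr[Hrp Hrs]]] := filter_meet GF Fp Fs.
  exists d, r; splits; apply/in_sep; rewrite pair_prod; split.
  + by split; [exact: (pair_in_trcl Hd).1|exact: F_sub].
  + exists d, s, r; splits; first exact: F_sub.
  exact: (Forces_mono le_trans (F_sub Fp) (F_sub Fr) Hrp K).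
Qed.

Lemma class_foundation A : (exists B, class_mem B A) -> exists B, class_mem B A /\ forall C, class_mem C B -> ~ class_mem C A.
Proof.
have [x ->] := class_surj A => -[B HB]; apply: NNPP => N.
have K : sat class_mem (∀ u ∈ class x, ∃ v, v ∈ u ∧ v ∈ class x).
{ have M : Means class_mem (∀ u ∈ class x, ∃ v, v ∈ u ∧ v ∈ class x)
  (forall C, class_mem C (class x) -> exists D, class_mem D C /\ class_mem D (class x)) by exact _.
  apply/M => C HC; apply: NNPP => N'; apply: N; exists C; split=> // D HD HD'; apply: N'; by exists D. }
have [phi E] : schematic (fun T e => (∀ u ∈ e 0, ∃ v, v ∈ u ∧ v ∈ e 0)%F) by exact _.
have [p[Fp]] := (class_truth phi (fun _ => x)).1 (eq_ind _ (sat class_mem) K _ (E _ _)).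
rewrite -E => {}K.
have Never y q : q # P -> le q p -> ~ forced_mem q y x.
{ elim/trcl_ind: y q => y IH q Hq Hqp Hy.
  have J : Forces (∃ v, v ∈ y ∧ v ∈ x) q := K y q Hq Hqp Hy.
  have [r [z [Hr [Hrq /(Forces_and PO.1 le_trans Hr)[r1[Hr1[L1[J1 J2]]]]]]]] :=
  Forces_ex PO.1 Hq J.
  have [r2[Hr2[L2[d[s[Hs[Hd[L3 E']]]]]]]] := J1 r1 Hr1 (PO.1 _ Hr1).
  apply: (IH d (pair_in_trcl Hd).1 r2 Hr2 (le_trans L2 (le_trans L1 (le_trans Hrq Hqp)))).
  exact: (forced_mem_eq le_trans Hr2 E' (forced_mem_mono le_trans L2 J2)). }
have [y Ey] := class_surj B; subst B; move/class_memP: HB => [q[Fq H]].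
have [r[Fr[Hrp Hrq]]] := filter_meet GF Fp Fq.
exact: (Never y r (F_sub Fr) Hrp (forced_mem_mono le_trans Hrq H)).
Qed.

Lemma class_union A : exists U, forall C, class_mem C U <-> exists B, class_mem B A /\ class_mem C B.
Proof.
have [x ->] := class_surj A.
have [U HU] := @class_separation (fun T e => (∃ B ∈ e 1, e 0 ∈ B)%F) (fun _ => class x) (class (prod (trcl x) P)) _.
exists U => C.
have M : Means class_mem (∃ B ∈ class x, C ∈ B) (exists B, class_mem B (class x) /\ class_mem C B) by exact _.
rewrite HU; split=> [[_ /M] //|[B[HB HC]]]; split; last by apply/M; exists B.
move: HB HC => /in_class[d[s[_[/pair_in_trcl[Hd _] ->]]]] /in_class[c[s'[_[Hc ->]]]].
by apply/in_class_prod; exists c; split=> //; exact: (pair_in_trans (@trans_trcl _ _) Hd Hc).1.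
Qed.

Lemma class_power A : exists U, forall C, class_mem C U <-> forall B, class_mem B C -> class_mem B A.
Proof.
have [x ->] := class_surj A.
have [U HU] := @class_separation (fun T e => incl (e 0) (e 1)) (fun _ => class x) (class (prod (power (prod (trcl x) P)) P)) _.
exists U => C.
have M : Means class_mem (incl C (class x)) (forall B, class_mem B C -> class_mem B (class x)).
{ rewrite /incl; exact _. }
rewrite HU; split=> [[_ /M] //|H]; split; last exact/M.
have [y Ey] := class_surj C; subst C; apply/in_class_prod.
exists (sep (prod (trcl x) P) (fun z => exists d s, z = pair d s /\ forced_mem s d y)).
split; first by apply/in_power => z /in_sep[].
apply: class_extensionality => B; rewrite (in_class (sep _ _)); split=> [HB|].
- have /in_class[d[s[Fs[Hd E]]]] := H B HB; subst B; have [q[Fq K]] := (class_memP _ _).1 HB.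
  exists d, q; splits; apply/in_sep; rewrite pair_prod; splits; last by exists d, q.
  + exact: (pair_in_trcl Hd).1.
  + exact: F_sub.
- move=> [d[s[Fs[/in_sep[_[d'[s'[/pair_inj[<- <-] K]]]] ->]]]].
  by apply/class_memP; exists s.
Qed.

Lemma class_replacement phi e A : let R B C := sat class_mem (interp (scons B (scons C e)) phi) in
  (forall B C C', class_mem B A -> R B C -> R B C' -> C = C') ->
  exists U, forall C, class_mem C U <-> exists B, class_mem B A /\ R B C.
Proof.
move=> R HR; have [e' Ee] := class_env e; have [x Ex] := class_surj A; subst e A.
have H d y : R (class d) (class y) <-> exists p, F p /\ Forces (interp (scons d (scons y e')) phi) p.
{ by rewrite /R -class_truth; apply: interp_ext => -[|[]]. }
have [b Hb] := @collection V (prod (trcl x) P) (fun z y => exists d r, z = pair d r /\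
  Forces (interp (scons d (scons y e')) phi) r) _.
have [U HU] := @class_separation (fun T e => (∃ B ∈ e 1, interp (scons B (scons (e 0) (fun k => e (S (S k))))) phi)%F)
  (scons (class x) (fun k => class (e' k))) (class (prod b P)) _.
exists U => C.
have M B : Means class_mem (interp (scons B (scons C (fun k => class (e' k)))) phi) (R B C) by exact: means_sat.
have MX : Means class_mem (∃ B ∈ class x, interp (scons B (scons C (fun k => class (e' k)))) phi)
  (exists B, class_mem B (class x) /\ R B C) by exact _.
rewrite HU; split=> [[_ /MX] //|[B[HB K]]]; split; last by apply/MX; exists B.
have [d[s[Fs[Hd E]]]] := (in_class _ _).1 HB; have [y Ey] := class_surj C; subst B C.
have [p[Fp J]] := (H d y).1 K.
have [||z[Hz[d'[r[/pair_inj[<- <-] J']]]]] := Hb (pair d p).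
- by apply/pair_prod; split; [exact: (pair_in_trcl Hd).1|exact: F_sub].
- by exists y, d, p.
- apply/in_class_prod; exists z; split=> //; apply: (HR (class d)) => //; apply/H; by exists p.
Qed.

Lemma in_class_check x A : class_mem A (class (check P x)) <-> ∃ y # x, A = class (check P y).
Proof.
rewrite in_class; split=> [[d[s[_[/pair_in_check[_[y[Hy ->]]] ->]]]]|[y[Hy ->]]]; first by exists y.
have [p Fp] := filter_nonempty GF; exists (check P y), p; splits; apply/pair_in_check.
by split; [exact: F_sub|exists y].
Qed.

Lemma forced_eq_check x y p : p # P -> forced_eq p (check P x) (check P y) -> x = y.
Proof.
elim/eps_ind: x y p => x IH y p Hp /(forced_eqE L _ _ Hp)[E1 E2].
have In u z : u # z -> pair (check P u) p # check P z by move=> Hu; apply/pair_in_check; split=> //; exists u.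
apply: set_ext => u; split=> Hu.
- have [r[Hr[_[d[s[_[/pair_in_check[_[v[Hv ->]]][_ E]]]]]]]] :=
  E1 _ p Hp (In _ _ Hu) p Hp (PO.1 _ Hp) (PO.1 _ Hp).
  by rewrite (IH u Hu v r Hr E).
- have [r[Hr[_[d[s[_[/pair_in_check[_[v[Hv ->]]][_ E]]]]]]]] :=
  E2 _ p Hp (In _ _ Hu) p Hp (PO.1 _ Hp) (PO.1 _ Hp).
  by rewrite -(IH v Hv u r Hr (forced_eq_sym Hr E)).
Qed.

Lemma class_check_inj x y : class (check P x) = class (check P y) -> x = y.
Proof. by move/class_eq => [p[Fp E]]; exact: (forced_eq_check (F_sub Fp) E). Qed.

#[local] Existing Instance means_class_is_pair.
Lemma means_class_pair_in h a b : Means class_mem (pair_in h (class a) (class b)) (class_mem (class (name_pair a b)) h).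
Proof.
eapply means_iff; first by rewrite /pair_in; exact _.
by split=> [[C[HC <-]]|H] //; exists (class (name_pair a b)).
Qed.

Section Choice.
Variables x al g : V.
Hypotheses (al_ord : ord al) (g_surj : ∀ c # trcl x, ∃ b # al, app g b = c).

Definition first_forced d b r : Prop := forced_mem r d x /\ forced_mem r (app g b) d /\
  ∀ c # b, ∀ q # P, le q r -> ~ forced_mem q (app g c) d.
Definition first_element A b : Prop :=
  class_mem (class (app g b)) A /\ ∀ c # b, ~ class_mem (class (app g c)) A.

Lemma first_forced_element d b r : F r -> first_forced d b r -> class_mem (class d) (class x) /\ first_element (class d) b.
Proof.
move=> Fr [H1[H2 H3]]; split; last split=> [|c Hc /class_memP[q[Fq H]]].
- by apply/class_memP; exists r.
- by apply/class_memP; exists r.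
- have [t[Ft[Htr Htq]]] := filter_meet GF Fr Fq.
  exact: (H3 c Hc t (F_sub Ft) Htr (forced_mem_mono le_trans Htq H)).
Qed.

Lemma first_element_unique A b c : b # al -> c # al -> first_element A b -> first_element A c -> b = c.
Proof.
move=> Hb Hc [H1 H2] [K1 K2]; case: (ord_total (ord_in al_ord Hb) (ord_in al_ord Hc)) => [J|[//|J]].
- by case: (K2 _ J).
- by case: (H2 _ J).
Qed.

Lemma ex_first_forced_below d b0 p : b0 # al -> p # P -> forced_mem p d x -> forced_mem p (app g b0) d ->
  ∃ r # P, le r p /\ ∃ b # al, first_forced d b r.
Proof.
move=> Hb0 Hp Hd H0; pose meets b := ∃ r # P, le r p /\ forced_mem r (app g b) d.
have D : Definable1 meets by rewrite /meets; definability.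
have M0 : meets b0 by exists p; splits; exact: PO.1.
have [|b[Ob[[r[Hr[Hrp K]]] Min]]] := @ord_least V meets D.
{ by exists b0; split=> //; exact: ord_in Hb0. }
exists r; splits; exists b; split.
- case: (ord_total Ob al_ord) => [//|J]; case: (Min b0) => //.
  case: J => [->//|J]; exact: (ord_trans Ob Hb0 J).
- split; first exact: (forced_mem_mono le_trans Hrp Hd).
  split=> //; by move=> c Hc q Hq Hle J; apply: (Min c Hc); exists q; splits; exact: le_trans Hrp.
Qed.

Lemma ex_first_forced A : class_mem A (class x) -> (exists B, class_mem B A) ->
  exists d b r, b # al /\ d # trcl x /\ F r /\ first_forced d b r /\ A = class d.
Proof.
move=> HA [B HB]; have [d[s[Fs[Hd E]]]] := (in_class _ _).1 HA; subst A.
have [Hdx _] := pair_in_trcl Hd; have [c[s'[Fs'[Hc E]]]] := (in_class _ _).1 HB; subst B.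
have [b0[Hb0 E0]] := g_surj (pair_in_trans (@trans_trcl _ _) Hdx Hc).1; subst c.
move: HA HB => /class_memP[p0[Fp0 H0]] /class_memP[p1[Fp1 H1]].
have [p[Fp[L0 L1]]] := filter_meet GF Fp0 Fp1.
have [|r[Fr[_[b[Hb H]]]]] :=
  @filter_generic_below V P L PO F GF (fun r => ∃ b # al, first_forced d b r) p _ Fp; last by exists d, b, r.
move=> q Hq Hqp; apply: (ex_first_forced_below Hb0 Hq).
- exact: (forced_mem_mono le_trans (le_trans Hqp L0) H0).
- exact: (forced_mem_mono le_trans (le_trans Hqp L1) H1).
Qed.

Lemma ex_choice_name : exists h, forall C, class_mem C (class h) <->
  exists d b r, b # al /\ d # trcl x /\ F r /\ first_forced d b r /\ C = class (name_pair d (app g b)).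
Proof.
have [|h Hh] := @replacement V (prod (prod (trcl x) al) P) (fun z w => exists d b r,
  z = pair (pair d b) r /\ first_forced d b r /\ w = pair (name_pair d (app g b)) r) _.
{ by move=> z w w' _ [d[b[r[->[_ ->]]]]] [d'[b'[r'[/pair_inj[/pair_inj[-> ->] ->][_ ->]]]]]. }
exists h => C; rewrite in_class; split.
- move=> [n[r[Fr[/Hh[z[Hz[d[b[r'[Ez[K /pair_inj[-> Er]]]]]]]] ->]]]]; subst z r'.
  by exists d, b, r; move: Hz => /pair_prod[/pair_prod[? ?] _].
- move=> [d[b[r[Hb[Hd[Fr[K ->]]]]]]]; exists (name_pair d (app g b)), r; splits; apply/Hh.
  by exists (pair (pair d b) r); rewrite !pair_prod; splits; [exact: F_sub|exists d, b, r].
Qed.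
End Choice.

Lemma class_choice A : (forall B, class_mem B A -> exists C, class_mem C B) -> exists h, sat class_mem (function_on h A) /\
  forall B, class_mem B A -> exists C, class_mem C B /\ sat class_mem (pair_in h B C).
Proof.
have [x ->] := class_surj A => NE; have [al[g[Oal[_ Sg]]]] := well_ordering (trcl x).
have [h Hh] := @ex_choice_name x al g; exists (class h).
have In B C : sat class_mem (pair_in (class h) B C) ->
  class_mem B (class x) /\ ∃ b # al, C = class (app g b) /\ first_element g B b.
{ have [d ->] := class_surj B; have [c ->] := class_surj C => /means_class_pair_in/Hh.
  move=> [d'[b[r[Hb[_[Fr[K /class_name_pair_inj[-> ->]]]]]]]].
  by have [? ?] := first_forced_element Fr K; split=> //; exists b. }
have Total B : class_mem B (class x) -> exists C, class_mem C B /\ sat class_mem (pair_in (class h) B C).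
{ move=> HB; have [d[b[r[Hb[Hd[Fr[K E]]]]]]] := ex_first_forced Oal Sg HB (NE B HB); subst B.
  exists (class (app g b)); split; first by have [_[]] := first_forced_element Fr K.
  by apply/means_class_pair_in/Hh; exists d, b, r. }
split=> //.
have M1 A' B C := means_sat class_mem (is_pair A' B C).
have M2 A' B := means_sat class_mem (pair_in (class h) A' B).
rewrite /function_on /is_function; meaning.
splits.
- move=> C /Hh[d[b[r[_[_[_[_ ->]]]]]]]; exists (class d), (class (app g b)); exact/means_class_is_pair.
- move=> B C C' /In[_[b[Hb[-> K]]]] /In[_[b'[Hb'[-> K']]]].
  by rewrite (first_element_unique Oal Hb Hb' K K').
- by move=> B; split=> [/Total[C[_ K]]|[C /In[]]] //; exists C.
Qed.
Lemma class_ZFC : ZFC class_mem.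
Proof.
split.
- meaning => A B H; exact: class_extensionality.
- rewrite /empty; meaning => A; case: (classic (exists B, class_mem B A)) => [/class_foundation|N]; [right|left] => // B HB.
  by apply: N; exists B.
- rewrite /upair; meaning => A B; have [x ->] := class_surj A; have [y ->] := class_surj B.
  exists (class (name_duo x y)) => C; exact: in_name_duo.
- meaning => A; exact: class_union.
- rewrite /powerset /incl; meaning => A; exact: class_power.
- rewrite /empty /is_succ; meaning; exists (class (check P (omega V))); split=> [|A /in_class_check[n[Hn ->]]].
  + exists (class (check P emp)); split; first by apply/in_class_check; exists emp; split=> //; exact: emp_in_omega.
  by move=> C /in_class_check[y[/in_emp]].
  + exists (class (check P n.+1)); split.
  { by apply/in_class_check; exists n.+1; split=> //; exact: succ_in_omega. }
  move=> C; rewrite !in_class_check; split=> [[z[/inS[Hz|->] ->]]|[[z[Hz ->]]|->]]; auto.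
  * by left; exists z.
  * by exists z; split=> //; apply/inS; left.
  * by exists n; split=> //; exact: memS.
- move=> phi e; have M u : Means class_mem (interp (scons u e) phi) (sat class_mem (interp (scons u e) phi)).
  { exact: means_sat. }
  meaning => A; exact: (@class_separation (fun T e => interp e phi) e A (ex_intro _ phi (fun _ _ => eq_refl))).
- move=> phi e R; have M u v : Means class_mem (interp (scons u (scons v e)) phi) (sat class_mem (interp (scons u (scons v e)) phi)).
  { exact: means_sat. }
  rewrite /R; meaning => A HA; exact: (class_replacement (fun B C C' HB => HA B HB C C')).
- have M h A := means_sat class_mem (function_on h A); have M' h A B := means_sat class_mem (pair_in h A B).
  rewrite /empty; meaning => A NE; apply: class_choice => B HB.
  by apply: NNPP => N; apply: (NE B HB) => C HC; apply: N; exists C.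
Qed.

Definition extension : zfc_model := {| univ := name_class; mem := class_mem; univ_ZFC := class_ZFC |}.
Definition ground x : extension := class (check P x).
Definition canonical_generic : extension := class (generic_name P).

Lemma in_canonical_generic (A : extension) : A # canonical_generic <-> exists p, F p /\ A = ground p.
Proof.
rewrite [X in X <-> _]in_class; split=> [[d[s[Fs[/in_generic_name[p[Hp /pair_inj[-> Es]]] ->]]]]|[p[Fp ->]]].
- by exists p; subst s.
- by exists (check P p), p; splits; apply/in_image; exists p; split=> //; exact: F_sub.
Qed.

Lemma ground_mem x y : ground x # ground y <-> x # y.
Proof.
rewrite [X in X <-> _]in_class_check; split=> [[z[Hz /class_check_inj->]] //|Hx]; by exists x.
Qed.

Lemma ground_transitive x w : w # ground x -> exists y, w = ground y.
Proof. by move/in_class_check => [y[_ ->]]; exists y. Qed.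

Let in_ground := in_embed ground_mem ground_transitive.
Let pair_in_ground := pair_in_embed ground_mem ground_transitive.
Let pair_ground := pair_embed_in ground_mem ground_transitive.

Lemma ground_generic p : ground p # canonical_generic <-> F p.
Proof.
rewrite in_canonical_generic; split=> [[q[Fq /class_check_inj->]] //|Fp]; by exists p.
Qed.

Lemma pair_class a b : @pair extension (class a) (class b) = class (name_pair a b).
Proof.
exact: (eq_sym ((means_is_pair (V := extension) _ _ _).1 ((means_class_is_pair a b _).2 eq_refl))).
Qed.

Section Evaluation.
Variable x : V.
Let t := trcl (sing x).
Let graph : extension := class (prod (image t (fun y => name_pair (check P y) y)) P).

Lemma in_valuation_graph (w v : extension) : pair w v # graph <-> ∃ y # t, w = ground y /\ v = class y.
Proof.
have [a ->] := class_surj w; have [b ->] := class_surj v.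
rewrite pair_class [X in X <-> _]in_class_prod; split.
- move=> [c[/in_image[y[Hy ->]] /class_name_pair_inj[-> ->]]]; by exists y.
- move=> [y[Hy[E1 E2]]]; exists (name_pair (check P y) y); rewrite in_image; split; first by exists y.
  by rewrite -!pair_class E1 E2.
Qed.

Lemma valuation_class : extension ⊨ valuation canonical_generic (ground x) (class x).
Proof.
have Tt : trans t := @trans_trcl _ _; have Hx : x # t by apply/in_trcl/in_sing.
rewrite /valuation; meaning; exists (ground t); splits.
- exact/(embed_trans ground_mem ground_transitive).
- exact/ground_mem.
- exists graph; split; [split; [split|]|split].
  + move=> u /in_class_prod[c[/in_image[y[Hy ->]] ->]].
  by exists (ground y), (class y); rewrite pair_class.
  + by move=> u v v' /in_valuation_graph[y[_[-> ->]]] /in_valuation_graph[z[_[/class_check_inj<- ->]]].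
  + move=> u; split=> [/in_ground[y[-> Hy]]|].
  * by exists (class y); apply/in_valuation_graph; exists y.
  * by move=> [v /in_valuation_graph[y[Hy[-> _]]]]; apply/ground_mem.
  + by apply/in_valuation_graph; exists x.
  + move=> u Hu v /in_valuation_graph[y[Hy[-> ->]]] w; rewrite [X in X <-> _]in_class; split.
  * move=> [d[s[Fs[K ->]]]]; exists (ground d), (ground s).
    rewrite pair_ground; splits; first exact/ground_generic.
    by apply/in_valuation_graph; exists d; splits; exact: (pair_in_trans Tt Hy K).1.
  * move=> [k[k'[Hk'[/pair_in_ground[d[s[->[Es K]]]] J]]]].
    move/in_valuation_graph: J => [d'[_[/class_check_inj<- ->]]].
    by exists d, s; rewrite -ground_generic -Es.
Qed.
End Evaluation.

Theorem extension_generic : (forall p q, le p q -> q # P) -> generic_extension ground P L canonical_generic.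
Proof.
move=> le_dom; split.
- exact: ground_mem.
- exact: ground_transitive.
- by meaning => A /in_canonical_generic[p[Fp ->]]; apply/ground_mem/F_sub.
- meaning => E; have [p Fp] := filter_nonempty GF; apply: (@in_emp extension (ground p)).
  by rewrite -E; apply/ground_generic.
- meaning => A /in_canonical_generic[p[Fp ->]] B HB.
  have [a[q[Ea[Eq K]]]] := (pair_in_ground _ _ _).1 HB; subst B.
  have E := embed_inj ground_mem Ea; subst a.
  by apply/ground_generic; exact: (filter_up GF Fp (le_dom _ _ K) K).
- meaning => A /in_canonical_generic[p[Fp ->]] B /in_canonical_generic[q[Fq ->]].
  have [r[Fr[H1 H2]]] := filter_meet GF Fp Fq.
  by exists (ground r); rewrite !pair_ground; splits; exact/ground_generic.
- move=> D; have M : Means (@mem V) (dense P L D) (sub D P /\ ∀ p # P, ∃ d # D, pair d p # L).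
  { rewrite /dense; exact _. }
  move=> /M[S H]; have [|p[Fp K]] := filter_generic GF (Q := fun p => p # D) _.
  { by move=> p /H[d[Hd Hle]]; exists d; splits; exact: S. }
  by meaning; exists (ground p); split; [exact/ground_generic|exact/ground_mem].
- move=> w; have [x ->] := class_surj w; exists x; exact: valuation_class.
Qed.
End NameClasses.

Definition countable (T : Type) : Prop := exists enum : nat -> T, forall x, exists n, enum n = x.

Section CountableModel.
Variable V : zfc_model.
Hypothesis V_countable : countable V.
Variables P L : V.
Hypothesis PO : preorder P L.
Implicit Types p q r D : V.
Notation le := (le L).
Let le_refl := PO.1.
Let le_trans := PO.2.

Lemma enter_or_avoid D p : p # P -> ∃ q # P, le q p /\ ((∃ r # P, le r p /\ r # D) -> q # D).
Proof.
move=> Hp; case: (classic (∃ r # P, le r p /\ r # D)) => [[r[Hr[Hle K]]]|N].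
- by exists r.
- by exists p; splits; exact: le_refl.
Qed.

Lemma descending_chain (s : nat -> V) : (forall n, s n # P) -> (forall n, le (s (S n)) (s n)) -> forall n k, le (s (k + n)) (s n).
Proof. by move=> H D n; elim=> [|k IH]; [exact: le_refl|exact: (le_trans (D _) IH)]. Qed.

Lemma generic_exists p0 : p0 # P -> exists F, generic_filter P L F /\ F p0.
Proof.
move=> H0; have [enum Henum] := V_countable.
pose below n p := the (fun q => q # P /\ le q p /\ ((∃ r # P, le r p /\ r # enum n) -> q # enum n)).
pose s := nat_rect (fun _ => univ V) p0 below.
have Hs n : s n # P by elim: n => [//|n IH]; exact: (the_spec (enter_or_avoid (enum n) IH)).1.
have Step n := (the_spec (enter_or_avoid (enum n) (Hs n))).2.
have Chain := descending_chain Hs (fun n => (Step n).1).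
have A0 : exists n, le (s n) p0 by exists 0; exact: le_refl.
exists (fun p => p # P /\ exists n, le (s n) p); split=> //; split=> [p[]|p q[Hp[n Hn]] Hq Hle|p q[Hp[n Hn]][Hq[k Hk]]||] //.
- by split=> //; exists n; exact: le_trans Hle.
- exists (s (k + n)); splits; [|exact: le_trans Hn|rewrite Nat.add_comm; exact: le_trans Hk].
  by exists (k + n); exact: le_refl.
- by exists p0.
- move=> Q D H; have [n Hn] := Henum (sep P Q); exists (s (S n)).
  have [|_ K] := (in_sep P (s (S n)) D).1; last by splits; exists (S n); exact: le_refl.
  rewrite -Hn; apply: (Step n).2; have [q[Hq[Hle K]]] := H _ (Hs n).
  by exists q; rewrite Hn in_sep.
Qed.

Hypothesis le_dom : forall p q, le p q -> q # P.

Lemma forces_complete phi e p : p # P -> (forall (W : zfc_model) (i : V -> W) G, generic_extension i P L G -> i p # G ->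
  sat (@mem W) (interp (fun k => val i G (e k)) phi)) -> Forces P L (interp e phi) p.
Proof.
move=> Hp H; apply: NNPP => /(Forces_not_dense le_refl le_trans Hp)[q[Hq[Hqp N]]].
have [F[GF Fq]] := generic_exists Hq; have GE := extension_generic PO GF le_dom.
have Fp : F p := filter_up GF Fq Hp Hqp.
have /(generic_truth GE PO)[r [/(ground_generic PO GF) Fr K]] := H _ _ _ GE ((ground_generic PO GF p).2 Fp).
exact: (Forces_incompatible PO GF Fr Fq K N).
Qed.
End CountableModel.

Section Submodel.
Variables (M : zfc_model) (D : M -> Prop).
Definition skolem_closed : Prop := forall phi e, (forall k, D (e k)) ->
  (exists x, ~ sat mem (interp (scons x e) phi)) -> exists x, D x /\ ~ sat mem (interp (scons x e) phi).
Hypothesis SK : skolem_closed.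
Definition sub_univ : Type := {x : M | D x}.
Definition sub_mem (x y : sub_univ) : Prop := proj1_sig x # proj1_sig y.
Implicit Types x y : sub_univ.

Lemma sub_univ_eq x y : proj1_sig x = proj1_sig y -> x = y.
Proof. by move: x y => [x Hx] [y Hy] /= E; apply: subset_eq_compat. Qed.

Lemma elementary phi (e : nat -> sub_univ) : sat sub_mem (interp e phi) <-> sat mem (interp (fun k => proj1_sig (e k)) phi).
Proof.
elim: phi e => [i j|i j||a IHa b IHb|a IHa] e //=.
- by split=> [->|/sub_univ_eq].
- by rewrite IHa IHb.
- have H x : sat sub_mem (interp (scons x e) a) <-> sat mem (interp (scons (proj1_sig x) (fun k => proj1_sig (e k))) a).
  { by rewrite IHa; apply: interp_ext; case. }
  split=> [K z|K x]; last exact/H.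
  apply: NNPP => N; have [||y[Dy Hy]] := SK (phi := a) (e := fun k => proj1_sig (e k)).
  + by move=> k; exact: (proj2_sig (e k)).
  + by exists z.
  + by apply: Hy; move: (K (exist _ y Dy)) => /H.
Qed.

Lemma schematic_elementary F (SF : schematic F) (e : nat -> sub_univ) :
  sat sub_mem (F _ e) <-> sat mem (F _ (fun k => proj1_sig (e k))).
Proof. by move: SF => [phi E]; rewrite !E; exact: elementary. Qed.

Variable z0 : M.
Hypothesis Dz0 : D z0.
Let e0 : nat -> sub_univ := fun _ => exist _ z0 Dz0.

Lemma sub_ZFC : ZFC sub_mem.
Proof.
have transfer Phi : schematic Phi -> (forall e, sat mem (Phi M e)) -> forall e, sat sub_mem (Phi sub_univ e).
{ by move=> SPhi H e; apply/schematic_elementary. }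
have Z := univ_ZFC M; split=> [||||||phi|phi|].
- exact: (transfer (fun T e => (∀ x, ∀ y, (∀ z, z ∈ x ⇔ z ∈ y) ⇒ x ≐ y)%F) _ (fun _ => zfc_ext Z) e0).
- exact: (transfer (fun T e => (∀ x, ¬ empty x ⇒ ∃ y ∈ x, ∀ z ∈ y, ¬ z ∈ x)%F) _ (fun _ => zfc_found Z) e0).
- exact: (transfer (fun T e => (∀ a, ∀ b, ∃ c, upair a b c)%F) _ (fun _ => zfc_pair Z) e0).
- exact: (transfer (fun T e => (∀ x, ∃ u, ∀ z, z ∈ u ⇔ ∃ y ∈ x, z ∈ y)%F) _ (fun _ => zfc_union Z) e0).
- exact: (transfer (fun T e => (∀ x, ∃ p, powerset x p)%F) _ (fun _ => zfc_power Z) e0).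
- exact: (transfer (fun T e => (∃ w, (∃ e ∈ w, empty e) ∧ ∀ n ∈ w, ∃ m ∈ w, is_succ n m)%F) _ (fun _ => zfc_inf Z) e0).
- exact: (transfer (fun T e => (∀ a, ∃ b, ∀ x, x ∈ b ⇔ x ∈ a ∧ interp (scons x e) phi)%F) _ (zfc_sep Z phi)).
- exact: (transfer (fun T e => let R (x y : T) := interp (scons x (scons y e)) phi in
  (∀ a, (∀ x ∈ a, ∀ y, ∀ y', R x y ⇒ R x y' ⇒ y ≐ y') ⇒ ∃ b, ∀ y, y ∈ b ⇔ ∃ x ∈ a, R x y)) _ (zfc_repl Z phi)).
- exact: (transfer (fun T e => (∀ a, (∀ x ∈ a, ¬ empty x) ⇒ ∃ h, function_on h a ∧ ∀ x ∈ a, ∃ y ∈ x, pair_in h x y)%F)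
  _ (fun _ => zfc_choice Z) e0).
Qed.

Definition submodel : zfc_model := {| univ := sub_univ; mem := sub_mem; univ_ZFC := sub_ZFC |}.
End Submodel.

Lemma schematic_forces_interp phi s i j k : schematic (fun T e => forces (e i) (e j) (interp (fun n => e (s n)) phi) (e k)).
Proof.
elim: phi s i j k => [a b|a b||a IHa b IHb|a IHa] s i j k /=.
- exact: _.
- exact: _.
- exact: _.
- have A := IHa (fun n => S (s n)) (S i) (S j) 0; have B := IHb (fun n => S (s n)) (S i) (S j) 0.
  by schematic_unfold; repeat schematic_step.
- apply: (@schematic_all (fun T x e => forces (e i) (e j) (interp (scons x (fun n => e (s n))) a) (e k))).
  have [p E] := IHa (fun n => match n with 0 => 0 | S n => S (s n) end) (S i) (S j) (S k); exists p => T e.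
  by rewrite -E; congr forces; congr interp; apply: funext => -[].
Qed.

Lemma schematic_forces F i j k : schematic F -> schematic (fun T e => forces (e i) (e j) (F T e) (e k)).
Proof.
move=> [p Hp]; have [q Hq] := schematic_forces_interp p (fun n => n) i j k; exists q => T e.
by rewrite -Hq Hp.
Qed.

Lemma schematic_ult_interp phi s i j : schematic (fun T e => ult (e i) (e j) (interp (fun n => e (s n)) phi)).
Proof.
elim: phi s i j => [a b|a b||a IHa b IHb|a IHa] s i j /=.
- exact: _.
- exact: _.
- exact: _.
- exact: schematic_imp.
- have A : schematic (fun T e => ult (e (S i)) (e (S j)) (interp (scons (e 0) (fun n => e (S (s n)))) a)).
  { have [p E] := IHa (fun n => match n with 0 => 0 | S n => S (s n) end) (S i) (S j); exists p => T e.
  by rewrite -E; congr ult; congr interp; apply: funext => -[]. }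
  exact: _.
Qed.

Lemma schematic_ult F i j : schematic F -> schematic (fun T e => ult (e i) (e j) (F T e)).
Proof.
move=> [p Hp]; have [q Hq] := schematic_ult_interp p (fun n => n) i j; exists q => T e; by rewrite -Hq Hp.
Qed.

Hint Extern 1 (schematic _) => solve [schematic_unfold; repeat (cbv beta; match goal with
  | |- schematic (fun T e => forces (e ?i) (e ?j) (@?F T e) (e ?k)) => notypeclasses refine (@schematic_forces F i j k _)
  | |- schematic (fun T e => ult (e ?i) (e ?j) (@?F T e)) => notypeclasses refine (@schematic_ult F i j _)
  | _ => schematic_step
  end)] : typeclass_instances.

Fixpoint fo_of_nat (fuel n : nat) : fo :=
  match fuel, of_nat n with
  | _, (0, m) => fo_mem (fst (of_nat m)) (snd (of_nat m))
  | _, (1, m) => fo_eq (fst (of_nat m)) (snd (of_nat m))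
  | S fuel, (2, m) => fo_imp (fo_of_nat fuel (fst (of_nat m))) (fo_of_nat fuel (snd (of_nat m)))
  | S fuel, (3, m) => fo_all (fo_of_nat fuel m)
  | _, _ => fo_bot
  end.

Lemma fo_of_nat_surj phi : exists fuel0, forall fuel, fuel0 <= fuel -> exists n, fo_of_nat fuel n = phi.
Proof.
have E k m : of_nat (to_nat (k, m)) = (k, m) by exact: cancel_of_to.
elim: phi => [i j|i j||a[fa IHa] b[fb IHb]|a[fa IHa]].
- by exists 0 => -[|fuel] _; exists (to_nat (0, to_nat (i, j))); rewrite /= !E.
- by exists 0 => -[|fuel] _; exists (to_nat (1, to_nat (i, j))); rewrite /= !E.
- by exists 0 => -[|fuel] _; exists (to_nat (4, 0)).
- exists (S (max fa fb)) => -[|fuel] Hf; first lia.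
  have [|na Ha] := IHa fuel; first lia.
  have [|nb Hb] := IHb fuel; first lia.
  by exists (to_nat (2, to_nat (na, nb))); rewrite /= !E /= Ha Hb.
- exists (S fa) => -[|fuel] Hf; first lia.
  by have [|n Hn] := IHa fuel; [lia|exists (to_nat (3, n)); rewrite /= !E Hn].
Qed.

Lemma countable_fo : countable fo.
Proof.
exists (fun n => fo_of_nat (fst (of_nat n)) (snd (of_nat n))) => phi; have [fuel H] := fo_of_nat_surj phi.
by have [//|n Hn] := H fuel; exists (to_nat (fuel, n)); rewrite cancel_of_to.
Qed.

Section Closure.
Variables (U : Type) (op : nat -> fo -> list U -> U).

(* Formulas serve as codes for terms, and for the lists of terms along their right spines. *)
Fixpoint term_value (t : fo) : U * list U :=
  match t with
  | fo_imp a b => (match a with fo_imp (fo_mem k _) phi => op k phi (snd (term_value b)) | _ => fst (term_value a) end,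
                 fst (term_value a) :: snd (term_value b))
  | _ => (op 0 fo_bot nil, nil)
  end.

Definition closure (u : U) : Prop := exists t, fst (term_value t) = u.

Lemma closure_list l : (forall u, In u l -> closure u) -> exists t, snd (term_value t) = l.
Proof.
elim: l => [|u l IH] H; first by exists fo_bot.
have [|t Ht] := IH; first by move=> v Hv; apply: H; right.
have [|s Hs] := H u; first by left.
by exists (fo_imp s t); rewrite /= Ht Hs.
Qed.

Lemma closure_op k phi l : (forall u, In u l -> closure u) -> closure (op k phi l).
Proof.
by move=> /closure_list[t Ht]; exists (fo_imp (fo_imp (fo_mem k 0) phi) t); rewrite /= Ht.
Qed.

Lemma closure_enumerated : exists enum : nat -> U, forall u, closure u -> exists n, enum n = u.
Proof.
have [enum H] := countable_fo; exists (fun n => fst (term_value (enum n))) => u [t Ht].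
by have [n Hn] := H t; exists n; rewrite Hn.
Qed.
End Closure.

Fixpoint free_bound (phi : fo) : nat :=
  match phi with
  | fo_mem i j | fo_eq i j => S (max i j)
  | fo_bot => 0
  | fo_imp a b => max (free_bound a) (free_bound b)
  | fo_all a => free_bound a
  end.

Lemma sat_free_bound (T : Type) (m : T -> T -> Prop) phi (e e' : nat -> T) :
  (forall n, n < free_bound phi -> e n = e' n) -> sat m (interp e phi) <-> sat m (interp e' phi).
Proof.
elim: phi e e' => [i j|i j||a IHa b IHb|a IHa] e e' //= H.
- by rewrite (H i) ?(H j); try lia.
- by rewrite (H i) ?(H j); try lia.
- by rewrite (IHa e e') 1?(IHb e e') // => n Hn; apply: H; lia.
- split=> K x; move: (K x); apply IHa => -[|n] Hn //=; rewrite H //; lia.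
Qed.

Section SkolemHull.
Variables (U : Type) (u0 : U) (M : nat -> zfc_model) (inj : forall n, M n -> U) (proj : forall n, U -> M n).
Hypothesis proj_inj : forall n x, proj n (@inj n x) = x.
Variable unary : nat -> U -> U.

Definition skolem n phi (l : list (M n)) : M n :=
  the (fun x => ~ sat mem (interp (scons x (fun k => nth k l emp)) phi)).

Definition hull_op (k : nat) (phi : fo) (l : list U) : U :=
  match of_nat k with
  | (0, n) => inj (skolem phi (map (@proj n) l))
  | (1, k) => unary k (hd u0 l)
  | _ => u0
  end.

Lemma closure_unary k u : closure hull_op u -> closure hull_op (unary k u).
Proof.
move=> H; have := @closure_op _ hull_op (to_nat (1, k)) fo_bot (u :: nil).
by rewrite /hull_op cancel_of_to; apply=> v [<-|[]].
Qed.

Lemma closure_base : closure hull_op u0.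
Proof. by have := @closure_op _ hull_op (to_nat (2, 0)) fo_bot nil; rewrite /hull_op cancel_of_to; apply. Qed.

Lemma closure_skolem n : skolem_closed (fun x : M n => closure hull_op (inj x)).
Proof.
move=> phi e He [x Hx]; pose l := map e (seq 0 (free_bound phi)).
have E y : sat mem (interp (scons y (fun k => nth k l emp)) phi) <-> sat mem (interp (scons y e) phi).
{ apply: sat_free_bound => -[|k] Hk //=; rewrite /l (nth_indep _ emp (e 0)).
  - by rewrite length_map length_seq; lia.
  - by rewrite map_nth seq_nth; first lia. }
exists (skolem phi l); split.
- have := @closure_op _ hull_op (to_nat (0, n)) phi (map (@inj n) l); rewrite /hull_op cancel_of_to map_map.
  have -> : map (fun x => proj n (inj x)) l = l by rewrite -[RHS]map_id; apply: map_ext.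
  by apply=> u /in_map_iff[y[<- /in_map_iff[k[<- _]]]].
- rewrite -E; apply: (the_spec (P := fun y => ~ sat mem (interp (scons y (fun k => nth k l emp)) phi))).
  by exists x; rewrite E.
Qed.
End SkolemHull.

Section Restriction.
Variables (V W : zfc_model) (i : V -> W) (P L : V) (G : W).
Hypothesis GE : generic_extension i P L G.
Variables (DV : V -> Prop) (DW : W -> Prop).
Hypotheses (SV : skolem_closed DV) (SW : skolem_closed DW) (HP : DV P) (HL : DV L) (HG : DW G).
Variables (zV : V) (HzV : DV zV) (zW : W) (HzW : DW zW).
Hypotheses (embed_closed : forall x, DV x <-> DW (i x))
  (name_closed : forall w, DW w -> exists x, DV x /\ (W ⊨ valuation G (i x) w)).
Notation V0 := (submodel SV HzV).
Notation W0 := (submodel SW HzW).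

Definition restricted_embedding (x : V0) : W0 := exist DW (i (proj1_sig x)) ((embed_closed _).1 (proj2_sig x)).
Notation P0 := (exist DV P HP : V0).
Notation L0 := (exist DV L HL : V0).
Notation G0 := (exist DW G HG : W0).

Lemma restrict_generic_extension : generic_extension restricted_embedding P0 L0 G0.
Proof.
have down Phi : schematic Phi -> forall e : nat -> W0, sat mem (Phi W (fun k => proj1_sig (e k))) ->
  sat (@mem W0) (Phi W0 e) by move=> SPhi e; rewrite -schematic_elementary.
split.
- by move=> x y; exact: (ge_mem GE).
- move=> x w Hw; have [y Ey] := ge_transitive GE (proj1_sig x) (proj1_sig w) Hw.
  have Hy : DV y by apply/embed_closed; rewrite -Ey; exact: (proj2_sig w).
  by exists (exist _ y Hy); exact: sub_univ_eq.
- exact: (down (fun T e => incl (e 0) (e 1)) _ (scons G0 (fun _ => restricted_embedding P0)) (ge_subset GE)).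
- exact: (down (fun T e => ¬ empty (e 0)) _ (fun _ => G0) (ge_nonempty GE)).
- exact: (down (fun T e => (∀ p ∈ e 0, ∀ q, pair_in (e 1) p q ⇒ q ∈ e 0)%F) _
  (scons G0 (fun _ => restricted_embedding L0)) (ge_upward GE)).
- exact: (down (fun T e => (∀ p ∈ e 0, ∀ q ∈ e 0, ∃ r ∈ e 0, pair_in (e 1) r p ∧ pair_in (e 1) r q)%F) _
  (scons G0 (fun _ => restricted_embedding L0)) (ge_directed GE)).
- move=> D HD; apply: (down (fun T e => (∃ p ∈ e 0, p ∈ e 1)%F) _ (scons G0 (fun _ => restricted_embedding D))).
  apply: (ge_generic GE (D := proj1_sig D)).
  exact: ((schematic_elementary SV (F := fun T e => dense (e 0) (e 1) (e 2)) _ (scons P0 (scons L0 (fun _ => D)))).1 HD).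
- move=> w; have [x[Hx H]] := name_closed (proj2_sig w); exists (exist _ x Hx).
  exact: (down (fun T e => valuation (e 0) (e 1) (e 2)) _
  (scons G0 (scons (restricted_embedding (exist _ x Hx)) (fun _ => w))) H).
Qed.
End Restriction.

Lemma countable_sub (T : Type) (D : T -> Prop) (enum : nat -> T) x0 :
  D x0 -> (forall x, D x -> exists n, enum n = x) -> countable {x | D x}.
Proof.
move=> D0 H; exists (fun n => match excluded_middle_informative (D (enum n)) with
  left Hn => exist D (enum n) Hn | right _ => exist D x0 D0 end) => -[x Hx].
have [n Hn] := H x Hx; exists n; case: excluded_middle_informative => [Dn|[]]; last by rewrite Hn.
exact: subset_eq_compat.
Qed.

Definition preservation (V : zfc_model) : Prop := forall (kappa f P L : V),
  (V ⊨ strongly_compact kappa) -> (V ⊨ unbounded_partial_function kappa f) ->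
  (V ⊨ menas_property kappa f) -> (V ⊨ lottery_preparation kappa f P L) ->
  forall (VG : zfc_model) (i : V -> VG) (G : VG), generic_extension i P L G -> forall A LA : VG, (VG ⊨ is_Add (i kappa) A LA) ->
  forall (VGg : zfc_model) (j : VG -> VGg) (g : VGg), generic_extension j A LA g -> VGg ⊨ strongly_compact (j (i kappa)).

Section CountableReduction.
Variables (V VG VGg : zfc_model) (i : V -> VG) (j : VG -> VGg) (P L : V) (G A LA : VG) (g : VGg).
Hypotheses (GE : generic_extension i P L G) (GE' : generic_extension j A LA g).
Notation U := (V + VG + VGg)%type.
Notation in_V x := (inl (inl x)).
Notation in_VG x := (inl (inr x)).
Notation in_VGg x := (inr x).
Definition level (n : nat) : zfc_model := match n with 0 => V | 1 => VG | _ => VGg end.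
Definition level_inj n : level n -> U :=
  match n with 0 => fun x => in_V x | 1 => fun x => in_VG x | _ => fun x => in_VGg x end.
Definition level_proj n : U -> level n :=
  match n with
  | 0 => fun u => match u with in_V x => x | _ => emp end
  | 1 => fun u => match u with in_VG x => x | _ => emp end
  | _ => fun u => match u with in_VGg x => x | _ => emp end
  end.

Lemma level_proj_inj n x : level_proj n (@level_inj n x) = x.
Proof. by case: n x => [|[|n]]. Qed.

Variables kappa f : V.
Definition move_level (k : nat) (u : U) : U :=
  match k, u with
  | 0, in_V x => in_VG (i x)
  | 1, in_VG w => in_V (the (fun x => w = i x))
  | 2, in_VG x => in_VGg (j x)
  | 3, in_VGg w => in_VG (the (fun x => w = j x))
  | 4, in_VG w => in_V (the (fun x => VG ⊨ valuation G (i x) w))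
  | 5, in_VGg w => in_VG (the (fun x => VGg ⊨ valuation g (j x) w))
  | 6, _ => in_V f
  | 7, _ => in_V P
  | 8, _ => in_V L
  | 9, _ => in_VG G
  | 10, _ => in_VG A
  | 11, _ => in_VG LA
  | 12, _ => in_VGg g
  | _, _ => u
  end.
Definition small_universe : U -> Prop := closure (hull_op (in_V kappa) level_inj level_proj move_level).
Let D0 x := small_universe (in_V x).
Let D1 x := small_universe (in_VG x).
Let D2 x := small_universe (in_VGg x).

Lemma small_universe_move k u : small_universe u -> small_universe (move_level k u).
Proof. exact: closure_unary. Qed.

Lemma small_universe_embed x : D0 x <-> D1 (i x).
Proof.
split=> [/(small_universe_move 0) //|/(small_universe_move 1) /=].
by rewrite -(embed_inj (ge_mem GE) (the_spec (P := fun y => i x = i y) (ex_intro _ x eq_refl))).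
Qed.

Lemma small_universe_embed' x : D1 x <-> D2 (j x).
Proof.
split=> [/(small_universe_move 2) //|/(small_universe_move 3) /=].
by rewrite -(embed_inj (ge_mem GE') (the_spec (P := fun y => j x = j y) (ex_intro _ x eq_refl))).
Qed.

Lemma small_universe_name w : D1 w -> exists x, D0 x /\ (VG ⊨ valuation G (i x) w).
Proof. by move=> /(small_universe_move 4) H; eexists; split; [exact: H|exact: (the_spec (ge_generated GE w))]. Qed.
Lemma small_universe_name' w : D2 w -> exists x, D1 x /\ (VGg ⊨ valuation g (j x) w).
Proof. by move=> /(small_universe_move 5) H; eexists; split; [exact: H|exact: (the_spec (ge_generated GE' w))]. Qed.

Hypothesis H : forall V : zfc_model, countable V -> preservation V.

Lemma preservation_of_countable : (V ⊨ strongly_compact kappa) -> (V ⊨ unbounded_partial_function kappa f) ->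
  (V ⊨ menas_property kappa f) -> (V ⊨ lottery_preparation kappa f P L) ->
  (VG ⊨ is_Add (i kappa) A LA) -> VGg ⊨ strongly_compact (j (i kappa)).
Proof.
move=> H1 H2 H3 H4 H5; have S := @closure_skolem _ (in_V kappa) _ _ _ level_proj_inj move_level.
have S0 : skolem_closed D0 := S 0; have S1 : skolem_closed D1 := S 1; have S2 : skolem_closed D2 := S 2.
have Hk : D0 kappa := closure_base _ _ _ _; have move_base k := small_universe_move k Hk.
have Hik := (small_universe_embed _).1 Hk; have Hjk := (small_universe_embed' _).1 Hik.
have Hf : D0 f := move_base 6; have HP : D0 P := move_base 7; have HL : D0 L := move_base 8.
have HG : D1 G := move_base 9; have HA : D1 A := move_base 10; have HLA : D1 LA := move_base 11.
have Hg : D2 g := move_base 12.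
have R1 := restrict_generic_extension GE S0 S1 HP HL HG Hk HG small_universe_embed small_universe_name.
have R2 := restrict_generic_extension GE' S1 S2 HA HLA Hg HG Hg small_universe_embed' small_universe_name'.
have [enum Henum] := closure_enumerated (hull_op (in_V kappa) level_inj level_proj move_level).
have C : countable (submodel S0 Hk).
{ apply: (countable_sub (enum := fun n => level_proj 0 (enum n)) Hk) => x /Henum[n E]; by exists n; rewrite E. }
pose k0 : submodel S0 Hk := exist D0 kappa Hk; pose f0 : submodel S0 Hk := exist D0 f Hf.
pose ik : submodel S1 HG := exist D1 (i kappa) Hik; pose jik : submodel S2 Hg := exist D2 (j (i kappa)) Hjk.
have Sc : schematic (fun T e => strongly_compact (e 0)) by exact _.
have K : submodel S2 Hg ⊨ strongly_compact jik.
{ apply: (H C (kappa := k0) (f := f0) _ _ _ _ R1 _ R2).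
  - exact: ((schematic_elementary S0 Sc (fun _ => k0)).2 H1).
  - exact: ((schematic_elementary S0 (F := fun T e => unbounded_partial_function (e 0) (e 1)) _ (scons k0 (fun _ => f0))).2 H2).
  - exact: ((schematic_elementary S0 (F := fun T e => menas_property (e 0) (e 1)) _ (scons k0 (fun _ => f0))).2 H3).
  - exact: ((schematic_elementary S0 (F := fun T e => lottery_preparation (e 0) (e 1) (e 2) (e 3)) _
    (scons k0 (scons f0 (scons (exist D0 P HP) (fun _ => exist D0 L HL))))).2 H4).
  - exact: ((schematic_elementary S1 (F := fun T e => is_Add (e 0) (e 1) (e 2)) _
    (scons ik (scons (exist D1 A HA) (fun _ => exist D1 LA HLA)))).2 H5). }
exact: ((schematic_elementary S2 Sc (fun _ => jik)).1 K).
Qed.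
End CountableReduction.

Theorem countable_reduction : (forall V : zfc_model, countable V -> preservation V) -> forall V, preservation V.
Proof.
move=> H V kappa f P L H1 H2 H3 H4 VG i G GE A LA H5 VGg j g GE'.
exact: (preservation_of_countable GE GE' H H1 H2 H3 H4 H5).
Qed.

Section Cardinals.
Variable V : zfc_model.
Implicit Types x y z a b c d f k w : V.
Notation Means := (Means (@mem V)).

Global Instance means_is_injection f a b : Means (is_injection f a b) (inj f a b).
Proof.
eapply means_iff; first by rewrite /is_injection; exact _.
rewrite /inj; split=> [[F[H I]]|[F[H I]]]; splits.
- by move=> x /H[y[Hy K]]; rewrite (app_eq F.1 K).
- move=> x x' Hx Hx' E; apply: (I _ _ (app f x)); first exact: (pair_app F Hx).
  rewrite E; exact: (pair_app F Hx').
- by move=> x Hx; exists (app f x); split; [exact: H|exact: (pair_app F Hx)].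
- by move=> x x' y /(pair_in_fun _ _ F)[Hx ->] /(pair_in_fun _ _ F)[Hx' E]; exact: I.
Qed.

Global Instance means_injects a b : Means (injects a b) (embeds a b).
Proof. rewrite /injects; exact _. Qed.

Definition bij f a b : Prop := inj f a b /\ ∀ y # b, ∃ x # a, pair x y # f.

Global Instance means_equinumerous a b : Means (equinumerous a b) (exists f, bij f a b).
Proof. rewrite /equinumerous; exact _. Qed.
Global Instance means_cardinal k : Means (cardinal k) (card k).
Proof. rewrite /cardinal; exact _. Qed.
Global Instance means_is_card x k : Means (is_card x k) (card k /\ exists f, bij f x k).
Proof. rewrite /is_card; exact _. Qed.
Global Instance means_smaller x k : Means (smaller x k) (small x k).
Proof. rewrite /smaller; exact _. Qed.

Definition lim x : Prop := ord x /\ x <> emp /\ ∀ y # x, ∃ z # x, y # z.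

Global Instance means_limit_ordinal x : Means (limit_ordinal x) (lim x).
Proof. rewrite /limit_ordinal; exact _. Qed.

Lemma lim_omega : lim (omega V).
Proof.
rewrite /lim; splits; first exact: ord_omega.
- by move=> E; apply: (@in_emp V emp); rewrite -{2}E; exact: emp_in_omega.
- by move=> n Hn; exists n.+1; split; [exact: succ_in_omega|exact: memS].
Qed.

Lemma not_lim_in_omega n : n # omega V -> ~ lim n.
Proof.
move=> Hn [_[N H]]; case: (omega_cases Hn) => [//|[m[Hm E]]]; subst n.
have [z[/inS[Hz|->] K]] := H m (memS m); [exact: mem_asym K Hz|exact: mem_irrefl K].
Qed.

Global Instance means_is_omega w : Means (is_omega w) (w = omega V).
Proof.
eapply means_iff; first by rewrite /is_omega; exact _.
split=> [[Lw Nw]|->]; last by split; [exact: lim_omega|exact: not_lim_in_omega].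
case: (ord_total Lw.1 (@ord_omega V)) => [K|[//|K]].
- by case: (not_lim_in_omega K).
- by case: (Nw _ K lim_omega).
Qed.

Global Instance means_uncountable k : Means (uncountable k) (omega V # k).
Proof.
eapply means_iff; first by rewrite /uncountable; exact _.
by split=> [[w[K <-]]|K] //; exists (omega V).
Qed.

Definition reg k : Prop := lim k /\ ∀ a # k, forall f, fun_on f a -> (∀ x # a, app f x # k) -> ∃ b # k, ∀ x # a, app f x # b.

Global Instance means_regular k : Means (regular k) (reg k).
Proof.
eapply means_iff; first by rewrite /regular; exact _.
split=> -[Lk K]; split=> // a Ha f F B; have [|b[Hb M]] := K a Ha f F.
- by move=> x Hx; exists (app f x); split; [exact: B|exact: (pair_app F Hx)].
- by exists b; split=> // x Hx; apply: (M x); exact: (pair_app F Hx).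
- by move=> x /B[y[Hy J]]; rewrite (app_eq F.1 J).
- by exists b; split=> // x y /(pair_in_fun _ _ F)[Hx ->]; exact: M.
Qed.

Definition inacc k : Prop := card k /\ omega V # k /\ reg k /\ ∀ a # k, small (power a) k.

Global Instance means_inaccessible k : Means (inaccessible k) (inacc k).
Proof.
eapply means_iff; first by rewrite /inaccessible; exact _.
rewrite /inacc; split=> -[A[B[C D]]]; splits=> a Ha; first exact: (D a Ha (power a)).
by move=> p ->; exact: D.
Qed.

Definition card_succ a k : Prop := card k /\ a # k /\ ∀ b # k, embeds b a.

Global Instance means_cardinal_succ a k : Means (cardinal_succ a k) (card_succ a k).
Proof. rewrite /cardinal_succ; exact _. Qed.

Global Instance means_in_H k x : Means (in_H k x) (small (trcl x) k).
Proof.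
eapply means_iff; first by rewrite /in_H; exact _.
by split=> [[t[-> K]]|K] //; exists (trcl x).
Qed.

Lemma ex_partial_choice a (R : V -> V -> Prop) : Definable2 R ->
  exists c, fun_on c a /\ ∀ x # a, (exists y, R x y) -> R x (app c x).
Proof.
move=> D; apply: (@ex_choice_fun V a (fun x y => (exists y, R x y) -> R x y)) => x _.
by case: (classic (exists y, R x y)) => [[y Hy]|N]; [exists y|exists x].
Qed.
End Cardinals.

Section Measures.
Variable V : zfc_model.
Variables k l X U : V.
Implicit Types x y z a b c d f g e B : V.

Record is_fine_measure : Prop := {
  measure_space : forall x, x # X <-> sub x l /\ small x k;
  measure_sub : ∀ B # U, sub B X;
  measure_full : X # U;
  measure_nonempty : ∀ B # U, B <> emp;
  measure_up : ∀ A # U, forall B, sub A B -> sub B X -> B # U;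
  measure_cap : forall A B, A # U -> B # U -> cap A B # U;
  measure_ultra : forall A, sub A X -> A # U \/ diff X A # U;
  measure_complete : forall S, sub S U -> small S k -> forall B, (forall x, x # B <-> x # X /\ ∀ A # S, x # A) -> B # U;
  measure_fine : ∀ a # l, sep X (fun x => a # x) # U }.

Lemma means_fine_measure : Means (@mem V) (fine_measure k l X U) is_fine_measure.
Proof.
apply: (means_iff (P := (forall x, x # X <-> sub x l /\ small x k) /\ ((∀ B # U, sub B X) /\ X # U /\ (∀ B # U, B <> emp) /\
  (∀ A # U, forall B, sub A B -> sub B X -> B # U) /\
  (∀ A # U, ∀ B # U, forall C, (forall x, x # C <-> x # A /\ x # B) -> C # U) /\
  (forall A B, sub A X -> (forall x, x # B <-> x # X /\ ~ x # A) -> A # U \/ B # U)) /\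
  (forall S, sub S U -> small S k -> forall B, (forall x, x # B <-> x # X /\ ∀ A # S, x # A) -> B # U) /\
  ∀ a # l, forall B, (forall x, x # B <-> x # X /\ a # x) -> B # U)).
{ rewrite /fine_measure /is_Pkl /ultrafilter /complete; exact _. }
split=> [[H1[[H2[H3[H4[H5[H6 H7]]]]][H8 H9]]]|[H1 H2 H3 H4 H5 H6 H7 H8 H9]].
- split=> //.
  + by move=> A B HA HB; apply: (H6 A HA B HB) => x; exact: in_cap.
  + by move=> A HA; apply: (H7 A _ HA) => x; exact: in_diff.
  + by move=> a Ha; apply: (H9 a Ha) => x; exact: in_sep.
- splits.
  + move=> A HA B HB C E; suff -> : C = cap A B by exact: H6.
  by apply: set_ext => x; rewrite E in_cap.
  + move=> A B HA E; suff -> : B = diff X A by exact: H7.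
  by apply: set_ext => x; rewrite E in_diff.
  + move=> a Ha B E; suff -> : B = sep X (fun x => a # x) by exact: H9.
  by apply: set_ext => x; rewrite E in_sep.
Qed.

Definition ae (Q : V -> Prop) : Prop := ∃ B # U, ∀ x # B, Q x.

Hypothesis FM : is_fine_measure.

Lemma ae_mono (Q Q' : V -> Prop) : ae Q -> (∀ x # X, Q x -> Q' x) -> ae Q'.
Proof. by move=> [B[HB K]] H; exists B; split=> // x Hx; apply: H; [exact: measure_sub HB _ Hx|exact: K]. Qed.
Lemma ae_all (Q : V -> Prop) : (∀ x # X, Q x) -> ae Q.
Proof. by exists X; split=> //; exact: measure_full. Qed.

Lemma ae_and (Q Q' : V -> Prop) : ae Q -> ae Q' -> ae (fun x => Q x /\ Q' x).
Proof.
move=> [B[HB K]] [B'[HB' K']]; exists (cap B B'); split; first exact: measure_cap.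
by move=> x /in_cap[Hx Hx']; split; [exact: K|exact: K'].
Qed.

Lemma ae_ex (Q : V -> Prop) : ae Q -> ∃ x # X, Q x.
Proof.
move=> [B[HB K]]; have [x Hx] := neq_emp_ex (measure_nonempty FM HB).
by exists x; split; [exact: measure_sub HB _ Hx|exact: K].
Qed.

Lemma ae_not (Q : V -> Prop) : ae Q -> ae (fun x => ~ Q x) -> False.
Proof. by move=> H K; have [x[_[]]] := ae_ex (ae_and H K). Qed.

Lemma ae_sep (Q : V -> Prop) : Definable1 Q -> ae Q <-> sep X Q # U.
Proof.
move=> D; split=> [[B[HB K]]|H]; last by exists (sep X Q); split=> // x /in_sep[].
apply: (measure_up FM HB) => x; last by move=> /in_sep[].
by move=> Hx; apply/in_sep; split; [exact: measure_sub HB _ Hx|exact: K].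
Qed.

Lemma ae_fine a : a # l -> ae (fun x => a # x).
Proof. by move=> Ha; apply/ae_sep; exact: (measure_fine FM Ha). Qed.

Lemma ae_decided (Q : V -> Prop) : Definable1 Q -> ae Q \/ ae (fun x => ~ Q x).
Proof.
move=> D; have [|K|K] := measure_ultra FM (A := sep X Q); first by move=> x /in_sep[].
- by left; apply/ae_sep.
- by right; exists (diff X (sep X Q)); split=> // x /in_diff[Hx N] Qx; apply/N/in_sep.
Qed.

Lemma ae_forall_small a (Q : V -> V -> Prop) : Definable2 Q -> small a k -> (∀ b # a, ae (Q b)) -> ae (fun x => ∀ b # a, Q b x).
Proof.
move=> D Sa H; apply/ae_sep; pose S := image a (fun b => sep X (Q b)).
apply: (measure_complete FM (S := S)).
- by move=> z /in_image[b[Hb ->]]; apply/ae_sep/H.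
- apply: (small_embeds _ Sa); apply: (@embeds_of_surjection V (lam a (fun b => sep X (Q b)))).
  by move=> y /in_image[b[Hb ->]]; exists b; rewrite app_lam.
- move=> x; rewrite in_sep; split=> -[Hx K]; split=> //.
  + by move=> A /in_image[b[Hb ->]]; apply/in_sep; split=> //; exact: K.
  + by move=> b Hb; have /K/in_sep[] : sep X (Q b) # S by apply/in_image; exists b.
Qed.

Lemma ae_constant a g : small a k -> ae (fun x => app g x # a) -> ∃ b # a, ae (fun x => app g x = b).
Proof.
move=> Sa H; apply: NNPP => N; apply: (ae_not H).
apply: (@ae_mono (fun x => ∀ b # a, app g x <> b)) => [|x _ K /K //].
apply: (@ae_forall_small a (fun b x => app g x <> b)) => // b Hb.
by case: (@ae_decided (fun x => app g x = b)) => // K; case: N; exists b.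
Qed.

Lemma ae_select (Q : V -> V -> Prop) : Definable2 Q -> ae (fun x => exists y, Q x y) ->
  exists g, fun_on g X /\ ae (fun x => Q x (app g x)).
Proof.
move=> D H; have [g[Fg Hg]] := ex_partial_choice X D; exists g; split=> //.
exact: (ae_mono H Hg).
Qed.

Lemma means_almost_all (R : V -> V -> Prop) (phi : V -> V -> form V) a b : Definable2 R ->
  (forall y z, Means (@mem V) (phi y z) (R y z)) -> fun_on a X -> fun_on b X ->
  Means (@mem V) (almost_all X U (fun x => ∃ y, ∃ z, pair_in a x y ∧ pair_in b x z ∧ phi y z))
  (ae (fun x => R (app a x) (app b x))).
Proof.
move=> D M Fa Fb; have D1 : Definable1 (fun x => R (app a x) (app b x)) by definability.
eapply means_iff; first by rewrite /almost_all; exact _.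
rewrite (ae_sep D1) /=; have E x : x # X -> (exists y z, pair x y # a /\ pair x z # b /\ R y z) <-> R (app a x) (app b x).
{ move=> Hx; split=> [[y [z [/(pair_in_fun _ _ Fa)[_ ->] [/(pair_in_fun _ _ Fb)[_ ->] K]]]] //|K].
  by exists (app a x), (app b x); splits; apply: pair_app; eauto. }
split=> [[B[HB K]]|H].
- have -> : sep X (fun x => R (app a x) (app b x)) = B; last by [].
  by apply: set_ext => x; rewrite K in_sep; split=> -[Hx /(E _ Hx)].
- by eexists; split; [exact: H|move=> x]; rewrite in_sep; split=> -[Hx /(E _ Hx)].
Qed.

Lemma los phi (e : nat -> V) : (forall n, fun_on (e n) X) ->
  sat mem (ult X U (interp e phi)) <-> ae (fun x => sat mem (interp (fun n => app (e n) x) phi)).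
Proof.
elim: phi e => [i j|i j||a IHa b IHb|a IHa] e He.
- exact: (means_almost_all (R := fun y z => y # z)).
- exact: (means_almost_all (R := fun y z => y = z)).
- by split=> //= /ae_ex[x[]].
- have DA : Definable1 (fun x => sat mem (interp (fun n => app (e n) x) a)) by definability.
  rewrite /= (IHa e He) (IHb e He); split=> [H|H K].
  + case: (ae_decided DA) => [/H K|K]; first exact: (ae_mono K).
  by apply: (ae_mono K) => x _ N /N.
  + by apply: (ae_mono (ae_and H K)) => x _ [HK /HK].
- have Step c : fun_on c X -> sat mem (ult X U (interp (scons c e) a)) <->
  ae (fun x => sat mem (interp (scons (app c x) (fun n => app (e n) x)) a)).
  { move=> Fc; rewrite IHa; first by case.
  by split=> /ae_mono; apply=> x _; apply interp_ext; case. }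
  split=> /= [H|H c /means_function_on Fc]; last by apply/(Step c Fc)/(ae_mono H).
  have DA : Definable1 (fun x => forall y, sat mem (interp (scons y (fun n => app (e n) x)) a)) by definability.
  case: (ae_decided DA) => // N.
  have [|g[Fg Hg]] := @ae_select (fun x y => ~ sat mem (interp (scons y (fun n => app (e n) x)) a)) _.
  { by apply: (ae_mono N) => x _ K; apply: NNPP => J; apply: K => y; apply: NNPP => L; apply: J; exists y. }
  by case: (ae_not _ Hg); apply/(Step g Fg)/H/means_function_on.
Qed.

Hypothesis k_card : card k.

Lemma ult_represents_unfold al : sat mem (ult_represents X U k al) ->
  exists h, app h k = al /\ (∀ b # k.+1, fun_on (app h b) X) /\ forall b g, b # k.+1 -> fun_on g X ->
    (ae (fun x => app g x # app (app h b) x) <-> ∃ c # b, ae (fun x => app g x = app (app h c) x)).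
Proof.
have M1 g c := means_sat (@mem V) (ult X U (g ∈ c)); have M2 g c := means_sat (@mem V) (ult X U (g ≐ c)).
have M : Means (@mem V) (ult_represents X U k al) (exists s, s = k.+1 /\ exists h, fun_on h s /\ pair k al # h /\
  ∀ b # s, forall c, pair b c # h -> fun_on c X /\ forall g, fun_on g X ->
  (sat mem (ult X U (g ∈ c)) <-> ∃ b' # b, exists c', pair b' c' # h /\ sat mem (ult X U (g ≐ c')))).
{ rewrite /ult_represents; exact _. }
move=> /M[s[->[h[Fh[Hal H]]]]]; exists h; split; first exact: app_eq Fh.1 Hal.
have Fc b : b # k.+1 -> fun_on (app h b) X by move=> Hb; exact: (H b Hb _ (pair_app Fh Hb)).1.
split=> // b g Hb Fg; have J := (H b Hb _ (pair_app Fh Hb)).2 g Fg.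
have Hc c : c # b -> c # k.+1.
{ move: Hb => /inS[Hb|->] K; apply/inS; left => //; exact: ord_trans k_card.1 K Hb. }
have F2 c n : c # k.+1 -> fun_on (scons g (fun _ => app h c) n) X by case: n => [|n] // /Fc.
rewrite (los (fo_mem 0 1) (fun n => F2 b n Hb)) in J; rewrite J; split=> [[c [K [d [/(pair_in_fun _ _ Fh)[_ ->] E]]]]|[c[K E]]].
- by exists c; split=> //; move: E; rewrite (los (fo_eq 0 1) (fun n => F2 c n (Hc _ K))).
- exists c; split=> //; exists (app h c); split; first exact: pair_app Fh (Hc _ K).
  by rewrite (los (fo_eq 0 1) (fun n => F2 c n (Hc _ K))).
Qed.

Section Represented.
Variable h : V.
Hypothesis h_mem : forall b g, b # k.+1 -> fun_on g X ->
  (ae (fun x => app g x # app (app h b) x) <-> ∃ c # b, ae (fun x => app g x = app (app h c) x)).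

Lemma represented_below b : b # k -> ae (fun x => app (app h b) x = b).
Proof.
have D : Definable1 (fun b => b # k -> ae (fun x => app (app h b) x = b)) by rewrite /ae; definability.
elim/eps_ind: b => b IH Hb; have Hb' : b # k.+1 by apply/inS; left.
have {}IH c : c # b -> ae (fun x => app (app h c) x = c).
{ by move=> Hc; apply: IH => //; exact: ord_trans k_card.1 Hc Hb. }
case: (@ae_decided (fun x => app (app h b) x = b)) => // N.
case: (@ae_decided (fun x => ∃ y # app (app h b) x, ~ y # b)) => M.
- have [g[Fg Hg]] := @ae_select (fun x y => y # app (app h b) x /\ ~ y # b) _ M.
  have [|c[Hc E]] := (h_mem Hb' Fg).1; first by apply: (ae_mono Hg) => x _ [].
  have [x[_[[_ Hn][E1 E2]]]] := ae_ex (ae_and Hg (ae_and E (IH c Hc))).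
  by case: Hn; rewrite E1 E2.
- have [|g[Fg Hg]] := @ae_select (fun x y => y # b /\ ~ y # app (app h b) x) _.
  { apply: (ae_mono (ae_and N M)) => x _ [N1 N2]; apply: NNPP => N3; apply/N1/set_ext => y.
  by split=> Hy; apply: NNPP => N4; [apply: N2|apply: N3]; exists y. }
  have [||c[Hc E]] := @ae_constant b g; first exact: small_mem.
  { by apply: (ae_mono Hg) => x _ []. }
  case: (@ae_not (fun x => app g x # app (app h b) x)); last by apply: (ae_mono Hg) => x _ [].
  by apply/(h_mem Hb' Fg); exists c; split=> //; apply: (ae_mono (ae_and E (IH c Hc))) => x _ [-> ->].
Qed.
End Represented.

Lemma ult_represents_normal al : sat mem (ult_represents X U k al) -> fun_on al X /\ (∀ b # k, ae (fun x => b # app al x)) /\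
  forall g, fun_on g X -> ae (fun x => app g x # app al x) -> ∃ b # k, ae (fun x => app g x = b).
Proof.
move=> /ult_represents_unfold[h[<- [Fh Hh]]]; have Below := represented_below Hh.
have Hk := memS k; splits; first exact: Fh.
- move=> b Hb; have Fb : fun_on (lam X (fun _ => b)) X by exact: fun_on_lam.
  have [_ E] := Hh k _ Hk Fb; apply: (ae_mono (E _)) => [|x Hx]; last by rewrite app_lam.
  by exists b; split=> //; apply: (ae_mono (Below b Hb)) => x Hx ->; rewrite app_lam.
- move=> g Fg /(Hh k g Hk Fg)[b[Hb E]]; exists b; split=> //.
  by apply: (ae_mono (ae_and E (Below b Hb))) => x _ [-> ->].
Qed.
End Measures.

Lemma definable_Forces_schematic V (Phi : scheme) (P L u : (nat -> V) -> V) (v : nat -> (nat -> V) -> V) : schematic Phi ->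
  definable_fun P -> definable_fun L -> (forall n, definable_fun (v n)) -> definable_fun u ->
  definable (fun e => Forces (P e) (L e) (Phi V (fun n => v n e)) (u e)).
Proof.
move=> [phi E] HP HL Hv Hu.
apply: (definable_ext (Q := fun e => Forces (P e) (L e) (interp (fun n => v n e) phi) (u e))) => [e|]; first by rewrite E.
by definability; exact: Hv.
Qed.

Section DefinableForcing.
Variables (V : zfc_model) (P L u x y z w : (nat -> V) -> V).
Hypotheses (DP : definable_fun P) (DL : definable_fun L) (Du : definable_fun u)
  (Dx : definable_fun x) (Dy : definable_fun y) (Dz : definable_fun z) (Dw : definable_fun w).
Let args n := match n with 0 => x | 1 => y | 2 => z | _ => w end.

Lemma definable_Forces4 (Phi : forall T : Type, T -> T -> T -> T -> form T) :
  schematic (fun T e => Phi T (e 0) (e 1) (e 2) (e 3)) ->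
  definable (fun e => Forces (P e) (L e) (Phi V (x e) (y e) (z e) (w e)) (u e)).
Proof. by move=> S; apply: (definable_Forces_schematic (v := args) S DP DL _ Du) => -[|[|[|n]]]. Qed.

Lemma definable_Forces3 (Phi : forall T : Type, T -> T -> T -> form T) : schematic (fun T e => Phi T (e 0) (e 1) (e 2)) ->
  definable (fun e => Forces (P e) (L e) (Phi V (x e) (y e) (z e)) (u e)).
Proof. by move=> S; apply: (definable_Forces_schematic (v := args) S DP DL _ Du) => -[|[|[|n]]]. Qed.
End DefinableForcing.

Ltac definability_schematic ::= match goal with
  | |- definable (fun e => ae ?U (@?Q e)) => change (definable (fun e => ∃ B # U, ∀ x # B, Q e x))
  | |- definable (fun e => Forces (@?P e) (@?L e) (?Phi (univ ?V) (@?x e) (@?y e) (@?z e)) (@?u e)) =>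
    notypeclasses refine (@definable_Forces3 V P L u x y z z _ _ _ _ _ _ _ Phi _); [.. | exact _]
  | |- definable (fun e => Forces (@?P e) (@?L e) (?Phi (univ ?V) (@?x e) (@?y e) (@?z e) (@?w e)) (@?u e)) =>
    notypeclasses refine (@definable_Forces4 V P L u x y z w _ _ _ _ _ _ _ Phi _); [.. | exact _]
  end.

Record generic V (P L : V) : Type := Generic {
  generic_model :> zfc_model;
  embed : V -> generic_model;
  generic_subset : generic_model;
  is_generic :> generic_extension embed P L generic_subset }.
Notation "g ∋ p" := (embed g p # generic_subset g) (at level 70).
Notation "x .[ g ]" := (val (embed g) (generic_subset g) x) (at level 2, left associativity, format "x .[ g ]").

Section Semantics.
Variable V : zfc_model.
Hypothesis V_countable : countable V.
Variables P L : V.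
Hypotheses (PO : preorder P L) (le_dom : forall p q, le L p q -> p # P /\ q # P).
Implicit Types x y z a b c d p q r s : V.
Notation le := (le L).
Notation Forces := (Forces P L).
Notation check := (check P).
Let le_refl := PO.1.
Let le_trans := PO.2.

Lemma ex_generic_extension p : p # P -> exists g : generic P L, g ∋ p.
Proof.
move=> Hp; have [F[GF Fp]] := generic_exists V_countable PO Hp.
have GE : generic_extension (ground PO GF) P L (canonical_generic PO GF).
{ by apply: extension_generic => a b /le_dom[]. }
by exists (Generic GE); exact/ground_generic.
Qed.

Section SchematicForcing.
Variable Phi : scheme.
Hypothesis Phi_schematic : schematic Phi.

Lemma Forces_sound e p (g : generic P L) : g ∋ p -> Forces (Phi e) p -> sat mem (Phi (fun n => (e n).[g])).
Proof.
move=> Hp H; move: Phi_schematic H => [phi E]; rewrite !E => H.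
by apply/(generic_truth g PO); exists p.
Qed.

Lemma Forces_of_extensions e p : p # P -> (forall g : generic P L, g ∋ p -> 
  sat mem (Phi (fun n => (e n).[g]))) -> Forces (Phi e) p.
Proof.
move=> Hp H; move: Phi_schematic (H) => [phi E]; rewrite !E => K.
apply: (forces_complete V_countable PO) => // [a b /le_dom[]|W i G GE Gp] //.
by rewrite -E; exact: (K (Generic GE)).
Qed.

Lemma generic_forced e (g : generic P L) : sat mem (Phi (fun n => (e n).[g])) -> exists p, g ∋ p /\ p # P /\ Forces (Phi e) p.
Proof.
move: Phi_schematic => [phi E]; rewrite !E => /(generic_truth g PO)[p[Hp H]].
by exists p; splits; exact: (generic_sub g Hp).
Qed.

Lemma forced_iff e p : p # P -> Forces (Phi e) p <->  forall g : generic P L, g ∋ p -> sat mem (Phi (fun n => (e n).[g])).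
Proof. by move=> Hp; split=> [H g Gp|]; [exact: Forces_sound H|exact: Forces_of_extensions]. Qed.
End SchematicForcing.

Section AtomicForcing.
Variables x y z p : V.
Hypothesis Hp : p # P.

Lemma forced_mem_iff : Forces (FMem x y) p <-> forall g : generic P L, g ∋ p -> x.[g] # y.[g].
Proof. exact: (@forced_iff (fun T e => FMem (e 0) (e 1)) _ (scons x (fun _ => y)) p Hp). Qed.
Lemma forced_eq_iff : Forces (FEq x y) p <-> forall g : generic P L, g ∋ p -> x.[g] = y.[g].
Proof. exact: (@forced_iff (fun T e => FEq (e 0) (e 1)) _ (scons x (fun _ => y)) p Hp). Qed.

Lemma forced_pair_in_iff : Forces (pair_in z x y) p <->  forall g : generic P L, g ∋ p -> pair x.[g] y.[g] # z.[g].
Proof.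
rewrite (@forced_iff (fun T e => pair_in (e 0) (e 1) (e 2)) _ (scons z (scons x (fun _ => y))) p Hp).
have M (g : generic P L) : sat mem (pair_in z.[g] x.[g] y.[g]) <-> _ := means_pair_in _ _ _.
by split=> H g Gp; apply/M; exact: H Gp.
Qed.
End AtomicForcing.

Lemma val_check (g : generic P L) x : (check x).[g] = embed g x.
Proof.
have GF := set_filter g; have Im := ge_mem g; have It := ge_transitive g.
set i := embed g; pose t := trcl (sing x); pose h := lam t check.
have Fg y c : pair y c # h <-> y # t /\ c = check y.
{ by rewrite in_lam; split=> [[z[Hz /pair_inj[-> ->]]]|[Hy ->]] //; exists y. }
have K w : w # i t -> forall v, pair w v # i h -> evaluate (generic_subset g) v = w.
{ have D := definable_fun1_evaluate (generic_subset g); elim/eps_ind: w => w IH Hw v.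
  move=> /(pair_in_embed Im It)[y[c[Ew[Ev /Fg[Hy Ec]]]]]; subst w v c.
  have {}IH u : u # y -> evaluate (generic_subset g) (i (check u)) = i u.
  { move=> Hu; have Ht := trcl_step Hy Hu; apply: IH; [exact/Im|exact/Im|].
  by apply/(pair_embed_in Im It)/Fg. }
  apply: set_ext => z; rewrite (in_val g (check y)) (in_embed Im It); split.
  - by move=> [d[p[_[/pair_in_check[_[u[Hu ->]]] ->]]]]; exists u; rewrite /val IH.
  - move=> [u[-> Hu]]; have [p Fp] := filter_nonempty GF; exists (check u), p; rewrite /val IH //.
  by splits; apply/pair_in_check; split; [exact: (filter_sub GF)|exists u]. }
have Hx : x # t by apply/in_trcl/in_sing.
by apply: (K (i x)); [exact/Im|apply/(pair_embed_in Im It)/Fg].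
Qed.

Lemma val_generic_name (g : generic P L) : (generic_name P).[g] = generic_subset g.
Proof.
apply: set_ext => w; rewrite (in_val g); split=> [[d[p[Fp[/in_generic_name[q[_ E]] ->]]]]|Hw].
- by move: E => /pair_inj[-> <-]; rewrite (val_check g).
- have [p[-> Gp]] := in_generic g Hw; have Hp := generic_sub g Gp.
  by exists (check p), p; splits; [apply/in_generic_name; exists p|rewrite (val_check g)].
Qed.

Global Instance means_check_name a b : Means (@mem V) (check_name P a b) (b = check a).
Proof.
eapply means_iff; first by rewrite /check_name; exact _.
split=> [[t[T[Ha[h[Fh[Hb H]]]]]]|->].
- have K x : x # t -> app h x = check x.
  { elim/eps_ind: x => x IH Hx; apply: set_ext => z; rewrite (H x Hx _ (pair_app Fh Hx)) in_check.
  split=> [[w [Hw [w' [/(pair_in_fun _ _ Fh)[Hw' ->] [p[Hp ->]]]]]]|[w[p[Hw[Hp ->]]]]].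
  - by exists w, p; rewrite IH.
  - exists w; split=> //; exists (check w); split; last by exists p.
    have Hw' := T x Hx w Hw; rewrite -IH //; exact: (pair_app Fh Hw'). }
  by rewrite -(K a Ha); exact: (eq_sym (app_eq Fh.1 Hb)).
- pose t := trcl (sing a); have Ha : a # t by apply/in_trcl/in_sing.
  have Fh : fun_on (lam t check) t by exact: fun_on_lam.
  have E x y : pair x y # lam t check <-> x # t /\ y = check x.
  { by rewrite (pair_in_fun _ _ Fh); split=> -[Hx ->]; rewrite app_lam. }
  exists t; splits; first exact: trans_trcl.
  exists (lam t check); splits; first exact/E.
  move=> x Hx y /E[_ ->] z; rewrite in_check; split.
  + move=> [w[p[Hw[Hp ->]]]]; exists w; split=> //; exists (check w); split; last by exists p.
  by apply/E; split=> //; exact: (@trans_trcl _ _ x).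
  + by move=> [w[Hw[w'[/E[_ ->][p[Hp ->]]]]]]; exists w, p.
Qed.

(* Mixing: below each condition of P, the first condition (in a well-ordering) carrying a witness
   decides the value of the mixed name. *)
Section Mixing.
Variable witness : V -> V -> Prop.
Hypothesis witness_definable : Definable2 witness.
Variables al g c : V.
Hypotheses (al_ord : ord al) (g_in : ∀ b # al, app g b # P) (g_surj : ∀ r # P, ∃ b # al, app g b = r) (c_fun : fun_on c P).
Definition witnessed b : Prop := b # al /\ exists x, witness x (app g b).
Definition selects b s : Prop := witnessed b /\ le s (app g b) /\ ∀ d # b, witnessed d -> ∀ r # P, le r s -> ~ le r (app g d).
Definition mixed_name : V := sep (prod (trcl c) P) (fun z => exists d s b t,
  z = pair d s /\ selects b s /\ t # P /\ pair d t # app c (app g b) /\ le s t).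

Lemma ex_selects_below r x : r # P -> witness x r -> exists s b, s # P /\ le s r /\ selects b s.
Proof.
move=> Hr Hx; have [b0[Hb0 E]] := g_surj Hr; subst r.
have [|b[_[[Gb[s[Hs[Hsr Hsb]]]] Min]]] := @ord_least V (fun b => witnessed b /\ ∃ s # P, le s (app g b0) /\ le s (app g b)) _.
{ exists b0; split; first exact: ord_in Hb0.
  by split; [split=> //; exists x|exists (app g b0); splits; exact: le_refl]. }
exists s, b; splits; rewrite /selects; splits=> d Hd Gd t Ht Hts K.
by apply: (Min d Hd); split=> //; exists t; splits; exact: le_trans Hsr.
Qed.

Lemma selects_unique b d s t r : r # P -> le r s -> le r t -> selects b s -> selects d t -> b = d.
Proof.
move=> Hr Hrs Hrt [Gb[Hsb Mb]] [Gd[Htd Md]].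
case: (ord_total (ord_in al_ord Gb.1) (ord_in al_ord Gd.1)) => [K|[//|K]].
- by case: (Md b K Gb r Hr Hrt (le_trans Hrs Hsb)).
- by case: (Mb d K Gd r Hr Hrs (le_trans Hrt Htd)).
Qed.

Lemma val_mixed_name (h : generic P L) b s : h ∋ s -> selects b s -> mixed_name.[h] = (app c (app g b)).[h].
Proof.
move=> Gs Db; have GF := set_filter h; have F_sub p := filter_sub GF (p := p).
apply: set_ext => z; rewrite !(in_val h); split.
- move=> [d[t[Gt[/in_sep[_[d'[t'[b'[u[/pair_inj[<- <-][Db'[Hu[Hd Hle]]]]]]]]] ->]]]].
  have [r[Gr[R1 R2]]] := filter_meet GF Gs Gt; have E := selects_unique (F_sub r Gr) R1 R2 Db Db'; subst b'.
  by exists d, u; splits; exact: (filter_up GF Gt Hu Hle).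
- move=> [d[u[Gu[Hd ->]]]]; have [r[Gr[R1 R2]]] := filter_meet GF Gs Gu.
  have [Gb[Hsb Mb]] := Db; exists d, r; splits; apply/in_sep; rewrite pair_prod; splits.
  + have Hc := (pair_in_trcl (pair_app c_fun (g_in Gb.1))).2.
  exact: (pair_in_trans (@trans_trcl _ _) Hc Hd).1.
  + exact: F_sub.
  + exists d, r, b, u; splits; last exact: F_sub.
  rewrite /selects; splits; first exact: (le_trans R1).
  by move=> e He Ge t Ht Htr; apply: (Mb e He Ge t Ht); exact: (le_trans Htr).
Qed.
End Mixing.

Theorem maximal_principle (Phi : scheme) (e : nat -> V) p : schematic Phi -> p # P ->
  (∀ q # P, le q p -> exists r x, r # P /\ le r q /\ Forces (Phi V (scons x e)) r) -> exists x, Forces (Phi V (scons x e)) p.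
Proof.
move=> SPhi Hp H; pose witness x r := Forces (Phi V (scons x e)) r.
have D : Definable2 witness.
{ by apply: (definable_Forces_schematic (v := fun n e' => scons (e' 0) e n) SPhi) => [| |[|n]|]; definability. }
have [c[Fc Hc]] := @ex_partial_choice V P (fun r x => witness x r) _.
have [al[g[Oal[[_[Hg _]] Sg]]]] := well_ordering P.
exists (mixed_name witness al g c); apply: (Forces_of_extensions SPhi) => // h Gp.
have GF := set_filter h.
have [||s[Gs[_[b Db]]]] := @filter_generic_below V P L PO _ GF (fun s => exists b, selects witness al g b s) p.
- exact: Gp.
- move=> q Hq Hqp; have [r[x[Hr[Hrq Hx]]]] := H q Hq Hqp.
  have [s[b[Hs[Hsr Db]]]] := ex_selects_below D Oal Sg Hr (Hx : witness x r).
  by exists s; splits; [exact: le_trans Hrq|exists b].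
- have [[Hb[x Hx]][Hsb _]] := Db; have Hgb := Hg b Hb.
  have Ggb := filter_up GF Gs Hgb Hsb.
  have K := Forces_sound SPhi Ggb (Hc _ Hgb (ex_intro _ x Hx)).
  have E : (fun n => (scons (mixed_name witness al g c) e n).[h]) = fun n => (scons (app c (app g b)) e n).[h].
  { apply: funext => -[|n] //=; exact: (val_mixed_name D Oal Hg Fc Gs Db). }
  by rewrite E.
Qed.

Corollary generic_maximal_principle (Phi : scheme) (e : nat -> V) p : schematic Phi -> p # P -> (forall g : generic P L, g ∋ p ->
  exists w, sat mem (Phi g (scons w (fun n => (e n).[g])))) -> exists x, Forces (Phi V (scons x e)) p.
Proof.
move=> SPhi Hp H; apply: maximal_principle => // q Hq Hqp.
have [g Gq] := ex_generic_extension Hq; have GF := set_filter g.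
have [w Hw] := H g (filter_up GF Gq Hp Hqp); have [x Ex] := val_surj g w; subst w.
have E : scons x.[g] (fun n => (e n).[g]) = fun n => (scons x e n).[g].
{ by apply: funext => -[|n]. }
move: Hw; rewrite E => /(generic_forced SPhi)[s[Gs[Hs K]]].
have [r[Gr[R1 R2]]] := filter_meet GF Gq Gs; have Hr := filter_sub GF Gr.
by exists r, x; splits; exact: (Forces_mono le_trans Hs Hr R2 K).
Qed.
End Semantics.

Lemma definable_fun2_check V : DefinableFun2 (@check V).
Proof.
have [phi E] : schematic (fun T e => check_name (e 1) (e 2) (e 0)) by exact _.
apply: (definable_ext (Q := fun e => sat mem (interp e phi))); last by definability; exact: definable_fun_var.
by move=> e; rewrite -E; split=> /(means_check_name (V := V)).
Qed.
Hint Resolve definable_fun2_check : definable.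

Section StageForcings.
Variable W : zfc_model.
Implicit Types c a k A L D R o p q r u v w x y z Q : W.

Definition partial_order A L : Prop :=
  A <> emp /\ (∀ z # L, ∃ p # A, ∃ q # A, z = pair p q) /\
  (∀ p # A, pair p p # L) /\ (forall p q r, pair p q # L -> pair q r # L -> pair p r # L) /\
  forall p q, pair p q # L -> pair q p # L -> p = q.

Global Instance means_poset A L : Means (@mem W) (poset A L) (partial_order A L).
Proof. rewrite /poset; exact _. Qed.

Definition is_allowed c A L : Prop := ∀ d # c, sat mem (strategically_closed A L d).

Global Instance means_allowed c A L : Means (@mem W) (allowed c A L) (is_allowed c A L).
Proof.
have M d := means_sat (@mem W) (strategically_closed A L d).
rewrite /allowed; exact _.
Qed.

Definition lottery_sum c a D R o : Prop := o = emp /\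
  (exists k, card_succ a k /\ forall z, z # D <-> z = o \/ exists Q A L, Q = pair A L /\ partial_order A L /\
  small (trcl Q) k /\ is_allowed c A L /\ ∃ p # A, z = pair Q p) /\ forall z, z # R <-> ∃ x # D, ∃ y # D, z = pair x y /\
  (y = o \/ exists Q A L, Q = pair A L /\ exists p q, x = pair Q p /\ y = pair Q q /\ pair p q # L).

Global Instance means_stage_lottery c a D R o : Means (@mem W) (stage_lottery c a D R o) (lottery_sum c a D R o).
Proof. rewrite /stage_lottery; exact _. Qed.

Definition trivial_stage D R o : Prop := o = emp /\ (forall z, z # D <-> z = o) /\ forall z, z # R <-> z = pair o o.

Global Instance means_stage_trivial D R o : Means (@mem W) (stage_trivial D R o) (trivial_stage D R o).
Proof. rewrite /stage_trivial; exact _. Qed.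

Record preorder_with_top D R o : Prop := {
  order_refl : ∀ u # D, pair u u # R;
  order_trans : forall u v w, pair u v # R -> pair v w # R -> pair u w # R;
  top_in : o # D;
  order_top : ∀ u # D, pair u o # R;
  order_dom : forall u v, pair u v # R -> u # D /\ v # D }.

Lemma pair_neq_emp x y : pair x y <> emp.
Proof. by move=> E; apply: (@in_emp W (duo x x)); rewrite -E; apply/in_duo; left. Qed.

Section LotterySum.
Variables c a D R o : W.
Hypothesis H : lottery_sum c a D R o.

Lemma in_lottery_order x y : pair x y # R <-> x # D /\ y # D /\
  (y = o \/ exists Q A L, Q = pair A L /\ exists p q, x = pair Q p /\ y = pair Q q /\ pair p q # L).
Proof.
case: H => _ [_ HR]; rewrite HR; split=> [[x'[Hx[y'[Hy[/pair_inj[-> ->] K]]]]] //|[Hx[Hy K]]].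
by exists x; split=> //; exists y.
Qed.

Lemma in_lottery_pair Q p : pair Q p # D -> exists A L, Q = pair A L /\ partial_order A L /\ p # A.
Proof.
case: H => -> [[k[_ HD]] _] /HD[/pair_neq_emp //|[Q'[A[L[EQ[PQ[_[_[p'[Hp /pair_inj[-> ->]]]]]]]]]]].
by exists A, L.
Qed.

Lemma lottery_preorder : preorder_with_top D R o.
Proof.
have [Eo[[k[_ HD]] _]] := H; have Ho : o # D by apply/HD; left.
split=> //.
- move=> u Hu; apply/in_lottery_order; splits.
  case/HD: (Hu) => [->|[Q[A[L[EQ[PQ[_[_[p[Hp ->]]]]]]]]]]; [by left|right].
  by exists Q, A, L; split=> //; exists p, p; splits; exact: PQ.2.2.1.
- move=> u v w /in_lottery_order[Hu[Hv H1]] /in_lottery_order[_[Hw H2]]; apply/in_lottery_order; splits.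
  case: H2 => [|[Q[A[L[EQ[p[q[E1[E2 K]]]]]]]]]; [by left|right].
  case: H1 => [Ev|[Q'[A'[L'[EQ'[p'[q'[E1'[E2' K']]]]]]]]]; first by case: (@pair_neq_emp Q p); rewrite -E1 Ev.
  move: E1; rewrite E2' => /pair_inj[E Eq]; move: EQ; rewrite -E EQ' => /pair_inj[EA EL]; subst A' L' q'.
  exists Q', A, L; split=> //; exists p', q; rewrite {2}E; splits; subst u.
  have [A''[L''[EQ[PQ _]]]] := in_lottery_pair Hu; move: EQ; rewrite EQ' => /pair_inj[EA EL]; subst A'' L''.
  exact: (PQ.2.2.2.1 p' p q K' K).
- by move=> u Hu; apply/in_lottery_order; splits; left.
- by move=> u v /in_lottery_order[Hu[Hv _]].
Qed.
End LotterySum.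

Lemma trivial_stage_preorder D R o : trivial_stage D R o -> preorder_with_top D R o.
Proof.
move=> [_[HD HR]]; split; first by move=> u /HD->; apply/HR.
- by move=> u v w /HR/pair_inj[-> ->] /HR/pair_inj[_ ->]; apply/HR.
- by apply/HD.
- by move=> u /HD->; apply/HR.
- by move=> u v /HR/pair_inj[-> ->]; split; apply/HD.
Qed.
End StageForcings.

Section Strategies.
Variable W : zfc_model.
Implicit Types a b c d e g h k o p q r s t u v w x y z A D E L R S Q : W.
Notation Means := (Means (@mem W)).

Definition second_player d E : Prop := sub E d /\ (∀ a # d, a = emp -> ~ a # E) /\
  (∀ a # d, lim a -> a # E) /\ ∀ a # d, ∀ b # d, b = a.+1 -> (b # E <-> ~ a # E).

Global Instance means_second_player_stages d E : Means (second_player_stages d E) (second_player d E).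
Proof. rewrite /second_player_stages; exact _. Qed.

Lemma ord_cases a : ord a -> a = emp \/ (exists b, a = b.+1) \/ lim a.
Proof.
move=> Oa; case: (classic (a = emp)) => [|N]; [by left|right].
case: (classic (exists b, a = b.+1)) => [|N']; [by left|right]; rewrite /lim; splits=> y Hy; exists y.+1.
split; last exact: memS; by case/inS: (ordS_in Oa Hy) => // E; case: N'; exists y.
Qed.

Lemma succ_not_lim b : ~ lim b.+1.
Proof.
move=> [_ [_ /(_ b (memS b))[z[/inS[Hz|->] K]]]]; [exact: mem_asym K Hz|exact: mem_irrefl K].
Qed.

Lemma second_player_unique d E E' : ord d -> second_player d E -> second_player d E' -> E = E'.
Proof.
move=> Od [S[H0[HL HS]]] [S'[H0'[HL' HS']]].
have K a : a # d -> (a # E <-> a # E').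
{ elim/eps_ind: a => a IH Ha; case: (ord_cases (ord_in Od Ha)) => [E0|[[b Eb]|L]].
  - by split=> J; [case: (H0 a Ha)|case: (H0' a Ha)].
  - have Hb : b # a by rewrite Eb; exact: memS.
  have Hbd := ord_trans Od Hb Ha; by rewrite (HS b Hbd a Ha Eb) (HS' b Hbd a Ha Eb) (IH b Hb Hbd).
  - by split=> _; [exact: HL'|exact: HL]. }
by apply: set_ext => a; split=> Ha; apply/K => //; [exact: S|exact: S'].
Qed.

Lemma ex_second_player d : ord d -> exists E, second_player d E.
Proof.
move=> Od; pose G a h := ite (lim a \/ exists b, a = b.+1 /\ app h b = emp) emp.+1 (emp : W).
have DG : DefinableFun2 G by rewrite /G; definability.
pose second a := rec G a <> emp.
have secondP a : second a <-> lim a \/ exists b, a = b.+1 /\ ~ second b.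
{ rewrite {1}/second (rec_eq DG) {1}/G.
  have E b : a = b.+1 -> (app (lam (trcl a) (rec G)) b = emp <-> ~ second b).
  { move=> Eb; have Hb : b # trcl a by apply: in_trcl; rewrite Eb; exact: memS.
  rewrite (app_lam (definable_fun1_rec DG) Hb).
  by split=> [H|/NNPP //]; apply. }
  case: (classic (lim a \/ exists b, a = b.+1 /\ app (lam (trcl a) (rec G)) b = emp)) => H.
  - rewrite (ite_true _ _ H); split=> _; last exact: succ_neq_emp.
  by case: H => [L|[b [Eb /(E b Eb) H]]]; [left|right; exists b].
  - rewrite (ite_false _ _ H); split=> [//|K]; case: H.
  by case: K => [L|[b [Eb /(E b Eb) H]]]; [left|right; exists b]. }
exists (sep d second); rewrite /second_player; splits.
- by move=> a /in_sep[].
- by move=> a _ -> /in_sep[_ /secondP[[_[]] //|[b[E0 _]]]]; case: (@succ_neq_emp W b).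
- by move=> a Ha L; apply/in_sep; split=> //; apply/secondP; left.
- move=> a Ha b Hb Eb; subst b; rewrite !in_sep (secondP a.+1); split.
  + by move=> [_[/succ_not_lim //|[b[/succ_inj <- N]]]] [].
  + by move=> N; split=> //; right; exists a; split=> // K; apply: N.
Qed.

Definition play (B : W -> Prop) L E S a s : Prop := fun_on s a /\ (∀ b # a, B (app s b)) /\
  (forall b c, b # a -> c # b -> pair (app s b) (app s c) # L) /\ ∀ b # a, b # E -> pair (restr s b) (app s b) # S.

Definition wins (B : W -> Prop) L E S : Prop := is_fun S /\ forall a s, a # E -> play B L E S a s ->
  exists p, B p /\ pair s p # S /\ ∀ b # a, pair p (app s b) # L.

Definition descends A L a s : Prop := fun_on s a /\ (∀ b # a, ∃ p # A, pair b p # s) /\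
  ∀ b # a, ∀ c # b, forall p q, pair b p # s -> pair c q # s -> pair p q # L.

Global Instance means_descending A L a s : Means (descending A L a s) (descends A L a s).
Proof. rewrite /descending; exact _. Qed.

Definition winning {T} (A L E S : T) : form T := (is_function S ∧ ∀a∈E, ∀s, descending A L a s ⇒
  (∀b∈a, b ∈ E ⇒ ∃r, restriction s b r ∧ ∃p, pair_in S r p ∧ pair_in s b p) ⇒
  ∃p∈A, pair_in S s p ∧ ∀b, ∀q, pair_in s b q ⇒ pair_in L p q)%F.

Lemma means_winning A L E S d : ord d -> sub E d -> Means (winning A L E S) (wins (fun p => p # A) L E S).
Proof.
move=> Od SE; eapply means_iff; first by rewrite /winning; exact _.
split=> -[FS H]; split=> // a.
- move=> s Ha [Fs[As[Ds Fo]]]; have Oa := ord_in Od (SE a Ha).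
  have [||p[Hp[Sp Lp]]] := H a Ha s.
  + rewrite /descends; splits.
  * by move=> b Hb; exists (app s b); split; [exact: As|exact: (pair_app Fs)].
  * move=> b Hb c Hc p q /(pair_in_fun _ _ Fs)[_ ->] /(pair_in_fun _ _ Fs)[_ ->]; exact: Ds.
  + move=> b Hb Be; exists (restr s b); split=> //; exists (app s b).
  by split; [exact: Fo|exact: (pair_app Fs)].
  + by exists p; splits=> b Hb; apply: (Lp b); exact: (pair_app Fs).
- move=> Ha s [Fs[As Ds]] Fo; have Oa := ord_in Od (SE a Ha).
  have [|p[Hp[Sp Lp]]] := H a s Ha.
  + rewrite /play; splits.
  * by move=> b /As[p [Hp /(pair_in_fun _ _ Fs)[_ <-]]].
  * by move=> b c Hb Hc; apply: (Ds b Hb c Hc); apply: (pair_app Fs) => //; exact: ord_trans Oa Hc Hb.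
  * by move=> b Hb Be; have [r [-> [p [K /(pair_in_fun _ _ Fs)[_ <-]]]]] := Fo b Hb Be.
  + by exists p; splits=> b q /(pair_in_fun _ _ Fs)[Hb ->]; exact: Lp.
Qed.

Lemma means_strategically_closed A L d : ord d -> Means (strategically_closed A L d)
  (exists E, second_player d E /\ exists S, wins (fun p => p # A) L E S).
Proof.
move=> Od; change (strategically_closed A L d) with (∃E, second_player_stages d E ∧ ∃S, winning A L E S)%F.
split=> [/sat_exists[E /sat_and[/means_second_player_stages HE /sat_exists[S]]]|[E[HE[S HS]]]].
- by move=> /(means_winning A L S Od HE.1) HS; exists E; split=> //; exists S.
- apply/sat_exists; exists E; apply/sat_and; split; first exact/means_second_player_stages.
  by apply/sat_exists; exists S; exact/(means_winning A L S Od HE.1).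
Qed.

Definition cohen_poset k A L : Prop := (forall p, p # A <-> ∃ a # k, fun_on p a /\
  forall x y, pair x y # p -> y = emp \/ exists e, e = emp /\ y = e.+1) /\
  forall z, z # L <-> ∃ p # A, ∃ q # A, z = pair p q /\ sub q p.

Global Instance means_is_Add k A L : Means (is_Add k A L) (cohen_poset k A L).
Proof. rewrite /is_Add; exact _. Qed.

Lemma fun_on_subset_prod s a B d : fun_on s a -> sub a d -> (∀ b # a, app s b # B) -> s # power (prod d B).
Proof.
move=> Fs S H; apply/in_power => z /(in_fun _ Fs)[b[Hb ->]]; apply/pair_prod.
by split; [exact: S|exact: H].
Qed.

Lemma ex_cohen_poset k : ord k -> exists A L, cohen_poset k A L.
Proof.
move=> Ok; pose Q p := ∃ a # k, fun_on p a /\ forall x y, pair x y # p -> y = emp \/ exists e, e = emp /\ y = e.+1.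
pose A := sep (power (prod k (emp.+1.+1))) Q.
exists A, (sep (prod A A) (fun z => ∃ p # A, ∃ q # A, z = pair p q /\ sub q p)); split=> [p|z].
- rewrite in_sep; split=> [[] //|H]; split=> //; have [a[Ha[Fp B]]] := H.
  apply: (fun_on_subset_prod Fp) => [b Hb|b Hb]; first exact: ord_trans Ok Hb Ha.
  by case: (B _ _ (pair_app Fp Hb)) => [->|[e[-> ->]]]; [apply: subS|]; exact: memS.
- rewrite in_sep; split=> [[] //|H]; split=> //.
  by have [p[Hp[q[Hq[-> _]]]]] := H; apply/pair_prod.
Qed.

Section Cohen.
Variables k A L : W.
Hypothesis AL : cohen_poset k A L.

Lemma cohen_order p q : pair p q # L <-> p # A /\ q # A /\ sub q p.
Proof.
rewrite AL.2; split=> [[p'[Hp[q'[Hq[/pair_inj[-> ->] S]]]]] //|[Hp[Hq S]]].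
by exists p; split=> //; exists q.
Qed.

Lemma cohen_partial_order : emp # k -> partial_order A L.
Proof.
move=> H0; rewrite /partial_order; splits.
- have He : emp # A.
  { apply/AL.1; exists emp; splits; last by move=> x y /in_emp.
  split; [split=> [c|a b b'] /in_emp //|move=> a; split=> [/in_emp //|[b /in_emp //]]]. }
  by move=> E; apply: (@in_emp W emp); rewrite -{2}E.
- by move=> z /AL.2[p[Hp[q[Hq[-> _]]]]]; exists p; split=> //; exists q.
- by move=> p Hp; apply/cohen_order; splits=> z.
- move=> p q r /cohen_order[Hp[_ S]] /cohen_order[_[Hr S']]; apply/cohen_order; splits=> z Hz; exact/S/S'.
- by move=> p q /cohen_order[_[_ S]] /cohen_order[_[_ S']]; exact: sub_antisym.
Qed.

Lemma cohen_chain_union a s : reg k -> a # k -> fun_on s a -> (∀ b # a, app s b # A) ->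
  (forall b c, b # a -> c # b -> sub (app s c) (app s b)) -> union (image a (app s)) # A.
Proof.
move=> [[Ok _] Rk] Ha Fs As Ms; have Oa := ord_in Ok Ha.
have in_limit t : t # union (image a (app s)) <-> ∃ b # a, t # app s b.
{ rewrite in_union; split=> [[y[/in_image[b[Hb ->]] Ht]]|[b[Hb Ht]]]; first by exists b.
  by exists (app s b); split=> //; apply/in_image; exists b. }
have [|g[Fg Hg]] := @ex_choice_fun W a (fun b g => g # k /\ fun_on (app s b) g).
{ by move=> b /As/AL.1[g[Hg[F _]]]; exists g. }
have [|be[Hbe Bbe]] := Rk a Ha g Fg; first by move=> x /Hg[].
have in_dom x : x # union (image a (app g)) <-> ∃ b # a, x # app g b.
{ rewrite in_union; split=> [[y[/in_image[b[Hb ->]] Hx]]|[b[Hb Hx]]]; first by exists b.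
  by exists (app g b); split=> //; apply/in_image; exists b. }
have compatible x y y' b b' : b # a -> b' # a -> pair x y # app s b -> pair x y' # app s b' -> y = y'.
{ move=> Hb Hb' H H'; case: (ord_total (ord_in Oa Hb) (ord_in Oa Hb')) => [K|[K|K]].
  - exact: ((Hg b' Hb').2.1.2 _ _ _ (Ms b' b Hb' K _ H) H').
  - by subst b'; exact: ((Hg b Hb).2.1.2 _ _ _ H H').
  - exact: ((Hg b Hb).2.1.2 _ _ _ H (Ms b b' Hb K _ H')). }
apply/AL.1; exists (union (image a (app g))); splits.
- apply: (ord_sub_in _ Ok Hbe) => [|x /in_dom[b[Hb Hx]]].
  + by apply: ord_union => y /in_image[b[Hb ->]]; exact: (ord_in Ok (Hg b Hb).1).
  + exact: (ord_trans (ord_in Ok Hbe) Hx (Bbe b Hb)).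
- split; first split.
  + by move=> t /in_limit[b[Hb Ht]]; exact: ((Hg b Hb).2.1.1 t Ht).
  + by move=> x y y' /in_limit[b[Hb H]] /in_limit[b'[Hb' H']]; exact: compatible H H'.
  + move=> x; rewrite in_dom; split=> [[b[Hb Hx]]|[y /in_limit[b[Hb Hy]]]].
  * by have [y Hy] := ((Hg b Hb).2.2 x).1 Hx; exists y; apply/in_limit; exists b.
  * by exists b; split=> //; apply/(Hg b Hb).2.2; exists y.
- by move=> x y /in_limit[b[Hb Hy]]; have [c[_[_ K]]] := (AL.1 _).1 (As b Hb); exact: K Hy.
Qed.

Lemma cohen_allowed : reg k -> is_allowed k A L.
Proof.
move=> Rk d Hd; have Ok := Rk.1.1; apply/(means_strategically_closed A L (ord_in Ok Hd)).
have [E HE] := ex_second_player (ord_in Ok Hd); exists E; split=> //.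
pose limit_move z := exists a s, fun_on s a /\ z = pair s (union (image a (app s))).
have D : Definable1 limit_move by rewrite /limit_move; definability.
have in_S s p a : fun_on s a -> pair s p # sep (prod (power (prod d A)) A) limit_move <->
  pair s p # prod (power (prod d A)) A /\ p = union (image a (app s)).
{ move=> Fs; rewrite in_sep; split=> [[H[a'[s'[Fs' /pair_inj[E1 E2]]]]]|[H E1]]; split=> //; last by exists a, s; rewrite E1.
  by subst s'; rewrite E2 (dom_unique Fs' Fs). }
exists (sep (prod (power (prod d A)) A) limit_move); split.
- split=> [z /in_sep[_[a[s[_ ->]]]]|s p p' H H']; first by exists s, (union (image a (app s))).
  have [_[a[s'[Fs /pair_inj[E1 _]]]]] := (in_sep _ _ D).1 H; subst s'.
  by rewrite ((in_S _ _ _ Fs).1 H).2 ((in_S _ _ _ Fs).1 H').2.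
- move=> a s Ha [Fs[As[Ds _]]]; have Had := HE.1 a Ha.
  have U : union (image a (app s)) # A.
  { apply: (cohen_chain_union Rk (ord_trans Ok Had Hd) Fs As) => b c Hb Hc.
  by case/cohen_order: (Ds b c Hb Hc) => _ []. }
  exists (union (image a (app s))); splits.
  + apply/(in_S _ _ _ Fs); split=> //; apply/pair_prod; split=> //.
  by apply: (fun_on_subset_prod Fs _ As) => b Hb; exact: ord_trans (ord_in Ok Hd) Hb Had.
  + move=> b Hb; apply/cohen_order; splits; first exact: As.
  move=> t Ht; apply/in_union; exists (app s b); split=> //; apply/in_image; by exists b.
Qed.
End Cohen.

Section SimulatedPlay.
Variables A L d E S : W.
Hypotheses (AL : partial_order A L) (Od : ord d) (HE : second_player d E) (HS : wins (fun p => p # A) L E S).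
Notation play := (play (fun p => p # A) L E S).
Let L_refl := AL.2.2.1.
Let L_trans p q r : pair p q # L -> pair q r # L -> pair p r # L := AL.2.2.2.1 p q r.

Lemma ex_play_below p h : p # A -> h # d -> exists u, play h.+1 u /\ pair (app u h) p # L.
Proof.
move=> Hp Hh; have Oh := ord_in Od Hh.
have sub_d x : x # h.+1 -> x # d by move=> /inS[Hx|->] //; exact: ord_trans Od Hx Hh.
pose R s a := (exists x, fun_on s x /\ (x # E -> pair s a # S) /\ ∀ b # x, pair a (app s b) # L) /\ pair a p # L.
have R_restr x s b : ord x -> fun_on s x -> b # x -> R (restr s b) (app s b) ->
  (b # E -> pair (restr s b) (app s b) # S) /\ ∀ c # b, pair (app s b) (app s c) # L.
{ move=> Ox Fs Hb [[b'[Fb'[H1 H2]]] _]; have Sb := ord_subS Ox (subS Hb).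
  have E1 := dom_unique Fb' (fun_on_restr Fs Sb); subst b'.
  by split=> // c Hc; have := H2 c Hc; rewrite (app_restr Fs Sb Hc). }
have R_play x s : ord x -> fun_on s x -> (∀ b # x, app s b # A /\ R (restr s b) (app s b)) -> play x s.
{ move=> Ox Fs H; split; [done|splits].
  - by move=> b /H[].
  - by move=> b c Hb Hc; apply: (R_restr x s b Ox Fs Hb (H b Hb).2).2.
  - by move=> b Hb; exact: (R_restr x s b Ox Fs Hb (H b Hb).2).1. }
have [x s Hx Fs H|u[Fu Hu]] := @transfinite_choice W A R h.+1 (ordS Oh) _.
- have Ox := ord_in (ordS Oh) Hx; case: (classic (x # E)) => [J|J].
  + have [a[Ha[Sa La]]] := HS.2 x s J (R_play x s Ox Fs H).
  have H0 : emp # x.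
  { case: (ord_total (ord_emp W) Ox) => [//|[E0|/in_emp //]].
    by case: (HE.2.1 x (sub_d x Hx)). }
  exists a; splits; split; last exact: (L_trans (La _ H0) (H _ H0).2.2).
  by exists x.
  + case: (ord_cases Ox) => [E0|[[b Eb]|Lx]]; last by case: J; apply: HE.2.2.1 => //; exact: sub_d.
  * exists p; splits; split; last exact: L_refl.
    by exists x; splits=> b; rewrite E0 => /in_emp.
  * have Hb : b # x by rewrite Eb; exact: memS.
    have [Ab Rb] := H b Hb; exists (app s b); splits; split; last exact: Rb.2.
    exists x; splits=> c; rewrite Eb => /inS[Hc|->]; last exact: L_refl.
    exact: (R_restr x s b Ox Fs Hb Rb).2.
- exists u; split; first exact: (R_play _ _ (ordS Oh)).
  exact: (Hu h (memS h)).2.2.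
Qed.

Lemma continued_play h a u t : play h.+1 u -> ~ h # E -> a # d -> h # a -> fun_on t a ->
  (∀ b # h.+1, app t b = app u b) -> (∀ b # a, h # b -> app t b # A) ->
  (forall b c, b # a -> c # b -> h # c -> pair (app t b) (app t c) # L) ->
  (∀ b # a, h # b -> b # E -> pair (restr t b) (app t b) # S) -> play a t.
Proof.
move=> [Fu[Au[Du Su]]] Nh Ha Hh Ft Etu At Dt St; have Oa := ord_in Od Ha; have Oh := ord_in Oa Hh.
have cases b : b # a -> b # h.+1 \/ h # b.
{ move=> Hb; case: (ord_total (ord_in Oa Hb) Oh) => [K|[->|K]]; [left; exact: subS|left; exact: memS|by right]. }
have Sh b : b # h.+1 -> sub b h.+1 := fun Hb => ord_subS (ordS Oh) (subS Hb).
have restr_tu b : b # a -> b # h.+1.+1 -> restr t b = restr u b.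
{ move=> Hb Hbh; have Sa := ord_subS Oa (subS Hb); have Su' := ord_subS (ordS Oh) Hbh.
  apply: (fun_on_ext (fun_on_restr Ft Sa) (fun_on_restr Fu Su')) => x Hx.
  by rewrite (app_restr Ft Sa Hx) (app_restr Fu Su' Hx) Etu //; exact: Su'. }
have Du' b c : b # a -> h # b -> c # h.+1 -> pair (app t b) (app u c) # L.
{ move=> Hb Hhb Hc; have Hsb : h.+1 # b.+1 := ordS_in (ord_in Oa Hb) Hhb.
  have Hsa : h.+1 # a by case/inS: Hsb => [K|-> //]; exact: ord_trans Oa K Hb.
  have HsE : h.+1 # E.
  { exact: ((HE.2.2.2 h (ord_trans Od Hh Ha) _ (ord_trans Od Hsa Ha) eq_refl).2 Nh). }
  have [q[_[Sq Lq]]] := HS.2 h.+1 u HsE (conj Fu (conj Au (conj Du Su))).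
  have Eq : app t h.+1 = q.
  { have := St _ Hsa (memS h) HsE; rewrite (restr_tu _ Hsa (memS _)) (restr_dom Fu) => K.
  exact: (HS.1.2 _ _ _ K Sq). }
  rewrite -Eq in Lq; case/inS: Hsb => [K|<-]; last exact: Lq.
  exact: (L_trans (Dt b _ Hb K (memS h)) (Lq c Hc)). }
split; [done|splits].
- by move=> b Hb; case: (cases b Hb) => K; [rewrite Etu //; exact: Au|exact: At].
- move=> b c Hb Hc; have Hca := ord_trans Oa Hc Hb; case: (cases b Hb) => K.
  + by rewrite (Etu b K) (Etu c (Sh b K c Hc)); exact: Du.
  + case: (cases c Hca) => K'; last exact: Dt.
  rewrite (Etu c) //; exact: Du'.
- move=> b Hb Be; case: (cases b Hb) => K; last exact: St.
  by rewrite (restr_tu b Hb (subS K)) Etu //; exact: Su.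
Qed.
End SimulatedPlay.

Definition passes E S q : Prop := forall a s, a # E -> fun_on s a -> (∀ b # a, app s b = q) -> pair s q # S.
Definition wins_below q S R E : Prop := wins (fun u => pair u q # R) R E S /\ passes E S q.

Definition prepared E A L p h v : Prop := wins (fun p => p # A) L E (pr1 v) /\
  play (fun p => p # A) L E (pr1 v) h.+1 (pr2 v) /\ pair (app (pr2 v) h) p # L.

Section LotteryGame.
Variables c a D R o d E : W.
Hypotheses (LS : lottery_sum c a D R o) (Od : ord d) (HE : second_player d E).
Let PT := lottery_preorder LS.
Let Eo : o = emp := LS.1.

Lemma pair_neq_top x y : pair x y <> o.
Proof. rewrite Eo; exact: pair_neq_emp. Qed.

Lemma lottery_cases u : u # D -> u = o \/ exists A L p, u = pair (pair A L) p /\ partial_order A L /\ p # A /\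
  is_allowed c A L /\ ∀ q # A, pair (pair A L) q # D.
Proof.
case: LS => _ [[k[_ HD]] _] /HD[|[Q[A[L[->[AL[Sm[Al[p[Hp ->]]]]]]]]]]; [by left|right].
exists A, L, p; splits=> q Hq; apply/HD; right; exists (pair A L), A, L; splits.
by exists q.
Qed.

Lemma lottery_pair_order x A L q : pair x (pair (pair A L) q) # R -> exists p, x = pair (pair A L) p /\ p # A /\ pair p q # L.
Proof.
move=> /(in_lottery_order LS)[Hx[_[/pair_neq_top //|[Q[A'[L'[EQ[p[q'[Ex[/pair_inj[EQ' <-] K]]]]]]]]]]].
subst x Q; move: EQ' => /pair_inj[EA EL]; subst A' L'; exists p; splits.
by have [A1[L1[/pair_inj[EA _][_ Hp]]]] := in_lottery_pair LS Hx; rewrite EA.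
Qed.

Lemma lottery_pair_le A L p q : pair (pair A L) p # D -> pair (pair A L) q # D -> pair p q # L ->
  pair (pair (pair A L) p) (pair (pair A L) q) # R.
Proof.
move=> Hp Hq K; apply/(in_lottery_order LS); splits; right; exists (pair A L), A, L; split=> //.
by exists p, q.
Qed.

(* When the first player chooses the condition p of the poset (A, L) at stage h, the second player pretends that
   the moves before were those of the play u with u(h) <= p in (A, L), and continues with a strategy S for
   (A, L); [w] provides S and u. *)
Variable w : W.
Hypothesis w_spec : forall h A L p, h # d -> pair (pair A L) p # D -> prepared E A L p h (app w (pair (pair (pair A L) p) h)).
Definition pretended b s h : W := lam b (fun x => ite (x # h.+1) (app (pr2 (app w (pair (app s h) h))) x) (pr2 (app s x))).
Definition answers s y : Prop := exists b, fun_on s b /\ ((∀ x # b, app s x = o) /\ y = o \/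
  exists h Q p q, h # b /\ (∀ x # h, app s x = o) /\ app s h = pair Q p /\ y = pair Q q /\
  pair (pretended b s h) q # pr1 (app w (pair (app s h) h))).
Definition lottery_strategy : W := sep (prod (power (prod d D)) D) (fun z => exists s y, z = pair s y /\ answers s y).

Lemma in_lottery_strategy s y : pair s y # lottery_strategy <-> s # power (prod d D) /\ y # D /\ answers s y.
Proof.
rewrite in_sep pair_prod; split=> [[[Hs Hy][s'[y'[/pair_inj[E1 E2] H]]]]|[Hs[Hy H]]].
- by subst s' y'.
- by split=> //; exists s, y.
Qed.

Lemma first_choice_unique s h h' Q Q' p p' : ord h -> ord h' -> (∀ x # h, app s x = o) -> app s h = pair Q p ->
  (∀ x # h', app s x = o) -> app s h' = pair Q' p' -> h = h'.
Proof.
move=> Oh Oh' H E1 H' E1'; case: (ord_total Oh Oh') => [K|[//|K]].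
- by case: (@pair_neq_top Q p); rewrite -E1 H'.
- by case: (@pair_neq_top Q' p'); rewrite -E1' H.
Qed.

Lemma lottery_strategy_fun : is_fun lottery_strategy.
Proof.
split=> [z /in_sep[_[s[y[-> _]]]]|s y y' /in_lottery_strategy[Hs[_[b[Fs H]]]] /in_lottery_strategy[_[_[b'[Fs' H']]]]].
{ by exists s, y. }
rewrite (dom_unique Fs' Fs) in H' => {Fs' b'}.
have in_D x : x # b -> x # d /\ app s x # D.
{ by move=> Hx; apply/pair_prod; apply: ((in_power _ _).1 Hs); exact: pair_app Fs Hx. }
case: H => [[Ho ->]|[h[Q[p[q[Hh[Ho[Es[-> K]]]]]]]]]; case: H' => [[Ho' ->] //|[h'[Q'[p'[q'[Hh'[Ho'[Es'[-> K']]]]]]]]].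
- by case: (@pair_neq_top Q' p'); rewrite -Es' Ho.
- by case: (@pair_neq_top Q p); rewrite -Es Ho'.
- have [[Hd HD][Hd' _]] := (in_D h Hh, in_D h' Hh').
  have E1 := first_choice_unique (ord_in Od Hd) (ord_in Od Hd') Ho Es Ho' Es'; subst h'.
  move: Es'; rewrite Es => /pair_inj[<- _]; congr pair.
  move: HD K K'; rewrite Es => HD; have [A[L[EQ _]]] := in_lottery_pair LS HD; subst Q.
  exact: (w_spec Hd HD).1.1.2.
Qed.

Lemma answer_in_strategy b s y : b # d -> fun_on s b -> (∀ x # b, app s x # D) -> y # D -> answers s y ->
  pair s y # lottery_strategy.
Proof.
move=> Hb Fs Ds Hy H; apply/in_lottery_strategy; splits.
apply: (fun_on_subset_prod Fs _ Ds); exact: ord_subS Od (subS Hb).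
Qed.

Lemma lottery_strategy_passes : passes E lottery_strategy o.
Proof.
move=> b s Hb Fs Ho; have HoD := top_in PT; apply: (answer_in_strategy (HE.1 b Hb) Fs _ HoD).
- by move=> x Hx; rewrite Ho.
- by exists b; split=> //; left.
Qed.

Section FirstChoice.
Variables b s h A L p : W.
Hypotheses (Hb : b # E) (Ps : play (fun u => pair u o # R) R E lottery_strategy b s) (Hh : h # b)
  (Ho : ∀ x # h, app s x = o) (Eh : app s h = pair (pair A L) p).
Let Hbd : b # d := HE.1 b Hb.
Let Ob : ord b := ord_in Od Hbd.
Let Oh : ord h := ord_in Ob Hh.
Let Sb x (Hx : x # b) : sub x b := ord_subS Ob (subS Hx).
Let Hhd : h # d := ord_trans Od Hh Hbd.
Let Fs : fun_on s b := Ps.1.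
Let Ds x (Hx : x # b) : app s x # D := (order_dom PT (Ps.2.1 x Hx)).1.
Let Rs x y : x # b -> y # x -> pair (app s x) (app s y) # R := Ps.2.2.1 x y.
Let Ss x (Hx : x # b) (Ex : x # E) : answers (restr s x) (app s x) :=
  ((in_lottery_strategy _ _).1 (Ps.2.2.2 x Hx Ex)).2.2.
Notation S := (pr1 (app w (pair (app s h) h))).
Notation u := (pr2 (app w (pair (app s h) h))).
Notation t := (pretended b s h).
Let app_r x y (Hx : x # b) : y # x -> app (restr s x) y = app s y := app_restr Fs (Sb Hx) (a := y).

Lemma first_choice_poset : partial_order A L /\ p # A /\ ∀ q # A, pair (pair A L) q # D.
Proof.
have := Ds Hh; rewrite Eh => /lottery_cases[/pair_neq_top //|[A'[L'[p'[/pair_inj[/pair_inj[-> ->] ->][? [? []]]]]]]].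
by splits.
Qed.

Lemma first_choice_not_second : ~ h # E.
Proof.
move=> /(Ss Hh)[x[Fx[[_]|[h'[Q[p'[q[Hh'[_[Es _]]]]]]]]]]; first by rewrite Eh => /pair_neq_top.
rewrite (dom_unique Fx (fun_on_restr Fs (Sb Hh))) in Hh'.
by move: Es; rewrite (app_r Hh Hh') (Ho Hh') => /(@eq_sym _ _ _)/pair_neq_top.
Qed.

Lemma later_choice x : x # b -> h # x -> app s x = pair (pair A L) (pr2 (app s x)) /\ pr2 (app s x) # A.
Proof. by move=> Hx Hhx; have := Rs Hx Hhx; rewrite Eh => /lottery_pair_order[q[->[Hq _]]]; rewrite pr2_pair. Qed.
Lemma pretended_fun_on : fun_on t b.
Proof. by apply: fun_on_lam; definability. Qed.

Lemma pretended_before x : x # h.+1 -> app t x = app u x.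
Proof.
move=> Hx; have Hxb : x # b by case/inS: Hx => [/(Sb Hh)|->].
by rewrite /pretended app_lam // ite_true.
Qed.

Lemma pretended_after x : x # b -> h # x -> app t x = pr2 (app s x).
Proof.
move=> Hx Hhx; rewrite /pretended app_lam // ite_false // => /inS[K|K]; [exact: mem_asym K Hhx|rewrite K in Hhx; exact: mem_irrefl Hhx].
Qed.

Lemma pretended_restr x : x # b -> h # x -> restr t x = pretended x (restr s x) h.
Proof.
move=> Hx Hhx; have Fr := fun_on_restr pretended_fun_on (Sb Hx).
apply: (fun_on_ext Fr) => [|y Hy]; first by apply: fun_on_lam; definability.
rewrite (app_restr pretended_fun_on (Sb Hx) Hy) /pretended !app_lam ?(app_r Hx) //.
exact: Sb Hx y Hy.
Qed.

Lemma pretended_play : play (fun p => p # A) L E S b t.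
Proof.
have [AL[Hp in_D]] := first_choice_poset; have := w_spec Hhd (in_D p Hp); rewrite -Eh => -[HS[Pu _]].
apply: (continued_play AL Od HE HS Pu first_choice_not_second Hbd Hh pretended_fun_on pretended_before).
- by move=> x Hx Hhx; rewrite pretended_after //; case: (later_choice Hx Hhx).
- move=> x y Hx Hy Hhy; have Hhx := ord_trans (ord_in Ob Hx) Hhy Hy; have Hyb := Sb Hx Hy.
  have := Rs Hx Hy; rewrite (later_choice Hyb Hhy).1 => /lottery_pair_order[q[Eq[_ K]]].
  by rewrite !pretended_after // Eq pr2_pair.
- move=> x Hx Hhx Ex; have [x'[Fx' K]] := Ss Hx Ex.
  rewrite (dom_unique Fx' (fun_on_restr Fs (Sb Hx))) in K.
  case: K => [[/(_ h Hhx)]|[h'[Q[p'[q[Hh'[Ho'[Es'[Ex' K]]]]]]]]]; first by rewrite app_r // Eh => /pair_neq_top.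
  have Eh' : h' = h.
  { apply: (first_choice_unique (s := restr s x) (ord_in (ord_in Ob Hx) Hh') Oh Ho' Es' (Q' := pair A L) (p' := p)).
  - by move=> y Hy; rewrite app_r ?Ho //; exact: ord_trans (ord_in Ob Hx) Hy Hhx.
  - by rewrite app_r. }
  by subst h'; rewrite app_r // in K; rewrite pretended_after // pretended_restr // Ex' pr2_pair.
Qed.

Lemma first_choice_answer : exists y, pair y o # R /\ pair s y # lottery_strategy /\ ∀ x # b, pair y (app s x) # R.
Proof.
have [AL[Hp in_D]] := first_choice_poset; have := w_spec Hhd (in_D p Hp); rewrite -Eh => -[HS[_ Up]].
have [q[Hq[Sq Lq]]] := HS.2 b t Hb pretended_play; have HqD := in_D q Hq.
exists (pair (pair A L) q); splits; first exact: (order_top PT HqD).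
- apply: (answer_in_strategy Hbd Fs (fun x Hx => Ds Hx) HqD); exists b; split=> //; right.
  by exists h, (pair A L), p, q.
- move=> x Hx; case: (ord_total (ord_in Ob Hx) Oh) => [K|[K|K]].
  + by rewrite Ho //; exact: (order_top PT HqD).
  + subst x; rewrite Eh; apply: (lottery_pair_le HqD (in_D p Hp)).
  apply: (AL.2.2.2.1 _ _ _ _ Up).
  rewrite -pretended_before; [exact: memS|exact: Lq].
  + have [Ex Ax] := later_choice Hx K; rewrite Ex; apply: (lottery_pair_le HqD (in_D _ Ax)).
  by rewrite -(pretended_after Hx K); exact: Lq.
Qed.
End FirstChoice.

Lemma lottery_strategy_answer b s : b # E -> play (fun u => pair u o # R) R E lottery_strategy b s ->
  exists p, pair p o # R /\ pair s p # lottery_strategy /\ ∀ x # b, pair p (app s x) # R.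
Proof.
move=> Hb Ps; have Ob := ord_in Od (HE.1 b Hb).
case: (classic (∀ x # b, app s x = o)) => [Ho|N].
{ exists o; splits; [exact: (order_refl PT (top_in PT))|exact: (lottery_strategy_passes Hb Ps.1 Ho)|].
  by move=> x /Ho->; exact: (order_refl PT (top_in PT)). }
have [|h[Oh[[Hh Nh] Min]]] := @ord_least W (fun h => h # b /\ app s h <> o) _.
{ by apply: NNPP => N'; apply: N => x Hx; apply: NNPP => Nx; apply: N'; exists x; split; first exact: ord_in Ob Hx. }
have [//|[A[L[p[Eh _]]]]] := lottery_cases (order_dom PT (Ps.2.1 h Hh)).1.
apply: (first_choice_answer Hb Ps Hh _ Eh) => x Hx; apply: NNPP => Nx; apply: (Min x Hx); split=> //.
exact: ord_trans Ob Hx Hh.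
Qed.
End LotteryGame.

Theorem ex_lottery_strategy c a D R o d E : lottery_sum c a D R o -> ord d -> d # c -> second_player d E ->
  exists S, wins_below o S R E.
Proof.
move=> LS Od Hd HE; pose provides z v := forall h A L p, z = pair (pair (pair A L) p) h -> prepared E A L p h v.
have DP : Definable2 provides by rewrite /provides /prepared /wins /play; definability.
have [|w[_ Hw]] := @ex_choice_fun W (prod D d) provides DP.
- move=> z /in_prod[x [h [/(lottery_cases LS)[->|[A[L[p[->[AL[Hp[Al _]]]]]]]] [Hh ->]]]].
  { by exists emp => h' A L p /pair_inj[/(@eq_sym _ _ _) E0 _]; case: (pair_neq_top LS E0). }
  have /(means_strategically_closed A L Od)[E'[HE'[S HS]]] := Al d Hd.
  rewrite (second_player_unique Od HE' HE) in HS; have [u Hu] := ex_play_below AL Od HE HS Hp Hh.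
  by exists (pair S u) => h' A' L' p' /pair_inj[/pair_inj[/pair_inj[<- <-] <-] <-]; rewrite /prepared pr1_pair pr2_pair.
- have w_spec h A L p (Hh : h # d) (Hp : pair (pair A L) p # D) : prepared E A L p h (app w (pair (pair (pair A L) p) h)).
  { by apply: Hw => //; apply/pair_prod. }
  exists (lottery_strategy D o d w); split; last exact: (lottery_strategy_passes LS Od HE w).
  split; first exact: (lottery_strategy_fun LS Od w_spec).
  by move=> b s; exact: (lottery_strategy_answer LS Od HE w_spec).
Qed.

Lemma ex_atom_strategy R q d E : ord d -> second_player d E -> pair q q # R -> (forall u, pair u q # R -> u = q) ->
  exists S, wins_below q S R E.
Proof.
move=> Od HE Hq atom; have FL : fun_on _ _ := fun_on_lam (power (prod d (sing q))) (definable_fun_const q).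
have P : passes E (lam (power (prod d (sing q))) (fun _ => q)) q.
{ move=> a s Ha Fs H; apply/(pair_in_fun _ _ FL); have Hs : s # power (prod d (sing q)).
  { apply: (fun_on_subset_prod Fs) => b Hb; last exact/in_sing/H.
  exact: ord_trans Od Hb (HE.1 a Ha). }
  by rewrite app_lam. }
exists (lam (power (prod d (sing q))) (fun _ => q)); split=> [|//]; split=> [|a s Ha[Fs[Ds _]]]; first exact: FL.1.
exists q; splits; first by apply: (P a s Ha Fs) => b /Ds/atom.
by move=> b /Ds/atom->.
Qed.

Lemma embeds_cup_sing t a u z : ~ z # a -> embeds t a -> embeds (cup t (sing u)) (cup a (sing z)).
Proof.
move=> Nz [i[Fi[Ri Ii]]]; apply: (@inj_lam W _ _ (fun x => ite (x # t) (app i x) z)).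
- move=> x Hx; apply/in_cup; case: (classic (x # t)) => K; first by left; rewrite ite_true //; exact: Ri.
  by right; rewrite ite_false //; apply/in_sing.
- have cases x : x # cup t (sing u) -> x # t \/ x = u by move=> /in_cup[|/in_sing]; [left|right].
  move=> x y /cases Hx /cases Hy; case: (classic (x # t)) => K; case: (classic (y # t)) => K'.
  + by rewrite !ite_true //; exact: Ii.
  + by rewrite ite_true // ite_false // => E1; case: Nz; rewrite -E1; exact: Ri.
  + by rewrite ite_false // ite_true // => E1; case: Nz; rewrite E1; exact: Ri.
  + by case: Hx => // ->; case: Hy.
Qed.

(* The transitive closure of the one-point order embeds into the chain given by p, {p}, (p, p), L, {A, L}, (A, L). *)
Lemma embeds_atom A L p : partial_order A L -> p # A ->
  embeds (trcl (pair (sing emp) (sing (pair emp emp)))) (trcl (pair A L)).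
Proof.
move=> AL Hp; pose A1 : W := sing emp; pose e1 : W := pair emp emp; pose L1 := sing e1; have E1 : duo A1 A1 = e1 by [].
pose T := cup (cup (cup (cup (cup emp (sing emp)) (sing A1)) (sing e1)) (sing L1)) (sing (duo A1 L1)).
have in_T y : y # T <-> y = emp \/ y = A1 \/ y = e1 \/ y = L1 \/ y = duo A1 L1.
{ by rewrite /T !in_cup !in_sing; split=> [[[[[[/in_emp //|]|]|]|]|]|]; tauto. }
have T_small : embeds T (trcl (pair A L)).
{ have step S x y : sub S (trcl x) -> x # y -> sub (cup S (sing x)) (trcl y).
  { by move=> H K v Hv; apply/trcl_cases; exists x; split=> //; case/in_cup: Hv => [/H|/in_sing]; [right|left]. }
  have new S x : sub S (trcl x) -> ~ x # S by move=> H /H/not_in_trcl.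
  have B0 : sub emp (trcl p) by move=> v /in_emp.
  have B1 := step _ _ (duo p p) B0 ((in_duo _ _ _).2 (or_introl eq_refl)).
  have B2 := step _ _ (pair p p) B1 ((in_duo _ _ _).2 (or_introl eq_refl)).
  have B3 := step _ _ L B2 (AL.2.2.1 p Hp).
  have B4 := step _ _ (duo A L) B3 ((in_duo _ _ _).2 (or_intror eq_refl)).
  have B5 := step _ _ _ B4 (duo_in_pair A L).
  apply: embeds_trans (embeds_sub B5); do 5 (apply: embeds_cup_sing; first by apply: new).
  exact: embeds_refl. }
apply: embeds_trans T_small; apply: embeds_sub; apply: trcl_min.
- move=> y /in_T[->|[->|[->|[->|->]]]] v; first by move=> /in_emp.
  + by move=> /in_sing->; apply/in_T; left.
  + by rewrite -E1 => /in_duo[|] ->; apply/in_T; right; left.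
  + by move=> /in_sing->; apply/in_T; tauto.
  + by move=> /in_duo[|] ->; apply/in_T; tauto.
- by move=> y /in_duo[->|->]; apply/in_T; [right; right; left|tauto].
Qed.

Lemma ex_lottery_atom c a D R o : ord c -> lottery_sum c a D R o ->
  exists q, pair q q # R /\ forall u, pair u q # R -> u = q.
Proof.
move=> Oc LS; have PT := lottery_preorder LS; have [Eo[[k[_ HD]] _]] := LS.
case: (classic (∀ z # D, z = o)) => [Do|N].
{ exists o; split; first exact: (order_refl PT (top_in PT)).
  by move=> u /(order_dom PT)[/Do]. }
have [z[Hz Nz]] : ∃ z # D, z <> o by apply: NNPP => N'; apply: N => z Hz; apply: NNPP => Nz; apply: N'; exists z.
case/HD: Hz => [//|[Q[A[L[EQ[AL[[m[Hm Em]][_[p[Hp _]]]]]]]]]]; subst Q.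
pose A1 : W := sing emp; pose L1 : W := sing (pair emp emp).
have in_L1 x y : pair x y # L1 <-> x = emp /\ y = emp by rewrite in_sing; split=> [/pair_inj //|[-> ->]].
have Al : is_allowed c A1 L1.
{ move=> d Hd; have [E HE] := ex_second_player (ord_in Oc Hd); apply/(means_strategically_closed A1 L1 (ord_in Oc Hd)).
  have [||S[[FS HS] _]] := ex_atom_strategy (R := L1) (q := emp) (ord_in Oc Hd) HE; first exact/in_L1.
  - by move=> u /in_L1[].
  - exists E; split=> //; exists S; split=> // b s Hb [Fs[Ds[Rs Ss]]]; have [|r[Lr K]] := HS b s Hb.
  + by rewrite /play; splits=> x /Ds/in_sing->; apply/in_L1.
  + by exists r; split=> //; apply/in_sing; case/in_L1: Lr. }
have HQ1 : pair (pair A1 L1) emp # D.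
{ apply/HD; right; exists (pair A1 L1), A1, L1; splits; last by exists emp; split=> //; apply/in_sing.
  - rewrite /partial_order; splits.
  + by move=> K; apply: (@in_emp W emp); rewrite -{2}K; apply/in_sing.
  + by move=> y /in_sing ->; exists emp; split; [apply/in_sing|exists emp; split=> //; apply/in_sing].
  + by move=> y /in_sing ->; apply/in_L1.
  + by move=> x y v /in_L1[-> _] /in_L1[_ ->]; apply/in_L1.
  + by move=> x y /in_L1[-> ->].
  - by exists m; split=> //; exact: embeds_trans (embeds_atom AL Hp) Em. }
exists (pair (pair A1 L1) emp); split=> [|u /(lottery_pair_order LS)[q[->[_ /in_L1[-> _]]]] //].
exact: (order_refl PT HQ1).
Qed.

Definition code {T} (e u a : T) : form T :=
  ((∀ z ∈ e, ∃ x ∈ a, ∃ y ∈ a, is_pair x y z) ∧ ∃ g, function_on g a ∧ (∀ x ∈ a, ∀ y, pair_in g x y ⇒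
  ∀ z, z ∈ y ⇔ ∃ v ∈ a, pair_in e v x ∧ ¬ v ≐ x ∧ pair_in g v z) ∧
  ∃ x ∈ a, pair_in e x x ∧ pair_in g x u ∧ ∀ y, pair_in e y y ⇒ y ≐ x)%F.
Definition codes e u a : Prop := (∀ z # e, ∃ x # a, ∃ y # a, z = pair x y) /\
  exists g, fun_on g a /\ (∀ x # a, forall y, pair x y # g ->
  forall z, z # y <-> ∃ v # a, pair v x # e /\ v <> x /\ pair v z # g) /\
  ∃ x # a, pair x x # e /\ pair x u # g /\ forall y, pair y y # e -> y = x.

Global Instance means_code e u a : Means (code e u a) (codes e u a).
Proof. rewrite /code; exact _. Qed.

Lemma codes_sub e u a : codes e u a -> sub e (prod a a).
Proof. by move=> [S _] z /S[x[Hx[y[Hy ->]]]]; apply/pair_prod. Qed.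

Lemma codes_inj e u u' a : codes e u a -> codes e u' a -> u = u'.
Proof.
move=> [_[g[Fg[Hg[x[Hx[Ex[Gx Ux]]]]]]]] [_[g'[Fg'[Hg'[x'[Hx'[Ex'[Gx' _]]]]]]]].
move: (Ux x' Ex') Gx' => -> Gx' {x' Hx' Ex' Ux}.
have K v : ∀ y # a, app g y = v -> app g' y = v.
{ elim/eps_ind: v => v IH y Hy Ev; apply: set_ext => z.
  rewrite (Hg' y Hy _ (pair_app Fg' Hy)) -{1}Ev (Hg y Hy _ (pair_app Fg Hy)).
  split=> -[t[Ht[Et[Nt Kt]]]]; exists t; splits; move: Kt.
  - move=> /(pair_in_fun _ _ Fg')[_ ->]; have Gt := pair_app Fg Ht.
  rewrite (IH (app g t) _ t Ht) //; rewrite -Ev; apply/(Hg y Hy _ (pair_app Fg Hy)); by exists t.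
  - move=> Gt; have [_ Ez] := (pair_in_fun _ _ Fg).1 Gt.
  have Hz : z # v by rewrite -Ev; apply/(Hg y Hy _ (pair_app Fg Hy)); exists t.
  by rewrite -(IH z Hz t Ht (eq_sym Ez)); exact: (pair_app Fg' Ht). }
rewrite ((pair_in_fun _ _ Fg).1 Gx).2 ((pair_in_fun _ _ Fg').1 Gx').2.
by rewrite (K (app g x) x Hx).
Qed.

Lemma ex_code t u a : trans t -> u # t -> embeds t a -> exists e, codes e u a.
Proof.
move=> Tt Hu [i[Fi[Ri Ii]]].
pose e := sep (prod a a) (fun z => exists v w, v # t /\ w # t /\ (v # w \/ v = u /\ w = u) /\ z = pair (app i v) (app i w)).
pose g := lam a (fun x => union (sep t (fun v => app i v = x))).
have Fg : fun_on g a by exact: fun_on_lam.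
have gE v : v # t -> pair (app i v) v # g.
{ move=> Hv; apply/(pair_in_fun _ _ Fg); split; first exact: Ri.
  rewrite /g app_lam //; first exact: Ri. apply: set_ext => z; rewrite in_union.
  by split=> [Hz|[v'[/in_sep[Hv' /Ii ->]]]] //; exists v; split=> //; apply/in_sep. }
have eE v w : v # t -> w # t -> pair (app i v) (app i w) # e <-> v # w \/ v = u /\ w = u.
{ move=> Hv Hw; rewrite in_sep pair_prod; split=> [[_[v'[w'[Hv'[Hw'[K /pair_inj[Ev Ew]]]]]]]|K].
  - by rewrite (Ii v v') // (Ii w w').
  - by split; [split; exact: Ri|exists v, w]. }
have eI z : z # e -> exists v w, v # t /\ w # t /\ (v # w \/ v = u /\ w = u) /\ z = pair (app i v) (app i w) by move=> /in_sep[].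
exists e; split; first by move=> z /in_sep[/in_prod[x[y[Hx[Hy ->]]]] _]; exists x; split=> //; exists y.
exists g; splits.
- move=> x Hx y Gy z; split.
  + move=> Hz; have [w[Hw Ex]] : ∃ w # t, app i w = x.
  { move/(pair_in_fun _ _ Fg): Gy Hz => [_ ->]; rewrite /g app_lam // => /in_union[w[/in_sep[Hw Ew] _]].
    by exists w. }
  have Ey : y = w by subst x; exact: (Fg.1.2 _ _ _ Gy (gE w Hw)).
  subst x y; have Hzt := Tt w Hw z Hz; exists (app i z); splits; [exact: Ri|by apply/eE; auto| |exact: gE].
  by move=> /Ii E1; move: Hz; rewrite E1 //; exact: mem_irrefl.
  + move=> [x'[_[/eI[v[w[Hv[Hw[K /pair_inj[E1 E2]]]]]][N Gz]]]]; subst x x'.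
  rewrite (Fg.1.2 _ _ _ Gy (gE w Hw)) (Fg.1.2 _ _ _ Gz (gE v Hv)).
  by case: K => // -[E1 E2]; case: N; rewrite E1 E2.
- exists (app i u); splits; [exact: Ri|by apply/eE; auto|exact: gE|].
  move=> y /eI[v[w[Hv[Hw[K /pair_inj[E1 E2]]]]]]; subst y; move: (Ii _ _ Hv Hw E2) K => <- [/mem_irrefl //|[-> //]].
Qed.

Lemma ex_lottery_code c a D R o u : ord a -> lottery_sum c a D R o -> u # D -> exists e, codes e u (a.+1.+1.+1.+1).
Proof.
move=> Oa [->[[k[[_[_ Ck]] HD]] _]] /HD[->|[Q[A[L[EQ[_[[b[Hb Eb]][_[p[Hp ->]]]]]]]]]].
- apply: (@ex_code (sing emp)) => [x /in_sing-> z /in_emp //||]; first exact/in_sing.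
  apply: embeds_sub => x /in_sing->; apply: (ord_sub_in (ord_emp W) _ (memS _)); last by move=> z /in_emp.
  by do 4 apply: ordS.
- have ET : embeds (trcl Q) a := embeds_trans Eb (Ck b Hb).
  pose t := cup (cup (cup (cup (trcl Q) (sing Q)) (sing (duo Q Q))) (sing (duo Q p))) (sing (pair Q p)).
  have in_t z : z # t <-> z # trcl Q \/ z = Q \/ z = duo Q Q \/ z = duo Q p \/ z = pair Q p.
  { by rewrite /t !in_cup !in_sing; tauto. }
  have Hpt : p # trcl Q.
  { apply: (trcl_step _ Hp); apply: (@trcl_step _ _ (duo A A)); last by apply/in_duo; left.
  by apply: in_trcl; rewrite EQ; apply/in_duo; left. }
  apply: (@ex_code t).
  + move=> y /in_t[K|[->|[->|[->|->]]]] z Hz; apply/in_t.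
  * by left; exact: trcl_step K Hz.
  * by left; exact: in_trcl.
  * by case/in_duo: Hz => ->; tauto.
  * by case/in_duo: Hz => ->; tauto.
  * by case/in_duo: Hz => ->; tauto.
  + by apply/in_t; tauto.
  + by do 4 (apply: embeds_cup_sing; first exact: mem_irrefl).
Qed.
End Strategies.

Section Normality.
Variable V : zfc_model.
Variables k l X U al : V.
Implicit Types b c d e f g h p q t x y z C F Z : V.
Notation ae := (ae U).
Notation "∀* x , P" := (ae (fun x => P)) (at level 200, x name, P at level 200).
Notation "'A' x" := (app al x) (at level 9, x at level 8).

Record normal_function : Prop := {
  normal_gt : ∀ b # k, ∀* x, b # A x;
  normal_lt : ∀* x, A x # k;
  normal_regressive : forall g, fun_on g X -> (∀* x, app g x # A x) -> ∃ b # k, ∀* x, app g x = b }.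

Hypothesis FM : is_fine_measure k l X U.
Notation "H ∩ H'" := (ae_and FM H H') (at level 40, left associativity).
Hypotheses (N : normal_function) (k_card : card k) (k_uncountable : omega V # k).
Let Ok : ord k := k_card.1.

Lemma regressive_constant (R : V -> V -> Prop) : Definable2 R -> (∀* x, ∃ b # A x, R x b) -> ∃ b # k, ∀* x, R x b.
Proof.
move=> DR H; have [g[Fg Hg]] := ae_select FM _ H.
have [|b[Hb Eb]] := normal_regressive N Fg; first by apply: (ae_mono FM Hg) => x _ [].
by exists b; split=> //; apply: (ae_mono FM (Hg ∩ Eb)) => x _ [[_ K] <-].
Qed.

Lemma ae_diagonal (Q : V -> V -> Prop) : Definable2 Q -> (∀ b # k, ae (Q b)) -> ∀* x, ∀ b # A x, Q b x.
Proof.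
move=> DQ H.
case: (ae_decided FM (Q := fun x => ∀ b # A x, Q b x) _) => // J; have [|b[Hb K]] := @regressive_constant (fun x b => ~ Q b x) _.
- apply: (ae_mono FM J) => x _ K; apply: NNPP => K'; apply: K => b Hb.
  by apply: NNPP => K; apply: K'; exists b.
- by case: (ae_not FM (H b Hb) K).
Qed.

Lemma ae_decides (Q : V -> V -> Prop) a : Definable2 Q -> small a k -> ∀* x, ∀ t # a, (Q t x <-> ae (Q t)).
Proof.
move=> DQ Sa.
apply: (ae_forall_small FM (Q := fun t x => Q t x <-> ae (Q t)) _ Sa) => t _.
case: (ae_decided FM (Q := Q t) _) => J; apply: (ae_mono FM J) => x _ K; split=> // K'.
by case: (ae_not FM K' J).
Qed.

Lemma normal_not_constant b : b # k -> ~ (∀* x, A x = b).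
Proof. by move=> Hb H; have [x[_[K E]]] := ae_ex FM (normal_gt N Hb ∩ H); move: K; rewrite E => /mem_irrefl. Qed.

Lemma normal_succ b : b # k -> b.+1 # k.
Proof.
move=> Hb; case/inS: (ordS_in Ok Hb) => // Ek; exfalso.
have [x[_[K1 K2]]] := ae_ex FM (normal_gt N Hb ∩ normal_lt N).
by move: K2; rewrite -Ek => /inS[/(mem_asym K1)|E] //; move: K1; rewrite E => /mem_irrefl.
Qed.

Lemma normal_lim : lim k.
Proof.
split=> //; split=> [E|y Hy]; first by move: k_uncountable; rewrite E => /in_emp.
by exists y.+1; split; [exact: normal_succ|exact: memS].
Qed.

(* A class of functions all of which are almost constant modulo E has few elements modulo E, since
   a k-sequence of inequivalent elements, evaluated at A x, would be such a function. *)
Lemma small_representatives Z (E : V -> V -> Prop) : Definable2 E -> (∀ p # Z, E p p) ->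
  (forall p q, E p q -> E q p) -> (forall p q r, E p q -> E q r -> E p r) ->
  (forall F, fun_on F X -> (∀* x, app F x # Z) -> ∃ p # Z, ∀* x, E (app F x) p) ->
  exists C, sub C Z /\ small C k /\ ∀ q # Z, ∃ c # C, E q c.
Proof.
move=> DE E_refl E_sym E_trans H; pose cl q := sep Z (E q).
have in_cl q z : z # cl q <-> z # Z /\ E q z by apply: in_sep.
have [|h Hh] := @choice_function V (image Z cl).
{ by move=> y /in_image[q[Hq ->]]; exists q; apply/in_cl; split; [|exact: E_refl]. }
pose rep q := app h (cl q).
have repP q : q # Z -> rep q # Z /\ E q (rep q) by move=> Hq; apply/in_cl/Hh/in_image; exists q.
have rep_eq p q : E p q -> rep p = rep q.
{ move=> K; rewrite /rep; congr app; apply: set_ext => z; rewrite !in_cl.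
  by split=> -[Hz K']; split=> //; [exact: E_trans (E_sym _ _ K) K'|exact: E_trans K K']. }
exists (image Z rep); splits; first by move=> z /in_image[q[Hq ->]]; case: (repP q Hq).
- case: (small_or_embeds (image Z rep) Ok) => // -[j[Fj[Rj Ij]]]; exfalso.
  pose F := lam X (fun x => app j (A x)).
  have [||p[Hp K]] := H F; first exact: fun_on_lam.
  { apply: (ae_mono FM (normal_lt N)) => x Hx K; rewrite /F app_lam //.
  by move: (Rj _ K) => /in_image[q[Hq ->]]; case: (repP q Hq). }
  have J : ∀* x, A x # k /\ app j (A x) = rep p.
  { apply: (ae_mono FM (normal_lt N ∩ K)) => x Hx [K1]; rewrite /F app_lam // => /rep_eq <-; split=> //.
  by move: (Rj _ K1) => /in_image[q[Hq ->]]; apply: rep_eq; exact: (repP q Hq).2. }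
  have [x0[_[H0 E0]]] := ae_ex FM J; apply: (normal_not_constant H0).
  by apply: (ae_mono FM J) => x _ [Hx Ex]; apply: Ij => //; rewrite Ex E0.
- by move=> q Hq; exists (rep q); split; [apply/in_image; exists q|exact: (repP q Hq).2].
Qed.

Lemma small_power a : a # k -> small (power a) k.
Proof.
move=> Ha; case: (small_or_embeds (power a) Ok) => // -[F[_[RF IF]]]; exfalso.
have DQ : Definable2 (fun z x => z # app F (A x)) by definability.
have J := ae_decides DQ (small_mem Ha) ∩ normal_lt N.
have [x0[_[E0 H0]]] := ae_ex FM J; apply: (normal_not_constant H0).
apply: (ae_mono FM J) => x _ [Ex Hx]; apply: IF => //; apply: set_ext => z.
have Sa y : y # k -> z # app F y -> z # a by move=> /RF /in_power; exact.
by split=> Hz; [apply/(E0 z (Sa _ Hx Hz))/(Ex z (Sa _ Hx Hz))|apply/(Ex z (Sa _ H0 Hz))/(E0 z (Sa _ H0 Hz))].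
Qed.

Lemma normal_inacc : inacc k.
Proof.
split=> //; split=> //; split; last exact: small_power; split; first exact: normal_lim.
move=> a Ha g Fg Hg.
have [|x[_[K1 K2]]] := ae_ex FM ((ae_forall_small FM (Q := fun xi x => app g xi # A x) _ (small_mem Ha) _) ∩ normal_lt N).
- by move=> xi /Hg; exact: (normal_gt N).
- by exists (A x).
Qed.

Lemma ae_embeds_not b : b # k -> ∀* x, ~ embeds (A x) b.
Proof.
move=> Hb.
case: (ae_decided FM (Q := fun x => embeds (A x) b) _) => // /(ae_select FM _)[h[_ Hh]]; exfalso.
have DR : Definable2 (fun xi y => y # b /\ ∀* x, app (app h x) xi = y) by definability.
have [xi Hxi|g[Fg Hg]] := ex_choice_fun (a := k) DR.
- have [|y[Hy K]] := ae_constant FM (g := lam X (fun x => app (app h x) xi)) (small_mem Hb).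
  { apply: (ae_mono FM (Hh ∩ normal_gt N Hxi)) => x Hx [[_[J _]] J2].
  by rewrite app_lam //; exact: J. }
  by exists y; split=> //; apply: (ae_mono FM K) => x Hx; rewrite app_lam.
- apply: (k_card.2 b Hb); exists g; rewrite /inj; splits; first by move=> xi /Hg[].
  move=> y z Hy Hz E; have [[_ Ky][_ Kz]] := (Hg y Hy, Hg z Hz).
  have [x[_[[J[Ay Az]][Ey Ez]]]] := ae_ex FM (Hh ∩ (normal_gt N Hy ∩ normal_gt N Hz) ∩ (Ky ∩ Kz)).
  by move: J => [_[_ J]]; apply: J => //; rewrite Ey Ez.
Qed.

Lemma ae_bounded a : a # k -> ∀* x, forall g, fun_on g a -> (∀ y # a, app g y # A x) -> ∃ b # A x, ∀ y # a, app g y # b.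
Proof.
move=> Ha; set Q := fun x => _.
case: (ae_decided FM (Q := Q) _) => // J; exfalso.
pose R x g := (∀ y # a, app g y # A x) /\ ~ ∃ b # A x, ∀ y # a, app g y # b.
have [|h[_ Hh]] := ae_select FM (Q := R) _.
{ apply: (ae_mono FM J) => x _ K; apply: NNPP => K'; apply: K => g Fg Hg; apply: NNPP => K.
  by apply: K'; exists g. }
have DR : Definable2 (fun xi y => y # k /\ ∀* x, app (app h x) xi = y) by definability.
have [xi Hxi|g[Fg Hg]] := ex_choice_fun (a := a) DR.
- have [|b[Hb Kb]] := @regressive_constant (fun x b => app (app h x) xi = b) _; last by exists b.
  by apply: (ae_mono FM Hh) => x _ [K _]; exists (app (app h x) xi); split=> //; exact: K.
- have [|b[Hb Eb]] := normal_inacc.2.2.1.2 a Ha g Fg; first by move=> xi /Hg[].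
  have DE : Definable2 (fun xi x => app (app h x) xi = app g xi) by definability.
  have E := ae_forall_small FM DE (small_mem Ha) (fun xi Hxi => (Hg xi Hxi).2).
  have [x[_[[K[_ NK]] Ab]]] := ae_ex FM (E ∩ Hh ∩ normal_gt N Hb).
  by apply: NK; exists b; split=> // y Hy; rewrite K //; exact: Eb.
Qed.

Lemma ae_inacc : ∀* x, inacc (A x).
Proof.
pose bounded a x := forall g, fun_on g a -> (∀ y # a, app g y # A x) -> ∃ b # A x, ∀ y # a, app g y # b.
pose Q b x := (~ embeds (A x) b /\ bounded b x) /\ (b.+1 # A x /\ small (power b) (A x)).
have H : ∀* x, ∀ b # A x, Q b x.
{ apply: ae_diagonal => b Hb.
  apply: (ae_and FM (ae_embeds_not Hb ∩ ae_bounded Hb)).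
  apply: (ae_and FM (normal_gt N (normal_succ Hb))).
  by have [c [/(normal_gt N) Hc I]] := small_power Hb; apply: (ae_mono FM Hc) => x _ K; exists c. }
have J := normal_lt N ∩ normal_gt N k_uncountable ∩ H.
apply: (ae_mono FM J) => x _ [[Hx Wx] {}H]; have Ox := ord_in Ok Hx.
rewrite /inacc; splits; [split=> // a /H[[]] //| |by move=> a /H[_[]]].
rewrite /reg /lim; splits; [by move=> E; move: Wx; rewrite E => /in_emp| |by move=> a /H[[]]].
by move=> y Hy; exists y.+1; split; [exact: (H y Hy).2.1|exact: memS].
Qed.

Definition closed_under f b : Prop := ∀ a # b, forall e, pair a e # f -> e # b.

Lemma ae_closed_under f : is_fun f -> (forall a e, pair a e # f -> e # k) -> ∀* x, closed_under f (A x).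
Proof.
move=> Ff Rf; apply: ae_diagonal => b Hb; case: (classic (exists e, pair b e # f)) => [[e He]|Nf].
- by apply: (ae_mono FM (normal_gt N (Rf _ _ He))) => x _ K e' /(Ff.2 _ _ _ He) <-.
- by apply: (ae_all FM) => x _ e He; case: Nf; exists e.
Qed.
End Normality.

Section TransitiveEmbedding.
Variables (V W : zfc_model) (i : V -> W).
Hypotheses (i_mem : forall x y, i x # i y <-> x # y) (i_trans : forall x w, w # i x -> exists y, w = i y).
Notation in_embed := (in_embed i_mem i_trans).

Lemma embed_embeds c d : embeds c d -> embeds (i c) (i d).
Proof.
move=> [h[Fh[Rh Ih]]]; exists (i h); rewrite /inj; splits; first exact/(embed_fun_on i_mem i_trans).
- by move=> w /in_embed[x[-> Hx]]; rewrite -(embed_app i_mem i_trans Fh Hx); apply/i_mem/Rh.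
- move=> w w' /in_embed[x[-> Hx]] /in_embed[x'[-> Hx']].
  rewrite -(embed_app i_mem i_trans Fh Hx) -(embed_app i_mem i_trans Fh Hx') => /(embed_inj i_mem) E.
  by rewrite (Ih x x').
Qed.

Lemma embed_lim x : lim (i x) <-> lim x.
Proof.
rewrite /lim (embed_ord i_mem i_trans) -(embed_emp i_mem i_trans).
split=> -[O[N H]]; splits; try by [move=> E; apply: N; rewrite E|move=> /(embed_inj i_mem)].
- by move=> y /i_mem/H[w[/in_embed[z[-> Hz]] /i_mem Hyz]]; exists z; split=> //.
- by move=> w /in_embed[y[-> /H[z[Hz Hyz]]]]; exists (i z); split; exact/i_mem.
Qed.
Lemma embed_omega : i (omega V) = omega W.
Proof.
case: (ord_total ((embed_ord i_mem i_trans _).2 (ord_omega V)) (ord_omega W)) => [K|[//|/in_embed[n[E Hn]]]].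
- by case: (not_lim_in_omega K); apply/embed_lim; exact: lim_omega.
- by case: (not_lim_in_omega Hn); apply/embed_lim; rewrite -E; exact: lim_omega.
Qed.

Lemma embed_second_player d E : second_player d E -> second_player (i d) (i E).
Proof.
have lift y w : w # i y -> exists z, w = i z /\ z # y by move/in_embed.
rewrite /second_player => -[S[H0[HL HS]]]; splits; first exact/(embed_sub i_mem i_trans).
- move=> _ /lift[w[-> Hw]]; rewrite -(embed_emp i_mem i_trans) => /(embed_inj i_mem) Ew /i_mem; exact: H0.
- move=> _ /lift[w[-> Hw]] /embed_lim Lw; apply/i_mem; exact: HL.
- move=> _ /lift[w[-> Hw]] _ /lift[z[-> Hz]]; rewrite -(embed_succ i_mem i_trans) => /(embed_inj i_mem) Ew.
  rewrite !i_mem; exact: HS.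
Qed.
End TransitiveEmbedding.

Fixpoint powers (W : zfc_model) m (x : W) : W := match m with 0 => x | S m => power (powers m x) end.

Lemma trans_powers (W : zfc_model) m (x : W) : trans x -> trans (powers m x).
Proof. by move=> T; elim: m => [|m IH] //= y /in_power Sy z /Sy Hz; apply/in_power; exact: IH. Qed.
Lemma sub_powers (W : zfc_model) m (x : W) : trans x -> sub (powers m x) (powers (S m) x).
Proof. by move=> /(trans_powers (m := m)) T y Hy; apply/in_power; exact: T. Qed.

Section CohenNames.
Variable W : zfc_model.
Implicit Types a b d e k m p q r s t u x y z A E L R S : W.
Notation Means := (Means (@mem W)).

Definition cofinal_map {T} (t d a : T) : form T :=
  (function_on t d ∧ ∀b∈a, ∃x∈d, ∃y∈a, pair_in t x y ∧ ¬ y ∈ b)%F.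
Definition cofinal t d a : Prop := fun_on t d /\ ∀ b # a, ∃ x # d, ∃ y # a, pair x y # t /\ ~ y # b.
Global Instance means_cofinal_map t d a : Means (cofinal_map t d a) (cofinal t d a).
Proof. rewrite /cofinal_map; exact _. Qed.

Definition indicator d s : W := lam d (fun x => ite (x # s) emp.+1 emp).
Definition is_indicator {T} (m s d : T) : form T := (function_on m d ∧
  ∀x∈d, ∃e, empty e ∧ ∃o, is_succ e o ∧ (x ∈ s ⇒ pair_in m x o) ∧ (¬ x ∈ s ⇒ pair_in m x e))%F.

Lemma indicator_fun d s : fun_on (indicator d s) d.
Proof. by apply: fun_on_lam. Qed.

Lemma in_indicator d s x y : pair x y # indicator d s <-> x # d /\ (x # s /\ y = emp.+1 \/ ~ x # s /\ y = emp).
Proof.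
rewrite (pair_in_fun _ _ (indicator_fun d s)); split=> -[Hx E]; split=> //.
- by rewrite E /indicator app_lam //; case: (classic (x # s)) => H; [left; rewrite ite_true|right; rewrite ite_false].
- by rewrite /indicator app_lam //; case: E => -[H ->]; [rewrite ite_true|rewrite ite_false].
Qed.

Lemma indicator_eq d s m : fun_on m d -> (∀ x # d, x # s -> pair x emp.+1 # m) ->
  (∀ x # d, ~ x # s -> pair x emp # m) -> m = indicator d s.
Proof.
move=> Fm H1 H0; apply: (fun_on_ext Fm (indicator_fun d s)) => x Hx; apply: (app_eq Fm.1).
rewrite /indicator app_lam //.
by case: (classic (x # s)) => H; [rewrite ite_true //; exact: H1|rewrite ite_false //; exact: H0].
Qed.

Global Instance means_is_indicator m s d : Means (is_indicator m s d) (m = indicator d s).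
Proof.
eapply means_iff; first by rewrite /is_indicator; exact _.
split=> [[Fm H]|->].
- by apply: indicator_eq => // x Hx Hs; have [e[Ee[o[Eo[H1 H0]]]]] := H x Hx; subst o e; [exact: H1|case: H0].
- split=> [|x Hx]; first exact: indicator_fun.
  exists emp; split=> //; exists emp.+1; splits=> [Hs|]; first by apply/in_indicator; auto.
  by case: (classic (x # s)) => Hs; [left|right; apply/in_indicator; auto].
Qed.

Lemma indicator_sub d d' s s' : sub (indicator d s) (indicator d' s') <-> sub d d' /\ ∀ x # d, (x # s <-> x # s').
Proof.
split=> [S|[Sd E] z /(in_fun _ (indicator_fun d s))[x[Hx ->]]].
- have K x : x # d -> exists y, pair x y # indicator d s /\ pair x y # indicator d' s'.
  { by move=> /(indicator_fun d s).2[y Hy]; exists y; split=> //; exact: S. }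
  split=> x Hx; have [y[/in_indicator[_ Hy] /in_indicator[Hx' Hy']]] := K x Hx => //.
  by case: Hy Hy' => -[Hs ->] [[Hs' E]|[Hs' E]]; [split|case: (succ_neq_emp E)|case: (@succ_neq_emp W emp)|split].
- apply/in_indicator; split; first exact: Sd.
  move: (pair_app (indicator_fun d s) Hx) => /in_indicator[_[[Hs ->]|[Hs ->]]]; [left|right]; by split=> //; rewrite -?E.
Qed.

Lemma lim_succ b x : lim b -> x # b -> x.+1 # b.
Proof.
move=> [Ob[_ H]] /H[y[Hy Hxy]]; case/inS: (ordS_in (ord_in Ob Hy) Hxy) => [K|-> //].
exact: (ord_trans Ob K Hy).
Qed.

Definition agree_on {T} (x y d : T) : form T := (∀z∈d, z ∈ x ⇔ z ∈ y)%F.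
Global Instance means_agree_on x y d : Means (agree_on x y d) (∀ z # d, (z # x <-> z # y)).
Proof. by rewrite /agree_on; exact _. Qed.

Section CohenPoset.
Variables k A L : W.
Hypothesis AL : cohen_poset k A L.

Lemma in_cohen m : m # A <-> exists d s, d # k /\ m = indicator d s.
Proof.
rewrite AL.1; split=> [[d[Hd[Fm B]]]|[d[s[Hd ->]]]]; exists d.
- exists (sep d (fun x => pair x emp.+1 # m)); split=> //; apply: indicator_eq => // x Hx; first by case/in_sep.
  rewrite in_sep => N; have := pair_app Fm Hx; case: (B _ _ (pair_app Fm Hx)) => [-> //|[e[-> ->]] K].
  by case: N.
- splits; first exact: indicator_fun.
  by move=> x y /in_indicator[_[[_ ->]|[_ ->]]]; [right; exists emp|left].
Qed.

Lemma cohen_poset_unique A' L' : cohen_poset k A' L' -> A' = A /\ L' = L.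
Proof.
move=> [HA HL]; have EA : A' = A by apply: set_ext => z; rewrite HA AL.1.
by subst A'; split=> //; apply: set_ext => z; rewrite HL AL.2.
Qed.

Lemma cohen_trcl : lim k -> sub (trcl (pair A L)) (powers 7 k).
Proof.
move=> Lk; have [Ok _] := Lk; have up n := sub_powers (m := n) Ok.1.
have double n x y : x # powers n k -> y # powers n k -> duo x y # powers (S n) k.
{ by move=> Hx Hy; apply/in_power => z /in_duo[->|->]. }
have ordered n x y : x # powers n k -> y # powers n k -> pair x y # powers (S (S n)) k.
{ by move=> Hx Hy; exact: (double _ _ _ (double _ _ _ Hx Hx) (double _ _ _ Hx Hy)). }
have [y0 Hy0] := neq_emp_ex Lk.2.1.
have emp_k : emp # k by apply: (ord_sub_in (@ord_emp W) Ok Hy0) => z /in_emp.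
have one_k : emp.+1 # k by apply: lim_succ.
have HA p : p # A -> p # powers 3 k.
{ move=> /AL.1[d[Hd[Fp B]]]; apply/in_power => z /(in_fun _ Fp)[x[Hx ->]].
  apply: (ordered 0) => /=; first exact: (ord_trans Ok Hx Hd).
  by case: (B _ _ (pair_app Fp Hx)) => [->|[e[-> ->]]]. }
have HA4 : A # powers 4 k by apply/in_power.
have HL6 : L # powers 6 k.
{ by apply/in_power => z /AL.2[p[/HA Hp[q[/HA Hq[-> _]]]]]; apply: (ordered 3). }
by apply: trcl_min => [|z /in_duo[->|->]]; [exact: trans_powers Ok.1|..]; apply: (double 6) => //; do 2 apply: (up _).
Qed.
End CohenPoset.

Definition cohen_condition a m y : Prop := exists A L, cohen_poset a A L /\ m # A /\ y = pair (pair A L) m.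

Definition cohen_point {T} (y s d a : T) : form T :=
  (∃A, ∃L, ∃Q, ∃m, is_Add a A L ∧ is_pair A L Q ∧ is_pair Q m y ∧ is_indicator m s d)%F.
Lemma means_cohen_point y s d a : d # a -> Means (cohen_point y s d a) (cohen_condition a (indicator d s) y).
Proof.
move=> Hd; eapply means_iff; first by rewrite /cohen_point; exact _.
split=> [[A[L[Q[m[AL[->[-> ->]]]]]]]|[A[L[AL[_ ->]]]]]; exists A, L; last by do 2 eexists; splits.
by splits; apply/(in_cohen AL); exists d, s.
Qed.

Definition point_forces {T} (s d a y x : T) : form T := (∃P, ∃L, ∃m, ∃z, is_Add a P L ∧ m ∈ P ∧
  is_indicator m s d ∧ check_name P y z ∧ forces P L (z ∈ x) m)%F.

Lemma means_point_forces s d a y x P L : cohen_poset a P L -> indicator d s # P ->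
  Means (point_forces s d a y x) (Forces P L (FMem (check P y) x) (indicator d s)).
Proof.
move=> PL HP; eapply means_iff; first by rewrite /point_forces; exact _.
split=> [[P' [L' [m [z [/(cohen_poset_unique PL)[-> ->] [_[->[-> H]]]]]]]] //|H].
by exists P, L, (indicator d s), (check P y).
Qed.

Definition winning_below {T} (q S R E : T) : form T :=
  (∃A, (∀u, u ∈ A ⇔ pair_in R u q) ∧ winning A R E S ∧ ∀a∈E, ∀s, function_on s a ⇒ (∀b∈a, pair_in s b q) ⇒ pair_in S s q)%F.

Lemma means_winning_below q S R E d : ord d -> sub E d -> Means (winning_below q S R E) (wins_below q S R E).
Proof.
move=> Od SE; have MW A := means_winning A R S Od SE.
eapply means_iff; first by rewrite /winning_below; exact _.
have cone A : (forall u, u # A <-> pair u q # R) -> (fun u => u # A) = (fun u => pair u q # R).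
{ by move=> H; apply: funext => u; apply: propositional_extensionality. }
have passP : passes E S q <-> ∀ a # E, forall s, fun_on s a -> (∀ b # a, pair b q # s) -> pair s q # S.
{ split=> H a; [move=> Ha s Fs K; apply: (H a s Ha Fs) => b Hb; exact: (app_eq Fs.1 (K b Hb))|].
  by move=> s Ha Fs K; apply: (H a Ha s Fs) => b Hb; rewrite -(K b Hb); exact: (pair_app Fs Hb). }
rewrite /wins_below passP; split=> [[A[/cone ->[H1 H2]]] //|[H1 H2]].
exists (sep (union (union R)) (fun u => pair u q # R)).
have H u : u # sep (union (union R)) (fun u => pair u q # R) <-> pair u q # R.
{ rewrite in_sep; split=> [[] //|K]; split=> //; apply/in_union; exists (duo u q).
  by split; [apply/in_union; exists (pair u q); split=> //; exact: duo_in_pair|apply/in_duo; left]. }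
by rewrite (cone _ H).
Qed.
End CohenNames.

Definition function_name V (P d : V) (F : V -> V) : V :=
  prod (image d (fun x => name_pair P (check P x) (F x))) P.

Section FunctionNames.
Variable V : zfc_model.
Variables P L : V.
Variable g : generic P L.
Implicit Types d x y z : V.

Lemma in_value_prod Y (w : g) : w # (prod Y P).[g] <-> ∃ y # Y, w = y.[g].
Proof.
rewrite (in_val g); split=> [[y[p[_[/pair_prod[Hy _] ->]]]]|[y[Hy ->]]]; first by exists y.
have [p Gp] := filter_nonempty (set_filter g); exists y, p; splits.
by apply/pair_prod; split=> //; exact: (generic_sub g).
Qed.

Lemma value_name_pair y z : (name_pair P y z).[g] = pair y.[g] z.[g].
Proof.
have K u v : (name_duo P u v).[g] = duo u.[g] v.[g].
{ apply: set_ext => w; rewrite in_value_prod in_duo; split=> [[t[/in_duo[->|->] ->]]|[->|->]]; auto.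
  - by exists u; split=> //; apply/in_duo; left.
  - by exists v; split=> //; apply/in_duo; right. }
by rewrite /name_pair !K.
Qed.

Section Function.
Variables (d : V) (F : V -> V).
Hypothesis F_definable : DefinableFun1 F.
Notation G := (function_name P d F).[g].

Lemma in_function_name (w : g) : w # G <-> ∃ x # d, w = pair (embed g x) (F x).[g].
Proof.
have D := definable_fun2_name_pair P.
rewrite in_value_prod; split=> [[y[/in_image[x[Hx ->]] ->]]|[x[Hx ->]]].
- by exists x; rewrite value_name_pair (val_check g).
- exists (name_pair P (check P x) (F x)); rewrite value_name_pair (val_check g); split=> //.
  by apply/in_image; exists x.
Qed.

Lemma fun_on_function_name : fun_on G (embed g d).
Proof.
have [Im It] := (ge_mem g, ge_transitive g); split; first split.
- by move=> w /in_function_name[x[_ ->]]; exists (embed g x), (F x).[g].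
- move=> u v v' /in_function_name[x[_ /pair_inj[-> ->]]] /in_function_name[x'[_ /pair_inj[E ->]]]; congr (F _).[g]; exact: (embed_inj Im E).
- move=> u; rewrite (in_embed Im It); split=> [[x[-> Hx]]|[v /in_function_name[x[Hx /pair_inj[-> _]]]]]; last by exists x.
  by exists (F x).[g]; apply/in_function_name; exists x.
Qed.

Lemma app_function_name x : x # d -> app G (embed g x) = (F x).[g].
Proof. by move=> Hx; apply: (app_eq fun_on_function_name.1); apply/in_function_name; exists x. Qed.
End Function.
End FunctionNames.

Section MeasureOfCovers.
Variable W : zfc_model.
Variables k l X Y U : W.
Hypotheses (k_lim : lim k) (k_sub : sub k l) (space : forall x, x # X <-> sub x l /\ small x k)
  (Y_sub : sub Y X) (Y_bounded : ∀ y # Y, ∃ s # k, ~ s # y) (U_up : ∀ A # U, forall B, sub A B -> sub B X -> B # U)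
  (U_sub : ∀ A # U, sub A X) (U_meet : forall A B, A # U -> B # U -> ∃ y # A, y # B)
  (U_cover : forall S, small S k -> (∀ A # S, sub A X) -> (∀ y # Y, ∃ A # S, y # A) -> ∃ A # S, A # U)
  (U_fine : ∀ a # l, sep X (fun x => a # x) # U).

Lemma small_add S u : small S k -> small (cup S (sing u)) k.
Proof.
by move=> [a[Ha E]]; exists a.+1; split; [exact: lim_succ|apply: embeds_cup_sing; [exact: mem_irrefl|]].
Qed.

Lemma small_duo A B : small (duo A B) k.
Proof.
have [e[He _]] : ∃ e # k, True.
{ by have [_[N _]] := k_lim; have [e He] := neq_emp_ex N; exists e. }
have S0 : small (emp : W) k by exists e; split=> //; apply: embeds_sub => z /in_emp.
apply: (small_embeds (embeds_sub _) (small_add B (small_add A S0))) => z /in_duo[->|->].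
- by apply/in_cup; left; apply/in_cup; right; apply/in_sing.
- by apply/in_cup; right; apply/in_sing.
Qed.

(* An injection of k into some a in k would make the family of the sets {x : s not in x}, for s in k, small. *)
Lemma card_of_covers : card k.
Proof.
have [Ok _] := k_lim; split=> // a Ha E; pose out s := sep X (fun x => ~ s # x).
have in_out s x : x # out s <-> x # X /\ ~ s # x by exact: in_sep.
have [|A /in_image[s[Hs ->]]|y Hy|_[/in_image[s[Hs ->]] HU]] := U_cover (S := image k out).
- exists a; split=> //; apply: embeds_trans E; apply: (@embeds_of_surjection _ (lam k out)) => A /in_image[s[Hs ->]].
  by exists s; rewrite app_lam.
- by move=> x /in_out[].
- have [s[Hs Ns]] := Y_bounded Hy; exists (out s); split; [by apply/in_image; exists s|exact/in_out/(conj (Y_sub Hy))].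
- by have [y[/in_out[_ Ny] /in_sep[_ Hsy]]] := U_meet HU (U_fine (k_sub Hs)).
Qed.

Lemma complete_of_covers S B : sub S U -> small S k -> (forall x, x # B <-> x # X /\ ∀ A # S, x # A) -> B # U.
Proof.
move=> SU Sm EB; have in_S' A : A # cup (image S (diff X)) (sing B) <-> (∃ Z # S, A = diff X Z) \/ A = B.
{ by rewrite in_cup in_sing in_image. }
have [|A /in_S'[[Z[_ ->]] x|-> x]|y Hy|A[/in_S'[[Z[HZ ->]]|-> //] HU]] := U_cover (S := cup (image S (diff X)) (sing B)).
- apply: small_add; apply: small_embeds Sm; apply: (@embeds_of_surjection _ (lam S (diff X))) => A /in_image[Z[HZ ->]].
  by exists Z; rewrite app_lam.
- by case/in_diff.
- by case/EB.
- case: (classic (∀ A # S, y # A)) => [H|No].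
  + by exists B; split; [apply/in_S'; right|apply/EB; split=> //; exact: Y_sub].
  + have [Z /(imply_to_and (Z # S))[HZ Nz]] := not_all_ex_not _ _ No.
  by exists (diff X Z); split; [apply/in_S'; left; exists Z|apply/in_diff; split=> //; exact: Y_sub].
- by have [y[/in_diff[_ Ny] Hy]] := U_meet HU (SU Z HZ).
Qed.

Lemma measure_of_covers : is_fine_measure k l X U.
Proof.
have full A : sub A X -> A # U \/ diff X A # U.
{ move=> SA; have [B /in_duo[->|-> x /in_diff[] //] //|y Hy|B[/in_duo[->|->] HU]] := U_cover (small_duo A (diff X A)); last by right.
  - case: (classic (y # A)) => Ny; [exists A|exists (diff X A)]; rewrite in_duo; split; [by left|by []|by right|].
  by apply/in_diff; split=> //; exact: Y_sub.
  - by left. }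
split=> //.
- by case: (full X) => // HU; have [y[/in_diff[Hy Ny] _]] := U_meet HU HU.
- by move=> B HB E; have [y[]] := U_meet HB HB; rewrite E => /in_emp.
- move=> A B HA HB; apply: (complete_of_covers _ (small_duo A B)) => [C /in_duo[->|->] //|x].
  rewrite in_cap; split=> [[Kx Lx]|[_ H]]; last by split; apply: H; apply/in_duo; tauto.
  by split=> [|C /in_duo[->|->] //]; exact: (U_sub HA).
- by move=> S SU Sm B EB; exact: (complete_of_covers SU Sm EB).
Qed.
End MeasureOfCovers.

(** * Iterations *)

Section Iteration.
Variable V : zfc_model.
Hypothesis V_countable : countable V.
(* The sequences of the posets P_b, of their orders, and of names for the Q_b, their orders and top elements. *)
Variables k f Ps Ls Qs Rs Os : V.
Implicit Types b c d p q r s u w x y z : V.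
Definition PP b : V := app Ps b.
Definition LL b : V := app Ls b.
Definition QQ b : V := app Qs b.
Definition RR b : V := app Rs b.
Definition OO b : V := app Os b.

Notation "p <=[ b ] q" := (le (LL b) p q) (at level 70, b at level 9, no associativity).
Notation "p ⊩[ b ] phi" := (Forces (PP b) (LL b) phi p) (at level 70, b at level 9, phi at level 69).
Notation generic_at b := (generic (PP b) (LL b)).

Definition coordinate b y : Prop := exists s, pair y s # QQ b.
Definition supported d c p : Prop := ∀ b # c, ~ b # d -> restr p b ⊩[b] FEq (app p b) (OO b).
Definition condition c p : Prop := fun_on p c /\ (∀ b # c, restr p b # PP b) /\
  (∀ b # c, coordinate b (app p b) /\ restr p b ⊩[b] FMem (app p b) (QQ b)) /\ (inacc c -> ∃ d # c, supported d c p).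

Record iteration : Prop := {
  iter_ord : ord k;
  iter_condition : ∀ c # k.+1, forall p, p # PP c <-> condition c p;
  iter_le : ∀ c # k.+1, forall p q, p <=[c] q <-> p # PP c /\ q # PP c /\
    ∀ b # c, restr p b ⊩[b] pair_in (RR b) (app p b) (app q b);
  iter_full : ∀ b # k, ∀ p # PP b, forall x, p ⊩[b] FMem x (QQ b) ->
    exists y, coordinate b y /\ p ⊩[b] FEq x y;
  iter_lottery : forall b a, b # k -> pair b a # f -> closed_under f b -> ∀ p # PP b,
    p ⊩[b] stage_lottery (check (PP b) b) (check (PP b) a) (QQ b) (RR b) (OO b);
  iter_trivial : ∀ b # k, ~ ((exists a, pair b a # f) /\ closed_under f b) -> ∀ p # PP b,
    p ⊩[b] stage_trivial (QQ b) (RR b) (OO b) }.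

Hypothesis I : iteration.

Lemma stage_in c b : c # k.+1 -> b # c -> b # k.
Proof. by move=> Hc; exact: (ord_subS (iter_ord I) Hc). Qed.
Lemma stage_trans c b : c # k.+1 -> b # c.+1 -> b # k.+1.
Proof. by move=> Hc /inS[Hb|-> //]; exact: (subS (stage_in Hc Hb)). Qed.
Lemma ord_stage c : c # k.+1 -> ord c.
Proof. exact: (ord_in (ordS (iter_ord I))). Qed.
Lemma stage_dom c p q : c # k.+1 -> p <=[c] q -> p # PP c /\ q # PP c.
Proof. by move=> Hc /(iter_le I Hc)[Hp[Hq _]]. Qed.

Section ConditionFunctions.
Variables c p : V.
Hypotheses (Hc : c # k.+1) (Hp : p # PP c).
Let conditionP : condition c p := (iter_condition I Hc p).1 Hp.

Lemma cond_fun_on : fun_on p c.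
Proof. exact: conditionP.1. Qed.

Lemma cond_restr b : b # c.+1 -> restr p b # PP b.
Proof.
by move=> /inS[Hb|->]; [exact: conditionP.2.1|rewrite (restr_dom cond_fun_on)].
Qed.

Lemma cond_app_restr b b' : b # c.+1 -> b' # b -> app (restr p b) b' = app p b'.
Proof. by move=> Hb; exact: (app_restr cond_fun_on (ord_subS (ord_stage Hc) Hb)). Qed.
Lemma cond_coordinate b : b # c -> coordinate b (app p b).
Proof. by move=> Hb; case: (conditionP.2.2.1 b Hb). Qed.
Lemma cond_coordinate_forced b : b # c -> restr p b ⊩[b] FMem (app p b) (QQ b).
Proof. by move=> Hb; case: (conditionP.2.2.1 b Hb). Qed.
Lemma cond_supported : inacc c -> ∃ d # c, supported d c p.
Proof. exact: conditionP.2.2.2. Qed.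
End ConditionFunctions.

Lemma restr_le c p q b : c # k.+1 -> b # c.+1 -> p <=[c] q -> restr p b <=[b] restr q b.
Proof.
move=> Hc Hb H; have [Hp Hq] := stage_dom Hc H; have Hbk := stage_trans Hc Hb.
apply/(iter_le I Hbk); splits; [exact: (cond_restr Hc Hp)|exact: (cond_restr Hc Hq)|].
move=> b' Hb'; rewrite (cond_app_restr Hc Hp Hb Hb') (cond_app_restr Hc Hq Hb Hb') (restr_ord p (ord_stage Hbk) Hb').
by move/(iter_le I Hc): H => [_[_ H]]; apply: H; exact: (ord_subS (ord_stage Hc) Hb).
Qed.

Lemma iterand_lottery b a (g : generic_at b) : b # k -> preorder (PP b) (LL b) -> pair b a # f -> closed_under f b ->
  lottery_sum (embed g b) (embed g a) (QQ b).[g] (RR b).[g] (OO b).[g].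
Proof.
move=> Hb PO Ha Cl; have [p Gp] := filter_nonempty (set_filter g); apply/means_stage_lottery.
have SL : schematic (fun T e => stage_lottery (e 0) (e 1) (e 2) (e 3) (e 4)) by exact _.
have := Forces_sound PO SL (e := scons (check (PP b) b) (scons (check (PP b) a) (scons (QQ b) (scons (RR b) (fun _ => OO b)))))
  Gp (iter_lottery I Hb Ha Cl (generic_sub g Gp)).
by rewrite /= !(val_check g).
Qed.

Lemma iterand_trivial b (g : generic_at b) : b # k -> preorder (PP b) (LL b) ->
  ~ ((exists a, pair b a # f) /\ closed_under f b) -> trivial_stage (QQ b).[g] (RR b).[g] (OO b).[g].
Proof.
move=> Hb PO NL; have [p Gp] := filter_nonempty (set_filter g); apply/means_stage_trivial.
exact: (@Forces_sound _ _ _ PO (fun T e => stage_trivial (e 0) (e 1) (e 2)) _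
  (scons (QQ b) (scons (RR b) (fun _ => OO b))) p g Gp (iter_trivial I Hb NL (generic_sub g Gp))).
Qed.

Lemma iterand_cases b (g : generic_at b) : b # k -> preorder (PP b) (LL b) -> (exists a, pair b a # f /\ closed_under f b /\
  lottery_sum (embed g b) (embed g a) (QQ b).[g] (RR b).[g] (OO b).[g]) \/ trivial_stage (QQ b).[g] (RR b).[g] (OO b).[g].
Proof.
move=> Hb PO; case: (classic ((exists a, pair b a # f) /\ closed_under f b)) => [[[a Ha] Cl]|NL]; [left|right].
- by exists a; splits; exact: iterand_lottery.
- exact: iterand_trivial.
Qed.

Lemma stage_preorder_iterand b (g : generic_at b) : b # k -> preorder (PP b) (LL b) ->
  preorder_with_top (QQ b).[g] (RR b).[g] (OO b).[g].
Proof.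
move=> Hb PO; case: (iterand_cases g Hb PO) => [[a[_[_ LS]]]|TS].
- exact: lottery_preorder LS.
- exact: trivial_stage_preorder.
Qed.

Lemma stage_pair_in_iff b p x y : b # k -> preorder (PP b) (LL b) -> p # PP b ->
  p ⊩[b] pair_in (RR b) x y <-> forall g : generic_at b, g ∋ p -> pair x.[g] y.[g] # (RR b).[g].
Proof. by move=> Hb PO; apply: (forced_pair_in_iff V_countable PO) => q r; exact: (stage_dom (subS Hb)). Qed.

Lemma stage_preorder c : c # k.+1 -> preorder (PP c) (LL c).
Proof.
elim/eps_ind: c.
move=> c IH Hc; have POb b : b # c -> preorder (PP b) (LL b).
{ by move=> Hb; exact: (IH b Hb (stage_trans Hc (subS Hb))). }
have pairP b p x y (Hb : b # c) := @stage_pair_in_iff b p x y (stage_in Hc Hb) (POb b Hb).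
split=> [p Hp|p q r Hpq Hqr].
- apply/(iter_le I Hc); splits=> b Hb; apply/(pairP _ _ _ _ Hb (cond_restr Hc Hp (subS Hb))) => g Gp.
  apply: (order_refl (stage_preorder_iterand g (stage_in Hc Hb) (POb b Hb))).
  exact: (@Forces_sound _ _ _ (POb b Hb) (fun T e => FMem (e 0) (e 1)) _
  (scons (app p b) (fun _ => QQ b)) _ g Gp (cond_coordinate_forced Hc Hp Hb)).
- have [[Hp Hq][_ Hr]] := (stage_dom Hc Hpq, stage_dom Hc Hqr).
  apply/(iter_le I Hc); splits=> b Hb; have Hbc := subS Hb.
  apply/(pairP _ _ _ _ Hb (cond_restr Hc Hp Hbc)) => g Gp.
  have Gq := filter_up (set_filter g) Gp (cond_restr Hc Hq Hbc) (restr_le Hc Hbc Hpq).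
  move/(iter_le I Hc): Hpq => [_ [_ /(_ b Hb)/(pairP _ _ _ _ Hb (cond_restr Hc Hp Hbc)) H1]].
  move/(iter_le I Hc): Hqr => [_ [_ /(_ b Hb)/(pairP _ _ _ _ Hb (cond_restr Hc Hq Hbc)) H2]].
  exact: (order_trans (stage_preorder_iterand g (stage_in Hc Hb) (POb b Hb)) (H1 g Gp) (H2 g Gq)).
Qed.

Lemma le_refl c p : c # k.+1 -> p # PP c -> p <=[c] p.
Proof. by move=> Hc; exact: (stage_preorder Hc).1. Qed.
Lemma le_trans c p q r : c # k.+1 -> p <=[c] q -> q <=[c] r -> p <=[c] r.
Proof. by move=> Hc; exact: (stage_preorder Hc).2. Qed.
Lemma forces_le c phi p q : c # k.+1 -> q <=[c] p -> p ⊩[c] phi -> q ⊩[c] phi.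
Proof. by move=> Hc H; have [Hq Hp] := stage_dom Hc H; exact: (Forces_mono (stage_preorder Hc).2 Hp Hq H). Qed.

Section Stage.
Variable b : V.

Lemma generic_up (g : generic_at b) p q : b # k.+1 -> p <=[b] q -> g ∋ p -> g ∋ q.
Proof. by move=> Hb H Gp; exact: (filter_up (set_filter g) Gp (stage_dom Hb H).2 H). Qed.
Lemma iterand_preorder (g : generic_at b) : b # k -> preorder_with_top (QQ b).[g] (RR b).[g] (OO b).[g].
Proof. by move=> Hb; exact: (stage_preorder_iterand g Hb (stage_preorder (subS Hb))). Qed.

Hypothesis Hb : b # k.+1.
Let PO := stage_preorder Hb.
Let dom p q : p <=[b] q -> p # PP b /\ q # PP b := stage_dom Hb (p := p) (q := q).

Lemma stage_mem_iff x y p : p # PP b -> p ⊩[b] FMem x y <-> forall g : generic_at b, g ∋ p -> x.[g] # y.[g].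
Proof. exact: (forced_mem_iff V_countable PO dom). Qed.
Lemma stage_eq_iff x y p : p # PP b -> p ⊩[b] FEq x y <-> forall g : generic_at b, g ∋ p -> x.[g] = y.[g].
Proof. exact: (forced_eq_iff V_countable PO dom). Qed.

Lemma stage_iff (Phi : scheme) e p : schematic Phi -> p # PP b ->
  p ⊩[b] Phi V e <-> forall g : generic_at b, g ∋ p -> sat mem (Phi g (fun n => (e n).[g])).
Proof. by move=> SPhi; exact: (forced_iff V_countable PO dom SPhi). Qed.

Lemma stage3_iff (Phi : forall T : Type, T -> T -> T -> form T) x y z p :
  schematic (fun T e => Phi T (e 0) (e 1) (e 2)) -> p # PP b ->
  p ⊩[b] Phi V x y z <-> forall g : generic_at b, g ∋ p -> sat mem (Phi g x.[g] y.[g] z.[g]).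
Proof. exact: (stage_iff (scons x (scons y (fun _ => z)))). Qed.

Lemma stage4_iff (Phi : forall T : Type, T -> T -> T -> T -> form T) x y z w p :
  schematic (fun T e => Phi T (e 0) (e 1) (e 2) (e 3)) -> p # PP b -> p ⊩[b] Phi V x y z w <->
  forall g : generic_at b, g ∋ p -> sat mem (Phi g x.[g] y.[g] z.[g] w.[g]).
Proof. exact: (stage_iff (scons x (scons y (scons z (fun _ => w))))). Qed.

Lemma ex_generic p : p # PP b -> exists g : generic_at b, g ∋ p.
Proof. exact: (ex_generic_extension V_countable PO dom). Qed.

Section Truth.
Variables (g : generic_at b) (q : V).
Hypothesis Gq : g ∋ q.

Lemma stage_truth (Phi : scheme) e : schematic Phi ->
  sat mem (Phi g (fun n => (e n).[g])) -> exists r, g ∋ r /\ r <=[b] q /\ r ⊩[b] Phi V e.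
Proof.
move=> S /(generic_forced PO S)[p[Gp[Hp Fp]]].
have [r[Gr[L1 L2]]] := filter_meet (set_filter g) Gp Gq.
by exists r; splits; exact: forces_le L1 Fp.
Qed.

Lemma stage3_truth (Phi : forall T : Type, T -> T -> T -> form T) x y z :
  schematic (fun T e => Phi T (e 0) (e 1) (e 2)) -> sat mem (Phi g x.[g] y.[g] z.[g]) ->
  exists r, g ∋ r /\ r <=[b] q /\ r ⊩[b] Phi V x y z.
Proof. exact: (stage_truth (e := scons x (scons y (fun _ => z)))). Qed.
End Truth.

Lemma coord_val c p (g : generic_at b) : c # k.+1 -> p # PP c -> b # c -> g ∋ restr p b -> (app p b).[g] # (QQ b).[g].
Proof.
move=> Hc Hp Hbc; have Hr := cond_restr Hc Hp (subS Hbc).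
exact: ((stage_mem_iff _ _ Hr).1 (cond_coordinate_forced Hc Hp Hbc)).
Qed.
End Stage.

Lemma le_iff c p q : c # k.+1 -> p # PP c -> q # PP c -> p <=[c] q <-> ∀ b # c, forall g : generic_at b, g ∋ restr p b ->
  pair (app p b).[g] (app q b).[g] # (RR b).[g].
Proof.
move=> Hc Hp Hq.
have pairP b x y (Hb : b # c) := @stage_pair_in_iff b (restr p b) x y (stage_in Hc Hb)
  (stage_preorder (stage_trans Hc (subS Hb))) (cond_restr Hc Hp (subS Hb)).
rewrite (iter_le I Hc); split=> [[_[_ H]] b Hb|H]; first exact/(pairP _ _ _ Hb)/H.
by splits=> b Hb; apply/(pairP _ _ _ Hb); exact: H.
Qed.

Lemma ex_coordinate b (Phi : scheme) (e : nat -> V) p : schematic Phi -> b # k -> p # PP b -> (forall g : generic_at b, g ∋ p ->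
  exists u : g, u # (QQ b).[g] /\ sat mem (Phi g (scons u (fun n => (e n).[g])))) ->
  exists y, coordinate b y /\ p ⊩[b] FMem y (QQ b) /\ p ⊩[b] Phi V (scons y e).
Proof.
move=> SPhi Hb Hp H; have Hbk := subS Hb.
pose skip1 n := match n with 0 => 0 | S n => S (S n) end.
pose Psi T (e : nat -> T) := (e 0 ∈ e 1 ∧ Phi T (fun n => e (skip1 n)))%F.
have SPsi : schematic Psi.
{ exact: schematic_imp (schematic_imp (schematic_mem 0 1) (schematic_imp (schematic_rename skip1 SPhi) schematic_bot)) schematic_bot. }
have E (T : Type) (y d : T) e0 : (fun n => scons y (scons d e0) (skip1 n)) = scons y e0.
{ by apply: funext => -[|n]. }
have val_scons (g : generic_at b) y e0 : (fun n => (scons y e0 n).[g]) = scons y.[g] (fun n => (e0 n).[g]).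
{ by apply: funext => -[|n]. }
have satP (g : generic_at b) (w : g) : sat mem (Psi g (scons w (fun n => (scons (QQ b) e n).[g]))) <->
  w # (QQ b).[g] /\ sat mem (Phi g (scons w (fun n => (e n).[g]))).
{ by rewrite val_scons /Psi sat_and E. }
have [|x Hx] := generic_maximal_principle V_countable (stage_preorder Hbk) (fun a a' => @stage_dom b a a' Hbk)
  (e := scons (QQ b) e) SPsi Hp.
{ by move=> g Gp; have [u Hu] := H g Gp; exists u; apply/satP. }
have {}Hx (g : generic_at b) : g ∋ p -> x.[g] # (QQ b).[g] /\ sat mem (Phi g (scons x.[g] (fun n => (e n).[g]))).
{ by move=> Gp; apply/satP; rewrite -val_scons; exact: ((stage_iff Hbk _ SPsi Hp).1 Hx). }
have [|y [Cy /(stage_eq_iff Hbk _ _ Hp) Ey]] := iter_full I Hb Hp (x := x).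
{ by apply/(stage_mem_iff Hbk _ _ Hp) => g Gp; case: (Hx g Gp). }
exists y; splits.
- by apply/(stage_mem_iff Hbk _ _ Hp) => g Gp; rewrite -(Ey g Gp); case: (Hx g Gp).
- by apply/(stage_iff Hbk _ SPhi Hp) => g Gp; rewrite val_scons -(Ey g Gp); case: (Hx g Gp).
Qed.

Section Construction.
Variables (c b0 p0 : V) (Rel : V -> V -> V -> Prop).
Hypotheses (Hc : c # k.+1) (Hb0 : b0 # c.+1) (Hp0 : p0 # PP b0) (Rel_definable : Definable3 Rel).
Definition follows b s : Prop := (∀ z # b, z # b0 -> app s z = app p0 z) /\ ∀ z # b, ~ z # b0 -> Rel z (restr s z) (app s z).

Lemma follows_restr d b s : ord d -> b # d -> fun_on s d -> follows d s -> follows b (restr s b).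
Proof.
move=> Od Hb Fs [K1 K2]; have Sb z (Hz : z # b) : z # d := ord_trans Od Hz Hb.
split=> z Hz Jz; rewrite (app_restr Fs Sb Hz); first exact: (K1 z (Sb z Hz) Jz).
by rewrite (restr_ord s (ord_in Od Hb) Hz); exact: (K2 z (Sb z Hz) Jz).
Qed.

Hypothesis Rel_ex : forall b s, b # c -> ~ b # b0 -> s # PP b -> follows b s ->
  exists y, coordinate b y /\ s ⊩[b] FMem y (QQ b) /\ Rel b s y.
Hypothesis Rel_supported : forall b s, b # c.+1 -> b0 # b -> inacc b -> fun_on s b ->
  (∀ z # b, restr s z # PP z) -> follows b s -> ∃ d # b, supported d b s.
Let Hb0k := stage_trans Hc Hb0.
Definition chosen_at b s y : Prop := (b # b0 -> y = app p0 b) /\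
  (~ b # b0 -> coordinate b y /\ s ⊩[b] FMem y (QQ b) /\ Rel b s y).

Lemma chosen_follows b s : (∀ z # b, chosen_at z (restr s z) (app s z)) -> follows b s.
Proof. by move=> H; split=> z Hz J; [exact: ((H z Hz).1 J)|exact: ((H z Hz).2 J).2.2]. Qed.

Lemma restr_chosen b s z : b # c.+1 -> fun_on s b -> (∀ z # b, chosen_at z (restr s z) (app s z)) ->
  z # b.+1 -> z # b0.+1 -> restr s z = restr p0 z.
Proof.
move=> Hb Fs H Hz Hz0; have Sb := ord_subS (ord_stage (stage_trans Hc Hb)) Hz.
have S0 := ord_subS (ord_stage Hb0k) Hz0; have F0 := cond_fun_on Hb0k Hp0.
apply: (fun_on_ext (fun_on_restr Fs Sb) (fun_on_restr F0 S0)) => v Hv.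
by rewrite (app_restr Fs Sb Hv) (app_restr F0 S0 Hv); apply: (H v _).1; [exact: Sb|exact: S0].
Qed.

Lemma chosen_condition b : b # c.+1 -> forall s, fun_on s b -> (∀ z # b, chosen_at z (restr s z) (app s z)) -> s # PP b.
Proof.
elim/eps_ind: b.
move=> b IH Hb s Fs H; have Hbk := stage_trans Hc Hb; have Ob := ord_stage Hbk.
case: (classic (b # b0.+1)) => [J|J].
{ by rewrite -(restr_dom Fs) (restr_chosen Hb Fs H (memS b) J); exact: (cond_restr Hb0k Hp0). }
have {}J : b0 # b.
{ case: (ord_total Ob (ordS (ord_stage Hb0k))) => [//|[->|K]]; first exact: memS.
  exact: (ord_trans Ob (memS b0) K). }
have restr_cond z : z # b -> restr s z # PP z.
{ move=> Hz; apply: IH => //; first exact: (ord_trans (ordS (ord_stage Hc)) Hz Hb).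
  - by apply: fun_on_restr Fs _ => v Hv; exact: (ord_trans Ob Hv Hz).
  - move=> v Hv; have Hvb := ord_trans Ob Hv Hz; rewrite (restr_ord s (ord_in Ob Hz) Hv).
  by rewrite (app_restr Fs (ord_subS Ob (subS Hz)) Hv); exact: H. }
apply/(iter_condition I Hbk); rewrite /condition; splits; last by move=> K; apply: Rel_supported => //; exact: chosen_follows.
move=> z Hz; case: (classic (z # b0)) => [K|/(H z Hz).2[Cz[Fz _]] //].
rewrite ((H z Hz).1 K) (restr_chosen Hb Fs H (subS Hz) (subS K)).
by split; [exact: (cond_coordinate Hb0k Hp0 K)|exact: (cond_coordinate_forced Hb0k Hp0 K)].
Qed.

Lemma coordinate_in b y t : trans t -> Qs # t -> coordinate b y -> y # t.
Proof.
move=> Tt HQ [s]; rewrite /QQ /app => /in_union[w[Hw K]].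
move: Hw => /in_sep[_ Hw]; exact: (in_pair_trans Tt (Tt _ (pair_in_trans Tt HQ Hw).2 _ K)).1.
Qed.

Lemma ex_condition : ∃ r # PP c, restr r b0 = p0 /\ ∀ b # c, ~ b # b0 -> Rel b (restr r b) (app r b).
Proof.
have Oc := ord_stage Hc; have F0 := cond_fun_on Hb0k Hp0.
pose R s y := exists b, fun_on s b /\ chosen_at b s y; pose t := trcl (duo p0 Qs).
have Tt : trans t by exact: trans_trcl.
have chosenP b s : b # c.+1 -> fun_on s b -> (∀ z # b, R (restr s z) (app s z)) -> ∀ z # b, chosen_at z (restr s z) (app s z).
{ move=> Hb Fs H z Hz; have [z'[Fz' K]] := H z Hz.
  have Fz := fun_on_restr Fs (ord_subS (ord_stage (stage_trans Hc Hb)) (subS Hz)).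
  by rewrite -{1}(dom_unique Fz' Fz). }
have [b s Hb Fs H|s[Fs H]] := @transfinite_choice V t R c Oc _.
- have Hb' := subS Hb; have C := chosenP b s Hb' Fs (fun z Hz => (H z Hz).2).
  case: (classic (b # b0)) => [J|J].
  + exists (app p0 b); split; last by exists b; split.
  by apply: (pair_in_trans Tt _ (pair_app F0 J)).2; apply/in_trcl/in_duo; left.
  + have [y[Cy[Fy Ry]]] := Rel_ex Hb J (chosen_condition Hb' Fs C) (chosen_follows C).
  exists y; split; last by exists b; split.
  by apply: (coordinate_in Tt _ Cy); apply/in_trcl/in_duo; right.
- have Hcc := memS c; have C := chosenP c s Hcc Fs (fun z Hz => (H z Hz).2).
  exists s; splits; [exact: (chosen_condition Hcc Fs C)| |exact: (chosen_follows C).2].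
  by rewrite (restr_chosen Hcc Fs C Hb0 (memS b0)) (restr_dom F0).
Qed.
End Construction.

Lemma le_extend c b0 p q : c # k.+1 -> b0 # c.+1 -> p # PP c -> q # PP c -> restr p b0 <=[b0] restr q b0 ->
  (∀ b # c, ~ b # b0 -> restr p b <=[b] restr q b -> forall g : generic_at b, g ∋ restr p b -> pair (app p b).[g] (app q b).[g] # (RR b).[g]) ->
  p <=[c] q.
Proof.
move=> Hc Hb0 Hp Hq H0 H; have Oc := ord_stage Hc; have Hb0k := stage_trans Hc Hb0.
suff K b : b # c.+1 -> restr p b <=[b] restr q b.
{ by move: (K c (memS c)); rewrite (restr_dom (cond_fun_on Hc Hp)) (restr_dom (cond_fun_on Hc Hq)). }
elim/eps_ind: b => b IH Hb; have Hbk := stage_trans Hc Hb; have Ob := ord_stage Hbk.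
apply/(le_iff Hbk (cond_restr Hc Hp Hb) (cond_restr Hc Hq Hb)) => z Hz g Gp.
have Hzc := ord_subS Oc Hb Hz; rewrite (cond_app_restr Hc Hp Hb Hz) (cond_app_restr Hc Hq Hb Hz).
move: Gp; rewrite (restr_ord p Ob Hz) => Gp.
case: (classic (z # b0)) => [J|J]; last exact: (H z Hzc J (IH z Hz (subS Hzc)) g Gp).
move/(le_iff Hb0k (cond_restr Hc Hp Hb0) (cond_restr Hc Hq Hb0)): H0 => /(_ z J g).
rewrite (cond_app_restr Hc Hp Hb0 J) (cond_app_restr Hc Hq Hb0 J) (restr_ord p (ord_stage Hb0k) J); exact.
Qed.

Section Mixture.
Variables c b0 u r w : V.
Hypotheses (Hc : c # k.+1) (Hb0 : b0 # c.+1) (Hwr : w <=[c] r) (Hur : u <=[b0] restr r b0).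
Let Hw := (stage_dom Hc Hwr).1.
Let Hr := (stage_dom Hc Hwr).2.
Let Hu := (stage_dom (stage_trans Hc Hb0) Hur).1.
Let Oc := ord_stage Hc.

Definition mixed_at b y s : Prop := forall g : generic_at b, g ∋ s ->
  (g ∋ restr w b -> y.[g] = (app w b).[g]) /\ (~ g ∋ restr w b -> y.[g] = (app r b).[g]).
Definition mixture T (e : nat -> T) : form T := ((e 1 ∈ e 2 ⇒ e 0 ≐ e 3) ∧ (¬ e 1 ∈ e 2 ⇒ e 0 ≐ e 4))%F.
Definition mixture_env b n : V := match n with
  | 0 => check (PP b) (restr w b) | 1 => generic_name (PP b) | 2 => app w b | _ => app r b end.

Lemma sat_mixture b (g : generic_at b) (y : g) : sat mem (mixture (scons y (fun n => (mixture_env b n).[g]))) <->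
  (g ∋ restr w b -> y = (app w b).[g]) /\ (~ g ∋ restr w b -> y = (app r b).[g]).
Proof. by rewrite /mixture sat_and /= (val_check g) (val_generic_name g). Qed.

Lemma forced_mixture b y s : b # c -> s # PP b -> s ⊩[b] mixture (scons y (mixture_env b)) <-> mixed_at b y s.
Proof.
move=> Hb Hs; have SM : schematic mixture by rewrite /mixture; exact _.
have E (g : generic_at b) : (fun n => (scons y (mixture_env b) n).[g]) =
  scons y.[g] (fun n => (mixture_env b n).[g]) by apply: funext => -[|n].
rewrite (stage_iff (stage_trans Hc (subS Hb)) _ SM Hs); split=> H g Gs.
- by apply/sat_mixture; rewrite -E; exact: H.
- by rewrite E; apply/sat_mixture; exact: H.
Qed.

Lemma mixed_le b s : b # c.+1 -> s # PP b -> (∀ z # b, z # b0 -> app s z = app u z) ->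
  (∀ z # b, ~ z # b0 -> mixed_at z (app s z) (restr s z)) -> s <=[b] restr r b.
Proof.
move=> Hb Hs E M; have Hbk := stage_trans Hc Hb; have Ob := ord_stage Hbk.
have Hrb := cond_restr Hc Hr Hb; have Fs := cond_fun_on Hbk Hs.
have [d[Hd[Hd0 Sd]]] : ∃ d # b.+1, d # b0.+1 /\ ∀ z # b, z # b0 -> z # d.
{ case: (ord_total Ob (ord_stage (stage_trans Hc Hb0))) => [K|[->|K]].
  - by exists b; splits; [exact: memS|exact: subS].
  - by exists b0; splits; exact: memS.
  - by exists b0; splits; [exact: subS|exact: memS]. }
have Sd0 := ord_subS (ord_stage (stage_trans Hc Hb0)) Hd0; have Sdb := ord_subS Ob Hd.
apply: (le_extend Hbk Hd Hs Hrb) => [|z Hz Nz _ g Gs].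
- have -> : restr s d = restr u d.
  { have Fu := cond_fun_on (stage_trans Hc Hb0) Hu.
  apply: (fun_on_ext (fun_on_restr Fs Sdb) (fun_on_restr Fu Sd0)) => z Hz.
  by rewrite (app_restr Fs Sdb Hz) (app_restr Fu Sd0 Hz) E //; [exact: Sdb|exact: Sd0]. }
  rewrite (restr_restr _ Sdb) -(restr_restr r Sd0); exact: (restr_le (stage_trans Hc Hb0) Hd0 Hur).
- have Hzc := ord_subS Oc Hb Hz; have Hzk := stage_in Hc Hzc.
  rewrite (cond_app_restr Hc Hr Hb Hz).
  have [|K1 K2] := M z Hz _ g Gs; first by move=> J; apply: Nz; exact: Sd.
  case: (classic (g ∋ restr w z)) => [J|J].
  + by rewrite (K1 J); exact: ((le_iff Hc Hw Hr).1 Hwr z Hzc g J).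
  + rewrite -(K2 J); apply: (order_refl (iterand_preorder g Hzk)).
  exact: (coord_val (stage_trans Hc (subS Hzc)) Hbk Hs Hz Gs).
Qed.

Lemma mixed_supported b s : b # c.+1 -> b0 # b -> inacc b -> fun_on s b -> (∀ z # b, restr s z # PP z) ->
  (∀ z # b, z # b0 -> app s z = app u z) -> (∀ z # b, ~ z # b0 -> mixed_at z (app s z) (restr s z)) -> ∃ d # b, supported d b s.
Proof.
move=> Hb Hb0b Ib Fs Hs E M; have Hbk := stage_trans Hc Hb; have Ob := ord_stage Hbk.
have [d1[Hd1 S1]] := cond_supported Hbk (cond_restr Hc Hr Hb) Ib.
have [d2[Hd2 S2]] := cond_supported Hbk (cond_restr Hc Hw Hb) Ib.
have [d3[Hd3[U1 U2]]] := ord_common_bound Ob Hd1 Hd2; have [d[Hd[U3 U4]]] := ord_common_bound Ob Hd3 Hb0b.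
exists d; split=> // z Hz Nz; have Hzc := ord_subS Oc Hb Hz; have Hzk := stage_trans Hc (subS Hzc).
apply/(stage_eq_iff Hzk _ _ (Hs z Hz)) => g Gs.
have supp v d' : v # PP c -> supported d' b (restr v b) -> sub d' d -> g ∋ restr v z -> (app v z).[g] = (OO z).[g].
{ move=> Hv Sv Sd Gv; have := Sv z Hz (fun J => Nz (Sd _ J)).
  rewrite (cond_app_restr Hc Hv Hb Hz) (restr_ord v Ob Hz) => /(stage_eq_iff Hzk _ _ (cond_restr Hc Hv (subS Hzc))).
  by move=> /(_ g Gv). }
have [|K1 K2] := M z Hz _ g Gs; first by move=> J; apply: Nz; exact: U4.
case: (classic (g ∋ restr w z)) => [J|J].
- by rewrite (K1 J); apply: (supp w d2) => // v /U2/U3.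
- rewrite (K2 J); apply: (supp r d1) => [//|//|v /U1/U3 //|].
  apply: (generic_up Hzk _ Gs); apply: mixed_le; [exact: subS|exact: Hs| |].
  + by move=> v Hv Jv; rewrite (app_restr Fs (ord_subS Ob (subS Hz)) Hv) E //; exact: (ord_trans Ob Hv Hz).
  + move=> v Hv Jv; rewrite (app_restr Fs (ord_subS Ob (subS Hz)) Hv) (restr_ord s (ord_in Ob Hz) Hv).
  by apply: M => //; exact: (ord_trans Ob Hv Hz).
Qed.

Lemma ex_mixture : ∃ v # PP c, restr v b0 = u /\ v <=[c] r /\ ∀ b # c, ~ b # b0 -> mixed_at b (app v b) (restr v b).
Proof.
pose Rel b s y := s # PP b /\ s ⊩[b] mixture (scons y (mixture_env b)).
have RelP b s y : b # c -> s # PP b -> Rel b s y <-> mixed_at b y s.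
{ by move=> Hb Hs; rewrite -(forced_mixture _ Hb Hs) /Rel; tauto. }
have mixedP b s : b # c.+1 -> (∀ z # b, ~ z # b0 -> Rel z (restr s z) (app s z)) ->
  ∀ z # b, ~ z # b0 -> mixed_at z (app s z) (restr s z).
{ by move=> Hb H z Hz N; apply/RelP; [exact: (ord_subS Oc Hb)|case: (H z Hz N)|exact: H]. }
have [||b s Hb Nb Hs[E M]|b s Hb Hb0b Ib Fs Hs[E M]|v[Hv[Ev M]]] := @ex_condition c b0 u Rel Hc Hb0 _ _.
- exact: Hu.
- have SM : schematic mixture by rewrite /mixture; exact _.
  apply: definable_and; first by definability.
  by apply: (definable_Forces_schematic (v := fun n e => scons (e 2) (mixture_env (e 0)) n) SM) => [||[|[|[|[|n]]]]|];
  rewrite /=; definability.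
- have SM : schematic mixture by rewrite /mixture; exact _.
  have Hbk := stage_in Hc Hb; have Hsr := mixed_le (subS Hb) Hs E (mixedP b s (subS Hb) M).
  have [g Gs|y[Cy[Fy Hy]]] := ex_coordinate (e := mixture_env b) SM Hbk Hs.
  + have coord v : v # PP c -> g ∋ restr v b -> (app v b).[g] # (QQ b).[g].
  { by move=> Hv; exact: (coord_val (subS Hbk) Hc Hv Hb). }
  case: (classic (g ∋ restr w b)) => J.
  * by exists (app w b).[g]; split; [exact: coord|apply/sat_mixture].
  * exists (app r b).[g]; split; last by apply/sat_mixture.
    by apply: coord => //; exact: (generic_up (subS Hbk) Hsr Gs).
  + by exists y; splits.
- exact: (mixed_supported Hb Hb0b Ib Fs Hs E (mixedP b s Hb M)).
- have {}M := mixedP c v (memS c) M; exists v; splits.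
  rewrite -(restr_dom (cond_fun_on Hc Hr)); apply: (mixed_le (memS c) Hv _ M) => z Hz J.
  by rewrite -Ev (cond_app_restr Hc Hv Hb0 J).
Qed.
End Mixture.

Lemma ex_extension c b0 u r : c # k.+1 -> b0 # c.+1 -> r # PP c -> u <=[b0] restr r b0 -> exists v, v <=[c] r /\ restr v b0 = u.
Proof.
by move=> Hc Hb0 Hr Hu; have [v[_[Ev[Hv _]]]] := ex_mixture Hc Hb0 (le_refl Hc Hr) Hu; exists v.
Qed.

Lemma ex_amalgam c b0 r w : c # k.+1 -> b0 # c.+1 -> w <=[c] r -> exists v, v <=[c] r /\ restr v b0 = restr r b0 /\
  forall u, u <=[c] v -> restr u b0 <=[b0] restr w b0 -> u <=[c] w.
Proof.
move=> Hc Hb0 Hwr; have [Hw Hr] := stage_dom Hc Hwr; have Hb0k := stage_trans Hc Hb0.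
have [v[Hv[Ev[Hvr M]]]] := ex_mixture Hc Hb0 Hwr (le_refl Hb0k (cond_restr Hc Hr Hb0)).
exists v; splits=> u Huv Huw; have [Hu _] := stage_dom Hc Huv.
apply: (le_extend Hc Hb0 Hu Hw Huw) => b Hb Nb Hle g Gu.
have Hbk := stage_trans Hc (subS Hb); have Gw := generic_up Hbk Hle Gu.
have Gv := generic_up Hbk (restr_le Hc (subS Hb) Huv) Gu.
by rewrite -((M b Hb Nb g Gv).1 Gw); exact: ((le_iff Hc Hu Hv).1 Huv b Hb g Gu).
Qed.

Lemma ex_padding c b0 u : c # k.+1 -> b0 # c.+1 -> u # PP b0 -> ∃ v # PP c, restr v b0 = u /\ supported b0 c v.
Proof.
move=> Hc Hb0 Hu; have [|b s Hb Nb Hs _|b s Hb Hb0b _ Fs Hs[_ H]|v[Hv[Ev H]]] :=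
  @ex_condition c b0 u (fun b s y => s ⊩[b] FEq y (OO b)) Hc Hb0 Hu.
- definability.
- have Hbk := stage_in Hc Hb; have Hbs := subS Hbk; have [|y [Cy /(stage_eq_iff Hbs _ _ Hs) Ey]] := iter_full I Hbk Hs (x := OO b).
  { by apply/(stage_mem_iff Hbs _ _ Hs) => g _; exact: (top_in (iterand_preorder g Hbk)). }
  exists y; splits; last by apply/(stage_eq_iff Hbs _ _ Hs) => g Gs; rewrite (Ey g Gs).
  by apply/(stage_mem_iff Hbs _ _ Hs) => g Gs; rewrite -(Ey g Gs); exact: (top_in (iterand_preorder g Hbk)).
- by exists b0.
- by exists v.
Qed.

Lemma le_supported c b0 p w : c # k.+1 -> b0 # c.+1 -> p # PP c -> w # PP c -> supported b0 c w ->
  restr p b0 <=[b0] restr w b0 -> p <=[c] w.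
Proof.
move=> Hc Hb0 Hp Hw S H0; apply: (le_extend Hc Hb0 Hp Hw H0) => b Hb Nb Hle g Gp.
have Hbk := stage_trans Hc (subS Hb); have Gw := generic_up Hbk Hle Gp.
rewrite ((stage_eq_iff Hbk _ _ (cond_restr Hc Hw (subS Hb))).1 (S b Hb Nb) g Gw).
exact: (order_top (iterand_preorder g (stage_in Hc Hb)) (coord_val Hbk Hc Hp Hb Gp)).
Qed.

Variables l X U al : V.
Hypothesis FM : is_fine_measure k l X U.
Notation "H ∩ H'" := (ae_and FM H H') (at level 40, left associativity).
Notation ae_mono := (ae_mono FM).
Notation ae_ex := (ae_ex FM).
Notation ae_select := (ae_select FM).
Notation ae_decided := (ae_decided FM).
Hypotheses (N : normal_function k X U al) (k_card : card k) (k_uncountable : omega V # k)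
  (f_fun : is_fun f) (f_in : forall a e, pair a e # f -> a # k /\ e # k).
Notation ae := (ae U).
Notation "∀* x , P" := (ae (fun x => P)) (at level 200, x name, P at level 200).
Notation "'A' x" := (app al x) (at level 9, x at level 8).
Notation "p ≈[ b ] q" := (p <=[b] q /\ q <=[b] p) (at level 70, b at level 9).
Notation k_succ := (normal_succ FM N k_card).
Let Ok : ord k := k_card.1.
Let k_inacc : inacc k := normal_inacc FM N k_card k_uncountable.

Lemma succ_stage b : b # k -> b.+1 # k.+1.
Proof. by move=> /k_succ; exact: subS. Qed.
Lemma equivalent_trans b p q r : b # k.+1 -> p ≈[b] q -> q ≈[b] r -> p ≈[b] r.
Proof. by move=> Hb [H1 H2] [H3 H4]; split; exact: (le_trans Hb (q := q)). Qed.

Lemma le_local c p q : c # k.+1 -> p # PP c -> q # PP c -> (∀ b # c, restr p b.+1 <=[b.+1] restr q b.+1) -> p <=[c] q.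
Proof.
move=> Hc Hp Hq H; apply/(le_iff Hc Hp Hq) => b Hb g Gp; have Oc := ord_stage Hc.
have Hs := ordS_in Oc Hb; have Hsk := stage_trans Hc Hs; have Hbs := memS b.
move/(le_iff Hsk (cond_restr Hc Hp Hs) (cond_restr Hc Hq Hs)): (H b Hb) => /(_ b Hbs g).
by rewrite (cond_app_restr Hc Hp Hs Hbs) (cond_app_restr Hc Hq Hs Hbs) (restr_ord p (ord_stage Hsk) Hbs); exact.
Qed.

Lemma le_succ b p q : b # k -> p # PP b.+1 -> q # PP b.+1 -> restr p b <=[b] restr q b ->
  (forall g : generic_at b, g ∋ restr p b -> pair (app p b).[g] (app q b).[g] # (RR b).[g]) -> p <=[b.+1] q.
Proof.
move=> Hb Hp Hq H E; apply: (le_extend (succ_stage Hb) (subS (memS b)) Hp Hq H).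
by move=> c /inS[Hc /(_ Hc)//|->] _ _.
Qed.

Lemma le_of_equal_coordinate b p q : b # k -> p # PP b.+1 -> q # PP b.+1 -> restr p b <=[b] restr q b ->
  restr p b ⊩[b] FEq (app p b) (app q b) -> p <=[b.+1] q.
Proof.
move=> Hb Hp Hq H E; apply: (le_succ Hb Hp Hq H) => g Gp; have Hbk := subS Hb.
rewrite -((stage_eq_iff Hbk _ _ (stage_dom Hbk H).1).1 E g Gp).
exact: (order_refl (iterand_preorder g Hb) (coord_val Hbk (succ_stage Hb) Hp (memS b) Gp)).
Qed.

Lemma ex_code_bound b : b # k -> ∃ a # k, forall (g : generic_at b) (u : g), u # (QQ b).[g] -> exists e, codes e u (embed g a).
Proof.
move=> Hb; have [a1[Ha1 E]] : exists a1, a1.+1 # k /\ forall a, pair b a # f -> a1.+1 = a.+1.+1.+1.+1.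
{ case: (classic (exists a, pair b a # f)) => [[a Ha]|Nf].
  - exists a.+1.+1.+1; split; first by do 4 apply: k_succ; case: (f_in Ha).
  by move=> a' /(f_fun.2 _ _ _ Ha) ->.
  - exists emp; split; first by apply: k_succ; exact: (ord_trans Ok (emp_in_omega V) k_uncountable).
  by move=> a Ha; case: Nf; exists a. }
exists a1.+1; split=> // g u Hu; have embedS z := embed_succ (ge_mem g) (ge_transitive g) z.
case: (iterand_cases g Hb (stage_preorder (subS Hb))) => [[a[Ha[_ LS]]]|[Eo[ED _]]].
- rewrite (E a Ha) !embedS; apply: (ex_lottery_code _ LS Hu).
  by apply/(embed_ord (ge_mem g) (ge_transitive g)); exact: (ord_in Ok (f_in Ha).2).
- move/ED: Hu => Eu; subst u; rewrite Eo embedS; apply: (@ex_code _ (sing emp)); last first.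
  + apply: (@inj_lam _ _ _ (fun _ => embed g a1)) => [x _|x x']; first exact: memS.
  by move=> /in_sing -> /in_sing ->.
  + exact/in_sing.
  + by move=> y /in_sing -> z /in_emp.
Qed.

Section CodeNames.
Variables b a : V.
Hypothesis Hb : b # k.
Let Hbk := subS Hb.
Notation check := (check (PP b)).

Lemma forced_code_iff p e y : p # PP b -> p ⊩[b] code e y (check a) <->
  forall g : generic_at b, g ∋ p -> codes e.[g] y.[g] (embed g a).
Proof.
move=> Hp; rewrite (stage3_iff Hbk (Phi := @code)) //.
by split=> H g Gp; move: (H g Gp); rewrite ?(val_check g) => /means_code; rewrite ?(val_check g).
Qed.

Lemma ex_code_name p y : (forall (g : generic_at b) (u : g), u # (QQ b).[g] -> exists e, codes e u (embed g a)) ->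
  p # PP b -> p ⊩[b] FMem y (QQ b) -> exists e, p ⊩[b] code e y (check a).
Proof.
move=> H Hp /(stage_mem_iff Hbk _ _ Hp) Hy; have S : schematic (fun T e => code (e 0) (e 1) (e 2)) by exact _.
apply: (generic_maximal_principle V_countable (stage_preorder Hbk) (fun q r => @stage_dom b q r Hbk)
  (e := scons y (fun _ => check a)) S Hp) => g Gp.
by have [e He] := H g _ (Hy g Gp); exists e; apply/means_code; rewrite /= (val_check g).
Qed.

Lemma code_names_agree C p e e' y y' : sub C (PP b) -> (∀ q # PP b, ∃ c # C, q ≈[b] c) ->
  p # PP b -> p ⊩[b] code e y (check a) -> p ⊩[b] code e' y' (check a) -> (∀ v # a, ∀ w # a, ∀ q # C,
  (q ⊩[b] FMem (check (pair v w)) e <-> q ⊩[b] FMem (check (pair v w)) e')) -> p ⊩[b] FEq y y'.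
Proof.
move=> SC RC Hp /(forced_code_iff _ _ Hp) K /(forced_code_iff _ _ Hp) K' H.
apply/(stage_eq_iff Hbk _ _ Hp) => g Gp; have [Im It] := (ge_mem g, ge_transitive g).
have incl d d' : sub d.[g] (prod (embed g a) (embed g a)) -> (∀ v # a, ∀ w # a,
  ∀ q # C, q ⊩[b] FMem (check (pair v w)) d -> q ⊩[b] FMem (check (pair v w)) d') -> sub d.[g] d'.[g].
{ move=> Sd Hd z Hz; have [z1 [z2 [/(in_embed Im It)[v[-> Hv]] [/(in_embed Im It)[w[-> Hw]] Ez]]]] : 
  exists z1 z2 : g, z1 # embed g a /\ z2 # embed g a /\ z = pair z1 z2 by apply/in_prod/Sd.
  move: Hz; rewrite Ez -(embed_pair Im It) -(val_check g) => /(val_mem g (stage_preorder Hbk))[q[Gq Fq]].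
  have Hq := generic_sub g Gq; have [c[Hc[Hqc Hcq]]] := RC q Hq.
  have /(stage_mem_iff Hbk _ _ (SC c Hc)) Fc := Hd v Hv w Hw c Hc (forces_le Hbk Hcq (Fq : q ⊩[b] FMem _ _)).
  exact: (Fc g (generic_up Hbk Hqc Gq)). }
have Ee : e.[g] = e'.[g].
{ apply: sub_antisym; apply: incl; try by move=> v Hv w Hw q Hq; case: (H v Hv w Hw q Hq).
  - exact: (codes_sub (K g Gp)).
  - exact: (codes_sub (K' g Gp)). }
by move: (K' g Gp); rewrite -Ee; exact: (codes_inj (K g Gp)).
Qed.
End CodeNames.

Definition almost_constant b : Prop := forall F, fun_on F X -> (∀* x, app F x # PP b) ->
  ∃ p # PP b, ∀* x, app F x ≈[b] p.

Lemma almost_constant_restr b c F : b # c -> c # k.+1 -> almost_constant b -> (∀* x, app F x # PP c) ->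
  ∃ p # PP b, ∀* x, restr (app F x) b ≈[b] p.
Proof.
move=> Hb Hc AC HF; have [||p[Hp Ep]] := AC (lam X (fun x => restr (app F x) b)).
- exact: fun_on_lam.
- by apply: (ae_mono HF) => x Hx H; rewrite app_lam //; exact: (cond_restr Hc H (subS Hb)).
- by exists p; split=> //; apply: (ae_mono Ep) => x Hx; rewrite app_lam.
Qed.

Lemma almost_constant_succ b : b # k -> almost_constant b -> almost_constant b.+1.
Proof.
move=> Hb AC F FF HF; have Hs := succ_stage Hb; have Hbs := memS b; have Hbk := subS Hb.
have [p[Hp Ep]] := almost_constant_restr Hbs Hs AC HF.
have [C[SC[smC RC]]] : exists C, sub C (PP b) /\ small C k /\ ∀ q # PP b, ∃ c # C, q ≈[b] c.
{ apply: (small_representatives FM N k_card _ _ _ _ AC) => [q Hq|q r[]|q r s] //; last exact: equivalent_trans.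
  by split; exact: le_refl. }
have [a[Ha Hcode]] := ex_code_bound Hb.
have [|names[_ Hnames]] := ae_select (Q := fun x e => p ⊩[b] code e (app (app F x) b) (check (PP b) a)) _.
{ apply: (ae_mono (HF ∩ Ep)) => x _ [Hx[_ Hpx]]; apply: (ex_code_name Hb Hcode Hp).
  exact: (forces_le Hbk Hpx (cond_coordinate_forced Hs Hx Hbs)). }
pose Q v w q x := q ⊩[b] FMem (check (PP b) (pair v w)) (app names x).
have decided : ∀* x, ∀ v # a, ∀ w # a, ∀ q # C, (Q v w q x <-> ae (Q v w q)).
{ have Sa := small_mem Ha; apply: (ae_forall_small FM _ Sa) => v _.
  apply: (ae_forall_small FM _ Sa) => w _; exact: (ae_decides FM _ smC). }
have J := HF ∩ Ep ∩ (Hnames ∩ decided).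
have [x0[_[[H0[L0 M0]][N0 D0]]]] := ae_ex J; exists (app F x0); split=> //.
apply: (ae_mono J) => x _ [[H1[L1 M1]][N1 D1]].
have E : p ⊩[b] FEq (app (app F x) b) (app (app F x0) b).
{ apply: (code_names_agree Hb SC RC Hp N1 N0) => v Hv w Hw q Hq; move: (D1 v Hv w Hw q Hq) (D0 v Hv w Hw q Hq).
  by rewrite /Q => -> ->. }
have E' : p ⊩[b] FEq (app (app F x0) b) (app (app F x) b).
{ by apply/(stage_eq_iff Hbk _ _ Hp) => g Gp; rewrite ((stage_eq_iff Hbk _ _ Hp).1 E g Gp). }
by split; apply: (le_of_equal_coordinate Hb) => //; [exact: (le_trans Hbk L1 M0)|exact: (forces_le Hbk L1 E)|
  exact: (le_trans Hbk L0 M1)|exact: (forces_le Hbk L0 E')].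
Qed.

Lemma stage_almost_constant b : b # k -> almost_constant b.
Proof.
elim/eps_ind: b.
move=> b IH Hb F FF HF; have Hbk := subS Hb; have Ob := ord_in Ok Hb.
have IH' c : c # b -> almost_constant c by move=> Hc; apply: IH => //; exact: (ord_trans Ok Hc Hb).
case: (classic (exists c, b = c.+1)) => [[c Eb]|Nb].
{ subst b; apply: almost_constant_succ => //; first exact: (ord_trans Ok (memS c) Hb).
  exact: (IH' _ (memS c)). }
have succ_in c : c # b -> c.+1 # b by move=> Hc; case/inS: (ordS_in Ob Hc) => // E; case: Nb; exists c.
have [c Hc|h[Fh Hh]] := ex_choice_fun (R := fun c p => p # PP c /\ ∀* x, restr (app F x) c ≈[c] p) _ (a := b); first exact: (almost_constant_restr Hc Hbk (IH' c Hc) HF).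
have E : ∀* x, ∀ c # b, restr (app F x) c ≈[c] app h c.
{ by apply: (ae_forall_small FM _ (small_mem Hb)) => c /Hh[]. }
have J := HF ∩ E; have [x0[_[H0 E0]]] := ae_ex J; exists (app F x0); split=> //.
apply: (ae_mono J) => x _ [H1 E1].
by split; apply: (le_local Hbk) => // c /succ_in Hc; have [[L0 M0][L1 M1]] := (E0 _ Hc, E1 _ Hc);
  [exact: (le_trans (subS (ord_trans Ok Hc Hb)) L1 M0)|exact: (le_trans (subS (ord_trans Ok Hc Hb)) L0 M1)].
Qed.

Lemma ae_reflected F : fun_on F X -> (∀* x, app F x # PP (A x)) ->
  exists d w, d # k /\ w # PP k /\ supported d k w /\ ∀* x, app F x ≈[A x] restr w (A x).
Proof.
move=> FF HF; have Hk := memS k; have Ax := normal_lt N.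
have [|d[Hd Sd]] := regressive_constant FM N (R := fun x d => d # A x /\ supported d (A x) (app F x)) _.
{ apply: (ae_mono (HF ∩ (Ax ∩ ae_inacc FM N k_card k_uncountable))) => x _ [Hx[Kx Ix]].
  by have [d[Hd Sd]] := cond_supported (subS Kx) Hx Ix; exists d. }
have [||p[Hp Ep]] := stage_almost_constant Hd (F := lam X (fun x => restr (app F x) d)); first exact: fun_on_lam.
{ apply: (ae_mono (HF ∩ (Ax ∩ Sd))) => x Hx [H[K[Hdx _]]]; rewrite app_lam //.
  exact: (cond_restr (subS K) H (subS Hdx)). }
have [w[Hw[Ew Sw]]] := ex_padding Hk (subS Hd) Hp; exists d, w; splits.
apply: (ae_mono (HF ∩ Ep ∩ (Ax ∩ Sd))) => x Hx [[H E][Kx[Hdx Sx]]].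
move: E; rewrite app_lam // => -[E1 E2]; have Hxk := subS Kx; have Hdx' := subS Hdx.
have Hw' := cond_restr Hk Hw Hxk; have Ew' : restr (restr w (A x)) d = p by rewrite (restr_ord w (ord_stage Hxk) Hdx).
split; apply: (le_supported Hxk Hdx') => //; rewrite ?Ew' // => b Hb Nb.
by rewrite (cond_app_restr Hk Hw Hxk Hb) (restr_ord w (ord_stage Hxk) Hb); apply: Sw => //; exact: (ord_trans Ok Hb Kx).
Qed.

Definition saturated b Z c : Prop := sub c (prod Z (PP b)) /\ forall z q, z # Z -> q # PP b ->
  (pair z q # c <-> forall q', q' <=[b] q -> exists r, r <=[b] q' /\ pair z r # c).
Definition saturation b Z (R : V -> V -> Prop) : V :=
  sep (prod Z (PP b)) (fun t => forall q, q <=[b] pr2 t -> exists r, r <=[b] q /\ R (pr1 t) r).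

Let Hk : k # k.+1 := memS k.

Section Saturation.
Variables b Z : V.
Hypothesis Hb : b # k.+1.

Lemma in_saturation (R : V -> V -> Prop) z q : Definable2 R -> pair z q # saturation b Z R <->
  z # Z /\ q # PP b /\ forall q', q' <=[b] q -> exists r, r <=[b] q' /\ R z r.
Proof. by move=> DR; rewrite /saturation in_sep pair_prod pr1_pair pr2_pair; tauto. Qed.

Lemma saturation_of_forced (R : V -> V -> Prop) z q : Definable2 R -> z # Z -> q # PP b ->
  (forall q', q' <=[b] q -> R z q') -> pair z q # saturation b Z R.
Proof.
move=> DR Hz Hq H; apply/in_saturation; split=> //; split=> // q' L; exists q'; split; last exact: H.
exact: (le_refl Hb (stage_dom Hb L).1).
Qed.

Lemma saturated_saturation (R : V -> V -> Prop) : Definable2 R -> saturated b Z (saturation b Z R).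
Proof.
move=> DR; split=> [t|z q Hz Hq]; first by rewrite /saturation in_sep => -[].
split=> [H|H].
- move=> q' L; have Hq' := (stage_dom Hb L).1; exists q'; split; first exact: le_refl.
  move/in_saturation: H => [_[_ H]]; apply/in_saturation; splits=> r Lr; apply: H; exact: (le_trans Hb Lr L).
- apply/in_saturation; splits=> q' L; have [r[Lr /in_saturation[_[Hr K]]]] := H q' L.
  have [s[Lsr Hs]] := K r (le_refl Hb Hr); exists s; split=> //; exact: (le_trans Hb Lsr Lr).
Qed.

Variable c : V.
Hypothesis Sc : saturated b Z c.

Lemma saturated_in z q : pair z q # c -> z # Z /\ q # PP b.
Proof. by move=> /Sc.1/pair_prod. Qed.

Lemma saturated_le z q q' : pair z q # c -> q' <=[b] q -> pair z q' # c.
Proof.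
move=> H L; have [Hz Hq] := saturated_in H; apply/(Sc.2 z q' Hz (stage_dom Hb L).1) => r Lr.
by apply: ((Sc.2 z q Hz Hq).1 H); exact: (le_trans Hb Lr L).
Qed.
End Saturation.

Definition pads b q w : Prop := w # PP k /\ restr w b = q /\ supported b k w.

Lemma pads_le b q w v : b # k.+1 -> pads b q w -> v # PP k -> restr v b <=[b] q -> v <=[k] w.
Proof. by move=> Hb [Hw[<- S]] Hv; exact: le_supported. Qed.
Lemma supported_mono b b' w : sub b b' -> supported b k w -> supported b' k w.
Proof. by move=> Sb S c Hc Nc; apply: S => // /Sb. Qed.

Lemma ae_pads w : w # PP k -> ∀* x, A x # k /\ pads (A x) (restr w (A x)) w.
Proof.
move=> Hw; have [d[Hd Sd]] := cond_supported Hk Hw k_inacc.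
apply: (ae_mono (normal_lt N ∩ normal_gt N Hd)) => x _ [Hx Hdx]; rewrite /pads; splits.
by apply: supported_mono Sd => z Hz; exact: (ord_trans (ord_in Ok Hx) Hz Hdx).
Qed.

Lemma le_of_ae v w : v # PP k -> w # PP k -> (∀* x, restr v (A x) <=[A x] restr w (A x)) -> v <=[k] w.
Proof.
move=> Hv Hw H; have [x[_[L[Hx Px]]]] := ae_ex (H ∩ ae_pads Hw).
exact: (pads_le (subS Hx) Px Hv L).
Qed.

Lemma ae_dense (Q : V -> V -> Prop) : Definable2 Q -> (∀ w # PP k, exists w', w' <=[k] w /\ ∀* x, Q x (restr w' (A x))) ->
  (∀* x, ∀ q # PP (A x), exists r, r <=[A x] q /\ Q x r).
Proof.
move=> DQ H; set D := fun x => _.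
case: (ae_decided (Q := D) _) => // J; exfalso.
have [|q[Fq Hq]] := ae_select (Q := fun x q => q # PP (A x) /\ forall r, r <=[A x] q -> ~ Q x r) _.
- apply: (ae_mono J) => x _ K; apply: NNPP => K'; apply: K => q Hq; apply: NNPP => K; apply: K'.
  by exists q; split=> // r Lr Hr; apply: K; exists r.
- have [|d[w[_[Hw[_ E]]]]] := ae_reflected Fq; first by apply: (ae_mono Hq) => x _ [].
  have [w'[Lw K]] := H w Hw.
  have [x[_[[[_ NQ][_ E2]][Kx Hx]]]] := ae_ex (Hq ∩ E ∩ (K ∩ normal_lt N)).
  by apply: NQ Kx; exact: (le_trans (subS Hx) (restr_le Hk (subS Hx) Lw) E2).
Qed.

(* Every condition of some stage b = A x may be strengthened to one that decides, for each z in g, whether z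
   is in the set named by c0; so c0 has an equivalent at stage b. *)
Lemma ex_bounded_name g c0 b0 : g # k -> b0 # k -> saturated k g c0 -> exists b c, b # k /\ sub g b /\ b0 # b /\
  saturated b b c /\ (forall z q, z # g -> q # PP k -> (pair z q # c0 <-> pair z (restr q b) # c)) /\
  forall z q, pair z q # c -> z # g.
Proof.
move=> Hg Hb0 S0.
pose decided z b u := exists w, pads b u w /\ (pair z w # c0 \/ forall w', w' <=[k] w -> ~ pair z w' # c0).
have D : ∀* x, ∀ z # g, ∀ q # PP (A x), exists u, u <=[A x] q /\ decided z (A x) u.
{ apply: (ae_forall_small FM _ (small_mem Hg)) => z _; apply: ae_dense => w Hw.
  have [w'[Lw Dw]] : exists w', w' <=[k] w /\ (pair z w' # c0 \/ forall w'', w'' <=[k] w' -> ~ pair z w'' # c0).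
  { case: (classic (exists w', w' <=[k] w /\ pair z w' # c0)) => [[w'[L K]]|NK]; first by exists w'; auto.
  by exists w; split; [exact: le_refl|right=> w' L K; apply: NK; exists w']. }
  exists w'; split=> //; apply: (ae_mono (ae_pads (stage_dom Hk Lw).1)) => x _ [_ Px]; by exists w'. }
have [x[_[Dx[Hb[Hgb Hb0b]]]]] := ae_ex (D ∩ (normal_lt N ∩ (normal_gt N Hg ∩ normal_gt N Hb0))).
move: Dx Hb Hgb Hb0b; set b := A x => Db Hb Hgb Hb0b; have Hbk := subS Hb; have Sg := ord_subS (ord_in Ok Hb) (subS Hgb).
pose R z q := z # g /\ exists w, pads b q w /\ pair z w # c0.
have lift q q' u w : q' <=[k] q -> u <=[b] restr q' b -> pads b u w -> exists v, v <=[k] q' /\ v <=[k] w.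
{ move=> Lq Lu Pw; have [Hq' _] := stage_dom Hk Lq; have [v[Lv Ev]] := ex_extension Hk Hbk Hq' Lu; exists v; split=> //.
  by apply: (pads_le Hbk Pw (stage_dom Hk Lv).1); rewrite Ev; exact: (le_refl Hbk (stage_dom Hbk Lu).1). }
exists b, (saturation b b R); splits; first exact: saturated_saturation.
- move=> z q Hz Hq; have Hqb := cond_restr Hk Hq Hbk; rewrite in_saturation; split=> [H|[_[_ H]]].
  + splits; first exact: Sg.
  move=> q' Lq; have [u[Lu[w[Pw[Cw|Nw]]]]] := Db z Hz q' (stage_dom Hbk Lq).1.
  * by exists u; split=> //; split=> //; exists w.
  * have [v[Lvq Lvw]] := lift q q u w (le_refl Hk Hq) (le_trans Hbk Lu Lq) Pw.
    by case: (Nw v Lvw); exact: (saturated_le Hk S0 H Lvq).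
  + apply/(S0.2 z q Hz Hq) => q' Lq; have [u[Lu[_[w[Pw Cw]]]]] := H _ (restr_le Hk Hbk Lq).
  have [v[Lvq Lvw]] := lift q q' u w Lq Lu Pw.
  by exists v; split=> //; exact: (saturated_le Hk S0 Cw Lvw).
- by move=> z q /in_saturation[_ [Hq /(_ q (le_refl Hbk Hq))[r[_[]]]]].
Qed.

Lemma chain_condition h : (∀ b # k, app h b # PP k) -> ∃ b # k, ∀* x, exists v, v <=[k] app h b /\ v <=[k] app h (A x).
Proof.
move=> Hh; have Ax := normal_lt N; pose F := lam X (fun x => restr (app h (A x)) (A x)).
have [||d[w[Hd[Hw[Sw E]]]]] := @ae_reflected F; first exact: fun_on_lam.
{ by apply: (ae_mono Ax) => x Hx Kx; rewrite app_lam //; exact: (cond_restr Hk (Hh _ Kx) (subS Kx)). }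
have {}E : ∀* x, restr (app h (A x)) (A x) ≈[A x] restr w (A x).
{ by apply: (ae_mono E) => x Hx; rewrite app_lam. }
have [x0[_[[L0 _][H0 D0]]]] := ae_ex (E ∩ (Ax ∩ normal_gt N Hd)).
exists (A x0); split=> //; move: L0 H0 D0; set b := A x0 => L0 H0 D0.
have Lw : app h b <=[k] w.
{ apply: (le_supported Hk (subS H0) (Hh b H0) Hw _ L0); apply: supported_mono Sw => z Hz.
  exact: (ord_trans (ord_in Ok H0) Hz D0). }
apply: (ae_mono (E ∩ ae_pads (Hh b H0))) => x _ [[_ L][Hx Px]]; have Hxk := subS Hx.
have Lb := le_trans Hxk (restr_le Hk Hxk Lw) L; have [v[Lv Ev]] := ex_extension Hk Hxk (Hh _ Hx) Lb; exists v; split=> //.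
by apply: (pads_le Hxk Px (stage_dom Hk Lv).1); rewrite Ev; exact: (le_refl Hxk (stage_dom Hxk Lb).1).
Qed.

Lemma values_bounded d c : d # k -> (forall z y w, pair (pair z y) w # c -> y # k /\ w # PP k) ->
  (forall z y y' w w' v, pair (pair z y) w # c -> pair (pair z y') w' # c -> v <=[k] w -> v <=[k] w' -> y = y') ->
  ∃ b # k, forall z y w, z # d -> pair (pair z y) w # c -> y # b.
Proof.
move=> Hd Hc unique.
have [z Hz|g[Fg Hg]] := ex_choice_fun (R := fun z b => b # k /\ forall y w, pair (pair z y) w # c -> y # b) _ (a := d).
- apply: NNPP => NB.
  have [b Hb|h[_ Hh]] := ex_choice_fun (R := fun b t => pair (pair z (pr1 t)) (pr2 t) # c /\ ~ pr1 t # b) _ (a := k).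
  { apply: NNPP => N1; apply: NB; exists b; split=> // y w H; apply: NNPP => N2; apply: N1.
  by exists (pair y w); rewrite pr1_pair pr2_pair. }
  have Ew b : b # k -> app (lam k (fun b => pr2 (app h b))) b = pr2 (app h b) by move=> Hb; rewrite app_lam.
  have [b Hb|b[Hb K]] := @chain_condition (lam k (fun b => pr2 (app h b))).
  { by rewrite Ew //; case: (Hc _ _ _ (Hh b Hb).1). }
  have Hy := (Hc _ _ _ (Hh b Hb).1).1.
  have [x[_[[v[L1 L2]][Hx Kx]]]] := ae_ex (K ∩ (normal_lt N ∩ normal_gt N Hy)).
  move: L1 L2; rewrite !Ew // => L1 L2; case: (Hh _ Hx).2.
  by rewrite -(unique _ _ _ _ _ _ (Hh b Hb).1 (Hh _ Hx).1 L1 L2).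
- have [|b[Hb Eb]] := k_inacc.2.2.1.2 d Hd g Fg; first by move=> z /Hg[].
  exists b; split=> // z y w Hz H; exact: (ord_trans (ord_in Ok Hb) ((Hg z Hz).2 y w H) (Eb z Hz)).
Qed.

Definition preserves_regular b : Prop := ∀ d # b, forall q t, q # PP b ->
  ~ q ⊩[b] cofinal_map t (check (PP b) d) (check (PP b) b).

Lemma forced_cofinal_map b q t d a : b # k.+1 -> q # PP b -> q ⊩[b] cofinal_map t (check (PP b) d) (check (PP b) a) <->
  forall g : generic_at b, g ∋ q -> cofinal t.[g] (embed g d) (embed g a).
Proof.
move=> Hb Hq; rewrite (stage3_iff Hb (Phi := @cofinal_map)) //.
by split=> H g Gq; move: (H g Gq); rewrite !(val_check g) => /means_cofinal_map.
Qed.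

Lemma forced_check_pair b t z y p : b # k.+1 -> p # PP b -> p ⊩[b] pair_in t (check (PP b) z) (check (PP b) y) <->
  forall g : generic_at b, g ∋ p -> pair (embed g z) (embed g y) # t.[g].
Proof.
move=> Hb Hp; rewrite (stage3_iff Hb (Phi := @pair_in)) //.
by split=> H g Gp; move: (H g Gp); rewrite !(val_check g) => /means_pair_in.
Qed.

(* Names for cofinal maps from d to A x, for almost all x, would reflect to a name for an unbounded map from
   d to k. *)
Lemma ae_preserves_regular : ∀* x, preserves_regular (A x).
Proof.
have Ax := normal_lt N; apply: (ae_diagonal FM N) => d Hd; set Q := fun x => _.
case: (ae_decided (Q := Q) _) => // J; exfalso.
pose R x h := pr1 h # PP (A x) /\ pr1 h ⊩[A x] cofinal_map (pr2 h) (check (PP (A x)) d) (check (PP (A x)) (A x)).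
have [|h[_ Hh]] := ae_select (Q := R) _.
{ apply: (ae_mono J) => x _ K; apply: NNPP => NR; apply: K => q t Hq Ft; apply: NR.
  by exists (pair q t); rewrite /R pr1_pair pr2_pair. }
pose forced z y r x := r <=[A x] pr1 (app h x) /\ r ⊩[A x] pair_in (pr2 (app h x)) (check (PP (A x)) z) (check (PP (A x)) y).
pose c := sep (prod (prod d k) (PP k)) (fun t => (∀* x, forced (pr1 (pr1 t)) (pr2 (pr1 t)) (restr (pr2 t) (A x)) x)).
have in_c z y w : pair (pair z y) w # c <-> z # d /\ y # k /\ w # PP k /\ ∀* x, forced z y (restr w (A x)) x.
{ by rewrite /c in_sep !pair_prod !pr1_pair !pr2_pair; tauto. }
have [z y w|z y y' w w' v|b[Hb Bb]] := values_bounded (c := c) Hd.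
- by move=> /in_c[_[Hy[Hw _]]].
- move=> /in_c[_[_[_ H1]]] /in_c[_[_[_ H2]]] L1 L2.
  have [x[_[[[M1 F1][_ F2]][Hx[Hq Fq]]]]] := ae_ex (H1 ∩ H2 ∩ (Ax ∩ Hh)).
  have Hxk := subS Hx; have L1' := restr_le Hk Hxk L1; have L2' := restr_le Hk Hxk L2.
  have Hv := (stage_dom Hxk L1').1; have [g Gv] := ex_generic Hxk Hv.
  have /(forced_check_pair _ _ _ Hxk Hv)/(_ g Gv) P1 := forces_le Hxk L1' F1.
  have /(forced_check_pair _ _ _ Hxk Hv)/(_ g Gv) P2 := forces_le Hxk L2' F2.
  have [Ft _] := (forced_cofinal_map _ _ _ Hxk Hq).1 Fq g (generic_up Hxk (le_trans Hxk L1' M1) Gv).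
  exact: (embed_inj (ge_mem g) (Ft.1.2 _ _ _ P1 P2)).
- have unbounded : ∀* x, ∃ y # A x, (~ y # b /\ ∃ z # A x, (z # d /\ exists r, forced z y r x)).
  { apply: (ae_mono (Ax ∩ normal_gt N Hd ∩ (normal_gt N Hb ∩ Hh))).
  move=> x _ [[Hx Hdx][Hbx[Hq Fq]]]; have Hxk := subS Hx; have [g Gq] := ex_generic Hxk Hq.
  have [Im It] := (ge_mem g, ge_transitive g); have [_ /(_ (embed g b))] := (forced_cofinal_map _ _ _ Hxk Hq).1 Fq g Gq.
  move=> [|z' [/(in_embed Im It)[z[-> Hz]] [y' [/(in_embed Im It)[y[-> Hy]] [P Ny]]]]]; first exact/Im.
  exists y; splits; first by move=> K; apply: Ny; apply/Im.
  exists z; splits; first exact: (ord_trans (ord_in Ok Hx) Hz Hdx).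
  have [|r[_[L Fr]]] := stage3_truth Hxk Gq (Phi := @pair_in) (x := pr2 (app h x)) (y := check (PP (A x)) z) (z := check (PP (A x)) y) _.
  { by rewrite !(val_check g); apply/means_pair_in. }
  by exists r. }
  have [y[Hy]] := regressive_constant FM N _ unbounded.
  move=> K; have [_[_[Ny _]]] := ae_ex K.
  have [|z[_ Kz]] := regressive_constant FM N (R := fun x z => z # d /\ exists r, forced z y r x) _.
  { by apply: (ae_mono K) => x _ [_ Kx]. }
  have [_[_[Hz _]]] := ae_ex Kz.
  have [|r[Fr Hr]] := ae_select (Q := fun x r => forced z y r x) _; first by apply: (ae_mono Kz) => x _ [].
  have [|_[w[_[Hw[_ E]]]]] := ae_reflected Fr.
  { by apply: (ae_mono (Ax ∩ Hr)) => x _ [Hx[L _]]; case: (stage_dom (subS Hx) L). }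
  apply: Ny; apply: (Bb z y w Hz); apply/in_c; splits.
  apply: (ae_mono (Ax ∩ (Hr ∩ E))) => x _ [Hx[[L Fx][_ Ex]]]; have Hxk := subS Hx.
  by split; [exact: (le_trans Hxk Ex L)|exact: (forces_le Hxk Ex Fx)].
Qed.

Definition saturated_sets b Z : V := sep (power (prod Z (PP b))) (saturated b Z).
Fixpoint names m b : V := match m with 0 => b | S m => saturated_sets b (names m b) end.
Fixpoint traces m : V := match m with 0 => k | S m => power (prod (traces m) (PP k)) end.

Lemma in_saturated_sets b Z c : c # saturated_sets b Z <-> saturated b Z c.
Proof. by rewrite /saturated_sets in_sep in_power; split=> [[]|H] //; split=> //; case: H. Qed.
Lemma definable_fun1_names m : DefinableFun1 (names m).
Proof. elim: m => [|m IH] /=; definability. Qed.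
#[local] Hint Resolve definable_fun1_names : definable.

(* The elements of Z (A x) chosen by F have the trace t modulo U; R exhibits the ultraproduct of the sets
   Z (A x) as a set injected into C. *)
Record represents (Z : V -> V) C (R : V -> V -> Prop) : Prop := {
  represents_definable : Definable2 R;
  ex_trace : forall F, fun_on F X -> (∀* x, app F x # Z (A x)) -> ∃ t # C, R F t;
  trace_inj : forall F G t, R F t -> R G t -> (∀* x, app F x = app G x) }.

Lemma represents_stages : exists R, represents (fun b => b) k R.
Proof.
exists (fun F t => (∀* x, app F x = t)); split; first definability.
- by move=> F FF HF; exact: (normal_regressive N).
- by move=> F G t HF HG; apply: (ae_mono (HF ∩ HG)) => x _ [-> ->].
Qed.

Lemma represents_saturated_sets (Z : V -> V) C R : DefinableFun1 Z -> represents Z C R ->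
  exists R', represents (fun b => saturated_sets b (Z b)) (power (prod C (PP k))) R'.
Proof.
move=> DZ [DR exR injR].
pose T F := sep (prod C (PP k)) (fun t => exists G, fun_on G X /\ (∀* x, app G x # Z (A x)) /\
  R G (pr1 t) /\ ∀* x, pair (app G x) (restr (pr2 t) (A x)) # app F x).
have in_T F t w : pair t w # T F <-> t # C /\ w # PP k /\ exists G, fun_on G X /\ (∀* x, app G x # Z (A x)) /\
  R G t /\ ∀* x, pair (app G x) (restr w (A x)) # app F x.
{ by rewrite /T in_sep pair_prod pr1_pair pr2_pair; tauto. }
pose saturates F := ∀* x, app F x # saturated_sets (A x) (Z (A x)).
exists (fun F t => saturates F /\ t = T F); split; first by rewrite /saturates /T; definability.
{ move=> F _ HF; exists (T F); splits; apply/in_power => t; by rewrite /T in_sep => -[]. }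
have incl F G : saturates F -> saturates G -> T F = T G -> ∀* x, sub (app F x) (app G x).
{ move=> HF HG E.
  case: (ae_decided (Q := fun x => sub (app F x) (app G x)) _) => // J; exfalso.
  have [|h[_ Hh]] := ae_select (Q := fun x h => pair (pr1 h) (pr2 h) # app F x /\ ~ pair (pr1 h) (pr2 h) # app G x) _.
  { apply: (ae_mono (J ∩ HF)) => x _ [/not_sub[t[Ht Nt]] /in_saturated_sets[S _]].
  have /in_prod[z[q[_[_ E']]]] := S t Ht; by exists t; rewrite E' pr1_pair pr2_pair -E'. }
  have [||_[w[_[Hw[_ Ew]]]]] := @ae_reflected (lam X (fun x => pr2 (app h x))); first exact: fun_on_lam.
  { apply: (ae_mono (Hh ∩ HF)) => x Hx [[Ht _] /in_saturated_sets S]; rewrite app_lam //.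
  by case: (saturated_in S Ht). }
  pose H := lam X (fun x => pr1 (app h x)).
  have Eh : (∀* x, app H x = pr1 (app h x)) by apply: (ae_all FM) => x Hx; rewrite /H app_lam.
  have {}Ew : (∀* x, pr2 (app h x) ≈[A x] restr w (A x)) by apply: (ae_mono Ew) => x Hx; rewrite app_lam.
  have all := HF ∩ HG ∩ (Hh ∩ (Eh ∩ (Ew ∩ normal_lt N))).
  have HZ : ∀* x, app H x # Z (A x).
  { apply: (ae_mono all) => x _ [[/in_saturated_sets S _][[Ht _][-> _]]]; by case: (saturated_in S Ht). }
  have [t[Ht RHt]] := exR H (fun_on_lam _ _) HZ.
  have /in_T[_[_[G'[_[_[RG' K]]]]]] : pair t w # T G.
  { rewrite -E; apply/in_T; splits; exists H; splits; first exact: fun_on_lam.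
  apply: (ae_mono all) => x _ [[/in_saturated_sets S _][[Hhx _][->[[_ L] Hx]]]].
  exact: (saturated_le (subS Hx) S Hhx L). }
  have [x[_[[[_ /in_saturated_sets S][[_ Nx][Ex[[L _] Hx]]]][K1 K2]]]] := ae_ex (all ∩ (injR _ _ _ RHt RG' ∩ K)).
  by apply: Nx; rewrite -Ex K1; exact: (saturated_le (subS Hx) S K2 L). }
move=> F G t [HF ->] [HG E].
by apply: (ae_mono (incl _ _ HF HG E ∩ incl _ _ HG HF (eq_sym E))) => x _ [S1 S2]; exact: sub_antisym.
Qed.

Lemma names_represented m : exists R, represents (names m) (traces m) R.
Proof.
elim: m => [|m[R HR]] /=; first exact: represents_stages.
exact: (represents_saturated_sets (definable_fun1_names m) HR).
Qed.

(* Otherwise the elements of x could be mapped injectively into names m (A x), which gives an injection of l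
   into traces m. *)
Lemma ae_few_names m : ~ embeds l (traces m) -> ∀* x, embeds (names m (A x)) x.
Proof.
move=> Hl.
case: (ae_decided (Q := fun x => embeds (names m (A x)) x) _) => // J; case: Hl.
have [|h[_ Hh]] := ae_select (Q := fun x h => inj h x (names m (A x))) _.
{ by apply: (ae_mono J) => x _ NE; case: (embeds_total x (names m (A x))) => [[h Hh]|//]; exists h. }
have [R[DR exR injR]] := names_represented m; pose F a := lam X (fun x => app (app h x) a).
have EF a x : x # X -> app (F a) x = app (app h x) a by move=> Hx; rewrite /F app_lam.
have [a Ha|tr[Ftr Htr]] := ex_choice_fun (R := fun a t => t # traces m /\ R (F a) t) _ (a := l).
{ apply: exR; first exact: fun_on_lam.
  by apply: (ae_mono (Hh ∩ ae_fine FM Ha)) => x Hx [[_[Rh _]] Hax]; rewrite EF //; exact: Rh. }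
exists tr; rewrite /inj; splits; first by move=> a /Htr[].
move=> a a' Ha Ha' E; have [_ Ra] := Htr a Ha; have [_ Ra'] := Htr a' Ha'; rewrite -E in Ra'.
have [x[Hx[[[_[_ Ih]] Ex][K K']]]] := ae_ex (Hh ∩ injR _ _ _ Ra Ra' ∩ (ae_fine FM Ha ∩ ae_fine FM Ha')).
by move: Ex; rewrite !EF //; exact: Ih.
Qed.

Implicit Types h t v : V.

(* The triple (p, b, c) stands for the pair of p in P_k and a name for the condition with domain b of
   Add(k,1) that codes the set named by c. *)
Definition triple p b c : V := pair p (pair b c).
Definition base h : V := pr1 h.
Definition height h : V := pr1 (pr2 h).
Definition graph h : V := pr2 (pr2 h).
Definition two_step : V := sep (prod (PP k) (prod k (power (prod k (union (image k PP))))))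
  (fun h => saturated (height h) (height h) (graph h)).
Definition two_step_le h' h : Prop := h' # two_step /\ h # two_step /\ base h' <=[k] base h /\
  sub (height h) (height h') /\ ∀ z # height h, forall q, q <=[height h'] restr (base h') (height h') ->
  (pair z q # graph h' <-> pair z (restr q (height h)) # graph h).
Notation "h' ≼ h" := (two_step_le h' h) (at level 70).

Lemma base_triple p b c : base (triple p b c) = p.
Proof. exact: pr1_pair. Qed.
Lemma height_triple p b c : height (triple p b c) = b.
Proof. by rewrite /height /triple pr2_pair pr1_pair. Qed.
Lemma graph_triple p b c : graph (triple p b c) = c.
Proof. by rewrite /graph /triple !pr2_pair. Qed.

Definition tripleE := (base_triple, height_triple, graph_triple).

Lemma in_two_step h : h # two_step <-> h = triple (base h) (height h) (graph h) /\ base h # PP k /\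
  height h # k /\ saturated (height h) (height h) (graph h).
Proof.
rewrite /two_step in_sep; split=> [[/in_prod[p[y[Hp[/in_prod[b[c[Hb[_ ->]]]] ->]]]] S]|[E[Hp[Hb S]]]].
- by move: S; rewrite -/(triple p b c) !tripleE.
- split=> //; rewrite E /triple !pair_prod; splits.
  apply/in_power => t /S.1/in_prod[z[q[Hz[Hq ->]]]]; apply/pair_prod.
  split; first exact: (ord_trans Ok Hz Hb).
  by apply/in_union; exists (PP (height h)); split=> //; apply/in_image; exists (height h).
Qed.

Lemma triple_in_two_step p b c : p # PP k -> b # k -> saturated b b c -> triple p b c # two_step.
Proof. by move=> Hp Hb S; apply/in_two_step; rewrite !tripleE. Qed.
Lemma two_stepP h : h # two_step -> base h # PP k /\ height h # k /\ saturated (height h) (height h) (graph h).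
Proof. by case/in_two_step. Qed.
Lemma sub_stage b c : c # k.+1 -> b # k.+1 -> sub b c -> b # c.+1.
Proof. by move=> Hc Hb; exact: (ord_sub_in (ord_stage Hb) (ordS (ord_stage Hc)) (memS c)). Qed.

Lemma thin_le h p : h # two_step -> p <=[k] base h -> triple p (height h) (graph h) ≼ h.
Proof.
move=> Th L; have [Hp[Hb S]] := two_stepP Th; rewrite /two_step_le !tripleE; splits.
- exact: (triple_in_two_step (stage_dom Hk L).1).
- by move=> z Hz q /(stage_dom (subS Hb))[Hq _]; rewrite (restr_dom (cond_fun_on (subS Hb) Hq)).
Qed.

Lemma two_step_refl h : h # two_step -> h ≼ h.
Proof.
move=> Th; have [Hp _] := two_stepP Th; have := thin_le Th (le_refl Hk Hp).
by case/in_two_step: Th => <-.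
Qed.

Lemma two_step_trans h1 h2 h3 : h1 ≼ h2 -> h2 ≼ h3 -> h1 ≼ h3.
Proof.
move=> [T1[T2[L1[S1 E1]]]] [_[T3[L2[S2 E2]]]]; rewrite /two_step_le; splits.
- exact: (le_trans Hk L1 L2).
- by move=> z /S2/S1.
- have [[P1[B1 _]][_[B2 _]]] := (two_stepP T1, two_stepP T2).
  have [B1' B2'] := (subS B1, subS B2); have B21 := sub_stage B1' B2' S1.
  move=> z Hz q Lq; rewrite (E1 z (S2 z Hz) q Lq) (E2 z Hz) ?restr_restr //.
  apply: (le_trans B2' (restr_le B1' B21 Lq)); rewrite restr_restr //; exact: (restr_le Hk B2' L1).
Qed.

Lemma emp_in_k : emp # k.
Proof. exact: (ord_trans Ok (emp_in_omega V) k_uncountable). Qed.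

Lemma emp_condition : emp # PP emp.
Proof.
apply/(iter_condition I (subS emp_in_k)); rewrite /condition; splits; try by move=> b /in_emp.
- by split; [split=> [c /in_emp|a b b' /in_emp]|move=> a; split=> [/in_emp|[b /in_emp]]].
- by case=> _ [/in_emp].
Qed.

Lemma restr_emp p : restr p emp = emp.
Proof. by apply: eq_emp => z /in_restr[_[a[/in_emp]]]. Qed.

Lemma ex_top_condition c : c # k.+1 -> ∃ w # PP c, ∀ p # PP c, p <=[c] w.
Proof.
move=> Hc; have H0 : emp # c.+1.
{ apply: (sub_stage Hc (subS emp_in_k)); by move=> z /in_emp. }
have [w[Hw[_ Sw]]] := ex_padding Hc H0 emp_condition; exists w; split=> // p Hp.
by apply: (le_supported Hc H0 Hp Hw Sw); rewrite !restr_emp; exact: (le_refl (subS emp_in_k) emp_condition).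
Qed.

Lemma ex_top_triple : ∃ h # two_step, height h = emp /\ ∀ h' # two_step, h' ≼ h.
Proof.
have [w[Hw Tw]] := ex_top_condition Hk; exists (triple w emp emp); rewrite !tripleE.
have T : triple w emp emp # two_step.
{ by apply: (triple_in_two_step Hw emp_in_k); split=> [z|z q] /in_emp. }
splits=> h' Th'; rewrite /two_step_le !tripleE; splits; try by move=> z /in_emp.
by apply: Tw; case: (two_stepP Th').
Qed.

Lemma saturation_le h p d (R : V -> V -> Prop) : Definable2 R -> h # two_step -> p <=[k] base h -> d # k -> sub (height h) d ->
  (forall z q, z # height h -> q <=[d] restr p d -> (R z q -> pair z (restr q (height h)) # graph h) /\
  (pair z (restr q (height h)) # graph h -> exists q', q' <=[d] q /\ R z q')) -> triple p d (saturation d d R) ≼ h.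
Proof.
move=> D Th Lp Hd Sd H; have [_[Hh Sh]] := two_stepP Th; have [Pp _] := stage_dom Hk Lp.
have Hdk := subS Hd; have Hhk := subS Hh; have Hhd := sub_stage Hdk Hhk Sd.
rewrite /two_step_le !tripleE; splits; first exact: (triple_in_two_step Pp Hd (saturated_saturation d Hdk D)).
move=> z Hz q Lq; have [Hq _] := stage_dom Hdk Lq; rewrite in_saturation; split=> [[_[_ K]]|K].
- apply/(Sh.2 z _ Hz (cond_restr Hdk Hq Hhd)) => q1 L1; have [q2[L2 E2]] := ex_extension Hdk Hhd Hq L1.
  have [q3[L3 R3]] := K q2 L2; exists (restr q3 (height h)); split; first by rewrite -E2; exact: (restr_le Hdk Hhd L3).
  exact: ((H z q3 Hz (le_trans Hdk L3 (le_trans Hdk L2 Lq))).1 R3).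
- splits; first exact: Sd.
  move=> q1 L1; apply: (H z q1 Hz (le_trans Hdk L1 Lq)).2; exact: (saturated_le Hhk Sh K (restr_le Hdk Hhd L1)).
Qed.

Lemma ex_saturated_name b Z (g : generic_at b) (w : g) : b # k.+1 -> sub w (embed g Z) ->
  exists c, saturated b Z c /\ forall z, embed g z # w <-> exists q, g ∋ q /\ pair z q # c.
Proof.
move=> Hb Sw; have PO := stage_preorder Hb; have [t Et] := val_surj g w; subst w.
pose R z q := q ⊩[b] FMem (check (PP b) z) t.
exists (saturation b Z R); split=> [|z]; first exact: saturated_saturation.
rewrite -(val_check g z); split=> [|[q[Gq /in_saturation[Hz[Hq H]]]]].
- move=> /[dup] Hz /(val_mem g PO)[q[Gq Fq]]; have Hq := generic_sub g Gq; exists q; split=> //.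
  apply: saturation_of_forced => // [|q' L]; last exact: (forces_le Hb L (Fq : q ⊩[b] FMem _ _)).
  by apply/(ge_mem g); apply: Sw; rewrite -(val_check g z).
- have [q' L|r[Gr[_ Rr]]] := filter_generic_below PO (set_filter g) (Q := R z) _ Gq.
  { by move=> L'; have [r[Lr Rr]] := H q' L'; exists r; splits; case: (stage_dom Hb Lr). }
  exact: ((stage_mem_iff Hb _ _ (generic_sub g Gr)).1 Rr g Gr).
Qed.

Lemma names_surjective b m (g : generic_at b) : b # k.+1 ->
  exists e : g, forall y : g, y # powers m (embed g b) -> exists x : g, x # embed g (names m b) /\ app e x = y.
Proof.
move=> Hb; elim: m => [|m[e He]] /=.
- by exists (lam (embed g b) (fun x : g => x)) => y Hy; exists y; rewrite app_lam.
- pose F (z : g) := sep (powers m (embed g b)) (fun y : g => exists x q : g, q # generic_subset g /\ pair x q # z /\ app e x = y).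
  exists (lam (embed g (saturated_sets b (names m b))) F) => y /in_power Sy /=.
  have Sw : sub (sep (embed g (names m b)) (fun x : g => app e x # y)) (embed g (names m b)) by move=> x /in_sep[].
  have [c[Sc Hc]] := ex_saturated_name Hb Sw; have [Im It] := (ge_mem g, ge_transitive g).
  have Hcs : embed g c # embed g (saturated_sets b (names m b)) by apply/Im/in_saturated_sets.
  exists (embed g c); split=> //; rewrite app_lam //; apply: set_ext => u; rewrite /F in_sep.
  split=> [[_ [x [q [Gq [/(pair_in_embed Im It)[x'[q'[Ex[Eq K]]]] <-]]]]]|Hu].
  + by subst x q; have /in_sep[] : embed g x' # sep (embed g (names m b)) (fun x : g => app e x # y) by apply/Hc; exists q'.
  + split; first exact: Sy.
  have [x [/[dup] Hx /(in_embed Im It)[x'[Ex _]] E]] := He u (Sy u Hu); subst x.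
  have /Hc[q[Gq K]] : embed g x' # sep (embed g (names m b)) (fun x : g => app e x # y) by apply/in_sep; rewrite E.
  by exists (embed g x'), (embed g q); splits; apply/(pair_embed_in Im It).
Qed.

Definition graph_name b h : V := image (sep (prod (height h) (PP b)) (fun t => pair (pr1 t) (restr (pr2 t) (height h)) # graph h))
  (fun t => pair (check (PP b) (pr1 t)) (pr2 t)).

Section GraphName.
Variables b h : V.
Hypotheses (Hb : b # k.+1) (Th : h # two_step) (Hhb : sub (height h) b).
Let Hh : height h # k := (two_stepP Th).2.1.
Let Hhk := subS Hh.
Let Sh : saturated (height h) (height h) (graph h) := (two_stepP Th).2.2.
Let Hhs : height h # b.+1 := sub_stage Hb Hhk Hhb.
Notation coded g := (graph_name b h).[g].

Lemma in_graph_name (g : generic_at b) z : embed g z # coded g <->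
  z # height h /\ exists q, g ∋ q /\ pair z (restr q (height h)) # graph h.
Proof.
rewrite (in_val g); split=> [[c[q[Gq[/in_image[t[/in_sep[/in_prod[z'[q'[Hz[_ ->]]]] K] /pair_inj[-> Eq]]] E]]]]|[Hz[q[Gq K]]]].
- move: K E Eq; rewrite pr1_pair pr2_pair (val_check g) => K /(embed_inj (ge_mem g)) -> Eq; split=> //.
  by subst q; exists q'.
- exists (check (PP b) z), q; splits; last by rewrite (val_check g).
  apply/in_image; exists (pair z q); rewrite pr1_pair pr2_pair; split=> //; apply/in_sep; rewrite pr1_pair pr2_pair.
  by split=> //; apply/pair_prod; split=> //; exact: (generic_sub g).
Qed.

Lemma forced_graph_name z q : z # height h -> q # PP b ->
  pair z (restr q (height h)) # graph h <-> forall g : generic_at b, g ∋ q -> embed g z # coded g.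
Proof.
move=> Hz Hq; split=> [K g Gq|H]; first by apply/in_graph_name; split=> //; exists q.
apply/(Sh.2 _ _ Hz (cond_restr Hb Hq Hhs)) => q' L.
have [s[Lsq Es]] := ex_extension Hb Hhs Hq L; have [g Gs] := ex_generic Hb (stage_dom Hb Lsq).1.
have /in_graph_name[_[r[Gr K]]] := H g (generic_up Hb Lsq Gs).
have [v[_[Lvs Lvr]]] := filter_meet (set_filter g) Gs Gr.
exists (restr v (height h)); split; first by rewrite -Es; exact: (restr_le Hb Hhs Lvs).
exact: (saturated_le Hhk Sh K (restr_le Hb Hhs Lvr)).
Qed.
End GraphName.

Definition point b (g : generic_at b) h : g := indicator (embed g (height h)) (graph_name b h).[g].

Lemma point_le b h h' (g : generic_at b) : b # k.+1 -> sub (height h') b -> h' ≼ h -> g ∋ restr (base h') b ->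
  sub (point g h) (point g h').
Proof.
move=> Hb S' [T'[T[_[S E]]]] G'; have [_[H' Sat']] := two_stepP T'; have [_[H Sat]] := two_stepP T.
have [H'k Hk'] := (subS H', subS H); have H's := sub_stage Hb H'k S'.
have Sb : sub (height h) b by move=> z /S/S'.
have Hs := sub_stage Hb Hk' Sb; have common q : g ∋ q -> exists r, g ∋ r /\ r <=[b] q /\ restr r (height h') <=[height h'] restr (base h') (height h').
{ move=> Gq; have [r[Gr[L1 L2]]] := filter_meet (set_filter g) Gq G'; exists r; splits.
  by have := restr_le Hb H's L2; rewrite restr_restr. }
apply/indicator_sub; split; first exact/(embed_sub (ge_mem g) (ge_transitive g)).
move=> w /(in_embed (ge_mem g) (ge_transitive g))[z[-> Hz]].
rewrite !in_graph_name; split=> -[Hz'[q[/common[r[Gr[L1 L2]]] K]]]; have := E z Hz _ L2; rewrite (restr_restr _ S) => Er.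
- split; [exact: S|exists r; split=> //]; apply/Er; exact: (saturated_le Hk' Sat K (restr_le Hb Hs L1)).
- split=> //; exists r; split=> //; apply/Er; exact: (saturated_le H'k Sat' K (restr_le Hb H's L1)).
Qed.

Definition good b a x : Prop := b # k /\ inacc b /\ preserves_regular b /\ closed_under f b /\ pair b a # f /\
  embeds (names 7 b) x /\ embeds x a.

Definition realizes b h t : Prop := t # PP b.+1 /\ restr t b = restr (base h) b /\
  restr t b ⊩[b] cohen_point (app t b) (graph_name b h) (check (PP b) (height h)) (check (PP b) b).

Lemma ex_succ_condition b p y : b # k -> p # PP b -> coordinate b y -> p ⊩[b] FMem y (QQ b) ->
  ∃ t # PP b.+1, restr t b = p /\ app t b = y.
Proof.
move=> Hb Hp Cy Fy; have Hs := succ_stage Hb; have Hbk := subS Hb; have Hbs := memS b.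
have [|||t[Ht[Et Rt]]] := @ex_condition b.+1 b p (fun _ _ y' => y' = y) Hs (subS Hbs) Hp.
- definability.
- move=> c s /inS[//|->] _ Hc [Es _]; exists y; splits.
  rewrite (fun_on_ext (cond_fun_on Hbk Hc) (cond_fun_on Hbk Hp)) // => z Hz; exact: Es.
- move=> c s /inS[/inS[Hc|->]|->] Hbc.
  + by case: (mem_asym Hc Hbc).
  + by case: (mem_irrefl Hbc).
  + by move=> [_[_[[/succ_not_lim]]]].
- by exists t; splits; apply: Rt => // /mem_irrefl.
Qed.

Section GoodStage.
Variables b a x : V.
Hypothesis G : good b a x.
Let Hb : b # k := G.1.
Let Hbk : b # k.+1 := subS Hb.
Let Hs : b.+1 # k.+1 := succ_stage Hb.
Let Hbs : b # b.+1 := memS b.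
Let Ob : ord b := ord_in Ok Hb.

Section InExtension.
Variable g : generic_at b.
Let Im := ge_mem g.
Let It := ge_transitive g.

Lemma embed_regular : reg (embed g b).
Proof.
have [_[[_[_[[Lb _] _]]][PR _]]] := G; split; first exact/(embed_lim Im It).
move=> w /(in_embed Im It)[d[-> Hd]] h Fh Rh; apply: NNPP => N1; have [t Et] := val_surj g h; subst h.
have [q Gq] := filter_nonempty (set_filter g).
have [|r[Gr[_ Fr]]] := stage3_truth Hbk Gq (Phi := @cofinal_map) (x := t) (y := check (PP b) d) (z := check (PP b) b) _.
- rewrite !(val_check g); apply/means_cofinal_map; split=> // y Hy; apply: NNPP => N2; apply: N1; exists y; split=> // z Hz.
  apply: NNPP => N3; apply: N2; exists z; split=> //; exists (app t.[g] z); splits; [exact: Rh|exact: (pair_app Fh Hz)].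
- exact: (PR d Hd r t (generic_sub g Gr) Fr).
Qed.

Lemma good_lottery : lottery_sum (embed g b) (embed g a) (QQ b).[g] (RR b).[g] (OO b).[g].
Proof. by have [_[_[_[Cl[Ha _]]]]] := G; apply: iterand_lottery => //; exact: stage_preorder. Qed.

Lemma cohen_in_lottery C L (m : g) : cohen_poset (embed g b) C L -> m # C -> pair (pair C L) m # (QQ b).[g].
Proof.
have [_[[_[om _]][_[_[_[few big]]]]]] := G.
move=> AL Hm; have [_[[c[[_[Ha _]] HD]] _]] := good_lottery; apply/HD; right; exists (pair C L), C, L; splits.
- by apply: (cohen_partial_order AL); rewrite -(embed_emp Im It); apply/Im; exact: (ord_trans Ob (emp_in_omega V) om).
- exists (embed g a); split=> //; have [e He] := names_surjective 7 g Hbk.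
  apply: embeds_trans (embed_embeds Im It (embeds_trans few big)); apply: (embeds_trans _ (embeds_of_surjection He)).
  exact: (embeds_sub (cohen_trcl AL embed_regular.1)).
- exact: (cohen_allowed AL embed_regular).
- by exists m.
Qed.

Lemma cohen_condition_le (m m' y y' : g) : cohen_condition (embed g b) m y -> cohen_condition (embed g b) m' y' ->
  (pair y y' # (RR b).[g] <-> sub m' m).
Proof.
move=> [C[L[AL[Hm ->]]]] [C'[L'[AL'[Hm' ->]]]]; have [EC EL] := cohen_poset_unique AL AL'; subst C' L'.
split=> [/(lottery_pair_order good_lottery)[p [/pair_inj[_ <-] [_ /(cohen_order AL)[_[]]]]] //|S].
by apply: (lottery_pair_le good_lottery); try exact: cohen_in_lottery; apply/(cohen_order AL).
Qed.

Lemma cohen_condition_below (m' y y' : g) : pair y y' # (RR b).[g] -> cohen_condition (embed g b) m' y' ->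
  exists m : g, cohen_condition (embed g b) m y /\ sub m' m.
Proof.
move=> H [C[L[AL[Hm E]]]]; subst y'; have [p [Ey [Hp /(cohen_order AL)[_[_ S]]]]] := lottery_pair_order good_lottery H.
by exists p; split=> //; exists C, L.
Qed.

Lemma point_condition h t : realizes b h t -> height h # b -> g ∋ restr t b ->
  cohen_condition (embed g b) (point g h) (app t b).[g].
Proof.
move=> [_[_ F]] Hh Gt; apply/(means_cohen_point (app t b).[g] (graph_name b h).[g] (d := embed g (height h)) _).
- exact/Im.
- move: F; rewrite (stage4_iff Hbk (Phi := @cohen_point)) => [|/(_ g Gt)]; first exact: (generic_sub g Gt).
  by rewrite !(val_check g).
Qed.
End InExtension.

Lemma ex_realizer h : h # two_step -> height h # b -> exists t, realizes b h t.
Proof.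
move=> /two_stepP[Hp _] Hh; have Hpb := cond_restr Hk Hp Hbk.
have SP : schematic (fun T e => cohen_point (e 0) (e 1) (e 2) (e 3)) by exact _.
have [g Gp|y[Cy[My Fy]]] := ex_coordinate (e := scons (graph_name b h)
  (scons (check (PP b) (height h)) (fun _ => check (PP b) b))) SP Hb Hpb.
- have [C[L AL]] := ex_cohen_poset (embed_regular g).1.1.
  have Hd : embed g (height h) # embed g b by apply/(ge_mem g).
  have Hm : point g h # C by apply/(in_cohen AL); exists (embed g (height h)), (graph_name b h).[g].
  exists (pair (pair C L) (point g h)); split; first exact: cohen_in_lottery.
  by rewrite /= !(val_check g); apply/(means_cohen_point _ _ Hd); exists C, L.
- have [t[Ht[Et Ey]]] := ex_succ_condition Hb Hpb Cy My; exists t.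
  by split=> //; split=> //; rewrite Et Ey.
Qed.

Lemma realizes_le h h' t t' : h' ≼ h -> height h # b -> height h' # b -> realizes b h' t' -> realizes b h t -> t' <=[b.+1] t.
Proof.
move=> L Hh Hh' R' R; have [Ht'[Et' _]] := R'; have [Ht[Et _]] := R.
have Lb : restr t' b <=[b] restr t b by rewrite Et Et'; exact: (restr_le Hk Hbk L.2.2.1).
apply: (le_succ Hb Ht' Ht Lb) => g G'; have Gt := generic_up Hbk Lb G'.
apply/(cohen_condition_le (point_condition R' Hh' G') (point_condition R Hh Gt)).
by apply: (point_le Hbk _ L); [move=> z Hz; exact: (ord_trans Ob Hz Hh')|rewrite -Et'].
Qed.
End GoodStage.

Definition generic_graph b : V := saturation b.+1 b.+1 (fun z s => exists h t, h # two_step /\ height h # b /\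
  realizes b h t /\ s <=[b.+1] t /\ z # height h /\ pair z (restr s (height h)) # graph h).

Definition captures b h0 r : Prop := base r # PP k /\ realizes b h0 (restr (base r) b.+1) /\
  r = triple (base r) b.+1 (generic_graph b).
Definition below b r h v : Prop := v ≼ r /\ exists t, realizes b h t /\ restr (base v) b.+1 <=[b.+1] t.

Section GenericGraph.
Variables b a x : V.
Hypothesis G : good b a x.
Let Hb : b # k := G.1.
Let Hbk : b # k.+1 := subS Hb.
Let Hs : b.+1 # k.+1 := succ_stage Hb.
Let Hbs : b # b.+1 := memS b.
Let Ob : ord b := ord_in Ok Hb.

Lemma realizer_below h t r (g : generic_at b) : realizes b h t -> height h # b -> r <=[b.+1] t -> g ∋ restr r b ->
  exists d (s : g), d # b /\ cohen_condition (embed g b) (indicator (embed g d) s) (app r b).[g] /\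
  sub (height h) d /\ ∀ z # height h, (embed g z # (graph_name b h).[g] <-> embed g z # s).
Proof.
move=> R Hh L Gr; have [Im It] := (ge_mem g, ge_transitive g); have [Hr Ht] := stage_dom Hs L.
have PC := point_condition G R Hh (generic_up Hbk (restr_le Hs (subS Hbs) L) Gr).
have [m[Cm Sm]] := cohen_condition_below G ((le_iff Hs Hr Ht).1 L b Hbs g Gr) PC.
have [C [Lc [AL [/(in_cohen AL)[d' [s [/(in_embed Im It)[d[Ed Hd]] Em]]] _]]]] := Cm; subst d' m.
move: Sm => /indicator_sub[/(embed_sub Im It) Sd E]; exists d, s; splits.
by move=> z Hz; apply: E; apply/Im.
Qed.

Lemma cohen_condition_inj (W : zfc_model) (c m m' y : W) : cohen_condition c m y -> cohen_condition c m' y -> m = m'.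
Proof. by move=> [C[L[_[_ ->]]]] [C'[L'[_[_ /pair_inj[]]]]]. Qed.

Lemma realizers_agree h h1 t t1 r z (g : generic_at b) : realizes b h t -> realizes b h1 t1 -> height h # b -> height h1 # b ->
  r <=[b.+1] t -> r <=[b.+1] t1 -> z # height h -> z # height h1 -> g ∋ restr r b ->
  embed g z # (graph_name b h).[g] <-> embed g z # (graph_name b h1).[g].
Proof.
move=> R R1 Hh Hh1 L L1 Hz Hz1 Gr; have [d[s[_[Cs[Sd E]]]]] := realizer_below R Hh L Gr.
have [d1[s1[_[Cs1[_ E1]]]]] := realizer_below R1 Hh1 L1 Gr.
rewrite (E z Hz) (E1 z Hz1); have Es : sub (indicator (embed g d) s) (indicator (embed g d1) s1).
{ by rewrite (cohen_condition_inj Cs Cs1). }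
by move: Es => /indicator_sub[_]; apply; apply/(ge_mem g)/Sd.
Qed.

Lemma in_generic_graph h t z s : h # two_step -> height h # b -> realizes b h t -> z # height h -> s <=[b.+1] t ->
  pair z s # generic_graph b <-> pair z (restr s (height h)) # graph h.
Proof.
move=> Th Hh R Hz L; have [_[Hhk Sat]] := two_stepP Th; have [Hss _] := stage_dom Hs L.
have Hhk' := subS Hhk; have Hhs := subS (subS Hh).
have Sh c : height c # b -> sub (height c) b by move=> Hc y Hy; exact: (ord_trans Ob Hy Hc).
rewrite /generic_graph in_saturation; split=> [[_[_ H]]|K].
- apply/(Sat.2 _ _ Hz (cond_restr Hs Hss Hhs)) => q' Lq.
  have [s1[L1 E1]] := ex_extension Hs Hhs Hss Lq; have [r[Lr[h1[t1[T1[H1[R1[Lr1[Hz1 K]]]]]]]]] := H s1 L1.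
  exists (restr r (height h)); split; first by rewrite -E1; exact: (restr_le Hs Hhs Lr).
  have Hr := cond_restr Hs (stage_dom Hs Lr).1 (subS Hbs).
  rewrite -(restr_ord r Ob Hh); apply/(forced_graph_name Hbk Th (Sh h Hh) Hz Hr) => g Gr.
  apply/(realizers_agree R R1 Hh H1 (le_trans Hs Lr (le_trans Hs L1 L)) Lr1 Hz Hz1 Gr)/in_graph_name; split=> //.
  by exists (restr r b); rewrite (restr_ord r Ob H1).
- splits; first exact: (subS (ord_trans Ob Hz Hh)).
  move=> q' Lq; exists q'; split; first exact: (le_refl Hs (stage_dom Hs Lq).1).
  exists h, t; splits; [exact: (le_trans Hs Lq L)|exact: (saturated_le Hhk' Sat K (restr_le Hs Hhs Lq))].
Qed.

Lemma below_le h0 r0 r h v : captures b h0 r0 -> r ≼ r0 -> h # two_step -> height h # b ->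
  pads b (restr (base h) b) (base h) -> below b r h v -> v ≼ h.
Proof.
move=> [_[_ E0]] Lr Th Hh Ph [Lv[t[R Lt]]]; have [Tv[_[_[Sv Ev]]]] := two_step_trans Lv Lr.
move: Sv Ev; rewrite E0 !tripleE => Sv Ev; have [Hv[Hvh _]] := two_stepP Tv.
have Sh : sub (height h) b.+1 by move=> z Hz; apply: subS; exact: (ord_trans Ob Hz Hh).
have Hvk := subS Hvh; have Hsv := sub_stage Hvk Hs Sv.
rewrite /two_step_le; splits.
- apply: (pads_le Hbk Ph Hv); have [_[<- _]] := R.
  by rewrite -(restr_ord _ (ordS Ob) Hbs); exact: (restr_le Hs (subS Hbs) Lt).
- by move=> z /Sh/Sv.
- move=> z Hz q Lq; rewrite (Ev z (Sh z Hz) q Lq) (in_generic_graph Th Hh R Hz) ?restr_restr //.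
  apply: (le_trans Hs (restr_le Hvk Hsv Lq)); rewrite restr_restr //.
Qed.
End GenericGraph.

Lemma ex_not_forced b y z q : b # k.+1 -> q # PP b -> ~ q ⊩[b] FMem y z ->
  exists r, r <=[b] q /\ forall r', r' <=[b] r -> ~ r' ⊩[b] FMem y z.
Proof.
move=> Hb Hq NF; apply: NNPP => NE; apply: NF; apply/(stage_mem_iff Hb _ _ Hq) => g Gq.
have [p Hp Lp|r[Gr[_ Fr]]] := filter_generic_below (stage_preorder Hb) (set_filter g) (Q := fun r => r ⊩[b] FMem y z) _ Gq.
- apply: NNPP => NE'; apply: NE; exists p; split=> // r Lr Fr; apply: NE'; exists r; splits; by case: (stage_dom Hb Lr).
- exact: ((stage_mem_iff Hb _ _ (generic_sub g Gr)).1 Fr g Gr).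
Qed.

Section ReflectNames.
Variables (d b0 : V) (S : V -> V).
Hypotheses (Hd : d # k) (Hb0 : b0 # k) (DS : DefinableFun1 S).
Let forced x z q : Prop := q ⊩[A x] FMem (check (PP (A x)) z) (S x).
Let D : Definable3 forced. Proof. rewrite /forced; definability. Qed.
Let graph0 : V := sep (prod d (PP k)) (fun t => (∀* x, forced x (pr1 t) (restr (pr2 t) (A x)))).

Let in_graph0 z q : pair z q # graph0 <-> z # d /\ q # PP k /\ ∀* x, forced x z (restr q (A x)).
Proof. by rewrite /graph0 in_sep pair_prod pr1_pair pr2_pair; tauto. Qed.

Let forced_le x z q r : A x # k -> r <=[A x] q -> forced x z q -> forced x z r.
Proof. by move=> Hx; exact: (forces_le (subS Hx)). Qed.

Lemma saturated_almost_forced : saturated k d graph0.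
Proof.
split=> [t /in_sep[]|z q Hz Hq] //; split=> [/in_graph0[_[_ F]] q' L|H].
- have Hq' := (stage_dom Hk L).1; exists q'; split; [exact: le_refl|apply/in_graph0; splits].
  by apply: (ae_mono (F ∩ normal_lt N)) => x _ [Fx Hx]; exact: (forced_le Hx (restr_le Hk (subS Hx) L)).
- apply/in_graph0; splits.
  case: (ae_decided (Q := fun x => forced x z (restr q (A x))) _) => // J; exfalso.
  have [|u[Fu Hu]] := ae_select (Q := fun x u => u <=[A x] restr q (A x) /\ forall r, r <=[A x] u -> ~ forced x z r) _.
  { apply: (ae_mono (J ∩ normal_lt N)) => x _ [NF Hx].
  exact: (ex_not_forced (subS Hx) (cond_restr Hk Hq (subS Hx)) NF). }
  have UA := Hu ∩ normal_lt N.
  have [|_[w[_[Hw[_ E]]]]] := ae_reflected Fu.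
  { by apply: (ae_mono UA) => x _ [[L _] Hx]; case: (stage_dom (subS Hx) L). }
  have Lw : w <=[k] q.
  { apply: (le_of_ae Hw Hq); apply: (ae_mono (UA ∩ E)) => x _ [[[L _] Hx][_ Ex]]; exact: (le_trans (subS Hx) Ex L). }
  have [r[Lr /in_graph0[_[_ F]]]] := H w Lw.
  have [x[_[[[[_ NF] Hx][_ Ex]] Fx]]] := ae_ex (UA ∩ E ∩ F).
  exact: (NF _ (le_trans (subS Hx) (restr_le Hk (subS Hx) Lr) Ex) Fx).
Qed.

Lemma reflect_names : exists b c, b # k /\ sub d b /\ b0 # b /\ saturated b b c /\ (forall z q, pair z q # c -> z # d) /\
  (∀* x, ∀ z # d, ∀ q # PP (A x), (q ⊩[A x] FMem (check (PP (A x)) z) (S x) <-> pair z (restr q b) # c)).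
Proof.
have [b[c[Hb[Sd[Hb0b[Sc[Ec dom]]]]]]] := ex_bounded_name Hd Hb0 saturated_almost_forced; exists b, c; splits.
apply: (ae_forall_small FM _ (small_mem Hd)) => z Hz; set Q := fun x => _.
case: (ae_decided (Q := Q) _) => // J; exfalso.
have [|q[Fq Hq]] := ae_select (Q := fun x q => q # PP (A x) /\ ~ (forced x z q <-> pair z (restr q b) # c)) _.
{ apply: (ae_mono J) => x _ NQ; apply: NNPP => NE; apply: NQ => q Hq; apply: NNPP => Nq; apply: NE; by exists q. }
have [|_[w[_[Hw[_ E]]]]] := ae_reflected Fq; first by apply: (ae_mono Hq) => x _ [].
have {}J : ∀* x, ~ (forced x z (restr w (A x)) <-> pair z (restr w b) # c).
{ apply: (ae_mono (Hq ∩ E ∩ (normal_lt N ∩ normal_gt N Hb))).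
  move=> x _ [[[_ Nq][L1 L2]][Hx Hbx]] [K1 K2]; apply: Nq; have Hbx' := subS Hbx.
  have [M1 M2] := (restr_le (subS Hx) Hbx' L1, restr_le (subS Hx) Hbx' L2).
  move: M1 M2; rewrite (restr_ord w (ord_in Ok Hx) Hbx) => M1 M2; split=> K.
  - exact: (saturated_le (subS Hb) Sc (K1 (forced_le Hx L2 K)) M1).
  - exact: (forced_le Hx L1 (K2 (saturated_le (subS Hb) Sc K M2))). }
case: (ae_decided (Q := fun x => forced x z (restr w (A x))) _) => F; have [x[_[NI Fx]]] := ae_ex (J ∩ F); apply: NI; split=> // K.
- by apply/(Ec z w Hz Hw)/in_graph0.
- by move/(Ec z w Hz Hw)/in_graph0: K => [_[_ F']]; have [x'[_[F1 F2]]] := ae_ex (F ∩ F'); case: F1.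
Qed.
End ReflectNames.

Hypotheses (l_large : ~ embeds l (traces 7)) (menas : ∀* x, exists a, pair (A x) a # f /\ embeds x a).

Lemma ae_good : ∀* x, exists a, good (A x) a x.
Proof.
have H1 := ae_inacc FM N k_card k_uncountable ∩ ae_preserves_regular.
have H2 := (ae_closed_under FM N f_fun (fun c e Hce => (f_in Hce).2)) ∩ ae_few_names l_large.
apply: (ae_mono (normal_lt N ∩ menas ∩ (H1 ∩ H2))).
by move=> x _ [[Hx[a[Ha E]]][[Ix Px][Cx Fx]]]; exists a.
Qed.

Definition decided b s d y u : Prop :=
  u <=[b] restr s b /\ u ⊩[b] cohen_point (app s b) y (check (PP b) d) (check (PP b) b).

Section Decided.
Variables b a x h t s : V.
Hypotheses (G : good b a x) (Hh : height h # b) (R : realizes b h t) (L : s <=[b.+1] t).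
Let Hb : b # k := G.1.
Let Hbk : b # k.+1 := subS Hb.
Let Hs : b.+1 # k.+1 := succ_stage Hb.
Let Hbs : b # b.+1.+1 := subS (memS b).

Lemma ex_decided : ∃ d # b, exists u y, decided b s d y u.
Proof.
have Hsb := cond_restr Hs (stage_dom Hs L).1 Hbs; have [g Gs] := ex_generic Hbk Hsb.
have [d[w[Hd[Cw _]]]] := realizer_below G R Hh L Gs; exists d; split=> //; have [y Ey] := val_surj g w; subst w.
have [|u[_[Lu Fu]]] := stage_truth Hbk Gs (Phi := fun T e => cohen_point (e 0) (e 1) (e 2) (e 3))
  (e := scons (app s b) (scons y (scons (check (PP b) d) (fun _ => check (PP b) b)))) _; last by exists u, y.
by rewrite /= !(val_check g); apply/means_cohen_point => //; apply/(ge_mem g).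
Qed.

Variables d y u : V.
Hypotheses (Hd : d # b) (Du : decided b s d y u).

Lemma decided_condition (g : generic_at b) : g ∋ u -> cohen_condition (embed g b) (indicator (embed g d) y.[g]) (app s b).[g].
Proof.
move=> Gu; have [_ F] := Du; move: F; rewrite (stage4_iff Hbk (Phi := @cohen_point)) => [|/(_ g Gu)].
- exact: (generic_sub g Gu).
- by rewrite !(val_check g); move/means_cohen_point; apply; apply/(ge_mem g).
Qed.

Lemma decided_agree (g : generic_at b) : g ∋ u ->
  sub (height h) d /\ ∀ z # height h, (embed g z # (graph_name b h).[g] <-> embed g z # y.[g]).
Proof.
move=> Gu; have Gs := generic_up Hbk Du.1 Gu; have [d'[w[_[Cw[Sd E]]]]] := realizer_below G R Hh L Gs.
have Ei := cohen_condition_inj Cw (decided_condition Gu).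
have /indicator_sub[/(embed_sub (ge_mem g) (ge_transitive g)) Sd' E'] : sub (indicator (embed g d') w) (indicator (embed g d) y.[g]) by rewrite Ei.
by split=> z Hz; [apply: Sd'; exact: Sd|rewrite (E z Hz); apply: E'; apply/(ge_mem g)/Sd].
Qed.

Variables b' c w : V.
Let h' : V := triple w b' c.
Hypotheses (Hb' : b' # b) (Sd : sub d b') (dom : forall z q, pair z q # c -> z # d)
  (names_agree : ∀ z # d, ∀ q # PP b, (q ⊩[b] FMem (check (PP b) z) y <-> pair z (restr q b') # c)) (Lw : restr w b <=[b] u).

Lemma in_reflected (g : generic_at b) z : embed g z # (graph_name b h').[g] <-> z # d /\ embed g z # y.[g].
Proof.
rewrite in_graph_name /h' !tripleE; split=> [[_[q[Gq K]]]|[Hz]].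
- have Hz := dom K; have Hq := generic_sub g Gq; split=> //; rewrite -(val_check g).
  by move/(names_agree Hz Hq): K => /(stage_mem_iff Hbk _ _ Hq); apply.
- rewrite -(val_check g) => /(val_mem g (stage_preorder Hbk))[q[Gq Fq]]; split; first exact: Sd.
  by exists q; split=> //; apply/(names_agree Hz (generic_sub g Gq)).
Qed.

Lemma reflected_above z v : h # two_step -> z # height h -> v <=[k] w -> pair z (restr v b') # c <-> pair z (restr v (height h)) # graph h.
Proof.
move=> Th Hz Lv; have Lq := le_trans Hbk (restr_le Hk Hbk Lv) Lw; have [Hq _] := stage_dom Hbk Lq; have Ob := ord_in Ok Hb.
have agree (g : generic_at b) (Gv : g ∋ restr v b) := decided_agree (generic_up Hbk Lq Gv).
have [g0 G0] := ex_generic Hbk Hq; have [Shd _] := agree g0 G0.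
rewrite -(restr_ord v Ob Hb') -(restr_ord v Ob Hh) -(names_agree (Shd z Hz) Hq) (stage_mem_iff Hbk _ _ Hq).
rewrite (forced_graph_name Hbk Th _ Hz Hq).
- by move=> z' Hz'; exact: (ord_trans Ob Hz' Hh).
- by split=> H g Gq; move: (H g Gq); rewrite (val_check g); case: (agree g Gq) => _ ->.
Qed.

Lemma reflected_le t' : realizes b h' t' -> t' <=[b.+1] s.
Proof.
move=> R'; have [Ht'[Et' _]] := R'; move: Et'; rewrite /h' base_triple => Et'.
have [Hss _] := stage_dom Hs L; have Lu : restr t' b <=[b] u by rewrite Et'.
apply: (le_succ Hb Ht' Hss (le_trans Hbk Lu Du.1)) => g Gt; have Gu := generic_up Hbk Lu Gt.
have Hb'' : height h' # b by rewrite /h' height_triple.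
apply/(cohen_condition_le G (point_condition G R' Hb'' Gt) (decided_condition Gu)).
have [Im It] := (ge_mem g, ge_transitive g); apply/indicator_sub; rewrite /h' height_triple; split; first exact/(embed_sub Im It).
by move=> z' /(in_embed Im It)[z[-> Hz]]; rewrite in_reflected; tauto.
Qed.
End Decided.

Lemma reflect_stage h s : h # two_step -> (∀* x, exists t, realizes (A x) h t /\ app s x <=[(A x).+1] t) ->
  exists h', h' ≼ h /\ ∀* x, forall t', realizes (A x) h' t' -> t' <=[(A x).+1] app s x.
Proof.
move=> Th H; have [Hp[Hh _]] := two_stepP Th; have H0 := H ∩ ae_good ∩ normal_gt N Hh.
have [|d[Hd K]] := regressive_constant FM N (R := fun x d => exists u y, decided (A x) (app s x) d y u) _.
{ by apply: (ae_mono H0) => x _ [[[t[R L]][a G]] Hhx]; exact: (ex_decided G Hhx R L). }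
have [u[Fu {}K]] := ae_select _ K; have [S[_ {}K]] := ae_select _ K.
have [|_[w[_[Hw[_ E]]]]] := ae_reflected Fu.
{ by apply: (ae_mono (K ∩ normal_lt N)) => x _ [[L _] Hx]; case: (stage_dom (subS Hx) L). }
have [b'[c[Hb'[Sd[Hhb[Sc[dom J]]]]]]] := reflect_names Hd Hh (S := app S) _.
have Th' := triple_in_two_step Hw Hb' Sc; exists (triple w b' c).
have all := H0 ∩ (K ∩ E) ∩ (J ∩ normal_gt N Hd ∩ (normal_lt N ∩ normal_gt N Hb')).
split; last first.
{ apply: (ae_mono all) => x _ [[[[[t[R L]][a G]] Hhx][D[_ Lw]]][[Jx Hdx][Hx Hbx]]] t'.
  exact: (reflected_le G L Hdx D Hbx Sd dom Jx Lw). }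
have Sh : sub (height h) b' by move=> z Hz; exact: (ord_trans (ord_in Ok Hb') Hz Hhb).
rewrite /two_step_le !tripleE; splits.
- apply: (le_of_ae Hw Hp); apply: (ae_mono all) => x _ [[[[[t[[_[Et _]] L]] _] _][[Lu _][_ Lw]]][_[Hx _]]].
  have Hxk := subS Hx; have Lt := restr_le (succ_stage Hx) (subS (memS (A x))) L.
  by rewrite -Et; exact: (le_trans Hxk Lw (le_trans Hxk Lu Lt)).
- move=> z Hz q Lq; have [v[Lv Ev]] := ex_extension Hk (subS Hb') Hw Lq; rewrite -Ev (restr_restr _ Sh).
  have [x[_[[[[[t[R L]][a G]] Hhx][D[_ Lw]]][[Jx Hdx][Hx Hbx]]]]] := ae_ex all.
  exact: (reflected_above G Hhx R L Hdx D Hbx Jx Lw Th Hz Lv).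
Qed.

Definition strategy_at a E c q S : Prop := coordinate c q /\ ∀ p # PP c, p ⊩[c] FMem q (QQ c) /\
  p ⊩[c] winning_below q S (RR c) (check (PP c) E) /\ (c <> a.+1 -> p ⊩[c] FEq q (OO c)).
Definition position c s xi : V := function_name (PP c) xi (fun e => app (base (app s e)) c).

Lemma le_coordinate p q c (g : generic_at c) : p <=[k] q -> c # k -> g ∋ restr p c ->
  pair (app p c).[g] (app q c).[g] # (RR c).[g].
Proof. by move=> L Hc; have [Pp Pq] := stage_dom Hk L; exact: ((le_iff Hk Pp Pq).1 L c Hc g). Qed.

Lemma fun_on_position c s xi (g : generic_at c) : fun_on (position c s xi).[g] (embed g xi).
Proof. exact: fun_on_function_name. Qed.

Lemma app_position c s xi e (g : generic_at c) : e # xi -> app (position c s xi).[g] (embed g e) = (app (base (app s e)) c).[g].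
Proof. exact: app_function_name. Qed.

Section Tail.
Variables b a x E : V.
Hypotheses (G : good b a x) (HE : second_player a.+1 E).
Let Hb : b # k := G.1.
Let Hs : b.+1 # k.+1 := succ_stage Hb.
Let Hf : pair b a # f := G.2.2.2.2.1.
Let Oa : ord a := ord_in Ok (f_in Hf).2.

Lemma tail_above c : c # k -> ~ c # b.+1 -> b # c.
Proof.
move=> Hc Nc; case: (ord_total (ord_in Ok Hc) (ord_in Ok Hb)) => [K|[K|//]]; case: Nc; apply/inS; tauto.
Qed.

(* In the lottery at succ a, which is not (succ a)-strategically closed, the first move opts for an atom. *)
Lemma iterand_strategy c (g : generic_at c) : c # k -> b # c -> exists q : g, q # (QQ c).[g] /\
  (exists S, wins_below q S (RR c).[g] (embed g E)) /\ (c <> a.+1 -> q = (OO c).[g]).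
Proof.
move=> Hc Hbc; have [Im It] := (ge_mem g, ge_transitive g); have PT := iterand_preorder g Hc.
have Osa : ord (embed g a.+1) by apply/(embed_ord Im It); exact: ordS.
have HE' := embed_second_player Im It HE; have Oc := ord_in Ok Hc.
case: (iterand_cases g Hc (stage_preorder (subS Hc))) => [[d[Hd[Cl LS]]]|[_[ED _]]].
- case: (classic (c = a.+1)) => [Ec|Nc].
  + have [|q[Hq atom]] := ex_lottery_atom _ LS; first exact/(embed_ord Im It).
  by exists q; splits; [case: (order_dom PT Hq)|exact: (ex_atom_strategy Osa HE' Hq atom)].
  + exists (OO c).[g]; splits; first exact: (top_in PT).
  apply: (ex_lottery_strategy LS Osa _ HE'); apply/Im.
  case: (ord_total (ordS Oa) Oc) => [//|[K|/inS[K|K]]]; first by case: Nc.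
  * by case: (mem_asym K (Cl b Hbc a Hf)).
  * by case: (mem_irrefl (x := a)); move: (Cl b Hbc a Hf); rewrite K.
- exists (OO c).[g]; splits; first exact: (top_in PT).
  by apply: (ex_atom_strategy Osa HE' (order_refl PT (top_in PT))) => u /(order_dom PT)[/ED].
Qed.

Lemma means_strategy c q S (g : generic_at c) : c # k ->
  Means (@mem g) (winning_below q.[g] S.[g] (RR c).[g] (check (PP c) E).[g]) (wins_below q.[g] S.[g] (RR c).[g] (embed g E)).
Proof.
move=> Hc; rewrite (val_check g); have [Im It] := (ge_mem g, ge_transitive g).
have Osa : ord (embed g a.+1) by apply/(embed_ord Im It); exact: ordS.
by apply: (means_winning_below _ _ _ Osa); apply/(embed_sub Im It)/HE.1.
Qed.

Lemma ex_strategy c : c # k -> b # c -> exists q S, strategy_at a E c q S.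
Proof.
move=> Hc Hbc; have Hck := subS Hc; have [w[Hw top]] := ex_top_condition Hck.
pose Phi T (e : nat -> T) := ((∃ S, winning_below (e 0) S (e 1) (e 2)) ∧ (¬ e 3 ≐ e 4 ⇒ e 0 ≐ e 5))%F.
have SPhi : schematic Phi by rewrite /Phi; exact _.
pose env := scons (RR c) (scons (check (PP c) E) (scons (check (PP c) c) (scons (check (PP c) a.+1) (fun _ => OO c)))).
have [|q [Cq [Mq /(stage_iff Hck _ SPhi Hw) Fq]]] := ex_coordinate (e := env) SPhi Hc Hw.
{ move=> g _; have [q[Hq[[S HS] Eq]]] := iterand_strategy g Hc Hbc; exists q; split=> //.
  have [q' Eq'] := val_surj g q; have [S' ES] := val_surj g S; subst q S.
  apply/sat_and; split; first by apply/sat_exists; exists S'.[g]; exact/(means_strategy q' S' g Hc).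
  rewrite /= !(val_check g) => Nc; apply: Eq => Ec; exact: Nc (f_equal (embed g) Ec). }
have {}Fq (g : generic_at c) (Gw : g ∋ w) := (sat_and _ _ _).1 (Fq g Gw).
have [|S FS] := generic_maximal_principle V_countable (stage_preorder Hck) (fun a a' => @stage_dom c a a' Hck)
  (Phi := fun T e => winning_below (e 1) (e 0) (e 2) (e 3)) (e := scons q (scons (RR c) (fun _ => check (PP c) E))) _ Hw.
{ by move=> g Gw; have [/sat_exists] := Fq g Gw. }
exists q, S; split=> // p Hp; splits; [exact: (forces_le Hck (top p Hp) Mq)|exact: (forces_le Hck (top p Hp) FS)|move=> Nc].
apply: (forces_le Hck (top p Hp)); apply/(stage_eq_iff Hck _ _ Hw) => g Gw; have [_] := Fq g Gw.
by apply=> /=; rewrite !(val_check g) => /(embed_inj (ge_mem g)).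
Qed.

Variable sg : V.
Hypothesis sgP : ∀ c # k, b # c -> strategy_at a E c (pr1 (app sg c)) (pr2 (app sg c)).
Notation first_move c := (pr1 (app sg c)).
Notation strategy c := (pr2 (app sg c)).

Lemma strategy_wins c (g : generic_at c) : c # k -> ~ c # b.+1 -> (first_move c).[g] # (QQ c).[g] /\
  wins_below (first_move c).[g] (strategy c).[g] (RR c).[g] (embed g E) /\ (c <> a.+1 -> (first_move c).[g] = (OO c).[g]).
Proof.
move=> Hc Nc; have Hck := subS Hc; have [_ H] := sgP Hc (tail_above Hc Nc).
have [p Gp] := filter_nonempty (set_filter g); have Hp := generic_sub g Gp; have [M[F Eo]] := H p Hp.
move/(stage_mem_iff Hck _ _ Hp)/(_ g Gp): M => M.
move: F; rewrite (stage4_iff Hck (Phi := @winning_below)) // => /(_ g Gp)/(means_strategy _ _ g Hc) W.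
by splits=> Nca; apply: ((stage_eq_iff Hck _ _ Hp).1 (Eo Nca)).
Qed.

Lemma tail_supported c s d0 : c # k.+1 -> inacc c -> b.+1 # c -> d0 # c -> (∀ z # c, restr s z # PP z) ->
  (∀ z # c, ~ z # b.+1 -> ~ z # d0 -> z <> a.+1 ->
  forall g : generic_at z, g ∋ restr s z -> (app s z).[g] = (OO z).[g]) -> ∃ d # c, supported d c s.
Proof.
move=> Hc [_[_[[Lc _] _]]] Hbc Hd0 Hsc Es; have Oc := ord_stage Hc.
have [d1[Hd1[S1 N1]]] : ∃ d # c, sub d0 d /\ (a.+1 # c -> a.+1 # d).
{ case: (classic (a.+1 # c)) => [Ha|Na]; last by exists d0; splits.
  have [d[Hd[S0 S]]] := ord_common_bound Oc Hd0 (lim_succ Lc Ha); exists d; splits=> // _; apply: S; exact: memS. }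
have [d[Hd[S2 S3]]] := ord_common_bound Oc Hd1 Hbc; exists d; split=> // z Hz Nz.
apply/(stage_eq_iff (stage_trans Hc (subS Hz)) _ _ (Hsc z Hz)); apply: Es => // [/S3|/S1/S2|E'] //.
by apply: Nz; rewrite E'; apply: S2; apply: N1; rewrite -E'.
Qed.

Lemma ex_start u : u # PP b.+1 -> ∃ r # PP k, restr r b.+1 = u /\ ∀ c # k, ~ c # b.+1 -> app r c = first_move c.
Proof.
move=> Hu; apply: (ex_condition Hk Hs Hu (Rel := fun c s y => y = first_move c)); first by definability.
- move=> c s Hc Nc Hsc _; exists (first_move c); have [Cq H] := sgP Hc (tail_above Hc Nc); splits.
  by case: (H s Hsc).
- move=> c s Hc Hbc Ic _ Hsc [_ Es]; apply: (tail_supported Hc Ic Hbc Hbc Hsc) => z Hz Nz _ Na g _.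
  by rewrite (Es z Hz Nz); have [_[_ ->]] := strategy_wins g (stage_in Hc Hz) Nz.
Qed.

Variable r0 : V.
Hypothesis start : ∀ c # k, ~ c # b.+1 -> app (base r0) c = first_move c.
Notation u0 := (restr (base r0) b.+1).
Definition tail_extension r : Prop := r ≼ r0 /\ restr (base r) b.+1 = u0.
Definition answers_at s xi c p y : Prop := p ⊩[c] pair_in (strategy c) (position c s xi) y.

Lemma answers_at_generic s xi c s' y (g : generic_at c) : c # k -> answers_at s xi c s' y -> s' # PP c -> g ∋ s' ->
  pair (position c s xi).[g] y.[g] # (strategy c).[g].
Proof.
move=> Hc H Hs'; move: H; rewrite /answers_at (stage3_iff (subS Hc) (Phi := @pair_in)) // => H /H; exact: (means_pair_in _ _ _).1.
Qed.

Section Answer.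
Variables s xi : V.
Hypotheses (Hxi : xi # E) (Fs : fun_on s xi) (Ts : ∀ e # xi, tail_extension (app s e))
  (Ds : forall e d, e # xi -> d # e -> app s e ≼ app s d).
Hypothesis answered : ∀ e # xi, e # E -> ∀ c # k, ~ c # b.+1 ->
  answers_at (restr s e) e c (restr (base (app s e)) c) (app (base (app s e)) c).
Notation p_ e := (base (app s e)).
Let Hxa : xi # a.+1 := HE.1 xi Hxi.
Let Ox : ord xi := ord_in (ordS Oa) Hxa.
Let Hp e (He : e # xi) : p_ e # PP k := (two_stepP (Ts He).1.1).1.

Section Response.
Variables (c : V) (g : generic_at c).
Hypotheses (Hc : c # k) (Nc : ~ c # b.+1) (Gs : ∀ e # xi, g ∋ restr (p_ e) c).
Notation t := (position c s xi).[g].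
Let Im := ge_mem g.
Let It := ge_transitive g.
Let Ft : fun_on t (embed g xi) := fun_on_position s xi g.

Lemma restr_position e : e # xi -> restr t (embed g e) = (position c (restr s e) e).[g].
Proof.
move=> He; have Se : sub e xi by move=> z Hz; exact: (ord_trans Ox Hz He).
have S' : sub (embed g e) (embed g xi) by apply/(embed_sub Im It).
apply: (fun_on_ext (fun_on_restr Ft S') (fun_on_position (restr s e) e g)) => w Hw; rewrite (app_restr Ft S' Hw).
move: Hw => /(in_embed Im It)[z[-> Hz]]; have E' : app (base (app (restr s e) z)) c = app (p_ z) c by rewrite (app_restr Fs Se Hz).
by apply: (eq_trans (app_position s g (Se z Hz))); rewrite -E'; apply: eq_sym; exact: app_position.
Qed.

Lemma ex_answer : exists p : g, p # (QQ c).[g] /\ pair t p # (strategy c).[g] /\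
  (∀ e # xi, pair p (app (p_ e) c).[g] # (RR c).[g]) /\
  ((∀ e # xi, (app (p_ e) c).[g] = (first_move c).[g]) -> p = (first_move c).[g]).
Proof.
have [Hq[[[[Sg Sf] W] Pa] _]] := strategy_wins g Hc Nc; have PT := iterand_preorder g Hc.
have Hxi' : embed g xi # embed g E by apply/Im.
have [|p[Bp[Sp Lp]]] := W (embed g xi) t Hxi'.
{ split=> //; splits.
  - move=> w /(in_embed Im It)[e[-> He]]; rewrite (app_position s g He) -(start Hc Nc).
  have [[_[_[L _]]] _] := Ts He; exact: (le_coordinate L Hc (Gs He)).
  - move=> w v /(in_embed Im It)[e[-> He]] /(in_embed Im It)[d[-> Hd]]; have Hdx := ord_trans Ox Hd He.
  rewrite (app_position s g He) (app_position s g Hdx); have [_[_[L _]]] := Ds He Hd; exact: (le_coordinate L Hc (Gs He)).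
  - move=> w /(in_embed Im It)[e[-> He]] /Im HeE; rewrite (app_position s g He) (restr_position He).
  exact: (answers_at_generic Hc (answered He HeE Hc Nc) (generic_sub g (Gs He)) (Gs He)). }
exists p; splits; first by case: (order_dom PT Bp).
- by move=> e He; rewrite -(app_position s g He); apply: Lp; apply/Im.
- move=> Eq; apply: (Sf _ _ _ Sp); apply: (Pa _ _ Hxi' Ft) => w /(in_embed Im It)[e[-> He]].
  by rewrite (app_position s g He) (Eq e He).
Qed.
End Response.

Lemma answer_value c s' y (g : generic_at c) : c # k -> ~ c # b.+1 -> answers_at s xi c s' y -> s' # PP c ->
  (∀ e # xi, s' <=[c] restr (p_ e) c) -> g ∋ s' -> y.[g] # (QQ c).[g] /\
  (∀ e # xi, pair y.[g] (app (p_ e) c).[g] # (RR c).[g]) /\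
  ((∀ e # xi, (app (p_ e) c).[g] = (first_move c).[g]) -> y.[g] = (first_move c).[g]).
Proof.
move=> Hc Nc H Hs' L Gs; have [|p[Qp[Sp Kp]]] := ex_answer Hc Nc (g := g).
{ by move=> e He; exact: (generic_up (subS Hc) (L e He) Gs). }
have [_[[[[_ Sf] _] _] _]] := strategy_wins g Hc Nc.
by rewrite (Sf _ _ _ (answers_at_generic Hc H Hs' Gs) Sp).
Qed.

Notation response := (follows b.+1 u0 (answers_at s xi)).

Lemma response_le c : c # k.+1 -> ∀ s' # PP c, response c s' -> ∀ e # xi, s' <=[c] restr (p_ e) c.
Proof.
apply: (eps_ind (Q := fun c => c # k.+1 -> ∀ s' # PP c, response c s' -> ∀ e # xi, s' <=[c] restr (p_ e) c)).
{ rewrite /follows /answers_at /position /function_name; definability. }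
move=> {}c IH Hc s' Hs' R e He; have [K1 K2] := R; have Oc := ord_stage Hc.
apply/(le_iff Hc Hs' (cond_restr Hk (Hp He) Hc)) => d Hd g Gs.
have Hdk := stage_in Hc Hd; rewrite (cond_app_restr Hk (Hp He) Hc Hd); case: (classic (d # b.+1)) => [J|J].
- have -> : app (p_ e) d = app s' d.
  { have [_ Eu] := Ts He; by rewrite (K1 d Hd J) -Eu (cond_app_restr Hk (Hp He) Hs J). }
  exact: (order_refl (iterand_preorder g Hdk) (coord_val (subS Hdk) Hc Hs' Hd Gs)).
- have Hsd := cond_restr Hc Hs' (subS Hd); have R' := follows_restr Oc Hd (cond_fun_on Hc Hs') R.
  by have [_[H _]] := answer_value Hdk J (K2 d Hd J) Hsd (IH d Hd (subS Hdk) _ Hsd R') Gs; exact: H.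
Qed.

Lemma ex_response : ∃ r # PP k, restr r b.+1 = u0 /\ (∀ e # xi, r <=[k] p_ e) /\
  ∀ c # k, ~ c # b.+1 -> answers_at s xi c (restr r c) (app r c).
Proof.
have [e0 He0] : exists e, e # xi by apply: neq_emp_ex => E0; exact: (HE.2.1 xi Hxa E0 Hxi).
have Hu : u0 # PP b.+1 by have [_ <-] := Ts He0; exact: (cond_restr Hk (Hp He0) Hs).
have [|c s' Hc Nc Hs' R'|c s' Hc Hbc Ic Fs' Hs' R'|r[Hr[Er Kr]]] := ex_condition Hk Hs Hu (Rel := answers_at s xi).
- by rewrite /answers_at /position /function_name; definability.
- have Hck := subS Hc; have L := response_le Hck Hs' R'.
  have [|y[Cy[My Fy]]] := ex_coordinate (Phi := fun T e => pair_in (e 1) (e 2) (e 0))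
  (e := scons (strategy c) (fun _ => position c s xi)) _ Hc Hs'.
  { move=> g Gs; have [|p[Qp[Sp _]]] := ex_answer (g := g) Hc Nc; last by exists p; split=> //; apply/means_pair_in.
  by move=> e He; exact: (generic_up Hck (L e He) Gs). }
  by exists y.
- have Oc := ord_stage Hc.
  have L z (Hz : z # c) := response_le (stage_trans Hc (subS Hz)) (Hs' z Hz) (follows_restr Oc Hz Fs' R').
  have val z (Hz : z # c) (J : ~ z # b.+1) (g : generic_at z) (Gs : g ∋ restr s' z) :=
  answer_value (stage_in Hc Hz) J (R'.2 z Hz J) (Hs' z Hz) (L z Hz) Gs.
  case: (classic (a # c)) => Ha.
  + have Hxc : xi # c by move: Hxa => /inS[K|-> //]; exact: (ord_trans Oc K Ha).
  have [|d[Fd Hd]] := ex_choice_fun (a := xi) (R := fun e d => d # c /\ supported d c (restr (p_ e) c)) _.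
  { by move=> e He; have [d Hd] := cond_supported Hc (cond_restr Hk (Hp He) Hc) Ic; exists d. }
  have [_[_[[_ Rc] _]]] := Ic; have [d0[Hd0 Bd]] := Rc xi Hxc _ Fd (fun e He => (Hd e He).1).
  apply: (tail_supported Hc Ic Hbc Hd0 Hs') => z Hz J Jd Na g Gs; have [_[_ E1]] := val z Hz J g Gs.
  have Hzk := stage_in Hc Hz; have [_[_ Eo]] := strategy_wins g Hzk J; rewrite E1; last exact: Eo.
  move=> e He; have [Hde Se] := Hd e He; rewrite (Eo Na); have Ge := generic_up (subS Hzk) (L z Hz e He) Gs.
  have N' : ~ z # app d e by move=> K; apply: Jd; exact: (ord_trans (ord_in Oc Hd0) K (Bd e He)).
  move: (Se z Hz N'); rewrite (cond_app_restr Hk (Hp He) Hc Hz) (restr_ord _ Oc Hz).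
  by move/(stage_eq_iff (subS Hzk) _ _ (generic_sub g Ge)); apply.
  + apply: (tail_supported Hc Ic Hbc Hbc Hs') => z Hz J _ _ g Gs; have [Qz _] := val z Hz J g Gs.
  have Hzk := stage_in Hc Hz; case: (iterand_cases g Hzk (stage_preorder (subS Hzk))) => [[d[_[Cl _]]]|[_[ED _]]].
  * by case: Ha; exact: (ord_trans Oc (Cl b (tail_above Hzk J) a Hf) Hz).
  * exact/ED.
- exists r; splits=> // e He; rewrite -(restr_dom (cond_fun_on Hk (Hp He))).
  apply: (response_le (memS k) Hr _ He); split=> // z Hz J; rewrite -Er.
  by rewrite (cond_app_restr Hk Hr Hs J).
Qed.

Lemma second_move : exists r, tail_extension r /\ (∀ e # xi, r ≼ app s e) /\
  ∀ c # k, ~ c # b.+1 -> answers_at s xi c (restr (base r) c) (app (base r) c).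
Proof.
have [p[_[Ep[Lp An]]]] := ex_response; have [_[_[[_ Rk] _]]] := k_inacc; have Hak := (f_in Hf).2.
have Hxk : xi # k by case/inS: Hxa => [K|-> //]; exact: (ord_trans Ok K Hak).
have comp e (He : e # xi) := two_stepP (Ts He).1.1.
have [|d[Hd Bd]] := Rk xi Hxk _ (fun_on_lam xi (F := fun e => height (app s e)) _).
{ by move=> e He; rewrite app_lam //; case: (comp e He) => _ []. }
have Hdk := subS Hd; have Sd e (He : e # xi) : sub (height (app s e)) d.
{ by move=> z Hz; move: (Bd e He); rewrite app_lam //; exact: (ord_trans (ord_in Ok Hd) Hz). }
have Hed e (He : e # xi) := sub_stage Hdk (subS (comp e He).2.1) (Sd e He).
pose R z q := ∃ e # xi, z # height (app s e) /\ pair z (restr q (height (app s e))) # graph (app s e).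
have coherent e e' z q : e # xi -> e' # e -> z # height (app s e') -> q <=[d] restr p d ->
  (pair z (restr q (height (app s e))) # graph (app s e) <-> pair z (restr q (height (app s e'))) # graph (app s e')).
{ move=> He He' Hz Lq; have [_[_[_[Se H]]]] := Ds He He'; rewrite -(restr_restr q Se); apply: (H z Hz).
  have L := restr_le Hdk (Hed e He) Lq; rewrite (restr_restr _ (Sd e He)) in L; have [_[Hh _]] := comp e He.
  exact: (le_trans (subS Hh) L (restr_le Hk (subS Hh) (Lp e He))). }
have L e (He : e # xi) : triple p d (saturation d d R) ≼ app s e.
{ apply: (saturation_le _ (Ts He).1.1 (Lp e He) Hd (Sd e He)) => z q Hz Lq; split=> [[e'[He'[Hz' K]]]|K].
  - case: (ord_total (ord_in Ox He) (ord_in Ox He')) => [J|[-> //|J]]; last exact/(coherent _ _ z q He J Hz' Lq).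
  exact/(coherent _ _ z q He' J Hz Lq).
  - by exists q; split; [exact: (le_refl Hdk (stage_dom Hdk Lq).1)|exists e]. }
exists (triple p d (saturation d d R)); rewrite /tail_extension !tripleE; splits=> //.
have [e0 He0] : exists e, e # xi by apply: neq_emp_ex => E0; exact: (HE.2.1 xi Hxa E0 Hxi).
exact: (two_step_trans (L e0 He0) (Ts He0).1).
Qed.
End Answer.

Variables (h0 : V) (hh : V -> V) (Dec : V -> V -> Prop).
Hypotheses (Cap : captures b h0 r0) (Hr0 : r0 # two_step) (Hh0 : height h0 # b) (h0_top : ∀ h # two_step, h ≼ h0)
  (hh_definable : DefinableFun1 hh) (Dec_definable : Definable2 Dec)
  (Dec_dense : forall z v, z # x -> v # two_step -> exists w, w ≼ v /\ Dec z w).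
Definition settled z r : Prop := hh z # two_step -> height (hh z) # b -> exists w, Dec z w /\ below b r0 (hh z) w /\
  forall v, v ≼ r -> restr (base v) b.+1 <=[b.+1] restr (base w) b.+1 -> v ≼ w.

Lemma settled_le z r r' : r' ≼ r -> settled z r -> settled z r'.
Proof.
move=> L H Th Hh; have [w[Dw[Bw K]]] := H Th Hh; exists w; splits=> v Lv.
by apply: K; exact: (two_step_trans Lv L).
Qed.

Lemma realizer_le_start h t : h # two_step -> height h # b -> realizes b h t -> t <=[b.+1] u0.
Proof. by move=> Th Hh Rt; have [_[R0 _]] := Cap; exact: (realizes_le G (h0_top Th) Hh0 Hh Rt R0). Qed.

Lemma ex_settled r z : tail_extension r -> z # x -> exists r', tail_extension r' /\ r' ≼ r /\ settled z r'.
Proof.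
move=> [Lr Er] Hz; have Tr := Lr.1; have [Hr[Hhr Sr]] := two_stepP Tr.
case: (classic (hh z # two_step /\ height (hh z) # b)) => [[Th Hh]|No]; last first.
{ by exists r; splits; [exact: two_step_refl|move=> Th Hh; case: No]. }
have [t Rt] := ex_realizer G Th Hh; have Lt := realizer_le_start Th Hh Rt; rewrite -Er in Lt.
have [v[Lv Ev]] := ex_extension Hk Hs Hr Lt; have Tv := thin_le Tr Lv; have [w[Lw Dw]] := Dec_dense Hz Tv.1.
have Lwr := two_step_trans Lw Tv; have [Tw[_[Lbw[Sh Ew]]]] := Lwr; have [Hw[Hd Sw]] := two_stepP Tw.
have [r1[Lr1[Er1 am]]] := ex_amalgam Hk Hs Lbw.
set d := height w in Hd Sw Sh Ew *; set pw := restr (base w) d in Ew; have Hdk := subS Hd.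
pose R y q := (q <=[d] pw /\ pair y q # graph w) \/ ((forall q', q' <=[d] q -> ~ q' <=[d] pw) /\
  y # height r /\ pair y (restr q (height r)) # graph r).
have DR : Definable2 R by exact _.
have L' : triple r1 d (saturation d d R) ≼ r.
{ apply: (saturation_le DR Tr Lr1 Hd Sh) => y q Hy Lq; have [Hq _] := stage_dom Hdk Lq; split=> [[[L K]|[_[_ //]]]|K].
  - exact/(Ew y Hy q L).
  - case: (classic (exists q', q' <=[d] q /\ q' <=[d] pw)) => [[q'[Lq' L]]|Nq].
  + exists q'; split=> //; left; split=> //; apply/(Ew y Hy q' L).
    exact: (saturated_le (subS Hhr) Sr K (restr_le Hdk (sub_stage Hdk (subS Hhr) Sh) Lq')).
  + by exists q; split; [exact: le_refl|right; splits=> q' Lq' L; apply: Nq; exists q']. }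
exists (triple r1 d (saturation d d R)); splits.
{ by split; [exact: (two_step_trans L' Lr)|rewrite base_triple Er1]. }
move=> _ _; exists w; splits.
- split; first exact: (two_step_trans Lwr Lr).
  by exists t; split=> //; rewrite -Ev; move: Lw => [_[_[L _]]]; rewrite base_triple in L; exact: (restr_le Hk Hs L).
- move=> u [Tu[_[Lu[Su Eu]]]] Luw; rewrite !tripleE in Lu Su Eu; have {}Lu := am _ Lu Luw.
  have [_[Hu _]] := two_stepP Tu; have Huk := subS Hu; rewrite /two_step_le; splits=> y Hy q Lq; rewrite (Eu y Hy q Lq).
  have L : restr q d <=[d] pw.
  { move: (restr_le Huk (sub_stage Huk Hdk Su) Lq); rewrite (restr_restr _ Su) => L; exact: (le_trans Hdk L (restr_le Hk Hdk Lu)). }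
  split=> [/in_saturation[_[Hq K]]|K].
  + apply/(Sw.2 y _ Hy Hq) => q1 L1; have [q2[L2[[_ K2]|[N2 _]]]] := K q1 L1; first by exists q2.
  by case: (N2 q2 (le_refl Hdk (stage_dom Hdk L2).1)); exact: (le_trans Hdk L2 (le_trans Hdk L1 L)).
  + apply: (saturation_of_forced Hdk DR Hy (stage_dom Hdk L).1) => q1 L1; left; split.
  * exact: (le_trans Hdk L1 L).
  * exact: (saturated_le Hdk Sw K L1).
Qed.

Variable j : V.
Hypotheses (Rj : ∀ z # x, app j z # a) (Ij : forall y z, y # x -> z # x -> app j y = app j z -> y = z).
(* The move r at xi: the second player answers the play s; the first player settles the requests of index xi, and
   those of index e when xi = e + 1, since one of e, e + 1 is a stage of the first player. *)
Definition move xi s r : Prop := tail_extension r /\ (∀ e # xi, r ≼ app s e) /\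
  (xi # E -> ∀ c # k, ~ c # b.+1 -> answers_at s xi c (restr (base r) c) (app (base r) c)) /\
  (~ xi # E -> ∀ z # x, app j z = xi \/ (app j z).+1 = xi -> settled z r).

Lemma settle_request r y : tail_extension r -> exists r', tail_extension r' /\ r' ≼ r /\ ∀ z # x, app j z = y -> settled z r'.
Proof.
move=> Tr; case: (classic (∃ z # x, app j z = y)) => [[z[Hz Ez]]|No].
- have [r'[T'[L' D']]] := ex_settled Tr Hz; exists r'; splits=> z' Hz' Ez'.
  by rewrite (Ij Hz' Hz) // Ez Ez'.
- by exists r; splits; [exact: (two_step_refl Tr.1.1)|move=> z Hz Ez; case: No; exists z].
Qed.

Lemma ex_move xi s : xi # a.+1 -> fun_on s xi -> (∀ e # xi, move e (restr s e) (app s e)) -> exists r, move xi s r.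
Proof.
move=> Hxi Fs M; have Ox := ord_in (ordS Oa) Hxi.
have Ds e d : e # xi -> d # e -> app s e ≼ app s d.
{ move=> He Hd; have [_[L _]] := M e He; rewrite -(app_restr Fs _ Hd); last exact: L.
  by move=> z Hz; exact: (ord_trans Ox Hz He). }
case: (classic (xi # E)) => HxE.
- have [|r[T[L An]]] := second_move HxE Fs (fun e He => (M e He).1) Ds; last by exists r; rewrite /move; splits.
  by move=> e He HeE; have [_[_[An _]]] := M e He; exact: An.
- have [r[Tr[Lr Sr]]] : exists r, tail_extension r /\ (∀ e # xi, r ≼ app s e) /\ ∀ z # x, (app j z).+1 = xi -> settled z r.
  { case: (ord_cases Ox) => [E0|[[e Ee]|Lx]]; last by case: HxE; exact: (HE.2.2.1 xi Hxi Lx).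
  - exists r0; splits; [by split=> //; exact: two_step_refl|by move=> e; rewrite E0 => /in_emp|].
    by move=> z _; rewrite E0 => /succ_neq_emp.
  - subst xi; have He := memS e; have [r[T[L Se]]] := settle_request e (M e He).1.
    exists r; splits; last by move=> z Hz /succ_inj Ez; exact: Se.
    move=> d Hd; have [Hd'|->] := (inS _ _).1 Hd; [exact: (two_step_trans L (Ds e d He Hd'))|exact: L]. }
  have [r'[T'[L' S']]] := settle_request xi Tr; exists r'; rewrite /move; splits; first by move=> e He; exact: (two_step_trans L' (Lr e He)).
  by move=> _ z Hz [Ez|Ez]; [exact: S'|exact: (settled_le L' (Sr z Hz Ez))].
Qed.

Lemma ex_master : exists r, tail_extension r /\ ∀ z # x, settled z r.
Proof.
have [||s[Fs Ms]] := @transfinite_choice V two_step (fun s r => exists xi, fun_on s xi /\ move xi s r) a.+1 (ordS Oa).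
{ rewrite /move /answers_at /position /function_name; definability. }
{ move=> xi s Hxi Fs H; have [|r M] := ex_move Hxi Fs; last first.
  { by exists r; split; [case: M => [[[]]]|exists xi]. }
  move=> e He; have [_[e'[F' M]]] := H e He; have Se : sub e xi by move=> z Hz; exact: (ord_trans (ord_in (ordS Oa) Hxi) Hz He).
  by have Ee := dom_unique F' (fun_on_restr Fs Se); subst e'. }
have M e (He : e # a.+1) : move e (restr s e) (app s e).
{ have [_[e'[F' M]]] := Ms e He; have Se : sub e a.+1 by move=> z Hz; exact: (ord_trans (ordS Oa) Hz He).
  by have Ee := dom_unique F' (fun_on_restr Fs Se); subst e'. }
have Ha := memS a; have [Ta[La _]] := M a Ha; exists (app s a); split=> // z Hz; have Hj := Rj Hz.
have settled_at e : e # a.+1 -> ~ e # E -> app j z = e \/ (app j z).+1 = e -> settled z (app s a).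
{ move=> He Ne Ez; have [_[_[_ S]]] := M e He; case/inS: (He) => [K|Ee]; last by rewrite -Ee; exact: S.
  by move: (La e K); rewrite (app_restr Fs (subS (a := a)) K) => L; exact: (settled_le L (S Ne z Hz Ez)). }
have Hja := subS Hj; case: (classic (app j z # E)) => He; last by apply: (settled_at _ Hja He); left.
have Hjs := ordS_in Oa Hj; apply: (settled_at _ Hjs); last by right.
by move=> K; case: ((HE.2.2.2 _ Hja _ Hjs eq_refl).1 K He).
Qed.

Section Below.
Variable r : V.
Hypothesis Tr : tail_extension r.

Lemma ex_below h : h # two_step -> height h # b -> exists v, below b r h v.
Proof.
move=> Th Hh; have [t Rt] := ex_realizer G Th Hh; have Lt := realizer_le_start Th Hh Rt; have [[T _] Er] := Tr; rewrite -Er in Lt.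
have [v[Lv Ev]] := ex_extension Hk Hs (two_stepP T).1 Lt; exists (triple v (height r) (graph r)).
split; [exact: thin_le|exists t; rewrite base_triple Ev; split=> //; exact: (le_refl Hs Rt.1)].
Qed.

Lemma below_trans h v v' : below b r h v -> v' ≼ v -> below b r h v'.
Proof.
move=> [L[t[Rt Lt]]] L'; split; first exact: (two_step_trans L' L).
by exists t; split=> //; have [_[_[Lb _]]] := L'; exact: (le_trans Hs (restr_le Hk Hs Lb) Lt).
Qed.

Lemma below_mono h h' v : h' ≼ h -> height h' # b -> below b r h' v -> below b r h v.
Proof.
move=> L Hh' [Lv[t'[Rt' Lt']]]; have [_[Th[_[S _]]]] := L; have [_[Hh _]] := two_stepP Th.
have Hhb := ord_sub_in (ord_in Ok Hh) (ord_in Ok Hb) Hh' S; have [t Rt] := ex_realizer G Th Hhb.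
by split=> //; exists t; split=> //; exact: (le_trans Hs Lt' (realizes_le G L Hhb Hh' Rt' Rt)).
Qed.
End Below.
End Tail.

Lemma ex_master_condition b a x h0 (hh : V -> V) (Dec : V -> V -> Prop) : good b a x -> DefinableFun1 hh -> Definable2 Dec ->
  height h0 # b -> h0 # two_step -> (∀ h # two_step, h ≼ h0) ->
  (forall z v, z # x -> v # two_step -> exists w, w ≼ v /\ Dec z w) -> exists r0 r, captures b h0 r0 /\
  tail_extension b r0 r /\ ∀ z # x, settled b r0 hh Dec z r.
Proof.
move=> G Dhh DDec Hh0 Th0 top dense; have Hb := G.1; have [_[_[_[_[Hf[_[j[_[Rj Ij]]]]]]]]] := G.
have [E HE] := ex_second_player (ordS (ord_in Ok (f_in Hf).2)).
have [|sg[_ sgP]] := ex_choice_fun (a := k) (R := fun c s => b # c -> strategy_at a E c (pr1 s) (pr2 s)) _.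
{ move=> c Hc; case: (classic (b # c)) => [Hbc|Nb]; last by exists emp.
  by have [q[S H]] := ex_strategy G HE Hc Hbc; exists (pair q S); rewrite pr1_pair pr2_pair. }
have [t Rt] := ex_realizer G Th0 Hh0; have [p[Hp[Ep start]]] := ex_start G HE sgP Rt.1.
have Hs := succ_stage Hb; have Cap : captures b h0 (triple p b.+1 (generic_graph b)) by rewrite /captures !tripleE Ep; splits.
have T0 : triple p b.+1 (generic_graph b) # two_step.
{ apply: (triple_in_two_step Hp (k_succ Hb)); exact: (saturated_saturation b.+1 Hs). }
exists (triple p b.+1 (generic_graph b)).
have [|r[Tr Sr]] := ex_master G HE sgP (r0 := triple p b.+1 (generic_graph b)) _ Cap T0 Hh0 top Dhh DDec dense Rj Ij.
- by rewrite base_triple.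
- by exists r.
Qed.

Section Measuring.
Variables la req h0 rho : V.
Definition Pkl : V := sep (power la) (fun y => small y k).
Definition set_names : V := power (prod Pkl two_step).
Definition puts B y v : Prop := exists h, pair y h # B /\ v ≼ h.
Definition forces_in B y v : Prop := forall v', v' ≼ v -> exists v'', v'' ≼ v' /\ puts B y v''.
Definition decides B y w : Prop := forces_in B y w \/ forall w', w' ≼ w -> ~ puts B y w'.
Definition is_master x r : Prop := exists a, good (A x) a x /\ exists r0, captures (A x) h0 r0 /\
  tail_extension (A x) r0 r /\ ∀ z # x,
  settled (A x) r0 (fun z => pr1 (app req z)) (fun z w => decides (pr2 (app req z)) (cap x la) w) z r.

Lemma puts_le B y v v' : v' ≼ v -> puts B y v -> puts B y v'.
Proof. by move=> L [h[K Lv]]; exists h; split=> //; exact: (two_step_trans L Lv). Qed.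

Lemma ex_decides B y v : v # two_step -> exists w, w ≼ v /\ decides B y w.
Proof.
move=> Tv; case: (classic (exists w, w ≼ v /\ puts B y w)) => [[w[L K]]|No].
- exists w; split=> //; left=> v' L'; exists v'; split; [exact: (two_step_refl L'.1)|exact: (puts_le L' K)].
- by exists v; split; [exact: two_step_refl|right=> w' L' K; apply: No; exists w'].
Qed.

Lemma in_Pkl y : y # Pkl <-> sub y la /\ small y k.
Proof. by rewrite in_sep in_power. Qed.

Hypotheses (Th0 : h0 # two_step) (Eh0 : height h0 = emp) (h0_top : ∀ h # two_step, h ≼ h0).

Lemma ae_ex_master : ∀* x, exists r, is_master x r.
Proof.
apply: (ae_mono (ae_good ∩ normal_gt N emp_in_k)) => x _ [[a G] He]; rewrite -Eh0 in He.
have [|r0[r H]] := ex_master_condition G (hh := fun z => pr1 (app req z)) (Dec := fun z w => decides (pr2 (app req z)) (cap x la) w) _ _ He Th0 h0_top; last by exists r, a; split=> //; exists r0.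
by move=> z v _; exact: ex_decides.
Qed.

Hypotheses (rhoP : ∀* x, is_master x (app rho x))
  (requests : forall h B, h # two_step -> B # set_names -> ∃ z # l, app req z = pair h B).
(* A pair (h, B) is measured when h forces, as far as the master conditions can tell, the set named by B to be in
   the measure induced by U. *)
Definition measured : V := sep (prod two_step set_names) (fun t => ae (fun x =>
  forall v, below (A x) (app rho x) (pr1 t) v -> forces_in (pr2 t) (cap x la) v)).

Lemma in_measured h B : pair h B # measured <-> (h # two_step /\ B # set_names) /\
  (∀* x, forall v, below (A x) (app rho x) h v -> forces_in B (cap x la) v).
Proof. by rewrite in_sep pair_prod pr1_pair pr2_pair. Qed.

Lemma cap_small_subset x : x # X -> cap x la # Pkl.
Proof.
move=> /(measure_space FM)[_ Sx]; apply/in_Pkl; split; first by move=> z /in_cap[].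
by apply: (small_embeds (embeds_sub _) Sx) => z /in_cap[].
Qed.

Lemma measured_of_ae h B : h # two_step -> B # set_names ->
  (∀* x, ∀ v # two_step, puts B (cap x la) v) -> pair h B # measured.
Proof.
move=> Th HB H; apply/in_measured; split=> //; apply: (ae_mono H) => x _ K v [Lv _] v' L'.
by exists v'; split; [exact: (two_step_refl L'.1)|exact: (K v' L'.1)].
Qed.

Lemma ae_below h : h # two_step -> ∀* x, (exists v, below (A x) (app rho x) h v) /\
  forall v, below (A x) (app rho x) h v -> v ≼ h.
Proof.
move=> Th; have [Hb[Hh _]] := two_stepP Th.
apply: (ae_mono (rhoP ∩ (normal_gt N Hh ∩ ae_pads Hb))) => x _ [[a[G[r0[Cap[Tr _]]]]][Hhx[_ Ph]]].
split=> [|v Bv]; last exact: (below_le G Cap Tr.1 Th Hhx Ph Bv).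
have He : height h0 # A x by rewrite Eh0; move: (ord_sub_in (ord_emp V) (ord_in Ok G.1) Hhx) => H; apply: H => z /in_emp.
exact: (ex_below G Cap He h0_top Tr Th Hhx).
Qed.

Lemma measured_meet h h' h'' B B' : pair h B # measured -> pair h' B' # measured -> h'' ≼ h -> h'' ≼ h' ->
  exists v y, y # Pkl /\ v ≼ h'' /\ puts B y v /\ puts B' y v.
Proof.
move=> /in_measured[_ Q] /in_measured[_ Q'] L L'; have Th := L.1; have [_[Hh _]] := two_stepP Th.
have all := Q ∩ Q' ∩ (rhoP ∩ normal_gt N Hh ∩ ae_below Th).
have [x[Hx[[{}Q {}Q'][[[a[G _]] Hhx][[v Bv] Lb]]]]] := ae_ex all.
have [v1[L1 K1]] := Q v (below_mono G L Hhx Bv) v (two_step_refl (Lb v Bv).1).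
have [v2[L2 K2]] := Q' v (below_mono G L' Hhx Bv) v1 L1; exists v2, (cap x la); splits.
- exact: cap_small_subset.
- exact: (two_step_trans L2 (two_step_trans L1 (Lb v Bv))).
- exact: (puts_le L2 K1).
Qed.

Lemma measured_below h B : h # two_step -> B # set_names ->
  (∀* x, exists v, below (A x) (app rho x) h v /\ puts B (cap x la) v) -> exists h', h' ≼ h /\ pair h' B # measured.
Proof.
move=> Th HB K; have master := rhoP ∩ normal_lt N.
have [|s[_ Ks]] := ae_select (Q := fun x s => exists v, below (A x) (app rho x) h v /\ puts B (cap x la) v /\
  s = restr (base v) (A x).+1) _.
{ by apply: (ae_mono K) => x _ [v[Bv Pv]]; exists (restr (base v) (A x).+1), v. }
have [|h1[L1 R1]] := reflect_stage (s := s) Th.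
{ by apply: (ae_mono Ks) => x _ [v[[_[t[Rt Lt]]][_ ->]]]; exists t. }
have Th1 := L1.1; have [_[Hh1 _]] := two_stepP Th1; have [z[Hz Ez]] := requests Th1 HB.
have [|s2[_ Ks2]] := ae_select (Q := fun x s => exists w, decides B (cap x la) w /\
  (exists t, realizes (A x) h1 t /\ restr (base w) (A x).+1 <=[(A x).+1] t) /\
  (forall v, v ≼ app rho x -> restr (base v) (A x).+1 <=[(A x).+1] restr (base w) (A x).+1 -> v ≼ w) /\
  s = restr (base w) (A x).+1) _.
{ apply: (ae_mono (rhoP ∩ (normal_gt N Hh1 ∩ ae_fine FM Hz))) => x _ [[a[_[r0[_[_ S]]]]][Hhx Hzx]].
  have := S z Hzx; rewrite /settled Ez pr1_pair pr2_pair => /(_ Th1 Hhx)[w[Dw[[_ Bw] Kw]]].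
  by exists (restr (base w) (A x).+1), w. }
have [|h2[L2 R2]] := reflect_stage (s := s2) Th1.
{ by apply: (ae_mono Ks2) => x _ [w[_[Bw[_ ->]]]]. }
exists h2; split; first exact: (two_step_trans L2 L1).
apply/in_measured; split; first by split; [case: L2|].
apply: (ae_mono (master ∩ (Ks ∩ R1 ∩ (Ks2 ∩ R2)))) => x _
  [[_ Hxk][[[v'[[Lv' _][Pv' Es]]] {}R1][[w[Dw[[t[Rt Lt]][Kw Es2]]]] {}R2]]] v [Lv[t2[Rt2 Lt2]]].
have Hs := succ_stage Hxk; have {}R1 := R1 t Rt; have {}R2 := R2 t2 Rt2; rewrite Es in R1; rewrite Es2 in R2.
have Lvw : v ≼ w := Kw v Lv (le_trans Hs Lt2 R2); case: Dw => [Dw|Nw]; first by move=> v1 K1; apply: Dw; exact: (two_step_trans K1 Lvw).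
have [Tv' _] := Lv'; have [p[Lp Ep]] := ex_extension Hk Hs (two_stepP Tv').1 (le_trans Hs Lt R1).
have Lu := thin_le Tv' Lp; case: (Nw _ _ (puts_le Lu Pv')); apply: (Kw _ (two_step_trans Lu Lv')).
by rewrite base_triple Ep; exact: (le_refl Hs (stage_dom Hs Lt).1).
Qed.

Lemma measured_cover h d T : h # two_step -> d # k -> (∀ j # d, app T j # set_names) ->
  (forall y v, y # Pkl -> v ≼ h -> exists v' j, v' ≼ v /\ j # d /\ puts (app T j) y v') ->
  exists h' j, h' ≼ h /\ j # d /\ pair h' (app T j) # measured.
Proof.
move=> Th Hd HT cover; have [|j[_ K]] := regressive_constant FM N
  (R := fun x j => j # d /\ exists v, below (A x) (app rho x) h v /\ puts (app T j) (cap x la) v) _.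
{ apply: (ae_mono (ae_below Th ∩ (rhoP ∩ normal_lt N ∩ normal_gt N Hd))).
  move=> x Hx [[[v Bv] Lb][[[a[G _]] Hxk] Hdx]]; have [v'[j[L[Hj K]]]] := cover _ v (cap_small_subset Hx) (Lb v Bv).
  exists j; split; first exact: (ord_trans (ord_in Ok Hxk) Hj Hdx).
  by split=> //; exists v'; split=> //; exact: (below_trans G Bv L). }
have [_[_[Hj _]]] := ae_ex K; have [|h'[L M]] := measured_below Th (HT j Hj); last by exists h', j.
by apply: (ae_mono K) => x _ [].
Qed.

Section SecondExtension.
Variables (g1 : generic_at k) (C LC : g1) (g2 : generic C LC).
Hypothesis CP : cohen_poset (embed g1 k) C LC.
Let Im := ge_mem g1.
Let It := ge_transitive g1.
Let PO1 := stage_preorder Hk.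
Let GF1 := set_filter g1.
Let GF2 := set_filter g2.
Notation m_ h := (point g1 h).
Definition in_filter h : Prop := h # two_step /\ g1 ∋ base h /\ g2 ∋ m_ h.

Lemma cohen_le m m' : le LC m m' <-> m # C /\ m' # C /\ sub m' m.
Proof. exact: (cohen_order CP). Qed.

Lemma cohen_preorder : preorder C LC.
Proof.
split=> [m Hm|m m' m'' /cohen_le[H1[_ S1]] /cohen_le[_[H3 S2]]]; apply/cohen_le; splits=> z Hz //.
by apply: S1; apply: S2.
Qed.

Lemma point_in_cohen h : h # two_step -> m_ h # C.
Proof.
move=> Th; have [_[Hh _]] := two_stepP Th; apply/(in_cohen CP).
by exists (embed g1 (height h)), (graph_name k h).[g1]; split=> //; apply/Im.
Qed.

Lemma point_mono h h' : h' ≼ h -> g1 ∋ base h' -> sub (m_ h) (m_ h').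
Proof.
move=> L Gh; have [Hb[Hh _]] := two_stepP L.1; apply: (point_le Hk _ L).
- by move=> z Hz; exact: (ord_trans Ok Hz Hh).
- by rewrite (restr_dom (cond_fun_on Hk Hb)).
Qed.

Lemma ex_point_above m : m # C -> exists b c, (∀ p # PP k, triple p b c # two_step) /\ forall p, sub m (m_ (triple p b c)).
Proof.
move=> /(in_cohen CP)[_ [s [/(in_embed Im It)[d[-> Hd]] ->]]].
have [|c0[Sc0 E0]] := ex_saturated_name (Z := d) (g := g1) (w := cap s (embed g1 d)) Hk; first by move=> z /in_cap[].
have [b[c[Hb[Sd[_[Sc[Ec dom]]]]]]] := ex_bounded_name Hd emp_in_k Sc0; exists b, c.
split=> [p Hp|p]; first exact: triple_in_two_step.
rewrite /point; apply/indicator_sub; rewrite !tripleE; split; first exact/(embed_sub Im It).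
move=> w /(in_embed Im It)[z[-> Hz]]; rewrite in_graph_name !tripleE; split=> [Hs|[_[q[Gq K]]]].
- have [q[Gq K]] := (E0 z).1 ((in_cap _ _ _).2 (conj Hs ((Im z d).2 Hz))).
  by split; [exact: Sd|exists q; split=> //; apply/(Ec z q Hz (generic_sub g1 Gq))].
- have /E0/in_cap[] // : exists q, g1 ∋ q /\ pair z q # c0.
  by exists q; split=> //; apply/(Ec z q Hz (generic_sub g1 Gq)).
Qed.

Lemma le_of_point_sub h h1 p : h # two_step -> h1 # two_step -> sub (m_ h) (m_ h1) -> g1 ∋ p -> p <=[k] base h ->
  exists p', g1 ∋ p' /\ p' <=[k] p /\ triple p' (height h1) (graph h1) ≼ h.
Proof.
rewrite /point => Th Th1 /indicator_sub[/(embed_sub Im It) Sh agree] Gp Lp.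
have [|r[Gr[Lr Fr]]] := stage3_truth Hk Gp (Phi := @agree_on)
  (x := graph_name k h) (y := graph_name k h1) (z := check (PP k) (height h)) _.
{ by rewrite (val_check g1); apply/means_agree_on. }
have [_[Hh _]] := two_stepP Th; have [_[Hh1 Sh1]] := two_stepP Th1.
have Hr := generic_sub g1 Gr; have Sk e : e # k -> sub e k by move=> He z Hz; exact: (ord_trans Ok Hz He).
exists r; splits; rewrite /two_step_le !tripleE; splits; first exact: triple_in_two_step.
- exact: (le_trans Hk Lr Lp).
- move=> z Hz q Lq; have [v[Lv <-]] := ex_extension Hk (subS Hh1) Hr Lq; rewrite (restr_restr _ Sh).
  have Hv := (stage_dom Hk Lv).1.
  rewrite (forced_graph_name Hk Th1 (Sk _ Hh1) (Sh z Hz) Hv) (forced_graph_name Hk Th (Sk _ Hh) Hz Hv).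
  have E (g : generic_at k) (Gv : g ∋ v) : embed g z # (graph_name k h).[g] <-> embed g z # (graph_name k h1).[g].
  { have Gg := generic_up Hk Lv Gv; move: Fr; rewrite (stage3_iff Hk (Phi := @agree_on)) //.
  by move=> /(_ g Gg)/means_agree_on; apply; rewrite (val_check g); apply/(ge_mem g). }
  by split=> H g Gv; apply/(E g Gv)/(H g Gv).
Qed.

Lemma ex_point_fun : exists M : g1, ∀ h # two_step, app M (embed g1 h) = m_ h.
Proof.
pose F := (function_name (PP k) two_step (graph_name k)).[g1]; pose D := embed g1 (lam two_step height).
exists (lam (embed g1 two_step) (fun w : g1 => indicator (app D w) (app F w))) => h Th.
rewrite app_lam; first exact/Im; have Fl := fun_on_lam two_step (F := height) _.
by rewrite /F app_function_name // /D -(embed_app Im It (Fl _) Th) app_lam.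
Qed.

Lemma filter_dense (D : V -> Prop) : Definable1 D -> (∀ h # two_step, exists d, d ≼ h /\ D d) -> exists d, in_filter d /\ D d.
Proof.
move=> DD dense; have [M EM] := ex_point_fun; have [w[Hw top]] := ex_top_condition Hk.
have Fl : fun_on (lam two_step base) two_step by exact: fun_on_lam.
have EB h (Th : h # two_step) : app (embed g1 (lam two_step base)) (embed g1 h) = embed g1 (base h).
{ by rewrite -(embed_app Im It Fl Th) app_lam. }
have [|m [Gm [_ [/(in_embed Im It)[d[-> /in_sep[Td Dd]]] [Gd Em]]]]] := filter_generic GF2
  (Q := fun m => exists e : g1, e # embed g1 (sep two_step D) /\ app (embed g1 (lam two_step base)) e # generic_subset g1 /\ app M e = m) _; last first.
{ by exists d; split=> //; move: Gd; rewrite (EB d Td) => Gd; split=> //; split=> //; rewrite -(EM d Td) Em. }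
move=> m0 Hm0; have [b[c[T K]]] := ex_point_above Hm0.
have [|p[Gp[d[Dd[Ld Ep]]]]] := filter_generic GF1 (Q := fun p => exists d, D d /\ d ≼ triple w b c /\ p = base d) _.
{ move=> p Hp; have [d[Ld Dd]] := dense _ (T p Hp); have [Td[_[Lb _]]] := Ld; rewrite base_triple in Lb.
  exists (base d); split; first by case: (two_stepP Td).
  split=> //; exists d; splits; apply: (two_step_trans Ld).
  by have := thin_le (T w Hw) (p := p); rewrite !tripleE; apply; exact: top. }
subst p; have Td := Ld.1; exists (m_ d); split; first exact: point_in_cohen.
split; first by apply/cohen_le; splits; [exact: point_in_cohen|move=> z /(K w); exact: (point_mono Ld Gp)].
by exists (embed g1 d); splits; [apply/Im/in_sep|rewrite (EB d Td)|exact: EM].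
Qed.

Lemma ex_filter_set : exists H : g2, forall h, embed g2 (embed g1 h) # H <-> in_filter h.
Proof.
have [M EM] := ex_point_fun; have [Im2 It2] := (ge_mem g2, ge_transitive g2).
pose M' := lam (embed g1 two_step) (app M); have FM' : fun_on M' (embed g1 two_step) by exact: fun_on_lam.
have Fl : fun_on (lam two_step base) two_step by exact: fun_on_lam.
exists (sep (embed g2 (embed g1 two_step)) (fun w : g2 => app (embed g2 (embed g1 (lam two_step base))) w # embed g2 (generic_subset g1) /\
  app (embed g2 M') w # generic_subset g2)) => h.
rewrite in_sep Im2 Im /in_filter; split=> -[Th]; have Th' := (Im h two_step).2 Th.
all: rewrite -(embed_app Im2 It2 FM' Th') /M' app_lam // (EM h Th) -(embed_app Im2 It2 _ Th') ?(embed_fun_on Im It) //.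
all: by rewrite Im2 -(embed_app Im It Fl Th) app_lam.
Qed.

Lemma filter_le h h' : in_filter h -> h ≼ h' -> in_filter h'.
Proof.
move=> [Th[Gh G2]] L; have Th' := L.2.1.
have Gh' : g1 ∋ base h' := filter_up GF1 Gh (two_stepP Th').1 L.2.2.1.
apply: (conj Th' (conj Gh' _)); apply: (filter_up GF2 G2 (point_in_cohen Th')); apply/cohen_le.
exact: (conj (point_in_cohen Th) (conj (point_in_cohen Th') (point_mono L Gh))).
Qed.

Lemma filter_compatible h d : in_filter h -> in_filter d -> exists r, r ≼ h /\ r ≼ d.
Proof.
have ordered e e' : in_filter e -> in_filter e' -> sub (height e) (height e') -> exists r, r ≼ e /\ r ≼ e'.
{ move=> [Te[Ge Ge2]] [Te'[Ge' Ge2']] S; have [m[_[/cohen_le[Hm[_ S1]] /cohen_le[_[_ S2]]]]] := filter_meet GF2 Ge2 Ge2'.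
  have Sm : sub (m_ e) (m_ e').
  { move: Hm S1 S2 => /(in_cohen CP)[x[s[_ ->]]] /indicator_sub[_ E1] /indicator_sub[_ E2].
  rewrite /point; apply/indicator_sub; split; first exact/(embed_sub Im It).
  move=> z Hz; rewrite (E1 z Hz) (E2 z) //; move: z Hz; exact/(embed_sub Im It). }
  have [p[Gp[L1 L2]]] := filter_meet GF1 Ge Ge'; have [p'[_[L' K]]] := le_of_point_sub Te Te' Sm Gp L1.
  by exists (triple p' (height e') (graph e')); split=> //; apply: thin_le => //; exact: (le_trans Hk L' L2). }
move=> Fh Fd; have Oh e (Fe : in_filter e) := ord_in Ok (two_stepP Fe.1).2.1.
case: (ord_total (Oh h Fh) (Oh d Fd)) => [K|[K|K]].
- by apply: ordered => // z Hz; exact: (ord_trans (Oh d Fd) Hz K).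
- by apply: ordered => //; rewrite K.
- have [|r[L1 L2]] := ordered d h Fd Fh; last by exists r.
  by move=> z Hz; exact: (ord_trans (Oh h Fh) Hz K).
Qed.

Lemma filter_dense_below h (D : V -> Prop) : Definable1 D -> in_filter h ->
  (forall r, r ≼ h -> exists d, d ≼ r /\ D d) -> exists d, in_filter d /\ d ≼ h /\ D d.
Proof.
move=> DD Fh dense; have [|d[Fd[H|No]]] := filter_dense (D := fun d => (d ≼ h /\ D d) \/ forall r, r ≼ d -> ~ r ≼ h) _.
- move=> e Te; case: (classic (exists r, r ≼ e /\ r ≼ h)) => [[r[L1 L2]]|No].
  + have [d[Ld Dd]] := dense r L2; exists d; split; first exact: (two_step_trans Ld L1).
  by left; split=> //; exact: (two_step_trans Ld L2).
  + by exists e; split; [exact: two_step_refl|right=> r L1 L2; apply: No; exists r].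
- by exists d.
- by have [r[L1 L2]] := filter_compatible Fd Fh; case: (No r L1 L2).
Qed.

Lemma filter_lower h d : in_filter h -> in_filter d -> exists r, in_filter r /\ r ≼ h /\ r ≼ d.
Proof.
move=> Fh Fd; have [|r[Fr[Lr[L|No]]]] := filter_dense_below (D := fun r => r ≼ d \/ forall r', r' ≼ r -> ~ r' ≼ d) _ Fh.
- move=> r Lr; case: (classic (exists r', r' ≼ r /\ r' ≼ d)) => [[r'[L1 L2]]|No]; first by exists r'; split; [|left].
  by exists r; split; [exact: (two_step_refl Lr.1)|right=> r' L1 L2; apply: No; exists r'].
- by exists r.
- by have [r'[L1 L2]] := filter_compatible Fr Fd; case: (No r' L1 L2).
Qed.

Definition membership_env h y xd n : V := match n with
  | 0 => graph_name k h | 1 => check (PP k) (height h) | 2 => check (PP k) k | 3 => check (PP k) y | _ => xd end.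
Notation membership e := (point_forces (e 0) (e 1) (e 2) (e 3) (e 4)).

Lemma sat_membership h y xd : h # two_step -> sat mem (membership (fun n => (membership_env h y xd n).[g1])) <->
  Forces C LC (FMem (check C (embed g1 y)) xd.[g1]) (m_ h).
Proof.
move=> Th; rewrite /= !(val_check g1); apply: (means_point_forces _ _ CP); exact: point_in_cohen.
Qed.

Let SM : schematic (fun T e => membership e). Proof. exact _. Qed.
Definition forces_member xd y h : Prop := base h ⊩[k] membership (membership_env h y xd).

Lemma forces_member_below xd y m h : in_filter h -> g2 ∋ m -> Forces C LC (FMem (check C (embed g1 y)) xd.[g1]) m ->
  exists h', h' ≼ h /\ forces_member xd y h'.
Proof.
move=> [Th[Gh G2]] Gm Fm; have [n[Gn[/cohen_le[Hn[_ Sm]] /cohen_le[_[Hm Sh]]]]] := filter_meet GF2 Gm G2.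
have [b[c[T K]]] := ex_point_above Hn; have Hb := generic_sub g1 Gh.
have [p[Gp[_ Lp]]] := le_of_point_sub Th (T _ Hb) (fun e He => K (base h) e (Sh e He)) Gh (le_refl Hk Hb).
rewrite !tripleE in Lp; have Tp := Lp.1; have Hmp := point_in_cohen Tp.
have Fp : Forces C LC (FMem (check C (embed g1 y)) xd.[g1]) (m_ (triple p b c)).
{ apply: (Forces_mono cohen_preorder.2 _ Hmp _ Fm); first exact: (generic_sub g2 Gm).
  by apply/cohen_le; splits; [exact: (generic_sub g2 Gm)|move=> z /Sm/K]. }
have [r[Gr[Lr Fr]]] := stage_truth Hk Gp SM ((sat_membership y xd Tp).2 Fp).
exists (triple r b c); split; last by move: Fr; rewrite /forces_member /membership_env /graph_name !tripleE.
by have := thin_le Tp (p := r); rewrite !tripleE => /(_ Lr) L; exact: (two_step_trans L Lp).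
Qed.

Lemma ex_name_below (S : g2) Z : exists B, sub B (prod Z two_step) /\ ∀ y # Z,
  (embed g2 (embed g1 y) # S <-> exists h, in_filter h /\ pair y h # B).
Proof.
have [xd ->] : exists xd, S = xd.[g1].[g2].
{ by have [x ->] := val_surj g2 S; have [xd ->] := val_surj g1 x; exists xd. }
set forced := forces_member xd.
have D : Definable2 forced.
{ apply: (definable_Forces_schematic (v := fun n e => membership_env (e 1) (e 0) xd n) SM) => [||[|[|[|[|n]]]]|] /=; definability. }
have in_B y h : pair y h # sep (prod Z two_step) (fun t => forced (pr1 t) (pr2 t)) <-> (y # Z /\ h # two_step) /\ forced y h.
{ by rewrite in_sep pair_prod pr1_pair pr2_pair. }
have forcedP y h : in_filter h -> forced y h -> Forces C LC (FMem (check C (embed g1 y)) xd.[g1]) (m_ h).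
{ by move=> [Th[Gh _]] /(stage_iff Hk _ SM (generic_sub g1 Gh))/(_ g1 Gh)/(sat_membership _ _ Th). }
exists (sep (prod Z two_step) (fun t => forced (pr1 t) (pr2 t))); split=> [z /in_sep[] //|y Hy].
rewrite -(val_check g2) (val_mem g2 cohen_preorder); split=> [[m[Gm Fm]]|[h[Fh /in_B[_ K]]]]; last first.
{ by exists (m_ h); split; [case: Fh => _ []|exact: forcedP]. }
have [|h[Fh[[_ K]|No]]] := filter_dense (D := fun h => (h # two_step /\ forced y h) \/ forall h', h' ≼ h -> ~ forced y h') _.
- move=> h Th; case: (classic (exists h', h' ≼ h /\ forced y h')) => [[h'[L K]]|No].
  + by exists h'; split=> //; left; split=> //; case: L.
  + by exists h; split; [exact: two_step_refl|right=> h' L K; apply: No; exists h'].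
- by exists h; split=> //; apply/in_B; split=> //; split=> //; case: Fh.
- by have [h'[L K]] := forces_member_below Fh Gm Fm; case: (No h' L).
Qed.

Hypotheses (Sla : sub la l) (Skl : sub k la).
Definition lift (x : V) : g2 := embed g2 (embed g1 x).
Definition in_measure (Y : g2) : Prop := exists h B, in_filter h /\ pair h B # measured /\
  forall y h', y # Pkl -> in_filter h' -> pair y h' # B -> lift y # Y.

Lemma lift_mem x y : lift x # lift y <-> x # y.
Proof. by rewrite /lift (ge_mem g2) Im. Qed.

Lemma lift_transitive x (w : g2) : w # lift x -> exists y, w = lift y.
Proof.
move=> /(in_embed (ge_mem g2) (ge_transitive g2))[e[-> /It[y ->]]]; by exists y.
Qed.
Notation in_lift := (in_embed lift_mem lift_transitive).

Lemma in_measure_meet Y Y' : in_measure Y -> in_measure Y' -> ∃ y # Pkl, lift y # Y /\ lift y # Y'.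
Proof.
move=> [h[B[Fh[K HB]]]] [h'[B'[Fh'[K' HB']]]]; have [h2[F2[L L']]] := filter_lower Fh Fh'.
have [|d[Fd[_[y[Hy[[e[Ke Le]][e'[Ke' Le']]]]]]]] :=
  filter_dense_below (D := fun d => ∃ y # Pkl, puts B y d /\ puts B' y d) _ F2.
{ move=> r Lr; have [v[y[Hy[Lv P]]]] := measured_meet K K' (two_step_trans Lr L) (two_step_trans Lr L').
  by exists v; split=> //; exists y. }
exists y; split=> //; split; [exact: (HB y e Hy (filter_le Fd Le) Ke)|exact: (HB' y e' Hy (filter_le Fd Le') Ke')].
Qed.

Lemma in_measure_fine s Y : s # la -> (∀ y # Pkl, s # y -> lift y # Y) -> in_measure Y.
Proof.
move=> Hs H; have [|h[Fh _]] := filter_dense (D := fun _ => True) _.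
{ by move=> h Th; exists h; split; [exact: two_step_refl|]. }
have in_B y v : pair y v # sep (prod Pkl two_step) (fun t => s # pr1 t) <-> (y # Pkl /\ v # two_step) /\ s # y.
{ by rewrite in_sep pair_prod pr1_pair. }
exists h, (sep (prod Pkl two_step) (fun t => s # pr1 t)); split=> //; split; last by move=> y h' Hy _ /in_B[_]; exact: H.
apply: measured_of_ae; [by case: Fh|by apply/in_power => z /in_sep[]|].
apply: (ae_mono (ae_fine FM (Sla Hs))) => x Hx Hsx v Tv; exists v; split; last exact: two_step_refl.
by apply/in_B; rewrite in_cap; split=> //; split=> //; exact: cap_small_subset.
Qed.

Section Cover.
Variables d T : V.
Hypotheses (Hd : d # k) (HT : ∀ q # d, app T q # set_names)
  (T_cover : ∀ y # Pkl, exists q h, q # d /\ in_filter h /\ pair y h # app T q).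
Let covers h : Prop := forall y v, y # Pkl -> v ≼ h -> exists v' q, v' ≼ v /\ q # d /\ puts (app T q) y v'.

Lemma ex_covers : exists h, in_filter h /\ covers h.
Proof.
have [|h[Fh[H|[y[Hy No]]]]] := filter_dense (D := fun h => covers h \/
  ∃ y # Pkl, forall v q, v ≼ h -> q # d -> ~ puts (app T q) y v) _; last first.
- have [q[h1[Hq[F1 K]]]] := T_cover Hy; have [v[L1 L2]] := filter_compatible Fh F1.
  by case: (No v q L1 Hq); exists h1.
- by exists h.
- move=> h Th; case: (classic (covers h)) => [H|No]; first by exists h; split; [exact: two_step_refl|left].
  apply: NNPP => No'; apply: No => y v Hy Lv; apply: NNPP => No; apply: No'; exists v; split=> //; right.
  by exists y; split=> // v' q L Hq P; apply: No; exists v', q.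
Qed.

Lemma ex_measured : exists h q, in_filter h /\ q # d /\ pair h (app T q) # measured.
Proof.
have [h[Fh Ch]] := ex_covers.
have [|h'[Fh'[_[q K]]]] := filter_dense_below (D := fun h => ∃ q # d, pair h (app T q) # measured) _ Fh.
- move=> r Lr; have [|h'[q[L K]]] := measured_cover Lr.1 Hd HT; last by exists h'; split=> //; exists q.
  by move=> y v Hy Lv; exact: (Ch y v Hy (two_step_trans Lv Lr)).
- by exists h', q.
Qed.
End Cover.

Lemma in_measure_cover S : small S (lift k) -> (∀ y # Pkl, ∃ Y # S, lift y # Y) -> ∃ Y # S, in_measure Y.
Proof.
move=> [_[/in_lift[d[-> Hd]][F[FF[RF JF]]]]] cover.
pose S' := sep (lift (prod d Pkl)) (fun t : g2 => exists Y : g2, Y # S /\ app F Y = pr1 t /\ pr2 t # Y).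
have [B[_ EB]] := ex_name_below S' (prod d Pkl).
pose T := lam d (fun q => sep (prod Pkl two_step) (fun t => pair (pair q (pr1 t)) (pr2 t) # B)).
have in_T q y h : q # d -> pair y h # app T q <-> (y # Pkl /\ h # two_step) /\ pair (pair q y) h # B.
{ by move=> Hq; rewrite /T app_lam // in_sep pair_prod pr1_pair pr2_pair. }
have TP q y : q # d -> y # Pkl ->
  (exists h, in_filter h /\ pair y h # app T q) <-> exists Y : g2, Y # S /\ app F Y = lift q /\ lift y # Y.
{ move=> Hq Hy; have E : lift (pair q y) # S' <-> exists Y : g2, Y # S /\ app F Y = lift q /\ lift y # Y.
  { by rewrite in_sep lift_mem pair_prod (embed_pair lift_mem lift_transitive) pr1_pair pr2_pair; tauto. }
  rewrite -E (EB (pair q y)) ?pair_prod //; split=> -[h[Fh]]; rewrite ?in_T // => K; exists h; split=> //; first by case: K.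
  by rewrite in_T //; split=> //; split=> //; case: Fh. }
have [||h[q[Fh[Hq M]]]] := ex_measured (T := T) Hd.
- by move=> q Hq; rewrite /T app_lam //; apply/in_power => z /in_sep[].
- move=> y Hy; have [Y[HY Ky]] := cover y Hy; have /in_lift[q[Eq Hq]] := RF Y HY.
  have [h[Fh K]] := (TP q y Hq Hy).2 (ex_intro _ Y (conj HY (conj Eq Ky))); by exists q, h.
- pose Z := union (sep S (fun Y => app F Y = lift q)).
  have HZ : in_measure Z.
  { exists h, (app T q); split=> //; split=> // y h' Hy Fh' K; have [Y[HY[E Ky]]] := (TP q y Hq Hy).1 (ex_intro _ h' (conj Fh' K)).
  by apply/in_union; exists Y; split=> //; apply/in_sep. }
  have [_[_[/in_union[Y[/in_sep[HY EY] _]] _]]] := in_measure_meet HZ HZ; exists Y; split=> //.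
  have -> // : Y = Z; apply: set_ext => z; rewrite in_union; split=> [Hz|[Y'[/in_sep[HY' EY'] Hz]]].
  + by exists Y; split=> //; apply/in_sep.
  + by rewrite (JF Y Y') // EY EY'.
Qed.

Let space : g2 := sep (power (lift la)) (fun y : g2 => small y (lift k)).

Lemma ex_measure_set : exists M : g2, forall Y, Y # M <-> sub Y space /\ in_measure Y.
Proof.
have [H EH] := ex_filter_set; exists (sep (power space) (fun Y : g2 => exists h B : g2, h # H /\ pair h B # lift measured /\
  forall y h' : g2, y # lift Pkl -> h' # H -> pair y h' # B -> y # Y)) => Y.
rewrite in_sep in_power; split=> -[SY[h[B[Fh[K HB]]]]]; split=> //.
- move: K Fh HB => /(pair_in_embed lift_mem lift_transitive)[h1[B1[->[-> K]]]] /EH Fh HB; exists h1, B1; splits.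
  move=> y h' Hy Fh' K'; apply: (HB _ (lift h')); [exact/lift_mem|exact/EH|exact/(pair_embed_in lift_mem lift_transitive)].
- exists (lift h), (lift B); split; first exact/EH.
  split; first exact/(pair_embed_in lift_mem lift_transitive).
  move=> y h' Hy Fh' /(pair_in_embed lift_mem lift_transitive)[y1[h1[Ey[Eh K']]]]; subst y h'.
  by apply: (HB y1 h1 _ _ K'); [exact/lift_mem|exact/EH].
Qed.

Lemma ex_lifted_measure : card (lift k) /\ exists X U : g2, is_fine_measure (lift k) (lift la) X U.
Proof.
have [M EM] := ex_measure_set; have [_[_[[Lk _] _]]] := k_inacc.
have in_space (y : g2) : y # space <-> sub y (lift la) /\ small y (lift k) by rewrite in_sep in_power.
have Ysub : sub (lift Pkl) space.
{ move=> _ /in_lift[y[-> /in_Pkl[S[a[Ha E]]]]]; apply/in_space; split; first exact/(embed_sub lift_mem lift_transitive).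
  by exists (lift a); split; [exact/lift_mem|exact: (embed_embeds lift_mem lift_transitive)]. }
have lim_k : lim (lift k) by apply/(embed_lim lift_mem lift_transitive).
have bounded (y : g2) : y # lift Pkl -> exists s : g2, s # lift k /\ ~ s # y.
{ move=> /in_lift[y'[-> /in_Pkl[_ Sy]]]; have [|s[Hs Ns]] := @not_sub V k y'.
  - by move=> S; exact: (small_not_embeds k_card Sy (embeds_sub S)).
  - by exists (lift s); rewrite !lift_mem. }
have sub_M Y : Y # M -> sub Y space by case/EM.
have meet Y Y' : Y # M -> Y' # M -> exists y : g2, y # Y /\ y # Y'.
{ by move=> /EM[_ H] /EM[_ H']; have [y[_ K]] := in_measure_meet H H'; exists (lift y). }
have cover S : small S (lift k) -> (∀ Y # S, sub Y space) -> (forall y : g2, y # lift Pkl -> ∃ Y # S, y # Y) -> ∃ Y # S, Y # M.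
{ move=> Sm SS H; have [|Y[HY K]] := in_measure_cover Sm; first by move=> y Hy; apply: H; exact/lift_mem.
  by exists Y; split=> //; apply/EM; split=> //; exact: SS. }
have fine (s : g2) : s # lift la -> sep space (fun y : g2 => s # y) # M.
{ move=> /in_lift[s'[-> Hs]]; apply/EM; split; first by move=> y /in_sep[].
  by apply: (in_measure_fine Hs) => y Hy Ks; apply/in_sep; split; [apply: Ysub; exact/lift_mem|exact/lift_mem]. }
have k_sub : sub (lift k) (lift la) by apply/(embed_sub lift_mem lift_transitive).
split; first exact: (card_of_covers lim_k k_sub Ysub bounded meet cover fine).
exists space, M; apply: (measure_of_covers lim_k in_space Ysub _ sub_M meet cover fine).
move=> Y /EM[_[h[B[Fh[K HB]]]]] Y' S S'; apply/EM; split=> //; exists h, B; split=> //; split=> // y h' Hy Fh' K'.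
exact/S/(HB y h').
Qed.
End SecondExtension.
End Measuring.

Theorem ex_measure_in_extension la (g1 : generic_at k) (C LC : g1) (g2 : generic C LC) :
  cohen_poset (embed g1 k) C LC -> sub la l -> sub k la -> embeds (prod two_step (set_names la)) l ->
  card (lift g2 k) /\ exists X U : g2, is_fine_measure (lift g2 k) (lift g2 la) X U.
Proof.
move=> CP Sla Skl [F[FF[RF JF]]]; have [h0[Th0[Eh0 top]]] := ex_top_triple.
have [req[_ Hreq]] := @ex_partial_choice V l (fun z t => t # prod two_step (set_names la) /\ app F t = z) _.
have requests h B : h # two_step -> B # set_names la -> ∃ z # l, app req z = pair h B.
{ move=> Th HB; have Ht : pair h B # prod two_step (set_names la) by apply/pair_prod.
  exists (app F (pair h B)); split; first exact: RF.
  have [|Hr Er] := Hreq _ (RF _ Ht); [by exists (pair h B)|exact: JF]. }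
have D : Definable2 (is_master la req h0) by rewrite /is_master /settled /captures /generic_graph /saturation; definability.
have [rho[_ rhoP]] := ae_select D (ae_ex_master la req Th0 Eh0 top).
exact: (ex_lifted_measure Eh0 top rhoP requests g2 CP Sla Skl).
Qed.

End Iteration.

Lemma preparation_iteration V (k f P L : V) : ord k -> (V ⊨ lottery_preparation k f P L) ->
  exists Ps Ls Qs Rs Os, iteration k f Ps Ls Qs Rs Os /\ P = PP Ps k /\ L = LL Ls k.
Proof.
move=> Ok H; have FA (Ps Ls b p : V) phi : Means (@mem V) (forced_at Ps Ls b p phi)
  (forall P L r, pair b P # Ps -> pair b L # Ls -> r = restr p b -> Forces P L phi r) by rewrite /forced_at; exact _.
eassert (M : Means (@mem V) (lottery_preparation k f P L) _).
{ rewrite /lottery_preparation /is_condition /condition_le /is_stage /full_name; cbv zeta; exact _. }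
move/M: H => [_ [-> [Ps [Ls [Qs [Rs [Os [FP [FL [FQ [FR [FO [HC [HS [/(pair_in_fun _ _ FP)[_ EP] /(pair_in_fun _ _ FL)[_ EL]]]]]]]]]]]]]]]].
have in_k c b : c # k.+1 -> b # c -> b # k by move=> /inS[Hc Hb|-> //]; exact: (ord_trans Ok Hb Hc).
have FE b p phi : b # k -> (forall P L r, pair b P # Ps -> pair b L # Ls -> r = restr p b -> Forces P L phi r) <->
  Forces (app Ps b) (app Ls b) phi (restr p b).
{ move=> Hb; have Hbk := subS Hb; split=> [K|K _ _ _ /(pair_in_fun _ _ FP)[_ ->] /(pair_in_fun _ _ FL)[_ ->] -> //].
  exact: (K _ _ _ (pair_app FP Hbk) (pair_app FL Hbk) eq_refl). }
have {}HC c (Hc : c # k.+1) := HC c Hc _ _ (pair_app FP Hc) (pair_app FL Hc).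
have {}HS b (Hb : b # k) := HS b Hb _ _ _ _ _ (pair_app FP (subS Hb)) (pair_app FL (subS Hb))
  (pair_app FQ Hb) (pair_app FR Hb) (pair_app FO Hb).
have EC c (Hc : c # k.+1) p : p # PP Ps c <-> condition Ps Ls Qs Os c p.
{ rewrite /condition ((HC c Hc).1 p); split=> -[Fp[K1[K2 K3]]]; (split=> //; split; [|split]).
  - by move=> b /K1[_ [-> [_ [/(pair_in_fun _ _ FP)[_ ->] K]]]].
  - move=> b Hb; have [J1 J2] := K2 b Hb _ _ (pair_app Fp Hb) (pair_app FQ (in_k c b Hc Hb)); split=> //.
  exact: ((FE b p _ (in_k c b Hc Hb)).1 J2).
  - move=> /K3[d[Hd K]]; exists d; split=> // b Hb Nb; case: (K b Hb) => // J.
  exact: ((FE b p _ (in_k c b Hc Hb)).1 (J _ _ (pair_app Fp Hb) (pair_app FO (in_k c b Hc Hb)))).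
  - by move=> b Hb; exists (restr p b); split=> //; exists (app Ps b); split; [exact: (pair_app FP (subS (in_k c b Hc Hb)))|exact: K1].
  - move=> b Hb _ _ /(pair_in_fun _ _ Fp)[_ ->] /(pair_in_fun _ _ FQ)[_ ->]; have [J1 J2] := K2 b Hb; split=> //.
  exact: ((FE b p _ (in_k c b Hc Hb)).2 J2).
  - move=> /K3[d[Hd K]]; exists d; split=> // b Hb; case: (classic (b # d)) => Nb; [by left|right].
  move=> _ _ /(pair_in_fun _ _ Fp)[_ ->] /(pair_in_fun _ _ FO)[_ ->]; exact: ((FE b p _ (in_k c b Hc Hb)).2 (K b Hb Nb)). }
exists Ps, Ls, Qs, Rs, Os; split=> //; split=> //.
- move=> c Hc p q; rewrite /le (HC c Hc).2; have Fp r (Hr : r # PP Ps c) := ((EC c Hc r).1 Hr).1.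
  split=> [[p'[Hp[q'[Hq[/pair_inj[-> ->] K]]]]]|[Hp[Hq K]]].
  + split=> //; split=> // b Hb; have Hbk := in_k c b Hc Hb.
  exact: ((FE b p' _ Hbk).1 (K b Hb _ _ _ (pair_app (Fp _ Hp) Hb) (pair_app (Fp _ Hq) Hb) (pair_app FR Hbk))).
  + exists p; split=> //; exists q; split=> //; split=> // b Hb ? ? ? /(pair_in_fun _ _ (Fp _ Hp))[_ ->].
  move=> /(pair_in_fun _ _ (Fp _ Hq))[_ ->] /(pair_in_fun _ _ FR)[_ ->]; exact: ((FE b p _ (in_k c b Hc Hb)).2 (K b Hb)).
- by move=> b Hb; case: (HS b Hb).
- by move=> b a Hb Ha Cl; have [_[H _]] := HS b Hb; case: (H a) => [/(_ Ha)|[_[_[->[-> K]]]]].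
- by move=> b Hb No; have [_[_[|]]] := HS b Hb.
Qed.

Definition above_card {T} (e : nat -> T) : form T := (∃d, pair_in (e 0) (e 1) d ∧ ∃c, is_card (e 2) c ∧ (c ∈ d ∨ c ≐ d))%F.

Lemma menas_measure V (k f l : V) : card k -> (forall a e, pair a e # f -> a # k /\ e # k) ->
  (V ⊨ menas_property k f) -> ord l -> sub k l -> exists X U al, is_fine_measure k l X U /\ normal_function k X U al /\
  ae U (fun x => exists a, pair (app al x) a # f /\ embeds x a).
Proof.
move=> Ck Ff H Ol Sk; have FMP := means_fine_measure; have UP (X U : V) phi := means_sat (@mem V) (ult X U phi).
have RP (X U al : V) := means_sat (@mem V) (ult_represents X U k al).
eassert (M : Means (@mem V) (menas_property k f) _) by (rewrite /menas_property; exact _).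
have [X[U[FM[jf[Fj[Vj[id[Fi[Vi[al[Ral {}M]]]]]]]]]]] := M.1 H l Ol Sk.
have [Fal[above regressive]] := ult_represents_normal FM Ck Ral; exists X, U, al.
have SM : schematic (fun T e => above_card e) by rewrite /above_card; exact _.
have [phi E] := SM; pose env := scons jf (scons al (fun _ => id)); change (sat mem (ult X U (above_card env))) in M.
have K : ae U (fun x => exists a, pair (app al x) a # f /\ embeds x a).
{ move: M; rewrite E (los FM) => [[|[|n]] //|M]; apply: (ae_mono FM M) => x Hx; rewrite -E.
  have MC (e : nat -> V) : Means (@mem V) (above_card e) (exists d, pair (e 1) d # e 0 /\
  exists c, (card c /\ exists h, bij h (e 2) c) /\ (c # d \/ c = d)) by rewrite /above_card; exact _.
  have Ej : app jf x = f by apply: (app_eq Fj.1); exact: Vj.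
  have Ei : app id x = x by apply: (app_eq Fi.1); exact: Vi.
  move/MC => /= [d]; rewrite Ej Ei => -[Hd[c[[_[h[Bh _]]] Hc]]]; exists d; split=> //.
  have Ec : embeds x c by exists h.
  case: Hc => [Hc|<- //]; apply: embeds_trans Ec (embeds_sub _) => z Hz.
  exact: (ord_trans (ord_in Ck.1 (Ff _ _ Hd).2) Hz Hc). }
split=> //; split=> //; split=> //; by apply: (ae_mono FM K) => x _ [a[Ha _]]; case: (Ff _ _ Ha).
Qed.

Lemma cantor V (M : V) : ~ embeds (power M) M.
Proof.
move=> [g[_[Rg Jg]]]; have in_D z : z # sep M (fun z => ∃ Y # power M, app g Y = z /\ ~ z # Y) <->
  z # M /\ ∃ Y # power M, app g Y = z /\ ~ z # Y by exact: in_sep.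
set D := sep _ _ in in_D; have HD : D # power M by apply/in_power => z /in_D[].
have N : ~ app g D # D by move=> K; case/in_D: (K) => _ [Y [HY [/(Jg Y D HY HD) -> N]]].
by apply: (N); apply/in_D; split; [exact: Rg|exists D].
Qed.

Lemma hartogs V (M : V) : exists l, ord l /\ ~ embeds l M.
Proof.
have [l[Ol[E _]]] := equipotent_ordinal (power M); exists l; split=> // K; exact: (cantor (embeds_trans E K)).
Qed.

(* Otherwise w contains all ordinals of V, each decided, as the value of an element of the name of w, by a condition. *)
Lemma ord_of_ground V (P L : V) (g : generic P L) (w : g) : preorder P L -> ord w -> exists a, w = embed g a /\ ord a.
Proof.
move=> PO Ow; have [Im It] := (ge_mem g, ge_transitive g).
suff [a Ea] : exists a, w = embed g a by exists a; split=> //; apply/(embed_ord Im It); rewrite -Ea.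
apply: NNPP => No; have big a : ord a -> embed g a # w.
{ move=> Oa; case: (ord_total ((embed_ord Im It a).2 Oa) Ow) => [//|[E|K]]; case: No; [by exists a|exact: (It _ _ K)]. }
have [x Ex] := val_surj g w; subst w.
have [b Hb] := @collection V (prod (trcl x) P) (fun t a => ord a /\ forced_eq P L (pr2 t) (pr1 t) (check P a)) _.
apply: (@no_set_of_ordinals V b) => a Oa; have /(in_val g)[c[p[_[Hc E]]]] := big a Oa.
rewrite -(val_check g) in E; have Ec := eq_sym E; move/(val_eq g PO): Ec => [q[Gq F]].
have Ht : pair c q # prod (trcl x) P by apply/pair_prod; split; [case: (pair_in_trcl Hc)|exact: (generic_sub g Gq)].
have [|a'[Ha'[_]]] := Hb _ Ht; rewrite !pr1_pair pr2_pair; first by exists a.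
move=> F'; have : (check P a).[g] = (check P a').[g].
{ by rewrite E; apply/(val_eq g PO); exists q. }
by rewrite !(val_check g) => /(embed_inj Im) ->.
Qed.

Lemma means_strongly_compact V (k : V) : Means (@mem V) (strongly_compact k)
  (card k /\ omega V # k /\ forall l, ord l -> sub k l -> exists X U, is_fine_measure k l X U).
Proof. have FMP := means_fine_measure; rewrite /strongly_compact; exact _. Qed.

Lemma preservation_countable V : countable V -> preservation V.
Proof.
move=> CV k f P L SC UP MN PR VG i G GE C LC Ad VGg j g GE2.
have [Ck[Wk _]] := (means_strongly_compact k).1 SC.
have MU : Means (@mem V) (unbounded_partial_function k f) (is_fun f /\ (forall a e, pair a e # f -> a # k /\ e # k) /\
  ∀ a # k, ∃ b # k, a # b /\ exists c, pair b c # f) by rewrite /unbounded_partial_function; exact _.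
move/MU: UP => [Ff[Hf _]]; have [Ps[Ls[Qs[Rs[Os[I[EP EL]]]]]]] := preparation_iteration Ck.1 PR; subst P L.
pose g1 : generic (PP Ps k) (LL Ls k) := Generic GE; pose g2 : generic (V := g1) C LC := @Generic g1 C LC VGg j g GE2.
have CP : cohen_poset (embed g1 k) C LC by apply/means_is_Add.
have strong la : ord la -> sub k la -> card (lift g2 k) /\ exists X U : g2, is_fine_measure (lift g2 k) (lift g2 la) X U.
{ move=> Ola Sk; pose T := traces k Ps 7; pose R := prod (two_step k Ps Ls) (set_names k Ps Ls la).
  have [l[Ol Nl]] := hartogs (cup T (cup R la)).
  have Nsub Y : sub Y (cup T (cup R la)) -> ~ embeds l Y by move=> S E; apply: Nl; exact: (embeds_trans E (embeds_sub S)).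
  have Nla : ~ embeds l la by apply: Nsub => z Hz; rewrite !in_cup; tauto.
  have Sla : sub la l.
  { case: (ord_total Ola Ol) => [K z Hz|[-> //|K]]; first exact: (ord_trans Ol Hz K).
  by case: Nla; apply: embeds_sub => z Hz; exact: (ord_trans Ola Hz K). }
  have [X[U[al[FM[N M]]]]] := menas_measure Ck Hf MN Ol (fun z Hz => Sla z (Sk z Hz)).
  apply: (ex_measure_in_extension CV I FM N Ck Wk Ff Hf _ M g2 CP Sla Sk); first by apply: Nsub => z Hz; rewrite !in_cup; tauto.
  case: (embeds_total R l) => // E; case: (Nsub R) => // z Hz; rewrite !in_cup; tauto. }
have Im x y : lift g2 x # lift g2 y <-> x # y := lift_mem g2 x y.
have It x (w : g2) : w # lift g2 x -> exists y, w = lift g2 y := @lift_transitive _ _ _ _ _ _ _ g2 x w.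
apply/means_strongly_compact; split; first exact: (strong k Ck.1 (fun z Hz => Hz)).1.
split; first by rewrite -(embed_omega Im It); exact/Im.
move=> l Ol Sl; have [v[Ev Ov]] := ord_of_ground (g := g2) (cohen_preorder CP) Ol; subst l.
have [la[Ea Ola]] := ord_of_ground (g := g1) (stage_preorder CV I (memS k)) Ov; subst v.
by apply: (strong la Ola _).2 => z Hz; apply/Im/Sl/Im.
Qed.

Theorem theorem4p1
  (V : zfc_model) (kappa f P L : V)
  (kappa_sc : V ⊨ strongly_compact kappa)
  (f_fun : V ⊨ unbounded_partial_function kappa f)
  (f_menas : V ⊨ menas_property kappa f)
  (P_prep : V ⊨ lottery_preparation kappa f P L)
  (VG : zfc_model) (i : V -> VG) (G : VG)
  (G_generic : generic_extension i P L G)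
  (A LA : VG) (A_Add : VG ⊨ is_Add (i kappa) A LA)
  (VGg : zfc_model) (j : VG -> VGg) (g : VGg)
  (g_generic : generic_extension j A LA g) :
  VGg ⊨ strongly_compact (j (i kappa)).
Proof.
exact (countable_reduction preservation_countable kappa_sc f_fun f_menas P_prep G_generic A_Add g_generic).
Qed.
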